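(* Let $\Phi:\mathbb{T}^n\times N\to N$ be a Kähler toric manifold, with Kähler metric $g$ and momentum map $\mathbf{J}:N\to\mathbb{R}^n$. Let $W=W(T)$ be the Weyl group of $\mathrm{Aut}(N,g)^0$ associated to the maximal torus $T=\Phi(\mathbb{T}^n)$. Given a smooth function $f:N\to\mathbb{R}$, the following hold. (a) $f$ is Kähler if and only if there exist $\xi\in\mathbb{R}^n$, $\varphi\in\mathrm{Aut}(N,g)^0$ and $r\in\mathbb{R}$ such that $f=\mathbf{J}^\xi\circ\varphi+r$. (b) If $f=\mathbf{J}^\xi\circ\varphi+r=\mathbf{J}^{\xi'}\circ\varphi'+r'$ on $N$, where $\xi,\xi'\in\mathbb{R}^n$, $\varphi,\varphi'\in\mathrm{Aut}(N,g)^0$ and $r,r'\in\mathbb{R}$, then there is $w\in W$ such that $(\xi,r)=w\cdot(\xi',r')$, where $W$ acts on $\mathbb{R}^n\oplus\mathbb{R}$ by $w\cdot(\xi,r)=(w\cdot\xi,\;r+\sigma_{\mathbf{J}}(w)(\xi))$.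
   Context: $\mathbb{T}^n=\mathbb{R}^n/\mathbb{Z}^n$; its Lie algebra is identified with $\mathbb{R}^n$ via the derivative at $0$ of the quotient map, and $\mathbb{R}^n$ with its dual via the Euclidean product $\langle\,,\,\rangle$. For an action $\Phi:\mathbb{T}^n\times N\to N$ write $\Phi_a(p)=\Phi(a,p)$ and $\xi_N(p)=\frac{d}{dt}\big|_0\Phi([t\xi],p)$ for $\xi\in\mathbb{R}^n$. A Kähler toric manifold is a connected compact Kähler manifold $N$ of complex dimension $n$ (metric $g$, Kähler form $\omega$) with an effective action $\Phi$ of $\mathbb{T}^n$ by holomorphic isometries and a momentum map $\mathbf{J}:N\to\mathbb{R}^n$, i.e. a smooth $\mathbb{T}^n$-invariant map with $\omega(\xi_N,\cdot)=d\mathbf{J}^\xi$ for all $\xi$, where $\mathbf{J}^\xi(p)=\langle\mathbf{J}(p),\xi\rangle$. A smooth $f:N\to\mathbb{R}$ is Kähler if its Hamiltonian vector field $X_f$ (defined by $\omega(X_f,\cdot)=df$) is Killing. $\mathrm{Aut}(N,g)$ is the group of holomorphic isometries of $N$ with the compact-open topology (a compact Lie group acting smoothly on $N$), $\mathrm{Aut}(N,g)^0$ its identity component. The map $a\mapsto\Phi_a$, also denoted $\Phi$, is a Lie group isomorphism from $\mathbb{T}^n$ onto a maximal torus $T$ of $\mathrm{Aut}(N,g)$ (hence of $\mathrm{Aut}(N,g)^0$); its derivative $\Phi_*:\mathbb{R}^n\to\mathfrak{t}=\mathrm{Lie}(T)$ is a linear bijection. $W=N(T)/T$, with $N(T)$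 the normalizer of $T$ in $\mathrm{Aut}(N,g)^0$, acts on $\mathfrak{t}$ by $[\phi]\cdot\eta=\mathrm{Ad}_\phi\eta$, and on $\mathbb{R}^n$ by $\Phi_*(w\cdot\xi)=w\cdot\Phi_*\xi$. The one-cocycle of $\mathbf{J}$ is $\sigma_{\mathbf{J}}:W\to(\mathbb{R}^n)^*$, $\sigma_{\mathbf{J}}(w)(\xi)=\mathbf{J}^\xi\circ\phi^{-1}-\mathbf{J}^{w\cdot\xi}$ for $w=[\phi]$; the right-hand side is a constant function on $N$ independent of the representative $\phi$ (identified with its value). *)

(* Defs.v *)
From HB Require Import structures.
From mathcomp Require Import all_boot all_order all_algebra.
From mathcomp Require Import all_classical all_reals all_analysis.
Set Implicit Arguments.
Unset Strict Implicit.
Unset Printing Implicit Defensive.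
Import Order.TTheory GRing.Theory Num.Theory.
Import numFieldNormedType.Exports.
Local Open Scope classical_set_scope.
Local Open Scope ring_scope.

Definition iter_derive (R : realType) (V W : normedModType R) (s : seq V)
    (f : V -> W) : V -> W :=
  foldr (fun v h => 'D_v h) f s.

(* C^oo on an open set U; values of f outside U are irrelevant. *)
Definition smooth_on (R : realType) (V W : normedModType R) (U : set V)
    (f : V -> W) : Prop :=
  forall (s : seq V) (x : V), U x -> differentiable (iter_derive s f) x.

(* C^n is 'rV[R]_(n + n), with z = x + i y written as row_mx x y; mulI is
   multiplication by i. *)
Definition mulI (R : realType) (n : nat) (u : 'rV[R]_(n + n)) :
    'rV[R]_(n + n) :=
  row_mx (- rsubmx u) (lsubmx u).

Definition holomorphic_on (R : realType) (n : nat) (U : set 'rV[R]_(n + n))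
    (F : 'rV[R]_(n + n) -> 'rV[R]_(n + n)) : Prop :=
  smooth_on U F /\
  forall x, U x -> forall u, 'd F x (mulI u) = mulI ('d F x u).

(* Second countability is not required: the manifolds below are compact. *)
Record complexManifold (R : realType) (n : nat) (N : topologicalType) :=
  ComplexManifold {
  chart_index : Type;
  chart_dom : chart_index -> set N;
  chart : chart_index -> N -> 'rV[R]_(n + n);
  chart_inv : chart_index -> 'rV[R]_(n + n) -> N;
  manifold_hausdorff : hausdorff_space N;
  chart_dom_open : forall i, open (chart_dom i);
  chart_img_open : forall i, open (chart i @` chart_dom i);
  chartK : forall i p, chart_dom i p -> chart_inv i (chart i p) = p;
  chart_continuous : forall i p, chart_dom i p -> {for p, continuous (chart i)};
  chart_inv_continuous : forall i p, chart_dom i p ->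
    {for chart i p, continuous (chart_inv i)};
  chart_cover : forall p, exists i, chart_dom i p;
  transition_holomorphic : forall i j,
    holomorphic_on (chart i @` (chart_dom i `&` chart_dom j))
                   (chart j \o chart_inv i) }.

Definition chart_img (R : realType) (n : nat) (N : topologicalType)
    (M : complexManifold R n N) (i : chart_index M) : set 'rV[R]_(n + n) :=
  chart i @` chart_dom i.

Definition smooth_fun (R : realType) (n : nat) (N : topologicalType)
    (M : complexManifold R n N) (W : normedModType R) (f : N -> W) : Prop :=
  forall i : chart_index M, smooth_on (chart_img i) (f \o chart_inv i).

Definition local_rep (R : realType) (n : nat) (N : topologicalType)
    (M : complexManifold R n N) (phi : N -> N) (i j : chart_index M) :
    'rV[R]_(n + n) -> 'rV[R]_(n + n) :=
  chart j \o phi \o chart_inv i.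

Definition holomorphic (R : realType) (n : nat) (N : topologicalType)
    (M : complexManifold R n N) (phi : N -> N) : Prop :=
  continuous phi /\
  forall i j : chart_index M,
    holomorphic_on (chart i @` (chart_dom i `&` phi @^-1` chart_dom j))
                   (local_rep phi i j).

(* The bilinear form with matrix A. *)
Definition mxform (R : realType) (m : nat) (A : 'M[R]_m) (u v : 'rV[R]_m) : R :=
  (u *m A *m v^T) 0 0.

(* phi^* g = g, for a tensor g given by its matrices in the charts. *)
Definition preserves (R : realType) (n : nat) (N : topologicalType)
    (M : complexManifold R n N)
    (g : chart_index M -> 'rV[R]_(n + n) -> 'M[R]_(n + n))
    (phi : N -> N) : Prop :=
  forall (i j : chart_index M) (p : N), chart_dom i p -> chart_dom j (phi p) ->
  let dphi := 'd (local_rep phi i j) (chart i p) in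
  forall u v, mxform (g j (chart j (phi p))) (dphi u) (dphi v) =
              mxform (g i (chart i p)) u v.

(* The Kähler form omega = g(I -, -) in the chart i. *)
Definition kform (R : realType) (n : nat) (N : topologicalType)
    (M : complexManifold R n N)
    (g : chart_index M -> 'rV[R]_(n + n) -> 'M[R]_(n + n))
    (i : chart_index M) (x u v : 'rV[R]_(n + n)) : R :=
  mxform (g i x) (mulI u) v.

(* metric i x is the Gram matrix of g at the point of coordinates x in the
   chart i; metric_coherent, i.e. id^* g = g, is the transformation law of a
   tensor; kform_closed is d omega = 0 evaluated on constant vector fields. *)
Record kahlerMetric (R : realType) (n : nat) (N : topologicalType)
    (M : complexManifold R n N) := KahlerMetric {
  metric :> chart_index M -> 'rV[R]_(n + n) -> 'M[R]_(n + n);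
  metric_smooth : forall i, smooth_on (chart_img i) (metric i);
  metric_coherent : preserves metric idfun;
  metric_sym : forall i x, chart_img i x ->
    forall u v, mxform (metric i x) u v = mxform (metric i x) v u;
  metric_pos : forall i x, chart_img i x ->
    forall u, u != 0 -> 0 < mxform (metric i x) u u;
  metric_hermitian : forall i x, chart_img i x ->
    forall u v, mxform (metric i x) (mulI u) (mulI v) = mxform (metric i x) u v;
  kform_closed : forall i x, chart_img i x -> forall u v w,
    'd (fun y => kform metric i y v w) x u +
    'd (fun y => kform metric i y w u) x v +
    'd (fun y => kform metric i y u v) x w = 0 }.

(* A vector field is given by its components in the charts. *)
Definition vfield (R : realType) (n : nat) (N : topologicalType)
    (M : complexManifold R n N) : Type :=
  chart_index M -> 'rV[R]_(n + n) -> 'rV[R]_(n + n).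

(* (L_X g)(u, v) = X (g(u, v)) - g([X, u], v) - g(u, [X, v]), where
   [X, u] = - dX(u) for the constant vector field u of a chart. *)
Definition killing (R : realType) (n : nat) (N : topologicalType)
    (M : complexManifold R n N) (g : kahlerMetric M) (X : vfield M) : Prop :=
  forall (i : chart_index M) x, chart_img i x -> forall u v,
    'd (fun y => mxform (g i y) u v) x (X i x) +
    mxform (g i x) ('d (X i) x u) v + mxform (g i x) u ('d (X i) x v) = 0.

(* The unique X with omega(X, -) = df (omega is nondegenerate). *)
Definition hamiltonian_vfield (R : realType) (n : nat) (N : topologicalType)
    (M : complexManifold R n N) (g : kahlerMetric M) (f : N -> R) : vfield M :=
  fun i x => xget 0 [set X | forall v, kform g i x X v =
                                       'd (f \o chart_inv i) x v].

Definition kahler_fun (R : realType) (n : nat) (N : topologicalType)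
    (M : complexManifold R n N) (g : kahlerMetric M) (f : N -> R) : Prop :=
  smooth_fun M f /\ killing g (hamiltonian_vfield g f).

Definition int_lattice (R : realType) (n : nat) : {pred 'rV[R]_n} :=
  fun v => v \is a mxOver Num.int.

Lemma int_lattice_zmod_closed (R : realType) (n : nat) :
  zmod_closed (@int_lattice R n).
Proof.
split=> [|u v /mxOverP uZ /mxOverP vZ]; apply/mxOverP => i j.
  by rewrite mxE rpred0.
by rewrite !mxE rpredB.
Qed.

HB.instance Definition _ (R : realType) (n : nat) :=
  GRing.isZmodClosed.Build 'rV[R]_n (@int_lattice R n)
    (@int_lattice_zmod_closed R n).

(* T^n = R^n / Z^n, as a quotient of abelian groups. *)
Definition torus (R : realType) (n : nat) : zmodType :=
  Quotient.quot (@int_lattice R n).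

Definition to_torus (R : realType) (n : nat) (v : 'rV[R]_n) : torus R n :=
  \pi_(Quotient.quot (@int_lattice R n))%qT v.

(* Smoothness and continuity of Phi on T^n x N are tested on R^n x N: the
   quotient map R^n -> T^n is an open local diffeomorphism. *)
Definition smooth_action (R : realType) (n : nat) (N : topologicalType)
    (M : complexManifold R n N) (Phi : torus R n -> N -> N) : Prop :=
  [/\ forall p, Phi 0 p = p,
      forall a b p, Phi (a + b) p = Phi a (Phi b p),
      continuous (fun vp : 'rV[R]_n * N => Phi (to_torus vp.1) vp.2) &
      forall i j : chart_index M,
      smooth_on
        [set vx : 'rV[R]_n * 'rV[R]_(n + n) | chart_img i vx.2 /\
           chart_dom j (Phi (to_torus vx.1) (chart_inv i vx.2))]
        (fun vx => chart j (Phi (to_torus vx.1) (chart_inv i vx.2)))].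

Definition fundamental_vfield (R : realType) (n : nat) (N : topologicalType)
    (M : complexManifold R n N) (Phi : torus R n -> N -> N) (xi : 'rV[R]_n) :
    vfield M :=
  fun i x =>
    derive1 (fun t : R => chart i (Phi (to_torus (t *: xi)) (chart_inv i x))) 0.

(* J^xi = <J, xi> *)
Definition momentum (R : realType) (n : nat) (N : Type) (J : N -> 'rV[R]_n)
    (xi : 'rV[R]_n) (p : N) : R :=
  \sum_(k < n) J p 0 k * xi 0 k.

Definition momentum_map (R : realType) (n : nat) (N : topologicalType)
    (M : complexManifold R n N) (g : kahlerMetric M)
    (Phi : torus R n -> N -> N) (J : N -> 'rV[R]_n) : Prop :=
  [/\ smooth_fun M J,
      forall a p, J (Phi a p) = J p &
      forall xi (i : chart_index M) x, chart_img i x -> forall v,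
        kform g i x (fundamental_vfield Phi xi i x) v =
        'd (momentum J xi \o chart_inv i) x v].

(* The group Aut(N, g) of holomorphic isometries. *)
Definition Aut (R : realType) (n : nat) (N : topologicalType)
    (M : complexManifold R n N) (g : kahlerMetric M) : set (N -> N) :=
  [set phi | preserves g phi /\ holomorphic M phi /\
     exists psi, [/\ cancel phi psi, cancel psi phi & holomorphic M psi]].

(* The identity component of Aut(N, g) for the compact-open topology. *)
Definition Aut0 (R : realType) (n : nat) (N : topologicalType)
    (M : complexManifold R n N) (g : kahlerMetric M) : set (N -> N) :=
  connected_component (Aut g : set {compact-open, N -> N}) idfun.

Record kahler_toric (R : realType) (n : nat) (N : topologicalType)
    (M : complexManifold R n N) (g : kahlerMetric M)
    (Phi : torus R n -> N -> N) (J : N -> 'rV[R]_n) : Prop := KahlerToric {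
  toric_nonempty : [set: N] !=set0;
  toric_connected : connected [set: N];
  toric_compact : compact [set: N];
  toric_smooth : smooth_action M Phi;
  toric_effective : forall a, (forall p, Phi a p = p) -> a = 0;
  toric_aut : forall a, Aut g (Phi a);
  toric_momentum : momentum_map g Phi J }.

(* phi^-1 for a bijection phi *)
Definition inverse (N : choiceType) (phi : N -> N) (p : N) : N :=
  xget p [set q | phi q = p].

Definition toric_torus (R : realType) (n : nat) (N : topologicalType)
    (Phi : torus R n -> N -> N) : set (N -> N) := range Phi.

(* N(T), the normalizer of T in Aut(N, g)^0 *)
Definition normalizer_torus (R : realType) (n : nat) (N : topologicalType)
    (M : complexManifold R n N) (g : kahlerMetric M)
    (Phi : torus R n -> N -> N) : set (N -> N) :=
  [set phi | Aut0 g phi /\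
     [set phi \o tau \o inverse phi | tau in toric_torus Phi] = toric_torus Phi].

(* W = N(T)/T, the set of cosets [phi] = phi T *)
Definition weyl_group (R : realType) (n : nat) (N : topologicalType)
    (M : complexManifold R n N) (g : kahlerMetric M)
    (Phi : torus R n -> N -> N) : set (set (N -> N)) :=
  [set [set phi \o tau | tau in toric_torus Phi]
     | phi in normalizer_torus g Phi].

(* An element of a Lie algebra is represented by the one-parameter subgroup
   that it generates: Phi_* xi is t |-> Phi_[t xi], and Ad_phi is conjugation
   by phi. *)
Definition Phi_star (R : realType) (n : nat) (N : topologicalType)
    (Phi : torus R n -> N -> N) (xi : 'rV[R]_n) : R -> N -> N :=
  fun t => Phi (to_torus (t *: xi)).

Definition Ad (R : realType) (N : topologicalType) (phi : N -> N)
    (gamma : R -> N -> N) : R -> N -> N :=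
  fun t => phi \o gamma t \o inverse phi.

(* w . xi is the vector with Phi_* (w . xi) = Ad_phi (Phi_* xi), w = [phi]. *)
Definition weyl_act (R : realType) (n : nat) (N : topologicalType)
    (Phi : torus R n -> N -> N) (w : set (N -> N)) (xi : 'rV[R]_n) : 'rV[R]_n :=
  xget 0 [set eta | exists2 phi, w phi &
                    Phi_star Phi eta = Ad phi (Phi_star Phi xi)].

(* sigma_J(w)(xi) is the value of the constant function
   J^xi o phi^-1 - J^(w . xi), w = [phi]. *)
Definition cocycle (R : realType) (n : nat) (N : topologicalType)
    (Phi : torus R n -> N -> N) (J : N -> 'rV[R]_n) (w : set (N -> N))
    (xi : 'rV[R]_n) : R :=
  xget 0 [set c | exists2 phi, w phi &
    forall p, momentum J xi (inverse phi p) -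
              momentum J (weyl_act Phi w xi) p = c].

Definition weyl_act_ext (R : realType) (n : nat) (N : topologicalType)
    (Phi : torus R n -> N -> N) (J : N -> 'rV[R]_n) (w : set (N -> N))
    (xr : 'rV[R]_n * R) : 'rV[R]_n * R :=
  (weyl_act Phi w xr.1, xr.2 + cocycle Phi J w xr.1).

(* Main.v *)
(** A Kähler function f is determined up to a constant by the 1-jet of its
    Killing field X_f at one point, so the Kähler functions form a finite
    dimensional space V, on which the flows of the X_f act by a bounded group of
    automorphisms of the Poisson bracket; hence V has an invariant inner product.
    On the closure of the orbit of f, a point w maximising <., h> commutes with h;
    slicing the orbit at w, and induction on the dimension of the centraliser,
    give an element of the orbit itself that commutes with h.  Taking for h the
    components of J one after the other, some f o phi commutes with all J^eta.  At
    a point where the rank of the torus action is maximal the fields X_{J^eta} span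
    a Lagrangian subspace and together with their multiples by i the whole tangent
    space, so the 1-jet shows that f o phi = J^xi + r.

    If J^xi o psi = J^xi' + const, the commuting functions J^eta o psi^-1 lie in the
    centraliser of J^xi; conjugating all of them into the J^eta by flows c of this
    centraliser, which fix J^xi, makes the inverse of psi^-1 o c an element of the
    normaliser of T that maps xi' to xi. *)
From HB Require Import structures.
From mathcomp Require Import all_boot all_order all_algebra.
From mathcomp Require Import all_classical all_reals all_analysis.
From mathcomp Require Import ring lra.
Require Import Defs.
Set Implicit Arguments.
Unset Strict Implicit.
Unset Printing Implicit Defensive.
Import Order.TTheory GRing.Theory Num.Theory.
Import numFieldNormedType.Exports.
Local Open Scope classical_set_scope.
Local Open Scope ring_scope.

(** The Lie theory takes place on V alone, with the group of matrices generated by the flows. This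
    group is bounded because the coordinates on V are values at finitely many points, and f o phi
    takes no values other than those of f. Nothing says that it is closed: a maximiser of <., h>
    lies only in the closure of the orbit, and the slice is what leads back to the orbit, since a
    point of the orbit near w is conjugate to one that commutes with w. The invariant inner product
    serves twice: it identifies the critical points of <., h>, and it makes ad w skew, so that ad w
    is invertible on its image, which the slice needs. Conjugating several functions one after the
    other must not destroy what has been reached. Therefore every function already in position joins
    a list s, and from then on only flows of the centraliser of s are used: they fix the members of
    s and keep all commutation relations with them. A Killing field is determined by its 1-jet
    because its second derivatives are expressed linearly by the 1-jet, in the same way as
    Christoffel symbols are expressed by derivatives of a metric. *)

(** * Functions of class C^k on open subsets of normed spaces *)

Section Cn.
Context {R : realType}.
Implicit Types (V W : normedModType R).

(* Off by one: Cn k asks the derivatives up to order k to be differentiable. *)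
Fixpoint Cn V W (k : nat) (U : set V) (f : V -> W) : Prop :=
  (forall x, U x -> differentiable f x) /\
  (if k is k'.+1 then forall v, Cn k' U ('D_v f) else True).

Lemma Cn_diff V W k (U : set V) (f : V -> W) x :
  Cn k U f -> U x -> differentiable f x.
Proof. by case: k => [|k] /= [h _] ?; exact: h. Qed.

Lemma CnW V W k (U : set V) (f : V -> W) : Cn k.+1 U f -> Cn k U f.
Proof.
elim: k f => [f [? _]//|k IH f [df Hf]]; split=> // v; exact: IH (Hf v).
Qed.

Lemma CnD V W k (U : set V) (f : V -> W) v : Cn k.+1 U f -> Cn k U ('D_v f).
Proof. by case=> _; apply. Qed.

Lemma Cn_sub V W k (U U' : set V) (f : V -> W) : U' `<=` U -> Cn k U f -> Cn k U' f.
Proof.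
move=> UU; elim: k f => [f [h _]|k IH f [h1 h2]] /=; split=> //.
- by move=> x /UU; exact: h.
- by move=> x /UU; exact: h1.
- by move=> v; exact: IH (h2 v).
Qed.

Lemma iter_derive_rcons V W s v (f : V -> W) :
  iter_derive (rcons s v) f = iter_derive s ('D_v f).
Proof. by rewrite /iter_derive -cats1 foldr_cat. Qed.

(** In [iter_derive] the head of the list is the outermost derivative, while [Cn] strips the
    innermost one; hence lists are split at their end. *)
Lemma smooth_onP V W (U : set V) (f : V -> W) :
  smooth_on U f <-> forall k, Cn k U f.
Proof.
split=> [h k|h s]; last first.
  move: {2}(size s) (erefl (size s)) => k; elim: k f s h => [|k IH] f s h.
    by move/size0nil=> -> x Ux; exact: (Cn_diff (h 0%N) Ux).
  case/lastP: s => [//|s v]; rewrite size_rcons => -[sk] x Ux.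
  rewrite iter_derive_rcons; apply: (IH ('D_v f)) => // j.
  exact: CnD (h j.+1).
elim: k f h => [|k IH] f h; split=> //; try exact: (h [::]).
by move=> v; apply: IH => s x Ux; have := h (rcons s v) x Ux; rewrite iter_derive_rcons.
Qed.

Lemma smooth_on_sub V W (U U' : set V) (f : V -> W) :
  U' `<=` U -> smooth_on U f -> smooth_on U' f.
Proof. by move=> UU h s x /UU; exact: h. Qed.

Lemma smooth_on_diff V W (U : set V) (f : V -> W) x :
  smooth_on U f -> U x -> differentiable f x.
Proof. by move=> h; exact: (h [::]). Qed.

Lemma diff_eps V W (f : V -> W) x : differentiable f x -> forall e, 0 < e ->
  \forall h \near 0, `|f (h + x) - f x - 'd f x h| <= e * `|h|.
Proof.
move=> df e e0; have /eqaddoP/(_ _ e0) := diff_locally df.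
by apply: filterS => h /=; rewrite !fctE /= opprD addrA.
Qed.

Lemma eps_diff V W (f : V -> W) x (L : {linear V -> W}) : continuous L ->
  (forall e, 0 < e -> \forall h \near 0, `|f (h + x) - f x - L h| <= e * `|h|) ->
  differentiable f x /\ 'd f x = L :> (V -> W).
Proof.
move=> cL h.
have key : f \o shift x = cst (f x) + L +o_ 0 id.
  apply/eqaddoP => e e0; have := h e e0.
  by apply: filterS => y; rewrite !fctE /= opprD addrA.
have dE := diff_unique cL key; split=> //.
by apply/diff_locallyP; rewrite dE.
Qed.

Lemma near_eq_diff V W (f h : V -> W) x :
  (\forall y \near x, f y = h y) -> differentiable f x ->
  differentiable h x /\ 'd h x = 'd f x :> (V -> W).
Proof.
move=> fh df; have fhx : f x = h x by exact: (nbhs_singleton fh).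
apply: eps_diff => [|e e0]; first exact: diff_continuous.
have : \forall y \near 0, f (y + x) = h (y + x).
  have := fh; rewrite (near_shift 0) /= subr0.
  by apply: filterS => y /=; rewrite ?subr0 // addrC.
have := diff_eps df e0.
by apply: filterS2 => y /= + <-; rewrite -fhx.
Qed.

Lemma near_open V (U : set V) (P : V -> Prop) x :
  open U -> U x -> (forall y, U y -> P y) -> \forall y \near x, P y.
Proof. by move=> oU Ux h; apply: filterS (open_nbhs_nbhs (conj oU Ux)). Qed.

Lemma Cn_ext V W k (U : set V) (f h : V -> W) : open U ->
  (forall x, U x -> f x = h x) -> Cn k U f -> Cn k U h.
Proof.
move=> oU; elim: k f h => [|k IH] f h fh [d1 d2]; split => //.
- by move=> x Ux; have [] := near_eq_diff (near_open oU Ux fh) (d1 x Ux).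
- by move=> x Ux; have [] := near_eq_diff (near_open oU Ux fh) (d1 x Ux).
move=> v; apply: IH (d2 v) => x Ux.
exact: (near_eq_derive v (near_open oU Ux fh)).
Qed.

Lemma derive_dE V W (f : V -> W) x v : differentiable f x -> 'D_v f x = 'd f x v.
Proof. by move=> /deriveE ->. Qed.

Lemma Cn_add V W k (U : set V) (f h : V -> W) : open U ->
  Cn k U f -> Cn k U h -> Cn k U (fun x => f x + h x).
Proof.
move=> oU; elim: k f h => [|k IH] f h [f1 f2] [h1 h2]; split => //.
- by move=> x Ux; exact: (differentiableD (f1 x Ux) (h1 x Ux)).
- by move=> x Ux; exact: (differentiableD (f1 x Ux) (h1 x Ux)).
move=> v; apply: (Cn_ext oU _ (IH _ _ (f2 v) (h2 v))) => x Ux.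
by rewrite (deriveD (diff_derivable (f1 x Ux)) (diff_derivable (h1 x Ux))).
Qed.

Lemma Cn_cst V W k (U : set V) (c : W) : Cn k U (fun=> c).
Proof.
elim: k c => [|k IH] c; split => //; try by move=> x _; exact: differentiable_cst.
move=> v; have -> : 'D_v (fun=> c : W) = (fun _ : V => 0).
  by apply/funext => x; exact: derive_cst.
exact: IH.
Qed.

Lemma Cn_postlin V W W' k (U : set V) (f : V -> W) (L : {linear W -> W'}) :
  open U -> continuous L -> Cn k U f -> Cn k U (fun x => L (f x)).
Proof.
move=> oU cL.
have dL y : differentiable L y by exact: linear_differentiable.
have df g x : differentiable g x ->
  differentiable (fun x => L (g x)) x /\ forall v : V, 'D_v (fun x => L (g x)) x = L ('D_v g x).
  move=> dg; have dLg : differentiable (L \o g) x by exact: differentiable_comp.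
  by split=> // v; rewrite (derive_dE v dLg) diff_comp // diff_lin //= (derive_dE v dg).
elim: k f => [|k IH] f [f1 f2]; split => //.
- by move=> x Ux; have [] := df _ _ (f1 x Ux).
- by move=> x Ux; have [] := df _ _ (f1 x Ux).
move=> v; apply: (Cn_ext oU _ (IH _ (f2 v))) => x Ux.
by have [_ ->] := df _ _ (f1 x Ux).
Qed.

Lemma diff_affine V V' (L : {linear V' -> V}) (c : V) x : continuous L ->
  differentiable (fun x => L x + c) x /\ 'd (fun x => L x + c) x = L :> (V' -> V).
Proof.
move=> cL; apply: eps_diff => // e e0; near=> h.
by rewrite linearD opprD addrACA subrr addr0 addrK subrr normr0 mulr_ge0 // ltW.
Unshelve. all: by end_near. Qed.

Lemma diff_prelin V V' W (g : V -> W) (L : {linear V' -> V}) (c : V) x :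
  continuous L -> differentiable g (L x + c) ->
  differentiable (fun x => g (L x + c)) x /\
    forall v, 'D_v (fun x => g (L x + c)) x = 'D_(L v) g (L x + c).
Proof.
move=> cL dg; have [dA dAE] := diff_affine c x cL.
have dgA : differentiable (g \o (fun x => L x + c)) x by exact: differentiable_comp.
by split => // v; rewrite (derive_dE v dgA) diff_comp // dAE (derive_dE (L v) dg).
Qed.

Lemma Cn_prelin V V' W k (U : set V) (f : V -> W) (L : {linear V' -> V}) (c : V) :
  continuous L -> open U -> Cn k U f ->
  Cn k [set x | U (L x + c)] (fun x => f (L x + c)).
Proof.
move=> cL oU.
have oA : open [set x | U (L x + c)].
  apply: (@open_comp _ _ (fun x => L x + c)) => // x _.
  apply: differentiable_continuous; have [] := diff_affine c x cL; by [].
elim: k f => [|k IH] f [f1 f2]; split => //.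
- by move=> x Ux; have [] := diff_prelin cL (f1 _ Ux).
- by move=> x Ux; have [] := diff_prelin cL (f1 _ Ux).
move=> v; apply: (Cn_ext oA _ (IH _ (f2 (L v)))) => x Ux /=.
by have [_ ->] := diff_prelin cL (f1 _ Ux).
Qed.

(** Registers scaling as a bilinear map, so that the differential of a general bilinear map yields
    the product rule [diff_scale]. *)
Lemma scaler_is_bilinear W : bilinear_for
    (GRing.Scale.Law.clone _ _ *:%R _) (GRing.Scale.Law.clone _ _ *:%R _)
    (@GRing.scale R W).
Proof.
split=> [u'|u] a x y /=; first by rewrite scalerDl scalerA.
by rewrite scalerDr !scalerA [u * a]mulrC.
Qed.
HB.instance Definition _ W := bilinear_isBilinear.Build R R W W _ _
  (@GRing.scale R W) (@scaler_is_bilinear W).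

Lemma diff_scale V W (a : V -> R) (f : V -> W) x :
  differentiable a x -> differentiable f x ->
  differentiable (fun x => a x *: f x) x /\
  forall v, 'D_v (fun x => a x *: f x) x = 'D_v a x *: f x + a x *: 'D_v f x.
Proof.
move=> da df.
have bil := @differentiable_bilin _ _ _ _ (@GRing.scale R W) (a x, f x) (@scale_continuous R W).
have dB u : 'd (fun p : R * W => p.1 *: p.2) (a x, f x) u = a x *: u.2 + u.1 *: f x.
  exact: (f_equal (@^~ u) (@diff_bilin _ _ _ _ (@GRing.scale R W) (a x, f x) (@scale_continuous R W))).
have dp := differentiable_pair da df.
have dc : differentiable ((fun p : R * W => p.1 *: p.2) \o (fun x => (a x, f x))) x.
  exact: differentiable_comp.
split=> // v; rewrite (derive_dE v dc) diff_comp // /comp dB diff_pair //=.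
by rewrite (derive_dE v da) (derive_dE v df) addrC.
Qed.

Lemma Cn_scale V W k (U : set V) (a : V -> R) (f : V -> W) : open U ->
  Cn k U a -> Cn k U f -> Cn k U (fun x => a x *: f x).
Proof.
move=> oU; elim: k a f => [|k IH] a f ca cf.
  by split=> // x Ux; have [] := diff_scale (Cn_diff ca Ux) (Cn_diff cf Ux).
split=> [x Ux|v]; first by have [] := diff_scale (Cn_diff ca Ux) (Cn_diff cf Ux).
apply: (Cn_ext oU _ (Cn_add oU (IH _ _ (CnD v ca) (CnW cf)) (IH _ _ (CnW ca) (CnD v cf)))).
by move=> x Ux; have [_ ->] := diff_scale (Cn_diff ca Ux) (Cn_diff cf Ux).
Qed.

Lemma Cn_mul V k (U : set V) (a b : V -> R) : open U ->
  Cn k U a -> Cn k U b -> Cn k U (fun x => a x * b x).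
Proof. exact: (@Cn_scale V R). Qed.

Lemma Cn_opp V W k (U : set V) (f : V -> W) : open U ->
  Cn k U f -> Cn k U (fun x => - f x).
Proof.
move=> oU cf; apply: (Cn_ext oU _ (Cn_scale oU (Cn_cst k U (-1 : R)) cf)) => x _.
by rewrite scaleN1r.
Qed.

Lemma Cn_sum V W k (U : set V) (I : Type) (r : seq I) (P : pred I) (f : I -> V -> W) :
  open U -> (forall i, P i -> Cn k U (f i)) -> Cn k U (fun x => \sum_(i <- r | P i) f i x).
Proof.
move=> oU h; elim: r => [|i r IH].
  by apply: (Cn_ext oU _ (Cn_cst k U 0)) => x _; rewrite big_nil.
case Pi : (P i); last by apply: (Cn_ext oU _ IH) => x _; rewrite big_cons Pi.
by apply: (Cn_ext oU _ (Cn_add oU (h i Pi) IH)) => x _; rewrite big_cons Pi.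
Qed.

Lemma Cn_prod V k (U : set V) (I : Type) (r : seq I) (P : pred I) (f : I -> V -> R) :
  open U -> (forall i, P i -> Cn k U (f i)) -> Cn k U (fun x => \prod_(i <- r | P i) f i x).
Proof.
move=> oU h; elim: r => [|i r IH].
  by apply: (Cn_ext oU _ (Cn_cst k U (1 : R))) => x _; rewrite big_nil.
case Pi : (P i); last by apply: (Cn_ext oU _ IH) => x _; rewrite big_cons Pi.
by apply: (Cn_ext oU _ (Cn_mul oU (h i Pi) IH)) => x _; rewrite big_cons Pi.
Qed.

(** The derivative [- a^-2 a'] contains the inverse of [a] to one order less, so the induction on
    [k] closes. *)
Lemma Cn_inv V k (U : set V) (a : V -> R) : open U -> (forall x, U x -> a x != 0) ->
  Cn k U a -> Cn k U (fun x => (a x)^-1).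
Proof.
move=> oU a0.
have dV x : U x -> differentiable a x -> differentiable (fun x => (a x)^-1) x.
  by move=> Ux da; exact: (differentiableV da (a0 x Ux)).
elim: k a a0 dV => [|k IH] a a0 dV ca.
  by split=> // x Ux; exact: dV (Cn_diff ca Ux).
split=> [x Ux|v]; first exact: dV (Cn_diff ca Ux).
have ci := IH _ a0 dV (CnW ca).
apply: (Cn_ext oU _ (Cn_opp oU (Cn_mul oU (Cn_mul oU ci ci) (CnD v ca)))) => x Ux.
rewrite (deriveV (a0 x Ux) (diff_derivable (Cn_diff ca Ux))) -exprVn expr2.
by rewrite -[RHS]/(_ * _) mulNr.
Qed.

End Cn.

(** * Matrix-valued functions: products, inverses and composition *)

Section CnMatrix.
Context {R : realType}.
Implicit Types (V W : normedModType R).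

Lemma mx_norm_ge m n (A : 'M[R]_(m, n)) i j : `|A i j| <= `|A|.
Proof.
rewrite [leRHS]/Num.Def.normr/= mx_normrE.
exact: (le_bigmax _ (fun ij : 'I_m * 'I_n => `|A ij.1 ij.2|) (i, j)).
Qed.

Lemma mx_norm_le m n (A : 'M[R]_(m, n)) c : 0 <= c ->
  (forall i j, `|A i j| <= c) -> `|A| <= c.
Proof.
move=> c0 h; rewrite [leLHS]/Num.Def.normr/= mx_normrE.
by apply: bigmax_le => // -[i j] _; exact: h.
Qed.

Lemma mx_norm_lt m n (A : 'M[R]_(m, n)) c : 0 < c ->
  (forall i j, `|A i j| < c) -> `|A| < c.
Proof.
move=> c0 h; rewrite [ltLHS]/Num.Def.normr/= mx_normrE.
by apply: bigmax_lt => // -[i j] _; exact: h.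
Qed.

Lemma linear_mx_continuous W m n (L : {linear 'M[R]_(m, n) -> W}) : continuous L.
Proof.
apply/linear_bounded_continuous/linear_boundedP.
near=> r => A; rewrite {1}(matrix_sum_delta A) linear_sum.
apply: (@le_trans _ _ (\sum_i \sum_j `|A| * `|L (delta_mx i j)|)).
  apply: le_trans (ler_norm_sum _ _ _) _; apply: ler_sum => i _.
  rewrite linear_sum; apply: le_trans (ler_norm_sum _ _ _) _; apply: ler_sum => j _.
  by rewrite linearZ normrZ ler_wpM2r // mx_norm_ge.
under eq_bigr do rewrite -mulr_sumr; rewrite -mulr_sumr mulrC ler_wpM2r //.
Unshelve. all: by end_near. Qed.

Lemma diff_mxP V m n (f : V -> 'M[R]_(m, n)) x :
  differentiable f x <-> forall i j, differentiable (fun y => f y i j) x.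
Proof.
split=> [df i j|df].
  exact: (@differentiable_comp _ _ _ _ f (fun A => A i j) x df (differentiable_coord _ _ _)).
have -> : f = (fun y => \sum_ij f y ij.1 ij.2 *: delta_mx ij.1 ij.2).
  apply/funext => y; rewrite {1}(matrix_sum_delta (f y)).
  by rewrite pair_big.
have -> : (fun y => \sum_ij f y ij.1 ij.2 *: delta_mx ij.1 ij.2) =
  \sum_ij (fun y => f y ij.1 ij.2 *: delta_mx ij.1 ij.2 : 'M[R]_(m, n)).
  by apply/funext => y; rewrite fct_sumE.
elim/big_ind: _ => [|g h dg dh|ij _]; first exact: differentiable_cst.
  exact: differentiableD.
exact: differentiableZl.
Qed.

Lemma derive_mxE V m n (f : V -> 'M[R]_(m, n)) x v i j : differentiable f x ->
  'D_v f x i j = 'D_v (fun y => f y i j) x.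
Proof. by move=> df; rewrite derive_mx ?mxE //; exact: diff_derivable. Qed.

Lemma Cn_mxP V k m n (U : set V) (f : V -> 'M[R]_(m, n)) : open U ->
  Cn k U f <-> forall i j, Cn k U (fun y => f y i j).
Proof.
move=> oU; elim: k f => [|k IH] f; split=> h.
- by move=> i j; split=> // x Ux; have /diff_mxP := Cn_diff h Ux.
- by split=> // x Ux; apply/diff_mxP => i j; exact: (Cn_diff (h i j)).
- move=> i j; split=> [x Ux|v]; first by have /diff_mxP := Cn_diff h Ux.
  have /IH/(_ i j) := CnD v h; apply: (Cn_ext oU) => x Ux.
  by rewrite derive_mxE //; exact: Cn_diff h Ux.
have df x : U x -> differentiable f x.
  by move=> Ux; apply/diff_mxP => i j; exact: (Cn_diff (h i j)).
split=> // v; apply/IH => i j; have := CnD v (h i j); apply: (Cn_ext oU) => x Ux.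
by rewrite derive_mxE //; exact: df.
Qed.

Lemma Cn_mulmx V k m n p (U : set V) (f : V -> 'M[R]_(m, n)) (h : V -> 'M[R]_(n, p)) :
  open U -> Cn k U f -> Cn k U h -> Cn k U (fun x => f x *m h x).
Proof.
move=> oU /(Cn_mxP _ _ oU) cf /(Cn_mxP _ _ oU) ch; apply/(Cn_mxP _ _ oU) => i j.
apply: (@Cn_ext _ _ _ _ _ (fun x => \sum_l f x i l * h x l j)) => //.
  by move=> x _; rewrite mxE.
by apply: Cn_sum => // l _; exact: Cn_mul.
Qed.

Lemma Cn_det V k m (U : set V) (f : V -> 'M[R]_m) :
  open U -> Cn k U f -> Cn k U (fun x => \det (f x)).
Proof.
move=> oU /(Cn_mxP _ _ oU) cf; apply: Cn_sum => // s _.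
by apply: Cn_mul => //; [exact: Cn_cst|exact: Cn_prod].
Qed.

(** Cramer's formula reduces the inverse to determinants of minors, which are polynomial in the
    entries. *)
Lemma Cn_invmx V k m (U : set V) (f : V -> 'M[R]_m) :
  open U -> (forall x, U x -> f x \in unitmx) -> Cn k U f -> Cn k U (fun x => invmx (f x)).
Proof.
move=> oU fu cf.
apply: (@Cn_ext _ _ _ _ _ (fun x => (\det (f x))^-1 *: \adj (f x))) => //.
  by move=> x Ux; rewrite /invmx fu.
apply: Cn_scale => //.
  by apply: Cn_inv => // [x Ux|]; [rewrite -unitfE; have := fu x Ux; rewrite unitmxE|exact: Cn_det].
apply/(Cn_mxP _ _ oU) => i j.
apply: (@Cn_ext _ _ _ _ _ (fun x => (-1) ^+ (j + i) * \det (row' j (col' i (f x))))) => //.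
  by move=> x Ux; rewrite mxE.
apply: Cn_mul => //; first exact: Cn_cst.
apply: Cn_det => //; apply/(Cn_mxP _ _ oU) => a b.
apply: (@Cn_ext _ _ _ _ _ (fun x => f x (lift j a) (lift i b))) => //.
  by move=> x Ux; rewrite !mxE.
by move/(Cn_mxP _ _ oU) : cf; apply.
Qed.

Lemma derive_comp_row V W m (f : V -> 'rV[R]_m) (h : 'rV[R]_m -> W) x v :
  differentiable f x -> differentiable h (f x) ->
  'D_v (fun y => h (f y)) x = \sum_j 'D_v f x 0 j *: 'D_(delta_mx 0 j) h (f x).
Proof.
move=> df dh; have dc : differentiable (h \o f) x by exact: differentiable_comp.
rewrite (derive_dE v dc) diff_comp // /comp -(derive_dE v df).
rewrite [in LHS](row_sum_delta ('D_v f x)) linear_sum; apply: eq_bigr => j _.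
by rewrite linearZ (derive_dE _ dh).
Qed.

Lemma derive_comp V W (Z : normedModType R) (f : V -> W) (h : W -> Z) x v :
  differentiable f x -> differentiable h (f x) ->
  'D_v (fun y => h (f y)) x = 'D_('D_v f x) h (f x).
Proof.
move=> df dh; have dc : differentiable (h \o f) x by exact: differentiable_comp.
by rewrite (derive_dE v dc) diff_comp // /comp -(derive_dE v df) (derive_dE _ dh).
Qed.

Lemma deriveDr V W (f : V -> W) x (a : R) u v : differentiable f x ->
  'D_(a *: u + v) f x = a *: 'D_u f x + 'D_v f x.
Proof. by move=> df; rewrite !(derive_dE _ df) linearP. Qed.

Lemma derive_row_sum W m (h : 'rV[R]_m -> W) x v : differentiable h x ->
  'D_v h x = \sum_j v 0 j *: 'D_(delta_mx 0 j) h x.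
Proof.
move=> dh; rewrite (derive_dE _ dh) {1}(row_sum_delta v) linear_sum.
by apply: eq_bigr => j _; rewrite linearZ (derive_dE _ dh).
Qed.

(** As [f] has values in row vectors, the chain rule is a finite sum of products of an entry of
    ['D_v f] with a partial derivative of [h] taken at [f]. The second factor is again a composite,
    one order lower, which is why the induction generalises [h]. *)
Lemma Cn_comp V W k m (U : set V) (O : set 'rV[R]_m) (f : V -> 'rV[R]_m)
    (h : 'rV[R]_m -> W) : open U -> (forall x, U x -> O (f x)) ->
  Cn k U f -> Cn k O h -> Cn k U (fun x => h (f x)).
Proof.
move=> oU fO.
have dc f' h' : Cn 0 U f' -> Cn 0 O h' -> (forall x, U x -> O (f' x)) ->
    forall x, U x -> differentiable (fun x => h' (f' x)) x.
  move=> [cf _] [ch _] fO' x Ux.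
  by apply: (@differentiable_comp _ _ _ _ f' h'); [exact: cf|exact/ch/fO'].
have Cn0 (X Y : normedModType R) i (A : set X) (u : X -> Y) : Cn i A u -> Cn 0 A u.
  by move=> cu; split=> // x Ax; exact: Cn_diff cu Ax.
elim: k W h dc => [|k IH] W h dc cf ch; first by split=> // x Ux; exact: dc.
split=> [x Ux|v]; first by apply: dc => //; [exact: Cn0 cf|exact: Cn0 ch].
apply: (@Cn_ext _ _ _ _ _ (fun x => \sum_j 'D_v f x 0 j *: 'D_(delta_mx 0 j) h (f x))) => //.
  by move=> x Ux; rewrite derive_comp_row //; [exact: Cn_diff cf Ux|exact: (Cn_diff ch (fO _ Ux))].
apply: Cn_sum => // j _; apply: Cn_scale => //.
  by have /(Cn_mxP _ _ oU) := CnD v cf; apply.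
exact: (IH _ _ dc (CnW cf) (CnD _ ch)).
Qed.

End CnMatrix.

(** * Curves: growth estimates, the Gronwall inequality, symmetry of second derivatives *)

Section Curves.
Context {R : realType}.
Implicit Types (V W : normedModType R).

Definition isd W (c : R -> W) (t : R) (v : W) : Prop := is_derive t 1 c v.

Lemma isd_diff W (c : R -> W) t v : isd c t v -> differentiable c t.
Proof. by case=> h _; apply/derivable1_diffP. Qed.

Lemma isd_val W (c : R -> W) t v : isd c t v -> 'D_1 c t = v.
Proof. by case. Qed.

Lemma diff_isd W (c : R -> W) t : differentiable c t -> isd c t ('D_1 c t).
Proof. by move=> /derivable1_diffP h; constructor. Qed.

Lemma isd_cont W (c : R -> W) t v : isd c t v -> {for t, continuous c}.
Proof. by move=> /isd_diff; exact: differentiable_continuous. Qed.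

Lemma isd_comp W (Z : normedModType R) (c : R -> W) (F : W -> Z) t v : isd c t v ->
  differentiable F (c t) -> isd (fun s => F (c s)) t ('D_v F (c t)).
Proof.
move=> h dF; have dc := isd_diff h.
have dd : differentiable (F \o c) t by exact: differentiable_comp.
by apply: (is_derive_eq (diff_isd dd)); rewrite -(isd_val h) -derive_comp.
Qed.

Lemma isd_mxP m n (c : R -> 'M[R]_(m, n)) t v :
  isd c t v <-> forall i j, isd (fun s => c s i j) t (v i j).
Proof.
split=> h.
  move=> i j; have dc := isd_diff h; have /diff_mxP/(_ i j) dij := dc.
  by apply: (is_derive_eq (diff_isd dij)); rewrite -derive_mxE // (isd_val h).
have dc : differentiable c t by apply/diff_mxP => i j; exact: isd_diff (h i j).
apply: (is_derive_eq (diff_isd dc)); apply/matrixP => i j.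
by rewrite derive_mxE // (isd_val (h i j)).
Qed.

Lemma isd_ext W (c d : R -> W) t v : (\forall s \near t, c s = d s) ->
  isd c t v -> isd d t v.
Proof. exact: near_eq_is_derive. Qed.

Lemma isd_scale W (a : R -> R) (c : R -> W) t a' c' : isd a t a' ->
  isd c t c' -> isd (fun s => a s *: c s) t (a' *: c t + a t *: c').
Proof.
move=> ha hc; have [d1 d2] := diff_scale (isd_diff ha) (isd_diff hc).
by apply: (is_derive_eq (diff_isd d1)); rewrite d2 (isd_val ha) (isd_val hc).
Qed.

Lemma isd_nincr (f df : R -> R) a b : a <= b ->
  (forall x, a <= x <= b -> isd f x (df x)) ->
  (forall x, a <= x <= b -> df x <= 0) -> f b <= f a.
Proof.
rewrite le_eqVlt => /predU1P[->//|ab] h d0.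
have [||c cab e] := @MVT _ f df a b ab.
- by move=> x /itvP xab; apply: h; rewrite !xab.
- apply: continuous_in_subspaceT => x; rewrite inE /= => /itvP xab.
  by apply: (@isd_cont _ f x (df x)); apply: h; rewrite !xab.
rewrite -subr_le0 e pmulr_lle0 ?subr_gt0 //; apply: d0.
by move/itvP: cab => cab; rewrite !cab.
Qed.

Lemma isd_id t : isd (fun s : R => s) t 1.
Proof. exact: is_derive_id. Qed.

Lemma isd_cst W (w : W) t : isd (fun=> w) t 0.
Proof. exact: is_derive_cst. Qed.

Lemma isd_add W (c d : R -> W) t u v : isd c t u -> isd d t v ->
  isd (fun s => c s + d s) t (u + v).
Proof. by move=> h1 h2; exact: (@is_deriveD _ _ _ c d t 1 u v h1 h2). Qed.

Lemma isd_opp W (c : R -> W) t u : isd c t u -> isd (fun s => - c s) t (- u).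
Proof. by move=> h1; exact: (@is_deriveN _ _ _ c t 1 u h1). Qed.

Lemma isd_sub W (c d : R -> W) t u v : isd c t u -> isd d t v ->
  isd (fun s => c s - d s) t (u - v).
Proof. by move=> h1 h2; apply: isd_add => //; exact: isd_opp. Qed.

Lemma isd_mul (a b : R -> R) t a' b' : isd a t a' -> isd b t b' ->
  isd (fun s => a s * b s) t (a' * b t + a t * b').
Proof. exact: (@isd_scale R). Qed.

Lemma isd_sum W (I : Type) (r : seq I) (c : I -> R -> W) (v : I -> W) t :
  (forall i, isd (c i) t (v i)) ->
  isd (fun s => \sum_(i <- r) c i s) t (\sum_(i <- r) v i).
Proof.
move=> h; elim: r => [|i r IH].
  rewrite big_nil; apply: isd_ext (isd_cst 0 t); near=> s; by rewrite big_nil.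
rewrite big_cons; apply: isd_ext (isd_add (h i) IH); near=> s; by rewrite big_cons.
Unshelve. all: by end_near. Qed.

Lemma isd_eq W (c : R -> W) t u v : isd c t u -> u = v -> isd c t v.
Proof. by move=> h <-. Qed.

Lemma isd_rescale W (c : R -> W) a b t v : isd c (a * t + b) v ->
  isd (fun s => c (a * s + b)) t (a *: v).
Proof.
move=> h.
have ha : isd (fun s : R => a * s + b) t a.
  apply: isd_eq (isd_add (isd_mul (isd_cst a t) (isd_id t)) (isd_cst b t)) _.
  by rewrite mul0r add0r mulr1 addr0.
have := @isd_comp _ _ _ c t a ha (isd_diff h).
have := deriveDr a (1 : R) 0 (isd_diff h).
rewrite derive0 !addr0 (isd_val h) -[a *: 1]/(a * 1) mulr1 => e.
by move/isd_eq; apply.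
Qed.

Lemma isd_exp k t : isd (fun s => expR (k * s)) t (k * expR (k * t)).
Proof.
have := @isd_rescale _ (@expR R) k 0 t (expR (k * t + 0)).
rewrite addr0 => h; apply: isd_ext (h (is_derive_expR _)).
by near=> s; rewrite addr0.
Unshelve. all: by end_near. Qed.

(** The norm is the maximum of the entries, so it suffices that each [± u i j - v] is
    nonincreasing. *)
Lemma isd_dom_pos m n (u du : R -> 'M[R]_(m, n)) (v dv : R -> R) (t : R) : 0 <= t ->
  (forall s : R, 0 <= s <= t -> isd u s (du s)) ->
  (forall s : R, 0 <= s <= t -> isd v s (dv s)) ->
  (forall s : R, 0 <= s <= t -> `|du s| <= dv s) ->
  `|u t - u 0| <= v t - v 0.
Proof.
move=> t0 hu hv hd.
have key i j (e : R) : `|e| = 1 -> e * (u t i j - u 0 i j) <= v t - v 0.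
  move=> e1.
  suff : e * u t i j - v t <= e * u 0 i j - v 0 by lra.
  apply: (@isd_nincr (fun s => e * u s i j - v s) (fun s => e * du s i j - dv s) 0 t t0).
  - move=> s /[dup] /hu/isd_mxP/(_ i j) h /hv hvs; apply: isd_sub => //.
    by apply: isd_eq (isd_mul (isd_cst e s) h) _; rewrite mul0r add0r.
  - move=> s s0t; rewrite subr_le0; have := hd s s0t.
    apply: le_trans.
    apply: le_trans (ler_norm _) _; rewrite normrM e1 mul1r.
    exact: mx_norm_ge.
apply: mx_norm_le => [|i j].
  rewrite subr_ge0; have := @isd_nincr (fun s => - v s) (fun s => - dv s) 0 t t0.
  rewrite lerN2; apply => s s0t; first by apply: isd_opp; exact: hv.
  rewrite oppr_le0; apply: le_trans (normr_ge0 (du s)) _.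
  exact: hd s s0t.
rewrite !mxE ler_norml; apply/andP; split.
  by have := key i j (-1); rewrite normrN1 => /(_ erefl); lra.
by have := key i j 1; rewrite normr1 => /(_ erefl); lra.
Unshelve. all: by end_near. Qed.

Lemma isd_dom m n (u du : R -> 'M[R]_(m, n)) (v dv : R -> R) t :
  (forall s : R, `|s| <= `|t| -> isd u s (du s)) ->
  (forall s : R, 0 <= s <= `|t| -> isd v s (dv s)) ->
  (forall s : R, `|s| <= `|t| -> `|du s| <= dv `|s|) ->
  `|u t - u 0| <= v `|t| - v 0.
Proof.
wlog t0 : u du t / 0 <= t => [H hu hv hd|].
  have [t0|/ltW t0] := leP 0 t; first exact: H hu hv hd.
  have := H (fun s => u (- s)) (fun s => - du (- s)) (- t).
  rewrite oppr_ge0 normrN opprK oppr0; apply => // s st.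
    apply: isd_ext (_ : isd (fun s => u (-1 * s + 0)) s _).
      by near=> r; rewrite mulN1r addr0.
    apply: isd_eq (@isd_rescale _ u (-1) 0 s (du (- s)) _) (scaleN1r _).
    by rewrite mulN1r addr0; apply: hu; rewrite normrN.
  by rewrite normrN -[in leRHS](normrN s); apply: hd; rewrite normrN.
rewrite (ger0_norm t0) => hu hv hd.
have pos s : 0 <= s <= t -> `|s| <= t by case/andP=> s0 ?; rewrite ger0_norm.
apply: (@isd_dom_pos m n u du v dv t t0) => // s st; first exact: hu (pos _ st).
by have := hd s (pos s st); rewrite (ger0_norm (andP st).1).
Unshelve. all: by end_near. Qed.

Lemma isd_const m n (u : R -> 'M[R]_(m, n)) t :
  (forall s : R, `|s| <= `|t| -> isd u s 0) -> u t = u 0.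
Proof.
move=> h; apply/eqP; rewrite -subr_eq0 -normr_le0.
have := @isd_dom m n u (fun=> 0) (fun=> 0) (fun=> 0) t h; rewrite subrr; apply.
- by move=> s _; exact: isd_cst.
- by move=> s _; rewrite normr0.
Qed.

Lemma gronwall1 (w dw : R -> R) c t : 0 <= t ->
  (forall s : R, 0 <= s <= t -> isd w s (dw s)) ->
  (forall s : R, 0 <= s <= t -> dw s <= c * w s) -> w t <= expR (c * t) * w 0.
Proof.
move=> t0 hw hd.
suff : expR (- c * t) * w t <= expR (- c * 0) * w 0.
  rewrite mulr0 expR0 mul1r mulNr expRN => h.
  by rewrite -ler_pdivrMl ?expR_gt0.
apply: (@isd_nincr (fun s => expR (- c * s) * w s)
  (fun s => - c * expR (- c * s) * w s + expR (- c * s) * dw s) 0 t t0).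
  by move=> s st; apply: isd_mul (isd_exp _ _) (hw s st).
move=> s st; have -> : - c * expR (- c * s) * w s + expR (- c * s) * dw s =
  expR (- c * s) * (dw s - c * w s) by ring.
by rewrite pmulr_rle0 ?expR_gt0 // subr_le0 hd.
Qed.

(** Here [x] stands for [|u|] and [s] for the sum of squares of the entries. Adding [e ^+ 2] to [s]
    absorbs the inhomogeneous term [e], so that the scalar inequality for [s + e ^+ 2] is
    homogeneous. *)
Lemma gronwall_arith (n1 K e x s : R) : 0 <= n1 -> 0 <= K -> 0 <= e -> 0 <= x ->
  x ^+ 2 <= s -> n1 * (2 * (x * (K * x + e))) <= n1 * (2 * K + 1) * (s + e ^+ 2).
Proof.
move=> n0 K0 e0 x0 xs; rewrite -mulrA ler_wpM2l //.
have h1 : 2 * (x * e) <= x ^+ 2 + e ^+ 2 by have := sqr_ge0 (x - e); lra.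
have h2 : K * x ^+ 2 <= K * s by rewrite ler_wpM2l.
have h3 : 0 <= K * e ^+ 2 by rewrite mulr_ge0 ?sqr_ge0.
lra.
Qed.

(** The maximum norm is not differentiable along a curve, so the estimate is run on the sum of
    squares and compared with the norm at both ends. That [G] is chosen before [u] and [e] is what
    makes the later error terms uniform. *)
Lemma gronwall m (K T : R) : 0 <= K -> 0 <= T -> exists2 G : R, 0 < G &
  forall (u du : R -> 'rV[R]_m) (e t : R), 0 <= t <= T -> 0 <= e ->
  (forall s : R, 0 <= s <= t -> isd u s (du s)) ->
  (forall s : R, 0 <= s <= t -> `|du s| <= K * `|u s| + e) ->
  `|u t| <= G * (`|u 0| + e).
Proof.
move=> K0 T0; set c := m%:R * (2 * K + 1).
have c0 : 0 <= c by rewrite mulr_ge0 // addr_ge0 // mulr_ge0.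
have m1 : 1 <= m%:R + 1 :> R by rewrite lerDr.
exists (expR (c * T) * (m%:R + 1)).
  by rewrite mulr_gt0 ?expR_gt0 // (lt_le_trans ltr01 m1).
move=> u du e t /andP[t0 tT] e0 hu hd.
pose sq (v : 'rV[R]_m) := \sum_j v 0 j * v 0 j.
have sq1 v : `|v| ^+ 2 <= sq v.
  have sq0 : 0 <= sq v by apply: sumr_ge0 => j _; rewrite -expr2 sqr_ge0.
  rewrite -[leRHS]sqr_sqrtr // ler_sqr ?nnegrE ?sqrtr_ge0 //.
  apply: mx_norm_le; rewrite ?sqrtr_ge0 // => i j.
  rewrite -sqrtr_sqr ord1 ler_sqrt //.
  rewrite /sq (bigD1 j) //= expr2 lerDl.
  by apply: sumr_ge0 => l _; rewrite -expr2 sqr_ge0.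
have sq2 v : sq v <= m%:R * `|v| ^+ 2.
  rewrite /sq; apply: (@le_trans _ _ (\sum_(j < m) `|v| ^+ 2)).
    apply: ler_sum => j _; rewrite -expr2 -real_normK ?num_real //.
    by rewrite ler_sqr ?nnegrE // mx_norm_ge.
  by rewrite sumr_const card_ord mulr_natl.
have g1 := @gronwall1 (fun s => sq (u s) + e ^+ 2)
  (fun s => \sum_j (du s 0 j * u s 0 j + u s 0 j * du s 0 j) + 0) c t t0.
have {g1} : sq (u t) + e ^+ 2 <= expR (c * t) * (sq (u 0) + e ^+ 2).
  apply: g1 => s st.
    apply: isd_add; last exact: isd_cst.
    apply: isd_sum => j; have /isd_mxP/(_ 0 j) h := hu s st.
    exact: isd_mul.
  rewrite addr0; apply: le_trans (gronwall_arith _ K0 e0 (normr_ge0 (u s)) (sq1 (u s))) => //.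
  apply: (@le_trans _ _ (\sum_(j < m) 2 * (`|u s| * `|du s|))).
    apply: ler_sum => j _; rewrite [u s 0 j * _]mulrC -mulr2n -[leLHS]mulr_natl.
    rewrite ler_pM2l // mulrC; apply: le_trans (ler_norm _) _.
    by rewrite normrM ler_pM // mx_norm_ge.
  rewrite sumr_const card_ord -[leLHS]mulr_natl ler_wpM2l // ler_pM2l //.
  by rewrite ler_wpM2l // hd.
move=> h; set B := `|u 0| + e.
have B0 : 0 <= B by rewrite addr_ge0.
have E1 : 1 <= expR (c * T) by rewrite -expR0 ler_expR mulr_ge0.
have EtT : expR (c * t) <= expR (c * T) by rewrite ler_expR ler_wpM2l.
rewrite -ler_sqr ?nnegrE //; last by rewrite !mulr_ge0 ?expR_ge0 // (le_trans ler01).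
apply: le_trans (sq1 _) _; apply: (@le_trans _ _ (expR (c * T) * ((m%:R + 1) * B ^+ 2))).
  apply: (@le_trans _ _ (sq (u t) + e ^+ 2)); first by rewrite lerDl sqr_ge0.
  apply: le_trans h _; apply: ler_pM; rewrite ?expR_ge0 ?addr_ge0 ?sqr_ge0 //.
    by apply: le_trans (sq1 _); rewrite sqr_ge0.
  rewrite mulrDl mul1r; apply: lerD; last by rewrite ler_sqr ?nnegrE // lerDr.
  by apply: le_trans (sq2 _) _; rewrite ler_wpM2l // ler_sqr ?nnegrE // lerDl.
rewrite !exprMn -mulrA; apply: ler_pM; rewrite ?expR_ge0 //.
- by rewrite mulr_ge0 ?sqr_ge0 // (le_trans ler01).
- by rewrite expr2 ler_peMr // expR_ge0.
- by rewrite ler_wpM2r ?sqr_ge0 // expr2 ler_peMr // (le_trans ler01).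
Qed.

(** Induction along the real line: the step yields [P] on a full neighbourhood of [s], so the
    supremum of the times reached can be passed unless it is within reach of [t]. It replaces
    compactness of segments below. *)
Lemma real_ind (P : R -> Prop) (t : R) :
  (forall s : R, 0 <= s <= t -> (forall r : R, 0 <= r < s -> P r) ->
    \forall r \near s, P r) -> 0 <= t -> P t.
Proof.
move=> h t0.
pose S : set R := [set s | 0 <= s <= t /\ forall r : R, 0 <= r <= s -> P r].
have P0 : P 0.
  apply: nbhs_singleton; apply: h; rewrite ?lexx //= => r /andP[r0 r1].
  by have := le_lt_trans r0 r1; rewrite ltxx.
have S0 : S 0.
  by split=> [|r]; [rewrite lexx | rewrite -eq_le => /eqP <-].
have supS : has_sup S by split; [exists 0|exists t => s [/andP[]]].
set x := sup S.
have x0 : 0 <= x by apply: ub_le_sup => //; case: supS.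
have xt : x <= t by apply: ge_sup; [exists 0|move=> s [/andP[]]].
have Plt r : 0 <= r < x -> P r.
  case/andP=> r0 rx; have xr : 0 < x - r by rewrite subr_gt0.
  have [s Ss] := sup_adherent xr supS; rewrite -/x opprB addrCA subrr addr0 => rs.
  by apply: Ss.2; rewrite r0 ltW.
have : \forall r \near x, P r by apply: h => //; rewrite x0.
case/nbhs_ballP => e /= e0 he.
have Pe r : 0 <= r < x + e -> P r.
  case/andP=> r0 rxe; have [rx|xr] := ltP r x; first by apply: Plt; rewrite r0.
  by apply: he; rewrite /ball /= ltr_norml ltrBrDl ltrBlDr; lra.
have [xet|txe] := leP (x + e / 2) t; last by apply: Pe; rewrite t0; lra.
suff : x + e / 2 <= x by lra.
apply: ub_le_sup; first by case: supS.
by split=> [|r /andP[r0 r1]]; [lra|apply: Pe; lra].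
Qed.

(** A bootstrap: the differential inequality is known only while [|u| < d], and the bound it
    implies, being below [d], prevents [u] from leaving this region. *)
Lemma gronwall_trap m (K T : R) : 0 <= K -> 0 <= T -> exists2 G : R, 0 < G &
  forall (u du : R -> 'rV[R]_m) (e t d : R), 0 <= t <= T -> 0 <= e ->
  (forall s : R, 0 <= s <= t -> isd u s (du s)) ->
  (forall s : R, 0 <= s <= t -> `|u s| < d -> `|du s| <= K * `|u s| + e) ->
  `|u 0| < d -> G * (`|u 0| + e) < d -> `|u t| <= G * (`|u 0| + e).
Proof.
move=> K0 T0; have [G G0 hG] := gronwall m K0 T0.
exists G => // u du e t d tT e0 hu hd u0d Gd.
have t0 : 0 <= t by case/andP: tT.
have ud s : 0 <= s <= t -> `|u s| < d.
  case/andP=> s0 st; apply: (@real_ind (fun s => `|u s| < d) s _ s0) => r /andP[r0 rs] lt.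
  suff ur : `|u r| < d.
    have /isd_cont cu : isd u r (du r) by apply: hu; lra.
    have cn : {for r, continuous (fun s => `|u s|)}.
      by apply: continuous_comp => //; exact: norm_continuous.
    exact: (cn _ (lt_nbhsl ur)).
  have [->//|rn0] := eqVneq r 0.
  have rp : 0 < r by rewrite lt_neqAle eq_sym rn0.
  apply: le_lt_trans Gd.
  have bd q : 0 <= q < r -> `|u q| <= G * (`|u 0| + e).
    move=> /andP[q0 qr]; apply: (hG u du e q) => //; first by lra.
    - by move=> p pq; apply: hu; lra.
    - by move=> p pq; apply: hd; [lra|apply: lt; lra].
  (* If the bound failed at [r], by continuity it would fail already at some [q < r], against
     [bd]. *)
  rewrite leNgt; apply/negP => ltu.
  have /isd_cont cu : isd u r (du r) by apply: hu; lra.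
  have cn : {for r, continuous (fun s => `|u s|)}.
    by apply: continuous_comp => //; exact: norm_continuous.
  have /nbhs_ballP [b /= b0 hb] := cn _ (lt_nbhsr ltu).
  pose q := Num.max 0 (r - b / 2).
  have qr : 0 <= q < r by rewrite /q le_max lexx /= gt_max rp /=; lra.
  have : ball r b q.
    rewrite /ball /= ger0_norm; last by rewrite subr_ge0 ltW //; case/andP: qr.
    by rewrite ltrBlDr -ltrBlDl /q lt_max; apply/orP; right; lra.
  by move/hb; rewrite /= ltNge bd.
by apply: (hG u du e t) => // s st; apply: hd => //; exact: ud.
Qed.

Lemma isd_lip (f df : R -> R) (t M : R) : 0 <= t ->
  (forall s : R, 0 <= s <= t -> isd f s (df s)) ->
  (forall s : R, 0 <= s <= t -> `|df s| <= M) -> `|f t - f 0| <= M * t.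
Proof.
move=> t0 hf hd.
have key (a : R) : `|a| = 1 -> a * (f t - f 0) <= M * t.
  move=> a1.
  suff h : a * f t - M * t <= a * f 0 - M * 0.
    by move: h; rewrite mulr0 subr0 mulrBr !lerBlDr addrC.
  apply: (@isd_nincr (fun s => a * f s - M * s) (fun s => a * df s - M) 0 t t0) => s st.
    apply: isd_sub.
      by apply: isd_eq (isd_mul (isd_cst a s) (hf s st)) _; rewrite mul0r add0r.
    by apply: isd_eq (isd_mul (isd_cst M s) (isd_id s)) _; rewrite mul0r add0r mulr1.
  rewrite subr_le0; apply: le_trans (ler_norm _) _.
  by rewrite normrM a1 mul1r hd.
rewrite ler_norml lerNl; apply/andP; split.
  by rewrite -mulN1r; apply: key; rewrite normrN1.
by rewrite -[leLHS]mul1r; apply: key; rewrite normr1.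
Qed.

Lemma schwarz_arith (a b c d p q e t : R) : 0 < t ->
  `|a - b - (c - d) - t * t * p| <= e / 2 * (t * t) ->
  `|a - c - (b - d) - t * t * q| <= e / 2 * (t * t) -> `|p - q| <= e.
Proof.
move=> t0 h1 h2; have tt : 0 < t * t by rewrite mulr_gt0.
rewrite -(ler_pM2r tt) -{1}(gtr0_norm tt) -normrM.
have -> : (p - q) * (t * t) = (a - c - (b - d) - t * t * q) - (a - b - (c - d) - t * t * p) by ring.
apply: le_trans (ler_normB _ _) _; rewrite [e]splitr mulrDl; exact: lerD.
Qed.

Lemma schwarz_arith2 (a b c d p : R) : d - c - (b - a) - p = d - b - p - (c - a).
Proof. by ring. Qed.

Lemma schwarz_arith3 (a b c d p : R) : a - b - p = a - c - (d + p) - (b - c - d).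
Proof. by ring. Qed.

Lemma isd_line V W (f : V -> W) a b s : differentiable f (s *: a + b) ->
  isd (fun s : R => f (s *: a + b)) s ('D_a f (s *: a + b)).
Proof.
move=> df; apply: (@isd_comp _ _ (fun s : R => s *: a + b) f s a) => //.
apply: isd_eq (isd_add (isd_scale (isd_id s) (isd_cst a s)) (isd_cst b s)) _.
by rewrite scale1r scaler0 !addr0.
Qed.

(* [f(x+tu+tv) - f(x+tu) - f(x+tv) + f(x)] is close to [t^2 D_w (D_z f)] by the
   mean value theorem, and symmetric in [u], [v]. *)
Lemma schwarz_near V (f : V -> R) (U : set V) x w z (e : R) :
  open U -> U x -> Cn 1 U f -> 0 < e -> \forall t \near (0 : R)^'+,
   `|f (t *: z + (t *: w + x)) - f (t *: w + x) - (f (t *: z + x) - f x)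
     - t * t * 'D_w ('D_z f) x| <= e * (t * t).
Proof.
move=> oU Ux cf e0; set F := 'D_z f.
have df y : U y -> differentiable f y by move=> Uy; exact: Cn_diff cf Uy.
have dF : differentiable F x by exact: Cn_diff (CnD z cf) Ux.
set B := `|w| + `|z| + 1.
have B0 : 0 < B by rewrite ltr_wpDl // addr_ge0.
(* The increments have norm at most [t * B], so each of the two linearisations of [F] costs
   [e * t / 2]; integrating the sum over [[0, t]] gives [e * t * t]. *)
have e4 : 0 < e / (2 * B) by rewrite divr_gt0 // mulr_gt0.
have /nbhs_ballP[r /= r0 hr] : nbhs x U by exact: open_nbhs_nbhs.
have /nbhs_ballP[q /= q0 hq] := diff_eps dF e4.
near=> t.
have t0 : 0 < t by near: t; exact: nbhs_right_gt.
have small h : `|h| <= t * B -> U (h + x) /\ `|F (h + x) - F x - 'd F x h| <= e / (2 * B) * `|h|.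
  move=> ht; have hrq : `|h| < Num.min r q.
    apply: le_lt_trans ht _; rewrite -ltr_pdivlMr //.
    by near: t; apply: nbhs_right_lt; rewrite divr_gt0 // lt_min r0 q0.
  move: hrq; rewrite lt_min => /andP[h1 h2]; split.
    by apply: hr; rewrite -ball_normE /= opprD addrC subrK normrN.
  by apply: hq; rewrite -ball_normE /= sub0r normrN.
have sz s (a : R) : 0 <= s <= t -> 0 <= a <= t -> `|s *: z + a *: w| <= t * B.
  move=> /andP[s0 st] /andP[a0 at_]; apply: le_trans (ler_normD _ _) _.
  rewrite !normrZ !ger0_norm // /B mulrDr mulr1 mulrDr addrC.
  rewrite -[leLHS]addr0; apply: lerD; last exact: ltW.
  by apply: lerD; rewrite ler_wpM2r.
pose phi (s : R) := f (s *: z + (t *: w + x)) - f (s *: z + x) - s * t * 'D_w F x.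
pose dphi (s : R) := F (s *: z + (t *: w + x)) - F (s *: z + x) - t * 'D_w F x.
have t1 : 0 <= t <= t by rewrite lexx ltW.
have z1 : 0 <= (0 : R) <= t by rewrite lexx ltW.
suff h : `|phi t - phi 0| <= e * t * t.
  move: h; rewrite /phi !scale0r !add0r !mul0r subr0 [e * (t * t)]mulrA.
  apply: le_trans; rewrite le_eqVlt; apply/orP; left; apply/eqP; congr (`| _ |).
  exact: schwarz_arith2.
apply: (@isd_lip phi dphi t (e * t) (ltW t0)) => s st.
  have [U1 _] := small _ (sz s t st t1); have [U2 _] := small _ (sz s 0 st z1).
  apply: isd_sub; first apply: isd_sub.
  - by apply: isd_line; apply: df; rewrite addrA.
  - by apply: isd_line; apply: df; move: U2; rewrite scale0r addr0.
  apply: isd_eq (isd_mul (isd_mul (isd_id s) (isd_cst t s)) (isd_cst ('D_w F x) s)) _.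
  by rewrite mul1r !mulr0 !addr0.
have [_ h1] := small _ (sz s t st t1); have [_ h2] := small _ (sz s 0 st z1).
rewrite /dphi addrA.
have hh1 := le_trans h1 (ler_wpM2l (ltW e4) (sz s t st t1)).
have hh2 := le_trans h2 (ler_wpM2l (ltW e4) (sz s 0 st z1)).
rewrite scale0r addr0 in hh2.
have -> : 'D_w F x = 'd F x w by exact: derive_dE.
have e1 : 'd F x (s *: z + t *: w) = s * 'd F x z + t * 'd F x w by rewrite linearD !linearZ.
have e2 : 'd F x (s *: z) = s * 'd F x z by rewrite linearZ.
move: hh1 hh2; rewrite e1 e2.
have -> : e / (2 * B) * (t * B) = e * t / 2 by field; rewrite gt_eqF.
move=> hh1 hh2; rewrite [e * t]splitr; apply: le_trans (lerD hh1 hh2).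
apply: le_trans (ler_normB _ _).
rewrite le_eqVlt; apply/orP; left; apply/eqP; congr (`| _ |).
exact: schwarz_arith3.
Unshelve. all: by end_near. Qed.

Lemma schwarz V (f : V -> R) (U : set V) x u v : open U -> U x -> Cn 1 U f ->
  'D_u ('D_v f) x = 'D_v ('D_u f) x.
Proof.
move=> oU Ux cf; apply/eqP; rewrite -subr_eq0 -normr_le0; apply/ler_addgt0Pr => e e0.
rewrite add0r; have e2 : 0 < e / 2 by rewrite divr_gt0.
have [t [[h1 h2] t0]] := filter_ex (filterI (filterI (schwarz_near u v oU Ux cf e2)
  (schwarz_near v u oU Ux cf e2)) (nbhs_right_gt (0 : R))).
apply: (schwarz_arith t0 h1); by rewrite addrCA in h2.
Qed.

End Curves.

(** * Primitives and global solutions of Lipschitz differential equations *)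

Section Picard.
Context {R : realType}.
Local Notation mu := (@lebesgue_measure R).

Lemma isd_const1 (u : R -> R) t :
  (forall s : R, `|s| <= `|t| -> isd u s 0) -> u t = u 0.
Proof.
move=> h.
have := @isd_const R 1 1 (fun s => (u s)%:M) t => H.
have : (u t)%:M = (u 0)%:M :> 'M[R]_1.
  apply: H => s st; apply/isd_mxP => i j; rewrite !ord1 mxE.
  by apply: isd_ext (h s st); near=> r; rewrite mxE eqxx mulr1n.
by move=> /matrixP/(_ 0 0); rewrite !mxE eqxx !mulr1n.
Unshelve. all: by end_near. Qed.

(** The integral from [- T] gives a primitive on the right of [- T]. Normalised to vanish at 0 these
    primitives agree where they overlap, so taking [T = |x| + 1] at the point [x] produces one on
    the whole line. *)
Lemma antiderivative (f : R -> R) : continuous f ->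
  exists2 F : R -> R, F 0 = 0 & forall t, isd F t (f t).
Proof.
move=> cf; pose G (T x : R) : R := (\int[mu]_(t in [set` `[- T, x]]) f t)%R.
have dG T x : - T < x -> isd (G T) x (f x).
  move=> Tx; have xx : x < x + 1 by rewrite ltrDl.
  have fi : mu.-integrable `[- T, x + 1] (EFin \o f).
    apply: continuous_compact_integrable; first exact: segment_compact.
    by apply: continuous_subspaceT.
  have [h1 h2] := continuous_FTC1_closed xx fi Tx (cf x).
  by rewrite derive1E in h2; exact: DeriveDef h1 h2.
pose F T x := G T x - G T 0.
have dF T x : - T < x -> isd (F T) x (f x).
  by move=> Tx; apply: isd_eq (isd_sub (dG T x Tx) (isd_cst (G T 0) x)) (subr0 _).
have uF T T' x : `|x| < T -> `|x| < T' -> F T x = F T' x.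
  move=> xT xT'; apply/eqP; rewrite -subr_eq0; apply/eqP.
  have := @isd_const1 (fun y => F T y - F T' y) x => /= ->.
    by rewrite /F !subrr.
  move=> s sx; rewrite -(subrr (f s)).
  have := le_lt_trans sx xT; have := le_lt_trans sx xT'.
  by rewrite !ltr_norml => /andP[? _] /andP[? _]; apply: isd_sub; exact: dF.
exists (fun x => F (`|x| + 1) x); first by rewrite /F normr0 subrr.
move=> t; apply: (isd_ext (_ : \forall s \near t, F (`|t| + 2) s = _)); last first.
  by apply: dF; rewrite ltrNl; apply: le_lt_trans (ler_norm _) _; rewrite normrN ltrDl.
near=> s; apply: uF; last by rewrite ltrDl.
have : `|t - s| < 1 by near: s; apply: cvgr_dist_lt => //; exact: ltr01.
have := ler_normD (t - s) (- t); rewrite addrAC subrr add0r !normrN.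
by move=> h1 h2; apply: le_lt_trans h1 _; rewrite addrC ltrD2l (lt_trans h2) // ltr1n.
Unshelve. all: by end_near. Qed.

Lemma antiderivative_row m (f : R -> 'rV[R]_m) : continuous f ->
  exists2 F : R -> 'rV[R]_m, F 0 = 0 & forall t, isd F t (f t).
Proof.
move=> cf.
have /choice[F hF] (j : 'I_m) : exists F : R -> R, F 0 = 0 /\ forall t, isd F t (f t 0 j).
  have [|F F0 dF] := @antiderivative (fun t => f t 0 j); last by exists F.
  move=> t; apply: (@continuous_comp _ _ _ f (fun A => A 0 j)); first exact: cf.
  exact: coord_continuous.
exists (fun t => \row_j F j t); first by apply/rowP => j; rewrite !mxE (hF j).1.
move=> t; apply/isd_mxP => i j; rewrite ord1; apply: isd_ext ((hF j).2 t).
by near=> s; rewrite mxE.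
Unshelve. all: by end_near. Qed.

Lemma continuous_bounded_itv (W : normedModType R) (f : R -> W) (T : R) :
  continuous f -> exists2 C : R, 0 <= C & forall t : R, `|t| <= T -> `|f t| <= C.
Proof.
move=> cf; have [T0|T0] := ltP T 0.
  by exists 0 => // t /(le_trans (normr_ge0 _)); rewrite leNgt T0.
have [||c _ hc] := @EVT_max R (fun t => `|f t|) (- T) T.
- by lra.
- apply: continuous_subspaceT => t.
  by apply: (@continuous_comp _ _ _ f); [exact: cf|exact: norm_continuous].
by exists `|f c| => // t tT; apply: hc; rewrite in_itv /= -ler_norml.
Qed.

(** The rate is part of the conclusion because limits are identified later through [half_pow_eq0],
    which compares explicit bounds instead of passing to the limit. *)
Lemma geom_cvg1 (a : nat -> R) (C : R) :
  (forall k, `|a k.+1 - a k| <= C / 2 ^+ k) ->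
  exists l, forall k, `|l - a k| <= 2 * C / 2 ^+ k.
Proof.
move=> h.
have C0 : 0 <= C by have := le_trans (normr_ge0 _) (h 0%N); rewrite expr0 divr1.
have p2 k : 0 < 2 ^+ k :> R by rewrite exprn_gt0.
have hd k j : `|a (k + j)%N - a k| <= 2 * C / 2 ^+ k - 2 * C / 2 ^+ (k + j).
  elim: j => [|j IH]; first by rewrite addn0 !subrr normr0.
  rewrite addnS -(subrKA (a (k + j)%N)); apply: le_trans (ler_normD _ _) _.
  apply: le_trans (lerD (h _) IH) _; rewrite le_eqVlt; apply/orP; left; apply/eqP.
  by rewrite exprS; field; rewrite !gt_eqF.
have hd' k j : (k <= j)%N -> `|a j - a k| <= 2 * C / 2 ^+ k.
  move=> kj; have := hd k (j - k)%N; rewrite subnKC // => /le_trans; apply.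
  by rewrite lerBlDr lerDl !mulr_ge0 // invr_ge0 ltW.
have z : (2 * C / 2 ^+ k) @[k --> \oo] --> (0 : R).
  have -> : (fun k => 2 * C / 2 ^+ k) = (fun k => (2 * C) * (2^-1) ^+ k) :> (nat -> R).
    by apply/funext => k; rewrite exprVn.
  have -> : (0 : R) = 2 * C * 0 by rewrite mulr0.
  apply: cvgMr; apply: cvg_expr; rewrite gtr0_norm ?invr_gt0 //.
  by rewrite invf_lt1 // ltr1n.
have cva : cvgn a.
  apply/cauchy_cvgP/cauchy_ballP => e e0; rewrite near_map2.
  have [K _ hK] : \forall k \near \oo, 2 * C / 2 ^+ k < e / 2.
    by apply: (@cvgr_lt _ _ _ _ _ 0 z); rewrite divr_gt0.
  have hK' k : (K <= k)%N -> `|a k - a K| < e / 2.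
    by move=> Kk; apply: le_lt_trans (hd' _ _ Kk) _; apply: hK => /=.
  exists (setT `&` [set k | (K <= k)%N], setT `&` [set k | (K <= k)%N]) => /=.
    by split; exists K => //= k /= ?; split.
  move=> [i j] /= [[_ Ki] [_ Kj]]; rewrite -ball_normE /= -(subrKA (a K)) [e]splitr.
  apply: le_lt_trans (ler_normD _ _) _.
  by rewrite ltrD ?hK' // distrC hK'.
exists (limn a) => k.
have cvk : (fun j => `|a j - a k|) @ \oo --> `|limn a - a k|.
  by apply: cvg_norm; apply: cvgB => //; exact: cvg_cst.
apply: (cvgr_to_le cvk); near=> j; apply: hd'.
by near: j; exact: nbhs_infty_ge.
Unshelve. all: by end_near. Qed.

Lemma geom_cvg m (a : nat -> 'rV[R]_m) (C : R) :
  (forall k, `|a k.+1 - a k| <= C / 2 ^+ k) ->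
  exists l, forall k, `|l - a k| <= 2 * C / 2 ^+ k.
Proof.
move=> h.
have C0 : 0 <= C by have := le_trans (normr_ge0 _) (h 0%N); rewrite expr0 divr1.
have /choice[l hl] (j : 'I_m) : exists l, forall k, `|l - a k 0 j| <= 2 * C / 2 ^+ k.
  apply: (@geom_cvg1 (fun k => a k 0 j)) => k.
  by apply: le_trans (h k); have := mx_norm_ge (a k.+1 - a k) 0 j; rewrite !mxE.
exists (\row_j l j) => k; apply: mx_norm_le => [|i j]; last by rewrite ord1 !mxE hl.
by rewrite divr_ge0 ?mulr_ge0 // exprn_ge0.
Qed.

Lemma half_pow_eq0 (x C : R) : 0 <= x -> (forall k, x <= C / 2 ^+ k) -> x = 0.
Proof.
move=> x0 h; apply/eqP; rewrite eq_le x0 andbT leNgt; apply/negP => xp.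
have z : (C * (2^-1) ^+ k) @[k --> \oo] --> (0 : R).
  have -> : (0 : R) = C * 0 by rewrite mulr0.
  apply: cvgMr; apply: cvg_expr; rewrite gtr0_norm ?invr_gt0 //.
  by rewrite invf_lt1 // ltr1n.
have [K _ hK] := @cvgr_lt _ _ _ _ _ 0 z x xp.
by have := lt_le_trans (hK K (leqnn K)) (h K); rewrite exprVn ltxx.
Qed.

Section picard.
Variables (m : nat) (F : R -> 'rV[R]_m -> 'rV[R]_m) (L : R) (x0 : 'rV[R]_m).
Hypothesis L0 : 0 <= L.
Hypothesis cF : forall c, continuous c -> continuous (fun t => F t (c t)).
Hypothesis lF : forall t x y, `|F t x - F t y| <= L * `|x - y|.

Let step (c : {c : R -> 'rV[R]_m | continuous c}) :
  exists c' : {c : R -> 'rV[R]_m | continuous c},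
    sval c' 0 = x0 /\ forall t, isd (sval c') t (F t (sval c t)).
Proof.
have [A A0 dA] := antiderivative_row (cF (svalP c)).
have dA' t : isd (fun t => A t + x0) t (F t (sval c t)).
  by apply: isd_eq (isd_add (dA t) (isd_cst x0 t)) (addr0 _).
have cA : continuous (fun t => A t + x0) by move=> t; exact: isd_cont (dA' t).
by exists (exist _ _ cA) => /=; rewrite A0 add0r.
Qed.

Lemma picard : exists2 c, c 0 = x0 & forall t, isd c t (F t (c t)).
Proof.
have [st hst] := choice step.
have c0c : continuous (fun _ : R => x0) by move=> t; exact: cvg_cst.
pose g k := iter k st (exist _ _ c0c).
pose c k := sval (g k).
have cc k : continuous (c k) := svalP (g k).
have cS k t : isd (c k.+1) t (F t (c k t)) by exact: (hst (g k)).2.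
have c00 k : c k.+1 0 = x0 by exact: (hst (g k)).1.
(* In the norm weighted by [expR (- 2 * K * |t|)] the Picard operator halves distances. Hence the
   iteration converges on the whole line, without any restriction to short times. *)
pose K := L + 1.
have K0 : 0 < K by rewrite ltr_wpDl.
have KV : K != 0 by rewrite gt_eqF.
have bd (T : R) : exists2 C : R, 0 <= C &
    forall k t, `|t| <= T -> `|c k.+1 t - c k t| <= C / 2 ^+ k * expR (2 * K * `|t|).
  have [|C C0 hC] := @continuous_bounded_itv _ (fun t => c 1%N t - c 0%N t) T.
    by move=> t; apply: cvgB; exact: cc.
  exists C => // k; elim: k => [|k IH] t tT.
    rewrite expr0 divr1; apply: le_trans (hC t tT) _; rewrite ler_peMr //.
    by rewrite -expR0 ler_expR !mulr_ge0 // ltW.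
  have := @isd_dom R 1 m (fun t => c k.+2 t - c k.+1 t) (fun t => F t (c k.+1 t) - F t (c k t))
    (fun s => C / 2 ^+ k.+1 * expR (2 * K * s))
    (fun s => C / 2 ^+ k.+1 * (2 * K * expR (2 * K * s))) t.
  rewrite !c00 subrr subr0 => /(_ _ _ _)/le_trans -> //.
  - by move=> s _; apply: isd_sub; exact: cS.
  - move=> s _; apply: isd_eq (isd_mul (isd_cst _ s) (isd_exp (2 * K) s)) _.
    by rewrite mul0r add0r.
  - move=> s st'; apply: le_trans (lF _ _ _) _.
    have h := IH s (le_trans st' tT).
    apply: (@le_trans _ _ (K * (C / 2 ^+ k * expR (2 * K * `|s|)))).
      by apply: ler_pM => //; rewrite lerDl.
    rewrite le_eqVlt; apply/orP; left; apply/eqP; rewrite exprS.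
    by field; rewrite gt_eqF // exprn_gt0.
  - by rewrite lerBlDr lerDl !mulr_ge0 ?invr_ge0 ?exprn_ge0 ?expR_ge0.
(* The convergence is uniform only on bounded intervals; the limit is therefore characterised for
   all bounds [T], [C] at once, and two candidates coincide because the same sequence approaches
   both. *)
have /choice[gam hgam] (t : R) : exists l, forall T C k, `|t| <= T -> 0 <= C ->
   (forall k t, `|t| <= T -> `|c k.+1 t - c k t| <= C / 2 ^+ k * expR (2 * K * `|t|)) ->
   `|l - c k t| <= 2 * (C * expR (2 * K * T)) / 2 ^+ k.
  have [C1 C10 h1] := bd `|t|.
  have [|l hl] := @geom_cvg m (fun k => c k t) (C1 * expR (2 * K * `|t|)).
    by move=> k; apply: le_trans (h1 k t (lexx _)) _; rewrite mulrAC.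
  exists l => T C k tT C0 h.
  have [|l' hl'] := @geom_cvg m (fun k => c k t) (C * expR (2 * K * T)).
    move=> j; apply: le_trans (h j t tT) _; rewrite mulrAC ler_wpM2r ?invr_ge0 ?exprn_ge0 //.
    by rewrite ler_wpM2l // ler_expR ler_wpM2l // ltW // mulr_gt0.
  suff -> : l = l' by exact: hl'.
  apply/eqP; rewrite -subr_eq0 -normr_eq0; apply/eqP.
  apply: (@half_pow_eq0 _ (2 * (C1 * expR (2 * K * `|t|)) + 2 * (C * expR (2 * K * T)))) => // j.
  rewrite -(subrKA (c j t)) mulrDl; apply: le_trans (ler_normD _ _) _.
  by apply: lerD => //; rewrite distrC.
have ubd (T : R) : exists2 D, 0 <= D & forall k (t : R), `|t| <= T -> `|gam t - c k t| <= D / 2 ^+ k.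
  have [C C0 hC] := bd T; exists (2 * (C * expR (2 * K * T))) => [|k t tT].
    by rewrite !mulr_ge0 ?expR_ge0.
  exact: hgam.
have cgam : continuous gam.
  move=> t; have [D D0 hD] := ubd (`|t| + 1).
  apply/cvgrPdist_lt => e e0.
  have [k hk] : exists k, D / 2 ^+ k < e / 3.
    apply: contrapT => /forallNP nk.
    have : e / 3 = 0.
      apply: (@half_pow_eq0 _ D) => [|k]; first by rewrite divr_ge0 // ltW.
      by rewrite leNgt; apply/negP/nk.
    by apply/eqP; rewrite gt_eqF // divr_gt0.
  near=> s.
  have ts : `|t - s| < 1 by near: s; apply: cvgr_dist_lt => //; exact: ltr01.
  have sT : `|s| <= `|t| + 1.
    have := ler_normB t (t - s); rewrite opprB addrCA subrr addr0 => /le_trans; apply.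
    by rewrite lerD2l ltW.
  have cst : `|c k t - c k s| < e / 3.
    by near: s; apply: (cvgrPdist_lt _ _).1 (cc k t) _ _; rewrite divr_gt0.
  have h1 := hD k t; have h2 := hD k s sT.
  have {}h1 : `|gam t - c k t| <= D / 2 ^+ k by apply: h1; rewrite lerDl.
  have -> : gam t - gam s = (gam t - c k t) + (c k t - c k s) - (gam s - c k s).
    by rewrite subrKA opprB addrA subrK.
  apply: le_lt_trans (ler_normB _ _) _; have := ler_normD (gam t - c k t) (c k t - c k s).
  move: h1 h2 cst hk; move: `|gam t - c k t| `|gam s - c k s| `|c k t - c k s| (D / _) `|_| => a b d f p *; lra.
(* [A] is the Picard operator applied to [gam]; it is close to [c k.+1] for every [k], as [gam] is,
   so it equals [gam]. *)
have [A [A0 dA]] := step (exist _ _ cgam).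
exists gam; last first => [t|].
  suff E : sval A = gam by have := dA t; rewrite E.
  apply/funext => s; apply/eqP; rewrite -subr_eq0 -normr_eq0; apply/eqP.
  have [D D0 hD] := ubd `|s|.
  apply: (@half_pow_eq0 _ (L * D * `|s| + D)) => // k.
  rewrite -(subrKA (c k.+1 s)) mulrDl; apply: le_trans (ler_normD _ _) _.
  apply: lerD; last first.
    rewrite distrC; apply: le_trans (hD k.+1 s (lexx _)) _.
    by rewrite ler_wpM2l // lef_pV2 ?posrE ?exprn_gt0 // exprS ler_peMl ?exprn_ge0 // ler1n.
  have := @isd_dom R 1 m (fun t => sval A t - c k.+1 t) (fun t => F t (gam t) - F t (c k t))
    (fun s => L * D / 2 ^+ k * s) (fun s => L * D / 2 ^+ k) s.
  rewrite A0 c00 subrr !subr0 mulr0 subr0 [_ * `|s|]mulrAC; apply.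
  - by move=> r _; apply: isd_sub; [exact: dA|exact: cS].
  - move=> r _; apply: isd_eq (isd_mul (isd_cst _ r) (isd_id r)) _.
    by rewrite mul0r add0r mulr1.
  - move=> r rs; apply: le_trans (lF _ _ _) _; rewrite -mulrA ler_wpM2l //.
    exact: hD.
have [D D0 hD] := ubd 0.
apply/eqP; rewrite -subr_eq0 -normr_eq0; apply/eqP; apply: (@half_pow_eq0 _ D) => // k.
rewrite -(c00 k); apply: le_trans (hD k.+1 0 _) _; first by rewrite normr0.
by rewrite ler_wpM2l // lef_pV2 ?posrE ?exprn_gt0 // exprS ler_peMl ?exprn_ge0 // ler1n.
Unshelve. all: by end_near. Qed.

End picard.

End Picard.

(** * Smooth dependence of a flow on the initial point *)

Section FlowSmooth.
Context {R : realType}.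

Lemma zmod_sub3 (V : zmodType) (a b c d : V) : a - b - c = (d - c) + (a - b - d).
Proof. by rewrite [RHS]addrC addrA subrK. Qed.

Lemma continuous_sum (T : topologicalType) (W : normedModType R) (I : Type) (r : seq I)
    (f : I -> T -> W) x : (forall i, {for x, continuous (f i)}) ->
  {for x, continuous (fun y => \sum_(i <- r) f i y)}.
Proof.
move=> h; elim: r => [|i r IH].
  have -> : (fun y => \sum_(i <- [::]) f i y) = (fun=> 0).
    by apply/funext => y; rewrite big_nil.
  exact: cvg_cst.
have -> : (fun y => \sum_(j <- i :: r) f j y) = (fun y => f i y + \sum_(j <- r) f j y).
  by apply/funext => y; rewrite big_cons.
by apply: cvgD => //; exact: h.
Qed.

Lemma Cn_lin (V W : normedModType R) k (U : set V) (L : {linear V -> W}) :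
  continuous L -> Cn k U L.
Proof.
move=> cL; have dL x : differentiable L x by exact: linear_differentiable.
case: k => [|k]; split=> // v.
have -> : 'D_v L = (fun=> L v).
  by apply/funext => x; rewrite (derive_dE v (dL x)) diff_lin.
exact: Cn_cst.
Qed.

Lemma linear_mx_bounded (W : normedModType R) m (L : {linear 'rV[R]_m -> W}) (B : R) v :
  (forall j, `|L (delta_mx 0 j)| <= B) -> `|L v| <= m%:R * B * `|v|.
Proof.
move=> h; rewrite {1}(row_sum_delta v) linear_sum.
apply: le_trans (ler_norm_sum _ _ _) _.
apply: (@le_trans _ _ (\sum_(j < m) B * `|v|)).
  apply: ler_sum => j _; rewrite linearZ normrZ mulrC ler_pM //.
  exact: mx_norm_ge.
by rewrite sumr_const card_ord -mulrA -[leLHS]mulr_natl.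
Qed.

Lemma derive_bounded2 (W : normedModType R) m (X : 'rV[R]_m -> W) x y (B : R) v :
  differentiable X x -> differentiable X y ->
  (forall j, `|'D_(delta_mx 0 j) X x - 'D_(delta_mx 0 j) X y| <= B) ->
  `|'D_v X x - 'D_v X y| <= m%:R * B * `|v|.
Proof.
move=> dx dy h; rewrite (derive_row_sum v dx) (derive_row_sum v dy) -sumrB.
apply: le_trans (ler_norm_sum _ _ _) _.
apply: (@le_trans _ _ (\sum_(j < m) B * `|v|)).
  apply: ler_sum => j _; rewrite -scalerBr normrZ mulrC ler_pM //.
  exact: mx_norm_ge.
by rewrite sumr_const card_ord -mulrA -[leLHS]mulr_natl.
Qed.

Lemma derive_bounded (W : normedModType R) m (X : 'rV[R]_m -> W) x (B : R) v :
  differentiable X x -> (forall j, `|'D_(delta_mx 0 j) X x| <= B) ->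
  `|'D_v X x| <= m%:R * B * `|v|.
Proof.
move=> dX h; rewrite (derive_dE _ dX); apply: linear_mx_bounded => j.
by rewrite -(derive_dE _ dX).
Qed.

(** For a C^1 map the error of linearisation is small uniformly in the base point: it is the
    integral of ['D_h X] minus its initial value along the segment from [z] to [z']. *)
Lemma strict_diff m n (U : set 'rV[R]_m) (X : 'rV[R]_m -> 'rV[R]_n) y (e : R) :
  open U -> U y -> Cn 1 U X -> 0 < e ->
  exists2 d : R, 0 < d & forall z z', ball y d z -> ball y d z' ->
    U z /\ `|X z' - X z - 'D_(z' - z) X z| <= e * `|z' - z|.
Proof.
move=> oU Uy cX e0.
(* A bound on the [m] partial derivatives costs a factor [m] on ['D_h]; the factor 2 is for
   comparing both the moving point and [z] with the centre [y]. *)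
have e1 : 0 < e / (2 * (m%:R + 1)) by rewrite divr_gt0 // mulr_gt0 // ltr_wpDl.
have : \forall z \near y, U z /\ forall j : 'I_m, `|'D_(delta_mx 0 j) X y - 'D_(delta_mx 0 j) X z| < e / (2 * (m%:R + 1)).
  apply: filterI; first exact: open_nbhs_nbhs.
  apply: (@filter_forall _ 'I_m (fun j z => `|'D_(delta_mx 0 j) X y - 'D_(delta_mx 0 j) X z| < e / (2 * (m%:R + 1))) (nbhs y) (nbhs_filter y)) => j.
  have /differentiable_continuous c := Cn_diff (CnD (delta_mx 0 j) cX) Uy.
  exact: (cvgrPdist_lt _ _).1 c _ e1.
case/nbhs_ballP => d /= d0 hd; exists d => // z z' Bz Bz'.
split; first by case: (hd z Bz).
set h := z' - z.
have line (s : R) : 0 <= s <= 1 -> ball y d (s *: h + z).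
  move=> /andP[s0 s1]; rewrite -ball_normE /=.
  have -> : y - (s *: h + z) = s *: (y - z') + (1 - s) *: (y - z).
    rewrite /h !scalerBr !scalerBl !scale1r; apply/rowP => j; rewrite !mxE; ring.
  apply: le_lt_trans (ler_normD _ _) _; rewrite !normrZ (ger0_norm s0) (ger0_norm (_ : 0 <= 1 - s)) ?subr_ge0 //.
  move: Bz Bz'; rewrite -ball_normE /= => b1 b2.
  have [->|sn] := eqVneq s 0; first by rewrite mul0r add0r subr0 mul1r.
  have sp : 0 < s by rewrite lt_neqAle eq_sym sn.
  have -> : d = s * d + (1 - s) * d by ring.
  by apply: ltr_leD; [rewrite ltr_pM2l|rewrite ler_wpM2l ?subr_ge0 // ltW].
have dX s : 0 <= s <= 1 -> differentiable X (s *: h + z).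
  by move=> s01; apply: Cn_diff cX _; case: (hd _ (line s s01)).
have dXz : differentiable X z by apply: Cn_diff cX _; case: (hd _ Bz).
have dvh s : 0 <= s <= 1 -> `|'D_h X (s *: h + z) - 'D_h X z| <= e * `|h|.
  move=> s01.
  apply: (le_trans (@derive_bounded2 _ m X _ _ (e / (m%:R + 1)) h (dX s s01) dXz _)); last first.
    rewrite ler_wpM2r // mulrA ler_pdivrMr ?ltr_wpDl // mulrC ler_wpM2l ?ltW //.
    by rewrite ltrDl.
  move=> j.
  have [_ /(_ j) h1] := hd _ (line s s01); have [_ /(_ j) h2] := hd _ Bz.
  rewrite -(subrKA ('D_(delta_mx 0 j) X y)) addrC; apply: le_trans (ler_normD _ _) _.
  rewrite distrC in h1.
  apply: le_trans (lerD (ltW h2) (ltW h1)) _.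
  by rewrite le_eqVlt; apply/orP; left; apply/eqP; field; rewrite gt_eqF // ltr_wpDl.
have := @isd_dom_pos R 1 n (fun s => X (s *: h + z) - s *: 'D_h X z)
  (fun s => 'D_h X (s *: h + z) - 'D_h X z) (fun s => e * `|h| * s) (fun=> e * `|h|) 1 ler01.
rewrite scale0r !scale1r scale0r add0r subr0 mulr1 mulr0 subr0.
have -> : h + z = z' by rewrite /h subrK.
rewrite addrAC; apply => s s01.
- apply: isd_sub; first by apply: isd_line; exact: dX.
  apply: isd_eq (isd_scale (isd_id s) (isd_cst _ s)) _.
  by rewrite scale1r scaler0 addr0.
- apply: isd_eq (isd_mul (isd_cst _ s) (isd_id s)) _.
  by rewrite mul0r add0r mulr1.
- exact: dvh.
Qed.

(** Compactness of [[0, t]]: a condition that holds locally with some [d], and remains true for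
    smaller [d], holds with a common [d]. *)
Lemma unif_delta (Q : R -> R -> Prop) (t : R) :
  (forall r (d d' : R), d' <= d -> Q r d -> Q r d') ->
  (forall s : R, 0 <= s <= t -> exists2 d : R, 0 < d & \forall r \near s, Q r d) ->
  0 <= t -> exists2 d : R, 0 < d & forall r, 0 <= r <= t -> Q r d.
Proof.
move=> mono loc t0.
apply: (@real_ind R (fun s => exists2 d : R, 0 < d & forall r, 0 <= r <= s -> Q r d) t _ t0).
move=> s st lt; have [d d0 /nbhs_ballP[b /= b0 hb]] := loc s st.
have [d' d'0 hd'] : exists2 d' : R, 0 < d' & forall r, 0 <= r <= s - b / 2 -> Q r d'.
  have [sb|sb] := leP 0 (s - b / 2).
    by apply: lt; rewrite sb; lra.
  by exists 1 => // r; lra.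
apply/nbhs_ballP; exists (b / 2) => /=; first by rewrite divr_gt0.
move=> r; rewrite /ball /= ltr_norml => /andP[h1 h2].
exists (Num.min d d'); first by rewrite lt_min d0.
move=> q /andP[q0 qr]; have [qs|qs] := leP q (s - b / 2).
  by apply: mono (hd' q _); rewrite ?ge_min ?lexx ?orbT // q0.
apply: mono (hb q _); first by rewrite ge_min lexx.
by rewrite /ball /= ltr_norml; lra.
Qed.

Definition flow_family m (U : set 'rV[R]_m) X (D : set 'rV[R]_m) (T : R)
    (th : R -> 'rV[R]_m -> 'rV[R]_m) : Prop :=
  (forall x, D x -> th 0 x = x) /\
  (forall x (t : R), D x -> `|t| < T -> U (th t x) /\ isd (th^~ x) t (X (th t x))).

(** Freezing the time outside [[- T, T]] makes the variational equation along a trajectory defined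
    and Lipschitz for all times, as [picard] demands. *)
Definition clamp (T t : R) : R := Num.max (- T) (Num.min T t).

Lemma clampK (T t : R) : `|t| <= T -> clamp T t = t.
Proof.
rewrite ler_norml /clamp => /andP[h1 h2].
by rewrite (min_idPr h2) (max_idPr h1).
Qed.

Lemma clamp_norm (T t : R) : 0 <= T -> `|clamp T t| <= T.
Proof.
move=> T0; rewrite ler_norml /clamp le_max lexx /= ge_max ge_min lexx /= andbT; lra.
Qed.

Lemma clamp_continuous (T : R) : continuous (clamp T).
Proof.
move=> t; apply: (@continuous_max _ _ (fun=> - T) (fun s => Num.min T s)); first exact: cvg_cst.
by apply: (@continuous_min _ _ (fun=> T) id) => //; exact: cvg_cst.
Qed.

Section family.
Variables (m : nat) (U D : set 'rV[R]_m) (X : 'rV[R]_m -> 'rV[R]_m) (T : R)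
  (th : R -> 'rV[R]_m -> 'rV[R]_m).
Hypotheses (oU : open U) (oD : open D) (cX : Cn 2 U X) (fam : flow_family U X D T th).

Lemma family_strict x (t e : R) : D x -> 0 <= t < T -> 0 < e ->
  exists2 d : R, 0 < d & forall s, 0 <= s <= t -> forall h, `|h| < d ->
    `|X (th s x + h) - X (th s x) - 'D_h X (th s x)| <= e * `|h|.
Proof.
move=> Dx /andP[t0 tT] e0.
pose Q s d := forall h, `|h| < d -> `|X (th s x + h) - X (th s x) - 'D_h X (th s x)| <= e * `|h|.
apply: (@unif_delta Q t) => // [r d d' dd h k kd|s /andP[s0 st]].
  by apply: h; apply: lt_le_trans kd dd.
have [Us ds] : U (th s x) /\ isd (th^~ x) s (X (th s x)).
  by apply: fam.2 => //; rewrite ger0_norm // (le_lt_trans st).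
have [d d0 hd] := strict_diff oU Us (CnW cX) e0.
exists (d / 2); first by rewrite divr_gt0.
have d2 : 0 < d / 2 by rewrite divr_gt0.
have /cvgrPdist_lt/(_ _ d2) := isd_cont ds.
apply: filterS => r hr h hd2.
have br : ball (th s x) d (th r x).
  by rewrite -ball_normE /=; apply: lt_trans hr _; lra.
have hE : th r x + h - th r x = h by rewrite addrAC subrr add0r.
have [|_] := hd (th r x) (th r x + h) br; last by rewrite hE.
rewrite -ball_normE /= opprD addrA; apply: le_lt_trans (ler_normB _ _) _.
by rewrite [d]splitr ltrD.
Qed.

(** [A] solves the variational equation along the trajectory of [x]. It is solved for the basis
    vectors and extended by linearity, so that linearity in [v] holds by construction and for every
    [s]. *)
Lemma family_linear x (t : R) : D x -> 0 <= t < T ->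
  exists A : R -> 'rV[R]_m -> 'rV[R]_m, [/\ forall v, A 0 v = v,
    forall s, linear (A s),
    forall s v, `|s| <= t -> isd (A^~ v) s ('D_(A s v) X (th s x)) &
    exists2 L : R, 0 <= L & forall s v, `|s| <= t -> `|'D_v X (th s x)| <= L * `|v|].
Proof.
move=> Dx /andP[t0 tT].
have famt s : `|s| <= t -> U (th s x) /\ isd (th^~ x) s (X (th s x)).
  by move=> st; apply: fam.2 => //; exact: le_lt_trans st tT.
pose y s := th (clamp t s) x.
have Uy s : U (y s) by case: (famt _ (clamp_norm s t0)).
have cy : continuous y.
  move=> s; apply: (@continuous_comp _ _ _ (clamp t) (th^~ x)); first exact: clamp_continuous.
  by have [_ /isd_cont] := famt _ (clamp_norm s t0).
have cD j : continuous (fun s => 'D_(delta_mx 0 j) X (y s)).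
  move=> s; apply: (@continuous_comp _ _ _ y ('D_(delta_mx 0 j) X)); first exact: cy.
  by apply: differentiable_continuous; exact: Cn_diff (CnD _ cX) (Uy s).
have dX s : differentiable X (y s) by exact: Cn_diff cX (Uy s).
have /choice[B hB] (j : 'I_m) : exists B : R, 0 <= B /\ forall s, `|'D_(delta_mx 0 j) X (y s)| <= B.
  have [B B0 hB] := continuous_bounded_itv t (cD j).
  exists B; split=> // s; have := hB (clamp t s) (clamp_norm s t0).
  by rewrite /y (clampK (clamp_norm s t0)).
pose L := m%:R * \sum_j B j.
have S0 : 0 <= \sum_j B j by apply: sumr_ge0 => j _; case: (hB j).
have L0 : 0 <= L by rewrite mulr_ge0.
have hL s v : `|'D_v X (y s)| <= L * `|v|.
  apply: derive_bounded => // j; apply: le_trans ((hB j).2 s) _.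
  by rewrite (bigD1 j) //= lerDl; apply: sumr_ge0 => i _; case: (hB i).
have pic v0 : exists2 c, c 0 = v0 & forall s, isd c s ('D_(c s) X (y s)).
  apply: (@picard R m (fun s v => 'D_v X (y s)) L v0 L0) => [c cc s|s u v].
    have -> : (fun s => 'D_(c s) X (y s)) = (fun s => \sum_j c s 0 j *: 'D_(delta_mx 0 j) X (y s)).
      by apply/funext => r; rewrite derive_row_sum.
    apply: continuous_sum => j; apply: cvgZ; last exact: cD.
    by apply: (@continuous_comp _ _ _ c (fun A => A 0 j)); [exact: cc|exact: coord_continuous].
  apply: le_trans (hL s _); rewrite !(derive_dE _ (dX s)) -linearB //.
have /choice[a ha] (j : 'I_m) : exists c : R -> 'rV[R]_m, c 0 = delta_mx 0 j /\ forall s, isd c s ('D_(c s) X (y s)).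
  by have [c c0 dc] := pic (delta_mx 0 j); exists c.
exists (fun s v => \sum_j v 0 j *: a j s); split.
- move=> v; rewrite [RHS]row_sum_delta; apply: eq_bigr => j _.
  by rewrite (ha j).1.
- move=> s b u v; rewrite scaler_sumr -big_split; apply: eq_bigr => j _ /=.
  by rewrite !mxE scalerDl scalerA.
- move=> s v st; have -> : th s x = y s by rewrite /y clampK.
  rewrite (derive_dE _ (dX s)) linear_sum; apply: isd_sum => j.
  apply: isd_eq (isd_scale (isd_cst _ s) ((ha j).2 s)) _.
  by rewrite scale0r add0r linearZ -(derive_dE _ (dX s)).
- by exists L => // s v st; have := hL s v; rewrite /y clampK.
Qed.

(** With [w] the difference of the trajectories of [h + x] and [x], a first estimate gives
    [|w| <= G |h|]. Then [w - A h] satisfies the variational equation up to an error small compared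
    with [|h|], and starts at 0, so a second estimate shows that [A t] is the differential. *)
Lemma family_diff x (t : R) A : D x -> 0 <= t < T ->
  (forall v, A 0 v = v) -> (forall s, linear (A s)) ->
  (forall s v, `|s| <= t -> isd (A^~ v) s ('D_(A s v) X (th s x))) ->
  (exists2 L : R, 0 <= L & forall s v, `|s| <= t -> `|'D_v X (th s x)| <= L * `|v|) ->
  differentiable (th t) x /\ forall v, 'D_v (th t) x = A t v.
Proof.
move=> Dx tT A0 linA dA [L L0 hL]; have [t0 t1] := andP tT.
pose Atm := GRing.isLinear.Build _ _ _ _ _ (linA t).
pose At : {linear 'rV[R]_m -> 'rV[R]_m} := HB.pack (A t) Atm.
have pos s : 0 <= s <= t -> `|s| <= t by case/andP=> s0 ?; rewrite ger0_norm.
have posT s : 0 <= s <= t -> `|s| < T by move=> /pos/le_lt_trans; apply.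
suff [d1 d2] : differentiable (th t) x /\ 'd (th t) x = At :> ('rV[R]_m -> 'rV[R]_m).
  by split=> // v; rewrite (derive_dE v d1) d2.
apply: eps_diff => [|e e0]; first exact: linear_mx_continuous.
have L10 : 0 <= L + 1 by rewrite addr_ge0.
have [G G0 hG] := @gronwall_trap R m _ _ L10 t0.
have [G' G'0 hG'] := @gronwall R m _ _ L0 t0.
have [d d0 hd] := family_strict Dx tT ltr01.
(* [G] passes from [w] to [h], and [G'] is the loss in the second use of the Gronwall inequality. *)
have e1 : 0 < e / (G' * G) by rewrite divr_gt0 // mulr_gt0.
have [d' d'0 hd'] := family_strict Dx tT e1.
have /nbhs_ballP[r /= r0 hr] : nbhs x D by exact: open_nbhs_nbhs.
(* [r] keeps [h + x] in [D]; the other two bounds keep [|w| <= G |h|] inside the ranges where the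
   strict differentiability estimates are valid. *)
pose dd := Num.min r (Num.min (d / (G + 1)) (d' / (G + 1))).
have G1 : 0 < G + 1 by rewrite addr_gt0.
have dd0 : 0 < dd by rewrite !lt_min r0 !divr_gt0.
apply/nbhs_ballP; exists dd => //= h; rewrite -ball_normE /= sub0r normrN /dd !lt_min.
case/and3P=> h1; rewrite !ltr_pdivlMr // => h2 h3.
have Dxh : D (h + x) by apply: hr; rewrite -ball_normE /= opprD addrCA subrr addr0 normrN.
pose w s := th s (h + x) - th s x.
have wE s : th s x + w s = th s (h + x) by rewrite /w addrC subrK.
have dw s : 0 <= s <= t -> isd w s (X (th s x + w s) - X (th s x)).
  move=> st; rewrite wE; apply: isd_sub.
    by have [] := fam.2 _ _ Dxh (posT _ st).
  by have [] := fam.2 _ _ Dx (posT _ st).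
have w0 : w 0 = h by rewrite /w !(fam.1) // addrK.
have Gh (a : R) : `|h| * (G + 1) < a -> `|h| < a /\ G * (`|h| + 0) < a.
  move=> ha; have hG0 : 0 <= `|h| * G by rewrite mulr_ge0 // ltW.
  by have := normr_ge0 h; rewrite addr0 [G * _]mulrC; move: ha; rewrite mulrDr mulr1; lra.
have wb s : 0 <= s <= t -> `|w s| <= G * (`|w 0| + 0).
  move=> st; have [q1 q2] := Gh _ h2.
  apply: (hG w (fun s => X (th s x + w s) - X (th s x)) 0 s d) => //; rewrite ?w0 //.
    by move=> p pt; apply: dw; lra.
  move=> p pt wd; rewrite addr0.
  have pt' : 0 <= p <= t by lra.
  have := ler_normD (X (th p x + w p) - X (th p x) - 'D_(w p) X (th p x)) ('D_(w p) X (th p x)).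
  rewrite subrK => /le_trans; apply; rewrite mulrDl addrC.
  by apply: lerD; [apply: hL; exact: pos|apply: hd].
pose u s := w s - A s h.
have := hG' u (fun s => X (th s x + w s) - X (th s x) - 'D_(A s h) X (th s x))
  (e / G' * `|h|) t.
rewrite /u w0 A0 subrr normr0 add0r => H.
have -> : th t (h + x) - th t x - At h = u t by [].
have -> : e * `|h| = G' * (e / G' * `|h|) by rewrite mulrA mulrCA divff ?mulr1 // gt_eqF.
apply: H => //; first by rewrite lexx t0.
- by rewrite mulr_ge0 // ltW // divr_gt0.
- by move=> s st; apply: isd_sub; [exact: dw|apply: dA; exact: pos].
move=> s st; have dXs : differentiable X (th s x).
  by apply: Cn_diff cX _; have [] := fam.2 _ _ Dx (posT _ st).
have E : 'D_(u s) X (th s x) = 'D_(w s) X (th s x) - 'D_(A s h) X (th s x).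
  by rewrite !(derive_dE _ dXs) linearB.
have -> : X (th s x + w s) - X (th s x) - 'D_(A s h) X (th s x) =
   'D_(u s) X (th s x) + (X (th s x + w s) - X (th s x) - 'D_(w s) X (th s x)).
  by rewrite E; exact: zmod_sub3.
apply: le_trans (ler_normD _ _) _; apply: lerD; first by apply: hL; exact: pos.
have [q1 q2] := Gh _ h3.
have wsb := wb s st; rewrite w0 in wsb.
apply: le_trans (hd' s st (w s) (le_lt_trans wsb q2)) _.
apply: le_trans (ler_wpM2l (ltW e1) wsb) _; rewrite addr0 le_eqVlt; apply/orP; left; apply/eqP.
by field; rewrite !gt_eqF.
Qed.

End family.

Lemma Cn_comp0 (V W : normedModType R) k m (O : set 'rV[R]_m) (L : {linear V -> 'rV[R]_m})
    (h : 'rV[R]_m -> W) : continuous L -> open O -> Cn k O h ->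
  Cn k [set z | O (L z)] (fun z => h (L z)).
Proof.
move=> cL oO ch; apply: (@Cn_comp _ _ _ _ _ _ O) => //; last exact: Cn_lin.
by apply: open_comp => // x _; exact: cL.
Qed.

Lemma Cn_row_mx (V : normedModType R) k m n (U : set V) (f : V -> 'rV[R]_m) (h : V -> 'rV[R]_n) :
  open U -> Cn k U f -> Cn k U h -> Cn k U (fun x => row_mx (f x) (h x)).
Proof.
move=> oU /(Cn_mxP _ _ oU) cf /(Cn_mxP _ _ oU) ch; apply/(Cn_mxP _ _ oU) => i j.
case E : (fintype.split j) => [a|b].
  by apply: (Cn_ext oU _ (cf i a)) => x _; rewrite mxE E.
by apply: (Cn_ext oU _ (ch i b)) => x _; rewrite mxE E.
Qed.

Lemma isd_row_mx m n (f : R -> 'rV[R]_m) (h : R -> 'rV[R]_n) t u v :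
  isd f t u -> isd h t v -> isd (fun x => row_mx (f x) (h x)) t (row_mx u v).
Proof.
move=> /isd_mxP df /isd_mxP dh; apply/isd_mxP => i j; rewrite mxE.
case E : (fintype.split j) => [a|b].
  by apply: isd_ext (df i a); near=> s; rewrite mxE E.
by apply: isd_ext (dh i b); near=> s; rewrite mxE E.
Unshelve. all: by end_near. Qed.

(** The trajectory together with the solution of its variational equation is a trajectory of a
    smooth field [X2] in twice the dimension. By induction that flow is of class [k], and its second
    component is the derivative of [th t] in the direction [v]. *)
Lemma flow_smooth k m (U D : set 'rV[R]_m) X T th (t : R) : open U -> open D ->
  smooth_on U X -> flow_family U X D T th -> 0 <= t < T -> Cn k D (th t).
Proof.
elim: k m U D X T th => [|k IH] m U D X T th oU oD /[dup] sX /smooth_onP cX fam tT.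
  split=> // x Dx; have [A [h1 h2 h3 h4]] := family_linear (cX 2) fam Dx tT.
  by have [] := family_diff oU oD (cX 2) fam Dx tT h1 h2 h3 h4.
(* The variational solution is available on compact intervals only, so the doubled flow lives on a
   slightly shorter interval, still containing [t]. *)
pose T' := (t + T) / 2.
have [t0 t1] := andP tT.
have T't : t < T' by rewrite /T'; lra.
have T'T : 0 <= T' < T by rewrite /T'; lra.
have tT' : 0 <= t <= T' by rewrite t0 ltW.
have /choice[A hA] (x : 'rV[R]_m) : exists A : R -> 'rV[R]_m -> 'rV[R]_m, D x ->
    [/\ forall v, A 0 v = v, forall s, linear (A s),
    forall s v, `|s| <= T' -> isd (A^~ v) s ('D_(A s v) X (th s x)) &
    exists2 L : R, 0 <= L & forall s v, `|s| <= T' -> `|'D_v X (th s x)| <= L * `|v|].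
  have [Dx|nDx] := pselect (D x); last by exists (fun _ v => v).
  by have [A] := family_linear (cX 2) fam Dx T'T; exists A.
have dth x : D x -> differentiable (th t) x /\ forall v, 'D_v (th t) x = A x t v.
  move=> Dx; have [h1 h2 h3 [L L0 h4]] := hA x Dx.
  apply: (family_diff oU oD (cX 2) fam Dx tT h1 h2).
    by move=> s v st; apply: h3; apply: le_trans st (ltW T't).
  by exists L => // s v st; apply: h4; apply: le_trans st (ltW T't).
split=> [x /dth[]//|v].
pose U2 := [set z : 'rV[R]_(m + m) | U (lsubmx z)].
pose D2 := [set z : 'rV[R]_(m + m) | D (lsubmx z)].
pose X2 (z : 'rV[R]_(m + m)) := row_mx (X (lsubmx z)) ('D_(rsubmx z) X (lsubmx z)).
pose th2 s (z : 'rV[R]_(m + m)) := row_mx (th s (lsubmx z)) (A (lsubmx z) s (rsubmx z)).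
have cl : continuous (@lsubmx R 1 m m) by exact: linear_mx_continuous.
have cr : continuous (@rsubmx R 1 m m) by exact: linear_mx_continuous.
have oU2 : open U2 by apply: open_comp => // z _; exact: cl.
have oD2 : open D2 by apply: open_comp => // z _; exact: cl.
have sX2 : smooth_on U2 X2.
  apply/smooth_onP => j.
  apply: Cn_row_mx => //; first exact: (Cn_comp0 cl oU (cX j)).
  apply: (@Cn_ext _ _ _ _ _ (fun z => \sum_(i < m) rsubmx z 0 i *: 'D_(delta_mx 0 i) X (lsubmx z))) => //.
    by move=> z Uz; rewrite derive_row_sum //; exact: Cn_diff (cX 0%N) Uz.
  apply: Cn_sum => // i _; apply: Cn_scale => //.
    have := @Cn_lin _ _ j U2 (@rsubmx R 1 m m) cr.
    by move/(Cn_mxP _ _ oU2)/(_ 0 i).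
  exact: (Cn_comp0 cl oU (CnD _ (cX j.+1))).
have fam2 : flow_family U2 X2 D2 T' th2.
  split=> [z Dz|z s Dz sT].
    by rewrite /th2 fam.1 //; have [-> _ _ _] := hA _ Dz; rewrite hsubmxK.
  have [Us ds] := fam.2 _ s Dz (lt_trans sT (andP T'T).2).
  have [h1 h2 h3 h4] := hA _ Dz.
  have dA := h3 s (rsubmx z) (ltW sT).
  split; first by rewrite /U2 /th2 /= row_mxKl.
  rewrite /X2 /th2 row_mxKl row_mxKr.
  exact: isd_row_mx.
have ct := IH _ U2 D2 X2 T' th2 oU2 oD2 sX2 fam2 (introT andP (conj t0 T't)).
have crt := Cn_postlin oD2 cr ct.
pose rl : 'rV[R]_m -> 'rV[R]_(m + m) := fun x => row_mx x 0.
have linr : linear rl by move=> a x y; rewrite /rl scale_row_mx add_row_mx scaler0 addr0.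
pose rlm := GRing.isLinear.Build _ _ _ _ _ linr.
pose rL : {linear 'rV[R]_m -> 'rV[R]_(m + m)} := HB.pack rl rlm.
have crL : continuous rL by exact: linear_mx_continuous.
have := Cn_prelin (row_mx 0 v) crL oD2 crt.
have E x : rL x + row_mx 0 v = row_mx x v by rewrite /= /rl add_row_mx addr0 add0r.
have -> : [set x | D2 (rL x + row_mx 0 v)] = D.
  by apply/funext => x; rewrite /D2 /= E row_mxKl.
apply: (Cn_ext oD) => x Dx /=; rewrite E /th2 row_mxKl !row_mxKr.
by have [_ ->] := dth x Dx.
Qed.

End FlowSmooth.

(** * Local existence and uniqueness of trajectories *)

Section LocalFlow.
Context {R : realType}.

Lemma loc_lip m n (U : set 'rV[R]_m) (X : 'rV[R]_m -> 'rV[R]_n) y : open U -> U y -> Cn 1 U X ->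
  exists L d : R, [/\ 0 <= L, 0 < d, ball y d `<=` U &
    forall z z', ball y d z -> ball y d z' -> `|X z' - X z| <= L * `|z' - z|].
Proof.
move=> oU Uy cX; have [d d0 hd] := strict_diff oU Uy cX ltr01.
set B := (\sum_j `|'D_(delta_mx 0 j) X y|) + 1.
have : \forall z \near y, U z /\ forall j : 'I_m, `|'D_(delta_mx 0 j) X z| < B.
  apply: filterI; first exact: open_nbhs_nbhs.
  apply: (@filter_forall _ 'I_m (fun j z => `|'D_(delta_mx 0 j) X z| < B) (nbhs y) (nbhs_filter y)) => j.
  have /differentiable_continuous c := Cn_diff (CnD (delta_mx 0 j) cX) Uy.
  apply: filterS ((cvgrPdist_lt _ _).1 c _ ltr01) => z h.
  have := ler_normB ('D_(delta_mx 0 j) X y) ('D_(delta_mx 0 j) X y - 'D_(delta_mx 0 j) X z).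
  rewrite subKr => /le_lt_trans; apply; apply: ler_ltD => //.
  by rewrite (bigD1 j) //= lerDl sumr_ge0.
case/nbhs_ballP => d' /= d'0 hd'.
have B0 : 0 <= B by rewrite addr_ge0 // sumr_ge0.
exists (m%:R * B + 1), (Num.min d d'); split.
- by rewrite addr_ge0 // mulr_ge0.
- by rewrite lt_min d0.
- move=> z; rewrite -ball_normE /= lt_min => /andP[_ h]; apply: (hd' z _).1.
  by rewrite -ball_normE.
move=> z z'; rewrite -!ball_normE /= !lt_min => /andP[z1 z2] /andP[z3 z4].
have [||Uz h] := hd z z'; rewrite -?ball_normE //.
have [|_ hj] := hd' z; first by rewrite -ball_normE.
have := ler_normD (X z' - X z - 'D_(z' - z) X z) ('D_(z' - z) X z).
rewrite subrK => /le_trans; apply; rewrite mulrDl addrC; apply: lerD.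
  by apply: derive_bounded => [|j]; [exact: Cn_diff cX Uz|exact: ltW].
by rewrite mul1r in h; rewrite mul1r.
Qed.

Lemma local_unique m (U : set 'rV[R]_m) X (c1 c2 : R -> 'rV[R]_m) t0 :
  open U -> Cn 1 U X -> U (c1 t0) -> c1 t0 = c2 t0 ->
  (\forall t \near t0, isd c1 t (X (c1 t))) -> (\forall t \near t0, isd c2 t (X (c2 t))) ->
  \forall t \near t0, c1 t = c2 t.
Proof.
move=> oU cX U0 e12 d1 d2; have [L [d [L0 d0 _ lip]]] := loc_lip oU U0 cX.
have k1 : {for t0, continuous c1} by exact: isd_cont (nbhs_singleton d1).
have k2 : {for t0, continuous c2} by exact: isd_cont (nbhs_singleton d2).
have b1 : \forall t \near t0, ball (c1 t0) d (c1 t).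
  by apply: k1; exact: nbhsx_ballx.
have b2 : \forall t \near t0, ball (c1 t0) d (c2 t).
  by rewrite e12; apply: k2; exact: nbhsx_ballx.
have /nbhs_ballP[r /= r0 hr] : \forall t \near t0, (isd c1 t (X (c1 t)) /\ isd c2 t (X (c2 t))) /\
    (ball (c1 t0) d (c1 t) /\ ball (c1 t0) d (c2 t)).
  by apply: filterI; apply: filterI.
apply/nbhs_ballP; exists r => //= t tr.
have [G G0 hG] := @gronwall R m L `|t - t0| L0 (normr_ge0 _).
(* The direction from [t0] to [t]: the Gronwall inequality runs forward in time, so both curves are
   reparametrised. *)
pose a : R := if t0 <= t then 1 else -1.
have aa : `|a| = 1 by rewrite /a; case: ifP => _; rewrite ?normrN1 ?normr1.
have at_ : a * `|t - t0| + t0 = t.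
  rewrite /a; case: leP => h; first by rewrite ger0_norm ?subr_ge0 // mul1r subrK.
  by rewrite ltr0_norm ?subr_lt0 // mulN1r opprK subrK.
have inb s : 0 <= s <= `|t - t0| -> ball t0 r (a * s + t0).
  case/andP=> s0 st; rewrite -ball_normE /= opprD addrC subrK normrN normrM aa mul1r ger0_norm //.
  by apply: le_lt_trans st _; rewrite distrC; move: tr; rewrite -ball_normE.
have := hG (fun s => c1 (a * s + t0) - c2 (a * s + t0))
  (fun s => a *: X (c1 (a * s + t0)) - a *: X (c2 (a * s + t0))) 0 `|t - t0|.
rewrite mulr0 add0r e12 subrr normr0 addr0 mulr0 at_ => H.
apply/eqP; rewrite -subr_eq0 -normr_le0; apply: H; rewrite ?lexx ?normr_ge0 //.
  by move=> s /inb/hr[[h1 h2] _]; apply: isd_sub; exact: isd_rescale.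
move=> s /inb/hr[_ [h1 h2]]; rewrite addr0 -scalerBr normrZ aa mul1r.
exact: lip.
Qed.

(** A ball of the maximum norm is a cube, and clamping each coordinate is a 1-Lipschitz retraction
    onto it. It extends a locally Lipschitz field to a globally Lipschitz one. *)
Definition clamp_row m (x : 'rV[R]_m) (d : R) (z : 'rV[R]_m) : 'rV[R]_m :=
  \row_j (x 0 j + clamp d (z 0 j - x 0 j)).

Lemma clamp_lip (T a b : R) : `|clamp T a - clamp T b| <= `|a - b|.
Proof.
have h1 := ler_norm (a - b); have h2 := ler_norm (b - a); rewrite distrC in h2.
rewrite ler_norml /clamp /Num.max /Num.min.
by do 4?case: ifPn; rewrite -?leNgt => *; apply/andP; split; lra.
Qed.

Lemma local_flow m (U : set 'rV[R]_m) X x0 : open U -> U x0 -> Cn 1 U X ->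
  exists r e G th, [/\ 0 < r :> R, 0 < e :> R, flow_family U X (ball x0 r) e th &
    forall x y (s t : R), ball x0 r x -> ball x0 r y -> `|s| < e -> `|t| < e ->
      `|th s x - th t y| <= G * (`|x - y| + `|s - t|)].
Proof.
move=> oU Ux cX; have [L [d [L0 d0 dU lip]]] := loc_lip oU Ux cX.
pose pi := clamp_row x0 (d / 2).
have d2 : 0 <= d / 2 by rewrite divr_ge0 // ltW.
have piB z : ball x0 d (pi z).
  rewrite -ball_normE /=; apply: mx_norm_lt => // i j; rewrite ord1 !mxE opprD addrA subrr add0r normrN.
  by apply: le_lt_trans (clamp_norm _ d2) _; lra.
have piK z : `|z - x0| <= d / 2 -> pi z = z.
  move=> h; apply/rowP => j; have hj : `|z 0 j - x0 0 j| <= d / 2.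
    by apply: le_trans h; have := mx_norm_ge (z - x0) 0 j; rewrite !mxE.
  by rewrite mxE (clampK hj) addrC subrK.
have pil z z' : `|pi z - pi z'| <= `|z - z'|.
  apply: mx_norm_le => // i j; rewrite ord1 !mxE opprD addrACA subrr add0r.
  apply: le_trans (clamp_lip _ _ _) _; have := mx_norm_ge (z - z') 0 j; rewrite !mxE.
  by apply: le_trans; rewrite opprB addrA subrK.
pose F (t : R) z := X (pi z).
have lF t z z' : `|F t z - F t z'| <= L * `|z - z'|.
  by apply: le_trans (lip _ _ (piB _) (piB _)) _; rewrite ler_wpM2l // pil.
have cF c : continuous c -> continuous (fun t => F t (c t)).
  move=> cc t; apply/cvgrPdist_lt => e e0.
  have e1 : 0 < e / (L + 1) by rewrite divr_gt0 // ltr_wpDl.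
  apply: filterS ((cvgrPdist_lt _ _).1 (cc t) _ e1) => s h.
  apply: le_lt_trans (lF t _ _) _; apply: (@le_lt_trans _ _ ((L + 1) * `|c t - c s|)).
    by rewrite ler_wpM2r // lerDl.
  by rewrite mulrC -ltr_pdivlMr // ltr_wpDl.
have /choice[g hg] x : exists c : R -> 'rV[R]_m, c 0 = x /\ forall t, isd c t (F t (c t)).
  by have [c c0 dc] := picard x L0 cF lF; exists c.
pose B := `|X x0| + L * d.
have B0 : 0 <= B by rewrite addr_ge0 // mulr_ge0 // ltW.
have FB t z : `|F t z| <= B.
  have := ler_normD (X (pi z) - X x0) (X x0); rewrite subrK /F => /le_trans; apply.
  rewrite addrC lerD2l; apply: le_trans (lip _ _ (ballxx _ d0) (piB z)) _.
  by rewrite ler_wpM2l //; have := piB z; rewrite -ball_normE /= distrC => /ltW.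
have gl x s t : `|g x s - g x t| <= B * `|s - t|.
  have := @isd_dom R 1 m (fun r => g x (1 * r + t)) (fun r => F r (g x (1 * r + t)))
    (fun r => B * r) (fun=> B) (s - t).
  rewrite mul1r subrK mulr0 add0r mulr0 subr0; apply.
  - move=> r _; apply: isd_eq (@isd_rescale _ _ (g x) 1 t r _ _) (scale1r _).
    exact: (hg x).2.
  - move=> r _; apply: isd_eq (isd_mul (isd_cst _ r) (isd_id r)) _.
    by rewrite mul0r add0r mulr1.
  - by move=> r _.
(* The extended field is bounded by [B], so within time [e] a point moves by at most [d / 4].
   Starting within [d / 4] of [x0] it stays within [d / 2], where the extended field is [X]. *)
pose e := d / (4 * (B + 1)).
have B1 : 0 < B + 1 by rewrite ltr_wpDl.
have e0 : 0 < e by rewrite divr_gt0 // mulr_gt0.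
have [G G0 hG] := @gronwall R m L e L0 (ltW e0).
have Gx x y t : `|t| < e -> `|g x t - g y t| <= G * `|x - y|.
  move=> te; pose a : R := if 0 <= t then 1 else -1.
  have aa : `|a| = 1 by rewrite /a; case: ifP => _; rewrite ?normrN1 ?normr1.
  have at_ : a * `|t| + 0 = t.
    rewrite /a addr0; case: leP => h; first by rewrite ger0_norm // mul1r.
    by rewrite ltr0_norm // mulN1r opprK.
  have := hG (fun s => g x (a * s + 0) - g y (a * s + 0))
    (fun s => a *: F s (g x (a * s + 0)) - a *: F s (g y (a * s + 0))) 0 `|t|.
  have z0 : a * 0 + 0 = 0 by rewrite mulr0 addr0.
  rewrite !at_ z0 (hg x).1 (hg y).1 addr0; apply => //; first by rewrite normr_ge0 ltW.
  - by move=> s _; apply: isd_sub; apply: isd_rescale; exact: (hg _).2.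
  - by move=> s _; rewrite [leRHS]addr0 -scalerBr normrZ aa mul1r; exact: lF.
exists (d / 4), e, (G + B), (fun t x => g x t); split => //; first by rewrite divr_gt0.
- split=> [x _|x t]; first exact: (hg x).1.
  rewrite -ball_normE /= distrC => xd te.
  have h : `|g x t - x0| < d / 2.
    rewrite -(subrKA x); apply: le_lt_trans (ler_normD _ _) _.
    have := gl x t 0; rewrite (hg x).1 subr0 => h1.
    have : B * `|t| <= d / 4.
      apply: (@le_trans _ _ ((B + 1) * e)).
        by apply: ler_pM => //; [rewrite lerDl|exact: ltW].
      by rewrite /e le_eqVlt; apply/orP; left; apply/eqP; field; rewrite gt_eqF.
    by move: h1 xd; move: (`|_|) (`|_|) (B * _) => *; lra.
  have piE := piK _ (ltW h).
  split; first by rewrite -piE; apply: dU; exact: piB.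
  by have := (hg x).2 t; rewrite /F piE.
- move=> x y s t _ _ se te; rewrite -(subrKA (g y s)); apply: le_trans (ler_normD _ _) _.
  apply: le_trans (lerD (Gx x y s se) (gl y s t)) _.
  rewrite mulrDr !mulrDl; have := normr_ge0 (x - y); have := normr_ge0 (s - t) => p q.
  have : 0 <= B * `|x - y| by rewrite mulr_ge0.
  have : 0 <= G * `|s - t| by rewrite mulr_ge0 // ltW.
  by rewrite /B mulrDl; move: (G * `|x - y|) (G * `|s - t|) => *; lra.
Qed.

End LocalFlow.

(** * Jacobians and gradients of maps between spaces of row vectors *)

Section MatrixCalculus.
Context {R : realType}.
Implicit Types (V : normedModType R).

Lemma isd_mulmx m n p (f : R -> 'M[R]_(m, n)) (h : R -> 'M[R]_(n, p)) t f' h' :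
  isd f t f' -> isd h t h' -> isd (fun s => f s *m h s) t (f' *m h t + f t *m h').
Proof.
move=> /isd_mxP df /isd_mxP dh; apply/isd_mxP => i j; rewrite !mxE -big_split /=.
apply: isd_ext (isd_sum (index_enum _) (fun l => isd_mul (df i l) (dh l j))).
by near=> s; rewrite mxE.
Unshelve. all: by end_near. Qed.

Lemma isd_trmx m n (f : R -> 'M[R]_(m, n)) t f' : isd f t f' ->
  isd (fun s => (f s)^T) t f'^T.
Proof.
move=> /isd_mxP df; apply/isd_mxP => i j; rewrite mxE; apply: isd_ext (df j i).
by near=> s; rewrite mxE.
Unshelve. all: by end_near. Qed.

Lemma derive_line V (W : normedModType R) (F : V -> W) x v w : differentiable F x ->
  isd (fun s : R => F (s *: v + x)) 0 w -> 'D_v F x = w.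
Proof.
move=> dF h; rewrite -(isd_val h).
have := @isd_line R _ _ F v x 0; rewrite scale0r add0r => /(_ dF)/isd_val ->; by [].
Qed.

Lemma isd_line0 V (W : normedModType R) (F : V -> W) x v : differentiable F x ->
  isd (fun s : R => F (s *: v + x)) 0 ('D_v F x).
Proof. by move=> dF; have := @isd_line R _ _ F v x 0; rewrite scale0r add0r; apply. Qed.

Lemma diff_mulmx V m n p (f : V -> 'M[R]_(m, n)) (h : V -> 'M[R]_(n, p)) x :
  differentiable f x -> differentiable h x -> differentiable (fun y => f y *m h y) x.
Proof.
move=> /diff_mxP df /diff_mxP dh; apply/diff_mxP => i j.
have -> : (fun y => (f y *m h y) i j) = \sum_l (fun y => f y i l * h y l j).
  by apply/funext => y; rewrite mxE fct_sumE.
by apply: differentiable_sum => l; exact: differentiableM.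
Qed.

Lemma derive_mulmx V m n p (f : V -> 'M[R]_(m, n)) (h : V -> 'M[R]_(n, p)) x v :
  differentiable f x -> differentiable h x ->
  'D_v (fun y => f y *m h y) x = 'D_v f x *m h x + f x *m 'D_v h x.
Proof.
move=> df dh; apply: derive_line; first exact: diff_mulmx.
have := isd_mulmx (isd_line0 v df) (isd_line0 v dh); by rewrite scale0r add0r.
Qed.

Lemma diff_trmx V m n (f : V -> 'M[R]_(m, n)) x : differentiable f x ->
  differentiable (fun y => (f y)^T) x.
Proof.
move=> /diff_mxP df; apply/diff_mxP => i j.
by have -> : (fun y => (f y)^T i j) = (fun y => f y j i) by apply/funext => y; rewrite mxE.
Qed.

Lemma derive_trmx V m n (f : V -> 'M[R]_(m, n)) x v : differentiable f x ->
  'D_v (fun y => (f y)^T) x = ('D_v f x)^T.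
Proof.
by move=> df; apply: derive_line (isd_trmx (isd_line0 v df)); exact: diff_trmx.
Qed.

(** The transpose of the usual Jacobian: vectors are rows and multiply from the left, so the factors
    of the chain rule appear in the order of application. *)
Definition jac m n (f : 'rV[R]_m -> 'rV[R]_n) (x : 'rV[R]_m) : 'M[R]_(m, n) :=
  \matrix_(i, j) 'D_(delta_mx 0 i) f x 0 j.

Lemma jacE m n (f : 'rV[R]_m -> 'rV[R]_n) x u : differentiable f x ->
  'D_u f x = u *m jac f x.
Proof.
move=> df; rewrite (derive_row_sum u df); apply/rowP => j.
by rewrite summxE mxE; apply: eq_bigr => i _; rewrite !mxE.
Qed.

Lemma Cn_jac k m n (U : set 'rV[R]_m) (f : 'rV[R]_m -> 'rV[R]_n) : open U ->
  Cn k.+1 U f -> Cn k U (jac f).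
Proof.
move=> oU cf; apply/(Cn_mxP _ _ oU) => i j.
have /(Cn_mxP _ _ oU)/(_ 0 j) := CnD (delta_mx 0 i) cf.
by apply: (Cn_ext oU) => x Ux; rewrite mxE.
Qed.

Lemma jac_eq m n (f : 'rV[R]_m -> 'rV[R]_n) x A : differentiable f x ->
  (forall u, 'D_u f x = u *m A) -> jac f x = A.
Proof.
by move=> df h; apply/row_matrixP => i; rewrite !rowE -h jacE.
Qed.

Lemma near_eq_jac m n (f h : 'rV[R]_m -> 'rV[R]_n) x :
  (\forall y \near x, f y = h y) -> jac f x = jac h x.
Proof.
by move=> fh; apply/matrixP => i j; rewrite !mxE (near_eq_derive _ fh).
Qed.

Lemma jac_comp m n p (f : 'rV[R]_m -> 'rV[R]_n) (h : 'rV[R]_n -> 'rV[R]_p) x :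
  differentiable f x -> differentiable h (f x) ->
  jac (fun y => h (f y)) x = jac f x *m jac h (f x).
Proof.
move=> df dh; apply: jac_eq; first exact: (@differentiable_comp _ _ _ _ f h).
by move=> u; rewrite derive_comp // !jacE // mulmxA.
Qed.

Definition grad m (f : 'rV[R]_m -> R) (x : 'rV[R]_m) : 'rV[R]_m :=
  \row_j 'D_(delta_mx 0 j) f x.

Lemma gradE m (f : 'rV[R]_m -> R) x u : differentiable f x ->
  'D_u f x = (grad f x *m u^T) 0 0.
Proof.
move=> df; rewrite (derive_row_sum u df) mxE; apply: eq_bigr => j _.
by rewrite !mxE mulrC.
Qed.

Lemma Cn_grad k m (U : set 'rV[R]_m) (f : 'rV[R]_m -> R) : open U ->
  Cn k.+1 U f -> Cn k U (grad f).
Proof.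
move=> oU cf; apply/(Cn_mxP _ _ oU) => i j.
by apply: (Cn_ext oU _ (CnD (delta_mx 0 j) cf)) => x Ux; rewrite mxE.
Qed.

Lemma derive_jac_sym m n (U : set 'rV[R]_m) (f : 'rV[R]_m -> 'rV[R]_n) x u v :
  open U -> U x -> Cn 1 U f -> u *m 'D_v (jac f) x = v *m 'D_u (jac f) x.
Proof.
move=> oU Ux cf.
have dj : differentiable (jac f) x by exact: Cn_diff (Cn_jac oU cf) Ux.
have E a b : a *m 'D_b (jac f) x = 'D_b ('D_a f) x.
  have -> : 'D_b ('D_a f) x = 'D_b (fun y => a *m jac f y) x.
    apply: near_eq_derive; apply: near_open oU Ux _ => y Uy.
    by rewrite jacE //; exact: Cn_diff cf Uy.
  by rewrite derive_mulmx // derive_cst mul0mx add0r.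
have D2 a b j : 'D_a ('D_b f) x 0 j = 'D_a ('D_b (fun y => f y 0 j)) x.
  rewrite (derive_mxE a 0 j (Cn_diff (CnD b cf) Ux)).
  apply: near_eq_derive; apply: near_open oU Ux _ => y Uy.
  by rewrite derive_mxE //; exact: Cn_diff cf Uy.
rewrite !E; apply/rowP => j.
have cfj : Cn 1 U (fun y => f y 0 j) by have /(Cn_mxP _ _ oU) := cf; apply.
exact: (etrans (D2 v u j) (etrans (schwarz v u oU Ux cfj) (esym (D2 u v j)))).
Qed.

End MatrixCalculus.

(** * Bilinear forms given by matrices, and the complex structure *)

Section Forms.
Context {R : realType}.

Lemma mxformD m (A B : 'M[R]_m) u v : mxform (A + B) u v = mxform A u v + mxform B u v.
Proof. by rewrite /mxform mulmxDr mulmxDl mxE. Qed.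

Lemma mxformN m (A : 'M[R]_m) u v : mxform (- A) u v = - mxform A u v.
Proof. by rewrite /mxform mulmxN mulNmx mxE. Qed.

Lemma mxform_mul m (A B C : 'M[R]_m) u v :
  mxform A (u *m B) (v *m C) = mxform (B *m A *m C^T) u v.
Proof. by rewrite /mxform trmx_mul !mulmxA. Qed.

Lemma mxform_mull m (A B : 'M[R]_m) u v : mxform A (u *m B) v = mxform (B *m A) u v.
Proof. by rewrite /mxform !mulmxA. Qed.

Lemma mxform_mulr m (A B : 'M[R]_m) u v : mxform A u (v *m B) = mxform (A *m B^T) u v.
Proof. by rewrite /mxform trmx_mul !mulmxA. Qed.

Lemma mxform_tr m (A : 'M[R]_m) u v : mxform A^T u v = mxform A v u.
Proof.
by rewrite /mxform -[in RHS](trmxK (v *m A *m u^T)) [RHS]mxE !trmx_mul trmxK mulmxA.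
Qed.

Lemma mxform_delta m (A : 'M[R]_m) i j : mxform A (delta_mx 0 i) (delta_mx 0 j) = A i j.
Proof. by rewrite /mxform -rowE trmx_delta -colE !mxE. Qed.

Lemma mxform_sub_delta m (A B : 'M[R]_m) p q j : ((p - q) *m A *m B) 0 j =
  mxform (A *m B) p (delta_mx 0 j) - mxform (A *m B) q (delta_mx 0 j).
Proof.
have h (C : 'M[R]_m) r : mxform C r (delta_mx 0 j) = (r *m C) 0 j.
  by rewrite /mxform trmx_delta -colE mxE.
by rewrite !h -mulmxA mulmxBl !mxE.
Qed.

Lemma mx00D (A B : 'M[R]_1) : (A + B) 0 0 = A 0 0 + B 0 0.
Proof. by rewrite mxE. Qed.

Lemma mxform_inj m (A B : 'M[R]_m) : (forall u v, mxform A u v = mxform B u v) -> A = B.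
Proof. by move=> h; apply/matrixP => i j; rewrite -!mxform_delta h. Qed.

Lemma mxform0 m u v : mxform (0 : 'M[R]_m) u v = 0.
Proof. by rewrite /mxform mulmx0 mul0mx mxE. Qed.

Lemma pos_unitmx m (A : 'M[R]_m) : (forall u, u != 0 -> 0 < mxform A u u) -> A \in unitmx.
Proof.
move=> h; rewrite -row_free_unit -kermx_eq0; apply/negPn/negP => /rowV0Pn[v].
move=> /sub_kermxP vA v0; have := h v v0.
by rewrite /mxform vA mul0mx mxE ltxx.
Qed.

Definition MI n : 'M[R]_(n + n) := block_mx 0 1%:M (- 1%:M) 0.

Lemma mulIE n (u : 'rV[R]_(n + n)) : mulI u = u *m MI n.
Proof.
rewrite -{2}[u]hsubmxK /MI mul_row_block !mulmx0 !mulmxN !mulmx1 add0r addr0.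
by rewrite /mulI.
Qed.

Lemma MI2 n : MI n *m MI n = - 1%:M.
Proof.
rewrite /MI mulmx_block !mulmx0 !mul0mx !mul1mx !mulmx1 !addr0 !add0r.
by rewrite (scalar_mx_block n n) opp_block_mx !oppr0.
Qed.

Lemma MIT n : (MI n)^T = - MI n.
Proof.
by rewrite /MI tr_block_mx !trmx0 raddfN /= trmx1 opp_block_mx opprK !oppr0.
Qed.

Lemma differentiable_mxform (V : normedModType R) m (G : V -> 'M[R]_m) u v x :
  differentiable G x -> differentiable (fun y => mxform (G y) u v) x /\
  forall w, 'D_w (fun y => mxform (G y) u v) x = mxform ('D_w G x) u v.
Proof.
move=> dG.
have d1 : differentiable (fun y => u *m G y) x.
  by apply: diff_mulmx => //; exact: differentiable_cst.
have d2 : differentiable (fun y => u *m G y *m v^T) x.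
  by apply: diff_mulmx => //; exact: differentiable_cst.
split; first by have /diff_mxP := d2; apply.
move=> w; rewrite -(derive_mxE w 0 0 d2) (derive_mulmx w d1); last exact: differentiable_cst.
by rewrite derive_cst mulmx0 addr0 derive_mulmx // derive_cst mul0mx add0r.
Qed.

End Forms.

(** * Hamiltonian and Killing fields of a Kähler metric in one chart *)

Section KahlerChart.
Context {R : realType} {n : nat}.
Local Notation E := 'rV[R]_(n + n).
Local Notation I := (@MI R n).
Implicit Types (U : set E) (G : E -> 'M[R]_(n + n)) (f : E -> R).

(** With vectors as rows, multiplication by i is right multiplication by [I], and the Kähler form
    g(i -, -) has the matrix [I *m G]. The last field is thus the closedness of the Kähler form. *)
Record kmetric U G : Prop := KMetric {
  km_open : open U;
  km_smooth : smooth_on U G;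
  km_sym : forall x, U x -> (G x)^T = G x;
  km_pos : forall x, U x -> forall u, u != 0 -> 0 < mxform (G x) u u;
  km_herm : forall x, U x -> I *m G x = G x *m I;
  km_closed : forall x, U x -> forall u v w,
    mxform (I *m 'D_u G x) v w + mxform (I *m 'D_v G x) w u +
    mxform (I *m 'D_w G x) u v = 0 }.

(** The solution [X] of [X *m I *m G = grad f], as the inverse of [I] is [- I]. *)
Definition ham G f (x : E) : E := - (grad f x *m invmx (G x) *m I).

Definition killm G (X : E -> E) (x : E) : Prop :=
  'D_(X x) G x + jac X x *m G x + G x *m (jac X x)^T = 0.

Lemma ham_ext G f h x : (\forall y \near x, f y = h y) -> ham G f x = ham G h x.
Proof.
move=> fh; rewrite /ham; have -> // : grad f x = grad h x.
by apply/rowP => j; rewrite !mxE (near_eq_derive _ fh).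
Qed.

Section chart.
Variables (U : set E) (G : E -> 'M[R]_(n + n)).
Hypothesis K : kmetric U G.
Let oU := km_open K.

Lemma km_unit x : U x -> G x \in unitmx.
Proof. by move=> Ux; apply: pos_unitmx; exact: km_pos K x Ux. Qed.

Lemma km_cn k : Cn k U G.
Proof. by have /smooth_onP := km_smooth K; apply. Qed.

Lemma km_diff x : U x -> differentiable G x.
Proof. exact: Cn_diff (km_cn 0). Qed.

Lemma omega_anti x u v : U x -> mxform (I *m G x) u v = - mxform (I *m G x) v u.
Proof.
move=> Ux; rewrite -mxform_tr trmx_mul (km_sym K Ux) MIT mulmxN mxformN.
by rewrite (km_herm K Ux).
Qed.

Lemma Cn_ham k f : Cn k.+1 U f -> Cn k U (ham G f).
Proof.
move=> cf; apply: Cn_opp => //; apply: Cn_mulmx => //; last exact: Cn_cst.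
apply: Cn_mulmx => //; first exact: Cn_grad.
by apply: Cn_invmx => //; [exact: km_unit|exact: km_cn].
Qed.

Lemma hamE f x : U x -> ham G f x *m I *m G x = grad f x.
Proof.
move=> Ux; rewrite /ham !mulNmx -[_ *m I *m I]mulmxA MI2 mulmxN mulmx1 mulNmx opprK.
by rewrite mulmxKV // km_unit.
Qed.

Lemma ham_uniq f x (X : E) : U x -> X *m I *m G x = grad f x -> X = ham G f x.
Proof.
move=> Ux; rewrite -(hamE f Ux) => /(congr1 (mulmx^~ (invmx (G x)))).
rewrite !mulmxK ?km_unit // => /(congr1 (mulmx^~ I)).
by rewrite -!mulmxA MI2 !mulmxN !mulmx1 => /oppr_inj.
Qed.

Lemma ham_derive f x v : U x -> differentiable f x ->
  mxform (I *m G x) (ham G f x) v = 'D_v f x.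
Proof. by move=> Ux df; rewrite (gradE v df) -hamE // /mxform !mulmxA. Qed.

Lemma ham_derive2 f x u v : U x -> Cn 2 U f ->
  'D_u ('D_v f) x = mxform (I *m 'D_u G x) (ham G f x) v +
                    mxform (I *m G x) (u *m jac (ham G f) x) v.
Proof.
move=> Ux cf.
have dG := km_diff Ux; have dX := Cn_diff (Cn_ham cf) Ux.
have dIG : differentiable (fun y => I *m G y) x.
  by apply: diff_mulmx => //; exact: differentiable_cst.
have dXIG : differentiable (fun y => ham G f y *m (I *m G y)) x by exact: diff_mulmx.
have dall : differentiable (fun y => ham G f y *m (I *m G y) *m v^T) x.
  by apply: diff_mulmx => //; exact: differentiable_cst.
have -> : 'D_u ('D_v f) x = 'D_u (fun y => (ham G f y *m (I *m G y) *m v^T) 0 0) x.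
  apply: near_eq_derive; apply: near_open oU Ux _ => y Uy.
  by rewrite -ham_derive //; exact: Cn_diff cf Uy.
rewrite -(derive_mxE u 0 0 dall) (derive_mulmx u dXIG); last exact: differentiable_cst.
rewrite derive_cst mulmx0 addr0 (derive_mulmx u dX dIG) (jacE u dX).
rewrite derive_mulmx // derive_cst mul0mx add0r mulmxDl mxE addrC.
by rewrite /mxform !mulmxA.
Qed.

Lemma lie_arith (a b c d e g p q : R) :
  a + b = e -> c + d = e -> p + q + c = 0 -> q = - a -> g = - d -> p + b + g = 0.
Proof. lra. Qed.

(** The Lie derivative of omega along a Hamiltonian field vanishes. As in Cartan's formula,
    closedness of omega turns the derivative along the field into derivatives along [u] and [v], and
    what remains is the antisymmetric part of the Hessian of [f]. *)
Lemma ham_lie_form f x u v : U x -> Cn 2 U f ->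
  mxform (I *m 'D_(ham G f x) G x) u v + mxform (I *m G x) (u *m jac (ham G f) x) v +
  mxform (I *m G x) u (v *m jac (ham G f) x) = 0.
Proof.
move=> Ux cf; set X := ham G f.
have dIG : differentiable (fun y => I *m G y) x.
  by apply: diff_mulmx; [exact: differentiable_cst|exact: km_diff].
have dIa w a b : mxform (I *m 'D_w G x) a b = - mxform (I *m 'D_w G x) b a.
  have [d1 e1] := differentiable_mxform a b dIG.
  have [d2 e2] := differentiable_mxform b a dIG.
  have De : 'D_w (fun y => I *m G y) x = I *m 'D_w G x.
    by rewrite derive_mulmx ?derive_cst ?mul0mx ?add0r //; exact: km_diff.
  rewrite -De -e1 -e2; have -> : 'D_w (fun y => mxform (I *m G y) a b) x =
     'D_w (fun y => - mxform (I *m G y) b a) x.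
    apply: near_eq_derive; apply: near_open oU Ux _ => y Uy; exact: omega_anti.
  by rewrite (deriveN (diff_derivable d2)).
have h1 := ham_derive2 u v Ux cf; have h2 := ham_derive2 v u Ux cf.
rewrite (schwarz v u oU Ux (CnW cf)) in h2.
apply: (lie_arith (esym h1) (esym h2) (km_closed K Ux (X x) u v)).
- exact: dIa.
- exact: omega_anti.
Qed.

(** The field preserves both g and omega, hence also the complex structure that relates them:
    comparing [I] times the Killing equation with [ham_lie_form] leaves
    [I *m B *m G = B *m I *m G]. *)
Lemma kill_holomorphic f x : U x -> Cn 2 U f -> killm G (ham G f) x ->
  jac (ham G f) x *m I = I *m jac (ham G f) x.
Proof.
move=> Ux cf kl; set B := jac _ x.
have L : I *m 'D_(ham G f x) G x + B *m (I *m G x) + I *m G x *m B^T = 0.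
  apply: mxform_inj => u v; rewrite mxform0 2!mxformD.
  by rewrite -[X in _ + X + _]mxform_mull -[X in _ + _ + X]mxform_mulr; exact: ham_lie_form.
have : I *m ('D_(ham G f x) G x + B *m G x + G x *m B^T) =
   I *m 'D_(ham G f x) G x + B *m (I *m G x) + I *m G x *m B^T.
  by rewrite L; have -> := kl; rewrite mulmx0.
rewrite !mulmxDr [I *m (G x *m _)]mulmxA => /addIr/addrI; rewrite !mulmxA => e.
by have := congr1 (mulmx^~ (invmx (G x))) e; rewrite !mulmxK ?km_unit.
Qed.

Lemma br_arith (a b c d e p q w1 w2 w3 : R) :
  a + p + q = 0 -> p + b + w1 = 0 -> q + w2 + w3 = 0 ->
  w1 = - d -> w3 = - c -> w2 = - e -> b - c = a + d + e.
Proof. lra. Qed.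

(** Differentiate omega(X_f, X_h) along [v]. Closedness replaces the derivative of omega along [v],
    and the invariance of omega under X_f and X_h cancels everything but the commutator. *)
Lemma ham_br f h x : U x -> Cn 2 U f -> Cn 2 U h ->
  ham G (fun y => 'D_(ham G h y) f y) x =
  ham G h x *m jac (ham G f) x - ham G f x *m jac (ham G h) x.
Proof.
move=> Ux cf ch.
have dG := km_diff Ux; have dF := Cn_diff (Cn_ham cf) Ux; have dH := Cn_diff (Cn_ham ch) Ux.
have dIG : differentiable (fun y => I *m G y) x.
  by apply: diff_mulmx => //; exact: differentiable_cst.
pose w y := (ham G f y *m (I *m G y) *m (ham G h y)^T).
have dFI : differentiable (fun y => ham G f y *m (I *m G y)) x by exact: diff_mulmx.
have dw : differentiable w x by apply: diff_mulmx => //; exact: diff_trmx.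
have nw : \forall y \near x, w y 0 0 = 'D_(ham G h y) f y.
  apply: near_open oU Ux _ => y Uy.
  by rewrite -ham_derive //; exact: Cn_diff cf Uy.
have dw0 : differentiable (fun y => w y 0 0) x by have /diff_mxP := dw; apply.
have [dbr _] := near_eq_diff nw dw0.
apply/esym/ham_uniq => //.
have De v : 'D_v (fun y => I *m G y) x = I *m 'D_v G x.
  by rewrite derive_mulmx ?derive_cst ?mul0mx ?add0r.
have Dw v : 'D_v w x = (v *m jac (ham G f) x *m (I *m G x) + ham G f x *m (I *m 'D_v G x)) *m (ham G h x)^T
   + ham G f x *m (I *m G x) *m (v *m jac (ham G h) x)^T.
  rewrite (derive_mulmx v dFI (diff_trmx dH)) (derive_mulmx v dF dIG) (derive_trmx v dH).
  by rewrite (jacE v dF) (jacE v dH) De.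
suff e v : mxform (I *m G x) (ham G h x *m jac (ham G f) x) v -
    mxform (I *m G x) (ham G f x *m jac (ham G h) x) v = 'D_v w x 0 0.
  apply/rowP => j; have := e (delta_mx 0 j).
  rewrite (derive_mxE _ 0 0 dw) (near_eq_derive _ nw) [grad _ _ 0 j]mxE => <-.
  exact: mxform_sub_delta.
have -> : 'D_v w x 0 0 = mxform (I *m 'D_v G x) (ham G f x) (ham G h x) +
    mxform (I *m G x) (v *m jac (ham G f) x) (ham G h x) +
    mxform (I *m G x) (ham G f x) (v *m jac (ham G h) x).
  by rewrite Dw mulmxDl !mx00D [X in X + _ = _]addrC.
have C := km_closed K Ux v (ham G f x) (ham G h x).
have L1 := ham_lie_form (ham G h x) v Ux cf.
have L2 := ham_lie_form v (ham G f x) Ux ch.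
have T1 := omega_anti (ham G h x) (v *m jac (ham G f) x) Ux.
have T2 := omega_anti v (ham G f x *m jac (ham G h) x) Ux.
have T3 := omega_anti (v *m jac (ham G h) x) (ham G f x) Ux.
exact: (br_arith C L1 L2 T1 T2 T3).
Qed.

End chart.
End KahlerChart.

(** * Holomorphic isometries between charts, and flows as such maps *)

Section KahlerMaps.
Context {R : realType} {n : nat}.
Local Notation E := 'rV[R]_(n + n).
Local Notation I := (@MI R n).

(** Being a holomorphic isometry is required on a neighbourhood of [x], so that the two identities
    may be differentiated at [x]. *)
Definition hiso (g1 g2 : E -> 'M[R]_(n + n)) (L : E -> E) (x : E) : Prop :=
  exists Q : set E, [/\ open Q, Q x, smooth_on Q L &
    forall y, Q y -> jac L y *m I = I *m jac L y /\
      jac L y *m g2 (L y) *m (jac L y)^T = g1 y].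

Lemma smooth_on_comp (V W : normedModType R) m (U : set V) (Q : set 'rV[R]_m)
    (f : V -> 'rV[R]_m) (h : 'rV[R]_m -> W) : open U -> (forall x, U x -> Q (f x)) ->
  smooth_on U f -> smooth_on Q h -> smooth_on U (fun x => h (f x)).
Proof.
move=> oU fO /smooth_onP cf /smooth_onP ch; apply/smooth_onP => k.
exact: (Cn_comp oU fO (cf k) (ch k)).
Qed.

Lemma smooth_on_ext (V W : normedModType R) (U : set V) (f h : V -> W) : open U ->
  (forall x, U x -> f x = h x) -> smooth_on U f -> smooth_on U h.
Proof.
by move=> oU fh /smooth_onP cf; apply/smooth_onP => k; exact: (Cn_ext oU fh (cf k)).
Qed.

Lemma open_preim (V : normedModType R) m (U : set V) (Q : set 'rV[R]_m) (f : V -> 'rV[R]_m) :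
  open U -> open Q -> smooth_on U f -> open (U `&` f @^-1` Q).
Proof.
move=> oU oO sf; rewrite openE => x [Ux Ox]; apply: filterI; first exact: open_nbhs_nbhs.
have /differentiable_continuous c := smooth_on_diff sf Ux.
by apply: c; exact: open_nbhs_nbhs.
Qed.

Lemma hiso_comp g1 g2 g3 L L' x : hiso g1 g2 L x -> hiso g2 g3 L' (L x) ->
  hiso g1 g3 (fun y => L' (L y)) x.
Proof.
move=> [Q [oO Ox sL hL]] [Q' [oO' Ox' sL' hL']].
exists (Q `&` L @^-1` Q'); split.
- exact: open_preim.
- by split.
- apply: (smooth_on_comp (Q := Q')) => //; first exact: open_preim.
    by move=> y [].
  by apply: smooth_on_sub sL => y [].
move=> y [Oy Q'y]; have [h1 h2] := hL y Oy; have [h3 h4] := hL' _ Q'y.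
rewrite (jac_comp (smooth_on_diff sL Oy) (smooth_on_diff sL' Q'y)); split.
  by rewrite -[LHS]mulmxA h3 [LHS]mulmxA h1 -[LHS]mulmxA.
by rewrite trmx_mul -h2 -h4 !mulmxA.
Qed.

Lemma hiso_ext g1 g2 L L' x : (\forall y \near x, L y = L' y) -> hiso g1 g2 L x -> hiso g1 g2 L' x.
Proof.
move=> /nbhs_ballP[r /= r0 hr] [Q [oO Ox sL hL]].
have oB : open (Q `&` ball x r) by apply: openI => //; exact: ball_open.
exists (Q `&` ball x r); split => //.
- by split=> //; exact: ballxx.
- apply: (smooth_on_ext oB _ (smooth_on_sub _ sL)) => [y [_ /hr]//|y []//].
move=> y Oy; have e : \forall z \near y, L z = L' z.
  by apply: near_open oB Oy _ => z [_ /hr].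
by rewrite -(near_eq_jac e) -(nbhs_singleton e); apply: hL; case: Oy.
Qed.

Lemma kmetric_sub (U U' : set E) G : open U' -> U' `<=` U -> kmetric U G -> kmetric U' G.
Proof.
move=> oU' UU [h1 h2 h3 h4 h5 h6]; constructor=> //.
- exact: smooth_on_sub h2.
- by move=> x /UU; exact: h3.
- by move=> x /UU; exact: h4.
- by move=> x /UU; exact: h5.
- by move=> x /UU; exact: h6.
Qed.

Lemma congruence_unit (A g1 g2 : 'M[R]_(n + n)) :
  A *m g2 *m A^T = g1 -> g1 \in unitmx -> A \in unitmx.
Proof. by move=> <-; rewrite !unitmx_mul => /andP[/andP[]]. Qed.

Lemma hiso_ham (U1 U2 : set E) g1 g2 L x f : kmetric U1 g1 -> kmetric U2 g2 ->
  U1 x -> U2 (L x) -> hiso g1 g2 L x -> differentiable f (L x) ->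
  ham g1 (fun y => f (L y)) x *m jac L x = ham g2 f (L x).
Proof.
move=> K1 K2 Ux ULx [Q [oO Ox sL hL]] df.
have [h1 h2] := hL x Ox; have dL := smooth_on_diff sL Ox.
have uA : jac L x \in unitmx by apply: (congruence_unit h2); exact: (km_unit K1).
apply: (ham_uniq K2 ULx).
have gE : grad (fun y => f (L y)) x = grad f (L x) *m (jac L x)^T.
  apply/rowP => j; rewrite mxE derive_comp // (gradE _ df) (jacE _ dL) trmx_mul mulmxA.
  by rewrite trmx_delta -colE mxE.
have := hamE K1 (fun y => f (L y)) Ux; rewrite gE -h2.
set X := ham _ _ _ => e.
have {e} : X *m jac L x *m I *m g2 (L x) *m (jac L x)^T = grad f (L x) *m (jac L x)^T.
  by rewrite -e -[X *m jac L x *m I]mulmxA h1 !mulmxA.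
by move/(congr1 (mulmx^~ (invmx (jac L x)^T))); rewrite !mulmxK ?unitmx_tr.
Qed.

Lemma hiso_kill_alg0 m (u : 'rV[R]_m) (B1 A A' B2 : 'M[R]_m) :
  u *m B1 *m A + u *m A' = u *m A *m B2 -> u *m (B1 *m A) = u *m (A *m B2 - A').
Proof. by move=> e; rewrite mulmxBr !mulmxA -e addrK. Qed.

Lemma hiso_kill_alg m (A A' B1 B2 g2 g2' : 'M[R]_m) : B1 *m A = A *m B2 - A' ->
  g2' + B2 *m g2 + g2 *m B2^T = 0 ->
  A' *m g2 *m A^T + A *m g2' *m A^T + A *m g2 *m A'^T + B1 *m (A *m g2 *m A^T)
    + A *m g2 *m A^T *m B1^T = 0.
Proof.
move=> eB kl; have T : A^T *m B1^T = B2^T *m A^T - A'^T.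
  by rewrite -trmx_mul eB linearB /= trmx_mul.
rewrite -[A *m g2 *m A^T *m B1^T]mulmxA T !mulmxA eB !mulmxBl mulmxBr.
have := congr1 (fun M => A *m M *m A^T) kl; rewrite mulmx0 mul0mx => <-.
rewrite !mulmxDr !mulmxDl !mulmxA.
set p := A' *m g2 *m A^T; set q := A *m g2 *m A'^T; set r := A *m g2' *m A^T.
set b := A *m B2 *m g2 *m A^T; set c := A *m g2 *m B2^T *m A^T.
by apply/matrixP => i j; rewrite !mxE; ring.
Qed.

(* Killing fields pull back: with A = dL, differentiating X1 A = X2 o L and
   g1 = A (g2 o L) A^T reduces the equation for X1 to A (equation for X2) A^T. *)
Lemma hiso_kill (U1 U2 : set E) g1 g2 L x f : kmetric U1 g1 -> kmetric U2 g2 ->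
  U1 x -> U2 (L x) -> hiso g1 g2 L x -> smooth_on U2 f ->
  killm g2 (ham g2 f) (L x) -> killm g1 (ham g1 (fun y => f (L y))) x.
Proof.
move=> K1 K2 Ux ULx hx sf kl.
have [Q [oO Ox sL hL]] := hx.
have oP : open (U1 `&` (Q `&` L @^-1` U2)).
  by apply: openI; [exact: km_open K1|apply: open_preim => //; exact: km_open K2].
set P := U1 `&` _ in oP; have Px : P x by split.
have hP y : P y -> hiso g1 g2 L y.
  by move=> [_ [Oy _]]; exists Q.
have K1P : kmetric P g1 by apply: kmetric_sub K1 => // y [].
have sLP : smooth_on P L by apply: smooth_on_sub sL => y [_ []].
have sfL : smooth_on P (fun y => f (L y)).
  by apply: (smooth_on_comp (Q := U2)) => // y [_ []].
have /smooth_onP cfL := sfL; have /smooth_onP cLP := sLP; have /smooth_onP cf := sf.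
set X1 := ham g1 _; set X2 := ham g2 f in kl *.
have dX1 : differentiable X1 x by exact: Cn_diff (Cn_ham K1P (cfL 1)) Px.
have dX2 : differentiable X2 (L x) by exact: Cn_diff (Cn_ham K2 (cf 1)) ULx.
have dA : differentiable (jac L) x by exact: Cn_diff (Cn_jac oP (cLP 1)) Px.
have dL : differentiable L x by exact: Cn_diff (cLP 0) Px.
have dg2 : differentiable g2 (L x) by exact: (km_diff K2).
have XA y : P y -> X1 y *m jac L y = X2 (L y).
  move=> Py; have [P1 [PO P2]] := Py.
  exact: (hiso_ham K1 K2 P1 P2 (hP y Py) (Cn_diff (cf 0%N) P2)).
set A := jac L x; set B1 := jac X1 x; set B2 := jac X2 (L x) in kl *.
set A' := 'D_(X1 x) (jac L) x.
have dAg : differentiable (fun y => jac L y *m g2 (L y)) x.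
  by apply: diff_mulmx => //; exact: (@differentiable_comp _ _ _ _ L g2).
have eB : B1 *m A = A *m B2 - A'.
  apply/row_matrixP => i; rewrite !rowE; set u := delta_mx 0 i.
  have : 'D_u (fun y => X1 y *m jac L y) x = 'D_u (fun y => X2 (L y)) x.
    by apply: near_eq_derive; apply: near_open oP Px _.
  rewrite derive_mulmx // (derive_comp u dL dX2) (jacE _ dX2) (jacE _ dL) (jacE _ dX1).
  rewrite (derive_jac_sym (X1 x) u oP Px (cLP 1%N)) => e.
  exact: (hiso_kill_alg0 e).
have eG : 'D_(X1 x) g1 x = A' *m g2 (L x) *m A^T + A *m 'D_(X2 (L x)) g2 (L x) *m A^T
   + A *m g2 (L x) *m A'^T.
  have -> : 'D_(X1 x) g1 x = 'D_(X1 x) (fun y => jac L y *m g2 (L y) *m (jac L y)^T) x.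
    by apply: near_eq_derive; apply: near_open oO Ox _ => y /hL[].
  rewrite (derive_mulmx _ dAg (diff_trmx dA)) derive_trmx // -/A'.
  rewrite derive_mulmx //; last exact: (@differentiable_comp _ _ _ _ L g2).
  by rewrite (derive_comp _ dL dg2) (jacE _ dL) (XA x Px) -/A -/A' mulmxDl.
have [_ g1E] := hL x Ox.
by rewrite /killm -/B1 eG -g1E -/A; exact: (hiso_kill_alg eB kl).
Qed.

Lemma family_jac m (U D : set 'rV[R]_m) X T th x (t : R) : open U -> open D ->
  Cn 2 U X -> flow_family U X D T th -> D x -> 0 <= t < T ->
  exists A : R -> 'M[R]_m, [/\ A 0 = 1%:M,
    forall s : R, 0 <= s <= t -> isd A s (A s *m jac X (th s x)),
    forall s : R, 0 <= s <= t -> A s = jac (th s) x &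
    exists2 L : R, 0 <= L & forall (s : R) (v : 'rV[R]_m), 0 <= s <= t -> `|v *m jac X (th s x)| <= L * `|v|].
Proof.
move=> oU oD cX fam Dx tT; have [t0 t1] := andP tT.
have [A [A0 linA dA [L L0 hL]]] := family_linear cX fam Dx tT.
have pos (s : R) : 0 <= s <= t -> `|s| <= t by case/andP=> s0 ?; rewrite ger0_norm.
have dX (s : R) : 0 <= s <= t -> differentiable X (th s x).
  move=> st; apply: Cn_diff cX _; have [] := fam.2 x s Dx; last by [].
  by apply: le_lt_trans (pos s st) t1.
have AE s v : v *m (\matrix_i A s (delta_mx 0 i)) = A s v.
  pose Lm := GRing.isLinear.Build _ _ _ _ _ (linA s).
  pose As : {linear 'rV[R]_m -> 'rV[R]_m} := HB.pack (A s) Lm.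
  rewrite mulmx_sum_row -[A s v]/(As v) {2}(row_sum_delta v) linear_sum.
  by apply: eq_bigr => i _; rewrite rowK linearZ.
exists (fun s => \matrix_i A s (delta_mx 0 i)); split.
- by apply/row_matrixP => i; rewrite rowK A0 row1.
- move=> s st; apply/isd_mxP => i j.
  have /isd_mxP/(_ 0 j) := dA s (delta_mx 0 i) (pos s st).
  rewrite (jacE _ (dX s st)) => h.
  have -> : ((\matrix_i A s (delta_mx 0 i)) *m jac X (th s x)) i j = (A s (delta_mx 0 i) *m jac X (th s x)) 0 j.
    by rewrite !mxE; apply: eq_bigr => l _; rewrite mxE.
  by apply: isd_ext h; near=> r; rewrite mxE.
- move=> s st; have st1 : 0 <= s < T by case/andP: st => -> /le_lt_trans ->.
  have sl (r : R) : `|r| <= s -> `|r| <= t by move/le_trans; apply; case/andP: st.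
  have [d1 d2] := family_diff oU oD cX fam Dx st1 A0 linA (fun r v h => dA r v (sl r h))
    (ex_intro2 _ _ L L0 (fun r v h => hL r v (sl r h))).
  by apply/esym/jac_eq => // u; rewrite d2 AE.
- by exists L => // s v st; rewrite -(jacE _ (dX s st)); apply: hL; exact: pos.
Unshelve. all: by end_near. Qed.

Lemma isd_const_pos m p (u : R -> 'M[R]_(m, p)) (t : R) : 0 <= t ->
  (forall s : R, 0 <= s <= t -> isd u s 0) -> u t = u 0.
Proof.
move=> t0 h; apply/eqP; rewrite -subr_eq0 -normr_le0.
have := @isd_dom_pos R m p u (fun=> 0) (fun=> 0) (fun=> 0) t t0 h; rewrite subrr; apply.
- by move=> s _; exact: isd_cst.
- by move=> s _; rewrite normr0.
Qed.

Lemma isd_row m p (u : R -> 'M[R]_(m, p)) t u' i : isd u t u' ->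
  isd (fun s => row i (u s)) t (row i u').
Proof.
move=> /isd_mxP h; apply/isd_mxP => a j; rewrite mxE; apply: isd_ext (h i j).
by near=> s; rewrite mxE.
Unshelve. all: by end_near. Qed.

Lemma flow_alg m (A B G G' : 'M[R]_m) : G' + B *m G + G *m B^T = 0 ->
  (A *m B *m G + A *m G') *m A^T + A *m G *m (A *m B)^T = 0.
Proof.
move=> kl; have := congr1 (fun M => A *m M *m A^T) kl; rewrite mulmx0 mul0mx => <-.
by rewrite trmx_mul !mulmxDr !mulmxDl !mulmxA [X in X + _]addrC.
Qed.

(** Let [A] be the Jacobian of the flow and [B] that of the field, so [A' = A *m B]. As [B] commutes
    with [I], the rows of [A *m I - I *m A] solve a linear equation with initial value 0. The
    derivative of [A *m G *m A^T] along the trajectory is [A] times the Killing equation times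
    [A^T], hence 0. *)
Lemma flow_hiso (U D : set E) G f T th x (t : R) : kmetric U G -> open D ->
  smooth_on U f -> (forall y, U y -> killm G (ham G f) y) ->
  flow_family U (ham G f) D T th -> D x -> 0 <= t < T -> hiso G G (th t) x.
Proof.
move=> K oD /smooth_onP cf kl fam Dx tT; have [t0 t1] := andP tT.
have oU := km_open K; set X := ham G f in kl fam *.
have cX k : Cn k U X by exact: (Cn_ham K (cf k.+1)).
exists D; split=> //; first by apply/smooth_onP => k; apply: flow_smooth fam tT => //; exact/smooth_onP.
move=> y Dy; have [A [A0 dA jA [L L0 hL]]] := family_jac oU oD (cX 2) fam Dy tT.
have t01 : 0 <= t <= t by rewrite t0 lexx.
have thU (s : R) : 0 <= s <= t -> U (th s y) /\ isd (th^~ y) s (X (th s y)).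
  by move=> /andP[s0 st]; apply: fam.2 => //; rewrite ger0_norm // (le_lt_trans st).
rewrite -(jA t t01); split.
  apply/eqP; rewrite -subr_eq0; apply/eqP/row_matrixP => i; rewrite row0.
  have [g g0 hg] := @gronwall R (n + n) L t L0 t0.
  pose u s := row i (A s *m I - I *m A s).
  have := hg u (fun s => u s *m jac X (th s y)) 0 t t01 (lexx _).
  rewrite /u A0 mul1mx mulmx1 subrr row0 normr0 addr0 mulr0 normr_le0 => H.
  apply/eqP/H => s st; last by rewrite addr0; exact: hL.
  rewrite -row_mul; apply: isd_row.
  have hB := kill_holomorphic K (thU s st).1 (cf 2) (kl _ (thU s st).1).
  apply: isd_eq (isd_sub (isd_mulmx (dA s st) (isd_cst I s)) (isd_mulmx (isd_cst I s) (dA s st))) _.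
  by rewrite mulmx0 mul0mx addr0 add0r mulmxBl -!mulmxA hB.
have := @isd_const_pos _ _ (fun s => A s *m G (th s y) *m (A s)^T) t t0.
rewrite A0 mul1mx trmx1 mulmx1 (fam.1 y Dy); apply => s st.
have [Us ds] := thU s st.
have dG := @isd_comp _ _ _ (fun s => th s y) G s _ ds (km_diff K Us).
apply: isd_eq (isd_mulmx (isd_mulmx (dA s st) dG) (isd_trmx (dA s st))) _.
exact: flow_alg (kl _ Us).
Qed.

End KahlerMaps.

(** * A Killing field is determined near a point by its 1-jet there *)

Section KillingJet.
Context {R : realType} {n : nat}.
Local Notation E := 'rV[R]_(n + n).

Lemma norm_mulmx m p q (A : 'M[R]_(m, p)) (B : 'M[R]_(p, q)) :
  `|A *m B| <= p%:R * `|A| * `|B|.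
Proof.
apply: mx_norm_le => [|i j]; first by rewrite !mulr_ge0.
rewrite mxE; apply: le_trans (ler_norm_sum _ _ _) _.
apply: (@le_trans _ _ (\sum_(l < p) `|A| * `|B|)).
  by apply: ler_sum => l _; rewrite normrM ler_pM // mx_norm_ge.
by rewrite sumr_const card_ord -[leLHS]mulr_natl mulrA.
Qed.

Lemma norm_trmx m p (A : 'M[R]_(m, p)) : `|A^T| <= `|A|.
Proof. by apply: mx_norm_le => // i j; rewrite mxE mx_norm_ge. Qed.

(** The computation behind the Christoffel symbols: symmetry in the first two indices and the
    symmetrisation in the last two determine [K]. *)
Lemma christoffel (m : nat) (K T : 'I_m -> 'I_m -> 'I_m -> R) :
  (forall a b c, K a b c = K b a c) ->
  (forall a b c, K a b c + K a c b = T a b c) ->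
  forall a b c, 2 * K a b c = T a b c + T b a c - T c a b.
Proof.
move=> sK h a b c; rewrite -!h (sK b a c) (sK b c a) (sK a c b); ring.
Qed.

Lemma loc_bounded (V W : normedModType R) (F : V -> W) x : {for x, continuous F} ->
  \forall y \near x, `|F y| <= `|F x| + 1.
Proof.
move=> c; apply: filterS ((cvgrPdist_lt _ _).1 c _ ltr01) => y h.
have := ler_normB (F x) (F x - F y); rewrite subKr => /le_trans; apply.
by rewrite lerD2l ltW.
Qed.

Lemma sum2_ge m (a : 'I_m -> 'I_m -> R) i j : (forall i j, 0 <= a i j) ->
  a i j <= \sum_i \sum_j a i j.
Proof.
move=> a0; rewrite (bigD1 i) //= (bigD1 j) //= -addrA lerDl addr_ge0 //.
  by apply: sumr_ge0.
by apply: sumr_ge0 => k _; apply: sumr_ge0.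
Qed.

Lemma jet_arith (m b c d f : R) : 0 <= m * c * f -> 0 <= m * b * d -> 0 <= m * b * f ->
  m * (f * b + d * c) + m * f * b + m * b * f <= (m * c + 3 * m * b) * (d + f).
Proof. by move=> h1 h2 h3; lra. Qed.

Lemma delta_mulmx2 m (A B : 'M[R]_m) q r : ((delta_mx 0 q : 'rV[R]_m) *m A *m B) 0 r = (A *m B) q r.
Proof. by rewrite -mulmxA -rowE mxE. Qed.

Section jet.
Variables (U : set E) (G : E -> 'M[R]_(n + n)) (X : E -> E).
Hypotheses (K : kmetric U G) (cX : forall k, Cn k U X)
  (kl : forall y, U y -> killm G X y).
Let oU := km_open K.

(* The terms of order at most one in X of the Killing equation differentiated
   along w. *)
Definition jetT (x w : E) : 'M[R]_(n + n) :=
  'D_w (fun y => 'D_(X y) G y) x + jac X x *m 'D_w G x + 'D_w G x *m (jac X x)^T.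

Lemma kill_derive x w : U x ->
  'D_w (jac X) x *m G x + G x *m ('D_w (jac X) x)^T = - jetT x w.
Proof.
move=> Ux; have dG := km_diff K Ux.
have dB : differentiable (jac X) x by exact: Cn_diff (Cn_jac oU (cX 1)) Ux.
have dBG : differentiable (fun y => jac X y *m G y) x by exact: diff_mulmx.
have dGB : differentiable (fun y => G y *m (jac X y)^T) x.
  by apply: diff_mulmx => //; exact: diff_trmx.
have n0 : \forall y \near x, - (jac X y *m G y + G y *m (jac X y)^T) = 'D_(X y) G y.
  apply: (near_open oU Ux) => y Uy; apply/eqP; rewrite eq_sym -addr_eq0 addrA.
  by apply/eqP; exact: kl.
rewrite /jetT -(near_eq_derive w n0).
have dS : differentiable (fun y => jac X y *m G y + G y *m (jac X y)^T) x.
  exact: differentiableD.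
rewrite (deriveN (diff_derivable dS)) (deriveD (diff_derivable dBG) (diff_derivable dGB)).
rewrite (derive_mulmx w dB dG) (derive_mulmx w dG (diff_trmx dB)) (derive_trmx w dB).
move: ('D_w (jac X) x) ('D_w G x) => B' G'.
by apply/matrixP => i j; rewrite !mxE; ring.
Qed.

(** [jetT] is linear in [X] and [jac X], with coefficients that are first and second derivatives of
    [G] and so bounded near [x]. *)
Lemma jetT_bound x : U x -> exists2 C : R, 0 <= C & \forall y \near x,
  forall i, `|jetT y (delta_mx 0 i)| <= C * (`|X y| + `|jac X y|).
Proof.
move=> Ux; set m := (n + n)%N.
have cG1 i : {for x, continuous ('D_(delta_mx 0 i) G)}.
  by apply: differentiable_continuous; exact: Cn_diff (CnD _ (km_cn K 1)) Ux.
have cG2 i j : {for x, continuous ('D_(delta_mx 0 i) ('D_(delta_mx 0 j) G))}.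
  by apply: differentiable_continuous; exact: Cn_diff (CnD _ (CnD _ (km_cn K 2))) Ux.
pose C1 := \sum_(i < m) (`|'D_(delta_mx 0 i) G x| + 1).
pose C2 := \sum_(i < m) \sum_(j < m) (`|'D_(delta_mx 0 i) ('D_(delta_mx 0 j) G) x| + 1).
have p1 i : 0 <= `|'D_(delta_mx 0 i) G x| + 1 by rewrite addr_ge0.
have p2 i j : 0 <= `|'D_(delta_mx 0 i) ('D_(delta_mx 0 j) G) x| + 1 by rewrite addr_ge0.
have C10 : 0 <= C1 by apply: sumr_ge0.
have C20 : 0 <= C2 by apply: sumr_ge0 => i _; apply: sumr_ge0.
exists (m%:R * C2 + (3 * m%:R) * C1 ); first by rewrite addr_ge0 // !mulr_ge0.
have b1 : \forall y \near x, forall i : 'I_m, `|'D_(delta_mx 0 i) G y| <= C1.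
  apply: (@filter_forall _ 'I_m (fun i y => `|'D_(delta_mx 0 i) G y| <= C1) (nbhs x) (nbhs_filter x)) => i.
  apply: filterS (loc_bounded (cG1 i)) => y /le_trans; apply.
  by rewrite /C1 (bigD1 i) //= lerDl; apply: sumr_ge0.
have b2 : \forall y \near x, forall i : 'I_m, forall j : 'I_m, `|'D_(delta_mx 0 i) ('D_(delta_mx 0 j) G) y| <= C2.
  apply: (@filter_forall _ 'I_m (fun i y => forall j : 'I_m, `|'D_(delta_mx 0 i) ('D_(delta_mx 0 j) G) y| <= C2) (nbhs x) (nbhs_filter x)) => i.
  apply: (@filter_forall _ 'I_m (fun j y => `|'D_(delta_mx 0 i) ('D_(delta_mx 0 j) G) y| <= C2) (nbhs x) (nbhs_filter x)) => j.
  apply: filterS (loc_bounded (cG2 i j)) => y /le_trans; apply.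
  exact: (@sum2_ge m (fun i j => `|'D_(delta_mx 0 i) ('D_(delta_mx 0 j) G) x| + 1)).
have nU : \forall y \near x, U y by exact: open_nbhs_nbhs.
apply: filterS3 nU b1 b2 => y Uy b1 b2 i.
have dX := Cn_diff (cX 0) Uy; have dG := km_diff K Uy.
have dGj j : differentiable ('D_(delta_mx 0 j) G) y by exact: Cn_diff (CnD _ (km_cn K 1)) Uy.
have e1 : 'D_(delta_mx 0 i) (fun z => 'D_(X z) G z) y =
   \sum_j ('D_(delta_mx 0 i) X y 0 j *: 'D_(delta_mx 0 j) G y + X y 0 j *: 'D_(delta_mx 0 i) ('D_(delta_mx 0 j) G) y).
  have nE : \forall z \near y, \sum_j X z 0 j *: 'D_(delta_mx 0 j) G z = 'D_(X z) G z.
    apply: (near_open oU Uy) => z Uz; rewrite derive_row_sum //; exact: (km_diff K Uz).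
  rewrite -(near_eq_derive _ nE).
  have dXj j : differentiable (fun z => X z 0 j) y by have /diff_mxP := dX; apply.
  have dj j := (diff_scale (dXj j) (dGj j)).1.
  have -> : (fun z => \sum_j X z 0 j *: 'D_(delta_mx 0 j) G z) =
     \sum_j (fun z => X z 0 j *: 'D_(delta_mx 0 j) G z).
    by apply/funext => z; rewrite fct_sumE.
  rewrite derive_sum => [|j]; last exact: diff_derivable.
  by apply: eq_bigr => j _; rewrite (diff_scale (dXj j) (dGj j)).2 derive_mxE.
rewrite /jetT e1; set x1 := `|X y|; set x2 := `|jac X y|.
have x10 : 0 <= x1 by exact: normr_ge0.
have x20 : 0 <= x2 by exact: normr_ge0.
apply: (@le_trans _ _ (m%:R * (x2 * C1 + x1 * C2) + m%:R * x2 * C1 + m%:R * C1 * x2)); last first.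
  by apply: jet_arith; rewrite !mulr_ge0.
apply: le_trans (ler_normD _ _) _; apply: lerD; last first.
  apply: le_trans (norm_mulmx _ _) _; apply: ler_pM; rewrite ?mulr_ge0 ?norm_trmx //.
  by rewrite ler_wpM2l.
apply: le_trans (ler_normD _ _) _; apply: lerD; last first.
  by apply: le_trans (norm_mulmx _ _) _; rewrite ler_wpM2l ?mulr_ge0.
apply: le_trans (ler_norm_sum _ _ _) _.
apply: (@le_trans _ _ (\sum_(j < m) (x2 * C1 + x1 * C2))); last first.
  by rewrite sumr_const card_ord -[leLHS]mulr_natl.
apply: ler_sum => j _; apply: le_trans (ler_normD _ _) _; rewrite !normrZ.
apply: lerD; apply: ler_pM => //; last exact: mx_norm_ge.
by have := mx_norm_ge (jac X y) i j; rewrite mxE.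
Qed.

Lemma jet_bound x : U x -> exists2 C : R, 0 <= C & \forall y \near x,
  forall i, `|'D_(delta_mx 0 i) (jac X) y| <= C * (`|X y| + `|jac X y|).
Proof.
move=> Ux; set m := (n + n)%N; have [C C0 hC] := jetT_bound Ux.
have cI : {for x, continuous (fun y => invmx (G y))}.
  apply: differentiable_continuous.
  by apply: Cn_diff (Cn_invmx oU _ (km_cn K 0)) Ux; exact: km_unit.
exists (m%:R * (2 * C) * (`|invmx (G x)| + 1)); first by rewrite !mulr_ge0 ?addr_ge0.
have nU : \forall y \near x, U y by exact: open_nbhs_nbhs.
apply: filterS3 nU hC (loc_bounded cI) => y Uy h1 h2 i.
set S := `|X y| + `|jac X y| in h1 *.
have S0 : 0 <= S by rewrite addr_ge0.
(* [Kf a b c] is the second derivative of the field in the directions [a], [b], paired with the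
   basis vector [c]. It is symmetric in [a], [b], and [kill_derive] gives its symmetrisation in [b],
   [c], so [christoffel] applies. *)
pose T a b c := - (jetT y (delta_mx 0 a)) b c.
pose Kf a b c := ('D_(delta_mx 0 a) (jac X) y *m G y) b c.
have Kb a b c : `|Kf a b c| <= 2 * C * S.
  have sK p q r : Kf p q r = Kf q p r.
    have := derive_jac_sym (delta_mx 0 q) (delta_mx 0 p) oU Uy (cX 1).
    move/(congr1 (fun w => (w *m G y) 0 r)) => h.
    exact: (etrans (esym (delta_mulmx2 _ _ _ _)) (etrans h (delta_mulmx2 _ _ _ _))).
  have hK p q r : Kf p q r + Kf p r q = T p q r.
    have := kill_derive (delta_mx 0 p) Uy => /matrixP/(_ q r).
    rewrite /T [LHS]mxE [RHS]mxE => <-; congr (_ + _).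
    have -> : G y *m ('D_(delta_mx 0 p) (jac X) y)^T = ('D_(delta_mx 0 p) (jac X) y *m G y)^T.
      by rewrite trmx_mul (km_sym K Uy).
    by rewrite /Kf [RHS]mxE.
  have e := christoffel sK hK a b c.
  have Tb p q r : `|T p q r| <= C * S.
    by rewrite /T normrN; apply: le_trans (mx_norm_ge _ _ _) (h1 p).
  have : `|2 * Kf a b c| <= C * S + C * S + C * S.
    rewrite e; apply: le_trans (ler_normB _ _) _; apply: lerD => //.
    by apply: le_trans (ler_normD _ _) _; exact: lerD.
  have CS : 0 <= C * S by rewrite mulr_ge0.
  by rewrite normrM ger0_norm // -mulrA; move: (`|_|) (C * S) CS => p q *; lra.
have -> : 'D_(delta_mx 0 i) (jac X) y = ('D_(delta_mx 0 i) (jac X) y *m G y) *m invmx (G y).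
  by rewrite mulmxK // (km_unit K).
apply: le_trans (norm_mulmx _ _) _.
have KN : `|'D_(delta_mx 0 i) (jac X) y *m G y| <= 2 * C * S.
  by apply: mx_norm_le => [|b c]; [rewrite !mulr_ge0|exact: Kb].
apply: (@le_trans _ _ (m%:R * (2 * C * S) * (`|invmx (G x)| + 1))).
  by apply: ler_pM => //; rewrite ler_wpM2l.
by rewrite le_eqVlt; apply/orP; left; apply/eqP; ring.
Qed.

(** On segments issuing from [x] the 1-jet, written as one row [u], satisfies [|u'| <= KK * |u|] by
    [jet_bound] and starts at 0. *)
Lemma killing_jet x : U x -> X x = 0 -> jac X x = 0 -> \forall y \near x, X y = 0.
Proof.
move=> Ux X0 B0; set m := (n + n)%N; have [C C0 hC] := jet_bound Ux.
have /nbhs_ballP[r /= r0 hr] : \forall y \near x, U y /\ forall i, `|'D_(delta_mx 0 i) (jac X) y| <= C * (`|X y| + `|jac X y|).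
  by apply: filterI => //; exact: open_nbhs_nbhs.
apply/nbhs_ballP; exists r => //= y; rewrite -ball_normE /= => yr.
pose h := y - x.
have line (s : R) : 0 <= s <= 1 -> ball x r (s *: h + x).
  move=> /andP[s0 s1]; rewrite -ball_normE /= opprD addrC subrK normrN normrZ ger0_norm //.
  by apply: le_lt_trans yr; rewrite distrC -[leRHS]mul1r ler_wpM2r.
pose u (s : R) := row_mx (X (s *: h + x)) (mxvec (jac X (s *: h + x))).
pose du (s : R) := row_mx (h *m jac X (s *: h + x)) (mxvec ('D_h (jac X) (s *: h + x))).
set KK := m%:R * `|h| + m%:R * (2 * C) * `|h|.
have KK0 : 0 <= KK by rewrite addr_ge0 // !mulr_ge0.
have [g g0 hg] := @gronwall R (m + m * m)%N KK 1 KK0 ler01.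
have norm_vec (A : 'M[R]_m) c : 0 <= c -> `|A| <= c -> `|mxvec A| <= c.
  move=> c0 Ac; apply: mx_norm_le => // i j; rewrite ord1.
  by case/mxvec_indexP: j => a b; rewrite mxvecE; apply: le_trans (mx_norm_ge _ _ _) Ac.
have uX s : `|X (s *: h + x)| <= `|u s|.
  by apply: mx_norm_le => // i j; rewrite ord1 -(row_mxEl (X _) (mxvec (jac X (s *: h + x)))) mx_norm_ge.
have uB s : `|jac X (s *: h + x)| <= `|u s|.
  apply: mx_norm_le => // i j; rewrite -mxvecE -(row_mxEr (X (s *: h + x))).
  exact: mx_norm_ge.
have u0 : u 0 = 0 by rewrite /u scale0r add0r X0 B0 linear0 row_mx0.
have := hg u du 0 1; rewrite u0 normr0 addr0 mulr0 normr_le0 => H.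
have /eqP : u 1 == 0.
  apply: H => //; first by rewrite ler01 lexx.
    move=> s s01; have [Us _] := hr _ (line s s01).
    have dX := Cn_diff (cX 0) Us; have dB := Cn_diff (Cn_jac oU (cX 1)) Us.
    apply: isd_row_mx; first by rewrite -(jacE _ dX); exact: isd_line.
    have /isd_mxP hB := isd_line dB.
    apply/isd_mxP => i j; rewrite ord1; case/mxvec_indexP: j => a b; rewrite mxvecE.
    by apply: isd_ext (hB a b); near=> q; rewrite mxvecE.
  move=> s s01; have [Us hs] := hr _ (line s s01).
  have dB := Cn_diff (Cn_jac oU (cX 1)) Us.
  rewrite addr0 /KK mulrDl.
  have A0 : 0 <= m%:R * `|h| * `|u s| by rewrite !mulr_ge0.
  have A1 : 0 <= m%:R * (2 * C) * `|h| * `|u s| by rewrite !mulr_ge0.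
  apply: mx_norm_le => [|i j]; first by rewrite addr_ge0.
  rewrite ord1; case: (splitP j) => k jk.
    have -> : j = lshift _ k by exact/val_inj.
    rewrite row_mxEl; apply: le_trans (mx_norm_ge _ _ _) _.
    apply: le_trans (norm_mulmx _ _) _; rewrite -[leLHS]addr0; apply: lerD => //.
    by rewrite ler_wpM2l // mulr_ge0.
  have -> : j = rshift _ k by exact/val_inj.
  rewrite row_mxEr; apply: le_trans (mx_norm_ge _ _ _) _.
  rewrite -[leLHS]add0r; apply: lerD => //; apply: norm_vec => //.
  have := @derive_bounded _ _ m (jac X) _ (C * (`|X (s *: h + x)| + `|jac X (s *: h + x)|)) h dB hs.
  move/le_trans; apply; rewrite [leRHS]mulrAC ler_wpM2r // -mulrA ler_wpM2l //.
  rewrite [2 * C]mulrC -mulrA ler_wpM2l // mulr_natl mulr2n; exact: lerD.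
move/(congr1 lsubmx); rewrite /u row_mxKl linear0 scale1r /h subrK; by [].
Unshelve. all: by end_near. Qed.

End jet.
End KillingJet.

(** * From charts to the manifold: isometries and Kähler functions *)

Section Manifold.
Context {R : realType} {n : nat} {N : topologicalType}.
Variables (M : complexManifold R n N) (g : kahlerMetric M).
Local Notation E := 'rV[R]_(n + n).
Local Notation I := (@MI R n).
Local Notation dom := (@chart_dom R n N M).
Local Notation ch := (@chart R n N M).
Local Notation inv := (@chart_inv R n N M).
Local Notation img := (@chart_img R n N M).

Lemma img_open i : open (img i). Proof. exact: chart_img_open. Qed.

Lemma img_ch i p : dom i p -> img i (ch i p). Proof. by exists p. Qed.

Lemma inv_dom i x : img i x -> dom i (inv i x).
Proof. by move=> [p pi <-]; rewrite chartK. Qed.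

Lemma invK i x : img i x -> ch i (inv i x) = x.
Proof. by move=> [p pi <-]; rewrite chartK. Qed.

Lemma near_inv i p (P : N -> Prop) : dom i p -> (\forall q \near p, P q) ->
  \forall y \near ch i p, P (inv i y).
Proof.
move=> pi hP; have := @chart_inv_continuous _ _ _ M i p pi.
by rewrite /prop_for /continuous_at chartK //; apply.
Qed.

Lemma near_dom i p : dom i p -> \forall q \near p, dom i q.
Proof. by move=> pi; apply: open_nbhs_nbhs; split=> //; exact: chart_dom_open. Qed.

Lemma near_img i p : dom i p -> \forall y \near ch i p, img i y.
Proof.
by move=> pi; apply: open_nbhs_nbhs; split; [exact: img_open|exact: img_ch].
Qed.

Lemma hiso_comp_at (g1 g2 g3 : E -> 'M[R]_(n + n)) L L' x z : L x = z ->
  hiso g1 g2 L x -> hiso g2 g3 L' z -> hiso g1 g3 (fun y => L' (L y)) x.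
Proof. by move=> <-; exact: hiso_comp. Qed.

Lemma local_repE phi i j p : dom i p -> local_rep phi i j (ch i p) = ch j (phi p).
Proof. by move=> pi; rewrite /local_rep /= chartK. Qed.

Lemma near_ch i p (P : E -> Prop) : dom i p -> (\forall y \near ch i p, P y) ->
  \forall q \near p, P (ch i q).
Proof. by move=> pi; apply: (@chart_continuous _ _ _ M i p pi). Qed.

Lemma diff_jac m1 m2 (F : 'rV[R]_m1 -> 'rV[R]_m2) x u : differentiable F x -> 'd F x u = u *m jac F x.
Proof. by move=> dF; rewrite -(derive_dE _ dF) jacE. Qed.

Lemma kmetric_chart i : kmetric (img i) (g i).
Proof.
have sg := @metric_smooth _ _ _ _ g i.
have dg x : img i x -> differentiable (g i) x by move=> ix; exact: smooth_on_diff sg ix.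
constructor => //; first exact: img_open.
- move=> x ix; apply: mxform_inj => u v; rewrite mxform_tr.
  exact: (@metric_sym _ _ _ _ g i x ix).
- by move=> x ix u; exact: (@metric_pos _ _ _ _ g i x ix).
- move=> x ix; have h : I *m g i x *m I^T = g i x.
    apply: mxform_inj => u v; rewrite -mxform_mul -!mulIE.
    exact: (@metric_hermitian _ _ _ _ g i x ix).
  by rewrite -[in RHS]h MIT !mulmxN mulNmx -[_ *m I *m I]mulmxA MI2 mulmxN mulmx1 opprK.
move=> x ix u v w.
have e a b c : 'd (fun y => kform g i y a b) x c = mxform (I *m 'D_c (g i) x) a b.
  have [d1 d2] := differentiable_mxform (mulI a) b (dg x ix).
  by rewrite -(derive_dE _ d1) d2 mulIE mxform_mull.
exact: (etrans (esym (f_equal2 +%R (f_equal2 +%R (e v w u) (e w u v)) (e u v w)))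
  (@kform_closed _ _ _ _ g i x ix u v w)).
Qed.

Lemma hisoP (gi gj : E -> 'M[R]_(n + n)) (L : E -> E) (Q : set E) : open Q -> smooth_on Q L ->
  (forall y, Q y -> forall u, 'd L y (mulI u) = mulI ('d L y u)) ->
  (forall y, Q y -> forall u v, mxform (gj (L y)) ('d L y u) ('d L y v) = mxform (gi y) u v) ->
  forall x, Q x -> hiso gi gj L x.
Proof.
move=> oQ sL h1 h2 x Qx; exists Q; split=> // y Qy.
have dL := smooth_on_diff sL Qy; split.
  apply/row_matrixP => a; rewrite !rowE; have := h1 y Qy (delta_mx 0 a).
  by rewrite !diff_jac // !mulIE !mulmxA => ->.
apply: mxform_inj => u v; rewrite -mxform_mul; have := h2 y Qy u v.
by rewrite !diff_jac.
Qed.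

Lemma hiso_at (gi gj : E -> 'M[R]_(n + n)) (L : E -> E) y : hiso gi gj L y ->
  [/\ forall s, differentiable (iter_derive s L) y,
   forall u, 'd L y (mulI u) = mulI ('d L y u) &
   forall u v, mxform (gj (L y)) ('d L y u) ('d L y v) = mxform (gi y) u v].
Proof.
move=> [Q [oQ Qy sL h]]; have [h1 h2] := h y Qy; have dL := smooth_on_diff sL Qy.
split; first by move=> s; exact: sL.
- by move=> u; rewrite !diff_jac // !mulIE -!mulmxA h1.
- by move=> u v; rewrite !diff_jac // mxform_mul h2.
Qed.

Lemma local_dom_open i j (phi : N -> N) : continuous phi ->
  open (ch i @` (dom i `&` phi @^-1` dom j)).
Proof.
move=> cphi; rewrite openE => _ [p [pi pj] <-].
have n1 : \forall q \near p, dom j (phi q).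
  by apply: cphi; apply: near_dom.
apply: filterS2 (near_inv pi n1) (near_img pi) => y h1 h2; exists (inv i y); last exact: invK.
by split=> //; exact: inv_dom.
Qed.

Lemma transition_hiso i j p : dom i p -> dom j p ->
  hiso (g i) (g j) (fun x => ch j (inv i x)) (ch i p).
Proof.
move=> pi pj.
have oQ : open (ch i @` (dom i `&` dom j)).
  by apply: (@local_dom_open i j idfun) => q; apply: cvg_id.
have [sm hol] := @transition_holomorphic _ _ _ M i j.
apply: (hisoP oQ sm hol); last by exists p.
move=> _ [q [qi qj] <-] u v.
have := @metric_coherent _ _ _ _ g i j q qi qj u v; rewrite /= chartK //.
Qed.

(** One pair of charts suffices, since transition maps are holomorphic isometries. Continuity keeps
    points near [p] inside the second chart, as the change of charts in [hisoN_all] requires. *)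
Definition hisoN (phi : N -> N) (p : N) : Prop := {for p, continuous phi} /\
  exists i j, [/\ dom i p, dom j (phi p) &
    hiso (g i) (g j) (local_rep phi i j) (ch i p)].

Lemma hisoN_all phi p i j : hisoN phi p -> dom i p -> dom j (phi p) ->
  hiso (g i) (g j) (local_rep phi i j) (ch i p).
Proof.
move=> [cphi [i0 [j0 [pi0 pj0 h]]]] pi pj.
have h1 := transition_hiso pi pi0.
have h2 := transition_hiso pj0 pj.
have h12 : hiso (g i) (g j0) (fun x => local_rep phi i0 j0 (ch i0 (inv i x))) (ch i p).
  by apply: (hiso_comp_at _ h1 h); rewrite chartK.
have lE : local_rep phi i0 j0 (ch i0 (inv i (ch i p))) = ch j0 (phi p).
  by rewrite chartK // local_repE.
have H := @hiso_comp_at _ _ _ (fun x => local_rep phi i0 j0 (ch i0 (inv i x))) _ _ _ lE h12 h2; apply: (hiso_ext _ H).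
have n0 : \forall q \near p, dom j0 (phi q) by apply: cphi; exact: near_dom.
apply: filterS (near_inv pi (filterI (near_dom pi0) n0)) => y [y1 y2].
by rewrite local_repE // chartK.
Qed.

Definition autp (phi psi : N -> N) : Prop :=
  [/\ cancel phi psi, cancel psi phi, forall p, hisoN phi p & forall p, hisoN psi p].

Lemma hisoN_holomorphic phi : (forall p, hisoN phi p) -> preserves g phi /\ holomorphic M phi.
Proof.
move=> h; have c : continuous phi by move=> p; case: (h p).
split=> [i j p pi pj /= u v|].
  have [_ _ h3] := hiso_at (hisoN_all (h p) pi pj).
  by have := h3 u v; rewrite /local_rep /= chartK.
split=> // i j; split.
  by move=> s _ [p [pi pj] <-]; have [] := hiso_at (hisoN_all (h p) pi pj).
by move=> _ [p [pi pj] <-] u; have [] := hiso_at (hisoN_all (h p) pi pj).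
Qed.

Lemma autp_Aut phi psi : autp phi psi -> Aut g phi.
Proof.
move=> [c1 c2 h1 h2]; have [p1 p2] := hisoN_holomorphic h1; have [_ q2] := hisoN_holomorphic h2.
by split=> //; split=> //; exists psi.
Qed.

(** [Aut] says of the inverse only that it is holomorphic; that it is isometric follows because its
    Jacobian is inverse to that of [phi]. *)
Lemma Aut_autp phi : Aut g phi -> exists psi, autp phi psi.
Proof.
move=> [pr [[cphi hphi] [psi [c1 c2 [cpsi hpsi]]]]]; exists psi.
have h1 p : hisoN phi p.
  split; first exact: cphi.
  have [i pi] := chart_cover M p; have [j pj] := chart_cover M (phi p).
  exists i, j; split=> //; have [sm hol] := hphi i j.
  apply: (hisoP (local_dom_open cphi) sm hol); last by exists p.
  move=> _ [q [qi qj] <-] u v; have := pr i j q qi qj u v.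
  by rewrite /local_rep /= chartK.
split; [exact: c1|exact: c2|exact: h1|move=> p; split; first exact: cpsi].
have [i pi] := chart_cover M p; have [j pj] := chart_cover M (psi p).
exists i, j; split=> //; have [sm hol] := hpsi i j.
have oQ := @local_dom_open i j _ cpsi.
apply: (hisoP oQ sm hol); last by exists p.
move=> _ [q [qi qj] <-] u v.
have Qq : (ch i @` (dom i `&` psi @^-1` dom j)) (ch i q) by exists q.
have pq : dom i (phi (psi q)) by rewrite c2.
have h := hisoN_all (h1 (psi q)) qj pq.
have [Q [oQ' Qx sL /(_ _ Qx)[_ e2]]] := h.
have d1 := smooth_on_diff sm Qq; have d2 := smooth_on_diff sL Qx.
have e : jac (local_rep psi i j) (ch i q) *m jac (local_rep phi j i) (ch j (psi q)) = 1%:M.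
  have lq : local_rep psi i j (ch i q) = ch j (psi q) by rewrite /local_rep /= chartK.
  rewrite -lq in d2 *; rewrite -(jac_comp d1 d2); apply: jac_eq.
    exact: (@differentiable_comp _ _ _ _ (local_rep psi i j) (local_rep phi j i)).
  move=> w; rewrite mulmx1.
  have : \forall y \near ch i q, local_rep phi j i (local_rep psi i j y) = y.
    have n1 : \forall r \near q, dom j (psi r) by apply: cpsi; exact: near_dom.
    apply: filterS2 (near_inv qi n1) (near_img qi) => y y1 y2.
    by rewrite /local_rep /= chartK // c2 invK.
  by move/(near_eq_derive w) => ->; rewrite derive_id.
have lq2 : local_rep phi j i (ch j (psi q)) = ch i q by rewrite /local_rep /= chartK // c2.
rewrite lq2 in e2.
rewrite !diff_jac // mxform_mul /local_rep /= chartK // -/(local_rep psi i j) -e2.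
rewrite !mulmxA; set A := jac (local_rep psi i j) _ in e *; set B := jac _ _ in e *.
by rewrite e mul1mx -mulmxA -trmx_mul e trmx1 mulmx1.
Qed.

Lemma autpV phi psi : autp phi psi -> autp psi phi.
Proof. by case. Qed.

Lemma hisoN_comp phi psi p : hisoN psi p -> hisoN phi (psi p) -> hisoN (phi \o psi) p.
Proof.
move=> h1 h2; have [c1 _] := h1; have [c2 _] := h2.
split; first exact: continuous_comp.
have [i pi] := chart_cover M p; have [j pj] := chart_cover M (psi p).
have [k pk] := chart_cover M (phi (psi p)).
exists i, k; split=> //; have h3 := hisoN_all h1 pi pj; have h4 := hisoN_all h2 pj pk.
have H := hiso_comp_at (local_repE psi j pi) h3 h4; apply: (hiso_ext _ H).
have n1 : \forall r \near p, dom j (psi r) by apply: c1; exact: near_dom.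
by apply: filterS (near_inv pi n1) => y y1; rewrite /local_rep /= chartK.
Qed.

Lemma autp_comp f1 i1 f2 i2 : autp f1 i1 -> autp f2 i2 -> autp (f1 \o f2) (i2 \o i1).
Proof.
move=> [a b c d] [a' b' c' d']; split.
- by move=> p /=; rewrite a a'.
- by move=> p /=; rewrite b' b.
- by move=> p; apply: hisoN_comp.
- by move=> p; apply: hisoN_comp.
Qed.

Lemma hisoN_id p : hisoN idfun p.
Proof.
split; first exact: cvg_id.
have [i pi] := chart_cover M p; exists i, i; split=> //.
exact: transition_hiso.
Qed.

Lemma autp_id : autp idfun idfun. Proof. by split=> // p; exact: hisoN_id. Qed.

Definition HX (f : N -> R) (i : chart_index M) : E -> E := ham (g i) (f \o inv i).

(** [kahler_fun] in matrix form. [hamiltonian_vfield] is chosen point by point, whereas [HX] is a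
    formula that can be differentiated. *)
Definition kah (f : N -> R) : Prop := smooth_fun M f /\
  forall i x, img i x -> killm (g i) (HX f i) x.

Lemma hamiltonian_HX f i x : img i x -> differentiable (f \o inv i) x ->
  hamiltonian_vfield g f i x = HX f i x.
Proof.
move=> ix df; have K := kmetric_chart i.
have ex : [set X | forall v, kform g i x X v = 'd (f \o inv i) x v] (HX f i x).
  by move=> v; rewrite /kform mulIE mxform_mull (ham_derive K) // derive_dE.
rewrite /hamiltonian_vfield; case: xgetP => [X _ hX|/(_ _ ex)//].
apply: (ham_uniq K ix); apply/rowP => j; rewrite [RHS]mxE derive_dE // -hX /kform mulIE.
by rewrite /mxform trmx_delta -colE [RHS]mxE.
Qed.

Lemma smooth_cn (f : N -> R) i k : smooth_fun M f -> Cn k (img i) (f \o inv i).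
Proof. by move=> /(_ i)/smooth_onP; apply. Qed.

Lemma HX_cn f i k : smooth_fun M f -> Cn k (img i) (HX f i).
Proof. by move=> sf; apply: (Cn_ham (kmetric_chart i)); exact: smooth_cn. Qed.

Lemma kahP f : kahler_fun g f <-> kah f.
Proof.
suff key : smooth_fun M f -> killing g (hamiltonian_vfield g f) <->
    forall i x, img i x -> killm (g i) (HX f i) x.
  by split=> -[sf h]; split=> //; apply/key.
move=> sf.
have e i x : img i x -> hamiltonian_vfield g f i x = HX f i x.
  by move=> ix; apply: hamiltonian_HX => //; exact: Cn_diff (smooth_cn i 0 sf) ix.
have ed i x : img i x -> differentiable (hamiltonian_vfield g f i) x /\
    forall u, 'd (hamiltonian_vfield g f i) x u = u *m jac (HX f i) x.
  move=> ix; have dX := Cn_diff (HX_cn i 0 sf) ix.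
  have nE : \forall y \near x, HX f i y = hamiltonian_vfield g f i y.
    by apply: filterS (open_nbhs_nbhs (conj (@img_open i) ix)) => y iy; rewrite e.
  have [d1 d2] := near_eq_diff nE dX.
  by split; [exact: d1|move=> u; exact: (etrans (congr1 (@^~ u) d2) (diff_jac u dX))].
have main i x : img i x -> (forall u v,
    'd (fun y => mxform (g i y) u v) x (hamiltonian_vfield g f i x) +
    mxform (g i x) ('d (hamiltonian_vfield g f i) x u) v +
    mxform (g i x) u ('d (hamiltonian_vfield g f i) x v) = 0) <-> killm (g i) (HX f i) x.
  move=> ix; have [d1 d2] := ed i x ix; have dg := km_diff (kmetric_chart i) ix.
  have E' u v : 'd (fun y => mxform (g i y) u v) x (hamiltonian_vfield g f i x) +
    mxform (g i x) ('d (hamiltonian_vfield g f i) x u) v +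
    mxform (g i x) u ('d (hamiltonian_vfield g f i) x v) =
    mxform ('D_(HX f i x) (g i) x + jac (HX f i) x *m g i x + g i x *m (jac (HX f i) x)^T) u v.
    have [d3 d4] := differentiable_mxform u v dg.
    rewrite -(derive_dE _ d3) d4 e // !d2 2!mxformD.
    by congr (_ + _ + _); [rewrite mxform_mull|rewrite mxform_mulr].
  split=> h; first by apply: mxform_inj => u v; rewrite mxform0 -E'.
  by move=> u v; rewrite E'; have -> := h; rewrite mxform0.
by split=> h i x ix; apply/main => //; exact: h.
Qed.

End Manifold.

(** * Kähler functions form a vector space, stable under holomorphic isometries *)

Section Pullback.
Context {R : realType} {n : nat} {N : topologicalType}.
Variables (M : complexManifold R n N) (g : kahlerMetric M).
Local Notation E := 'rV[R]_(n + n).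
Local Notation dom := (@chart_dom R n N M).
Local Notation ch := (@chart R n N M).
Local Notation inv := (@chart_inv R n N M).
Local Notation img := (@chart_img R n N M).
Implicit Types (f : N -> R) (phi : N -> N).

Lemma smooth_fun_diff f i p : smooth_fun M f -> dom i p -> differentiable (f \o inv i) (ch i p).
Proof. by move=> sf pi; exact: Cn_diff (smooth_cn i 0 sf) (img_ch pi). Qed.

Lemma near_local phi i j f p : {for p, continuous phi} -> dom i p -> dom j (phi p) ->
  \forall y \near ch i p, (f \o inv j) (local_rep phi i j y) = ((f \o phi) \o inv i) y.
Proof.
move=> c pi pj; have n1 : \forall r \near p, dom j (phi r) by apply: c; exact: near_dom.
by apply: filterS (near_inv pi n1) => y y1; rewrite /local_rep /= chartK.
Qed.

Lemma HX_push phi p i j f : hisoN g phi p -> smooth_fun M f -> dom i p -> dom j (phi p) ->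
  HX g (f \o phi) i (ch i p) *m jac (local_rep phi i j) (ch i p) = HX g f j (ch j (phi p)).
Proof.
move=> h sf pi pj; have hi := hisoN_all h pi pj; have lE := local_repE phi j pi.
rewrite /HX -(ham_ext _ (near_local f h.1 pi pj)) -lE.
apply: (hiso_ham (kmetric_chart g i) (kmetric_chart g j) (img_ch pi) _ hi).
  by rewrite lE; exact: img_ch.
by rewrite lE; exact: smooth_fun_diff.
Qed.

Lemma smooth_pullback phi f : (forall p, hisoN g phi p) -> smooth_fun M f -> smooth_fun M (f \o phi).
Proof.
move=> h sf i s _ [p pi <-]; have [j pj] := chart_cover M (phi p).
have [Q [oQ Qp sL _]] := hisoN_all (h p) pi pj.
have oP := open_preim oQ (img_open (M := M) (i := j)) sL.
have n1 := near_local f (h p).1 pi pj.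
have /nbhs_ballP[r /= r0 hr] := n1.
pose P := (Q `&` local_rep phi i j @^-1` img j) `&` ball (ch i p) r.
have oP2 : open P by apply: openI => //; exact: ball_open.
have sm : smooth_on P ((f \o phi) \o inv i).
  apply: (smooth_on_ext oP2 _ (smooth_on_comp (Q := img j) oP2 _ (smooth_on_sub _ sL) (sf j))).
  - by move=> y [_ /hr].
  - by move=> y [[]].
  - by move=> y [[]].
apply: sm; split; last exact: ballxx.
by split=> //; rewrite /= local_repE //; exact: img_ch.
Qed.

Lemma kah_pullback phi f : (forall p, hisoN g phi p) -> kah g f -> kah g (f \o phi).
Proof.
move=> h [sf kf]; split; first exact: smooth_pullback.
move=> i _ [p pi <-]; have [j pj] := chart_cover M (phi p).
have hi := hisoN_all (h p) pi pj; have lE := local_repE phi j pi.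
have := hiso_kill (kmetric_chart g i) (kmetric_chart g j) (img_ch pi) _ hi (sf j) _.
rewrite lE => /(_ (img_ch pj) (kf j _ (img_ch pj))); rewrite /killm /HX.
have n2 : \forall y \near ch i p, ham (g i) (fun y => (f \o inv j) (local_rep phi i j y)) y =
    ham (g i) ((f \o phi) \o inv i) y.
  have /nbhs_ballP[r /= r0 hr] := near_local f (h p).1 pi pj.
  apply/nbhs_ballP; exists r => //= y yr; apply: ham_ext.
  by apply: (near_open _ yr hr); exact: ball_open.
by rewrite (near_eq_jac n2) (nbhs_singleton n2).
Qed.

Lemma jac_lin (a : R) (F H : E -> E) x : differentiable F x -> differentiable H x ->
  jac (fun y => a *: F y + H y) x = a *: jac F x + jac H x.
Proof.
move=> dF dH; have dZ : differentiable (fun y => a *: F y) x by exact: differentiableZ.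
apply: jac_eq; first exact: (differentiableD dZ dH).
move=> u; have e := deriveD (diff_derivable (v := u) dZ) (diff_derivable (v := u) dH).
apply: (etrans e); rewrite (deriveZ a (diff_derivable dF)) (jacE _ dF) (jacE _ dH).
by rewrite mulmxDr -scalemxAr.
Qed.

Lemma killm_lin (a : R) (G : E -> 'M[R]_(n + n)) (F H : E -> E) x : differentiable G x ->
  differentiable F x -> differentiable H x -> killm G F x -> killm G H x ->
  killm G (fun y => a *: F y + H y) x.
Proof.
rewrite /killm => dG dF dH e1 e2; rewrite jac_lin // deriveDr //.
have -> : (a *: jac F x + jac H x)^T = a *: (jac F x)^T + (jac H x)^T.
  by rewrite linearD linearZ.
rewrite !mulmxDl !mulmxDr -!scalemxAl -!scalemxAr.
move: e1 e2; move: ('D_ _ _ _) (_ *m G x) (G x *m _) => A1 A2 A3 e1.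
move: ('D_ _ _ _) (_ *m G x) (G x *m _) => B1 B2 B3 e2.
transitivity (a *: (A1 + A2 + A3) + (B1 + B2 + B3)).
  by rewrite !scalerDr; apply/matrixP => b c; rewrite !mxE; ring.
by rewrite e1 e2 scaler0 addr0.
Qed.

Lemma killm_ext (G : E -> 'M[R]_(n + n)) (F H : E -> E) x :
  (\forall y \near x, F y = H y) -> killm G F x -> killm G H x.
Proof. by move=> ne; rewrite /killm -(near_eq_jac ne) -(nbhs_singleton ne). Qed.

Lemma HXD (a : R) f h i x : differentiable (f \o inv i) x -> differentiable (h \o inv i) x ->
  HX g (fun p => a * f p + h p) i x = a *: HX g f i x + HX g h i x.
Proof.
move=> df dh; rewrite /HX /ham.
have -> : grad ((fun p => a * f p + h p) \o inv i) x =
    a *: grad (f \o inv i) x + grad (h \o inv i) x.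
  apply/rowP => j; rewrite !mxE.
  have da : differentiable (fun y => a *: (f \o inv i) y) x by exact: differentiableZ.
  have := deriveD (diff_derivable (v := delta_mx 0 j) da) (diff_derivable (v := delta_mx 0 j) dh).
  by rewrite (deriveZ a (diff_derivable df)).
by rewrite !mulmxDl -!scalemxAl opprD scalerN.
Qed.

Lemma kah_lin (a : R) f h : kah g f -> kah g h -> kah g (fun p => a * f p + h p).
Proof.
move=> [sf kf] [sh kh].
have sm : smooth_fun M (fun p => a * f p + h p).
  move=> i; apply/smooth_onP => k; apply: Cn_add; first exact: img_open.
    by apply: Cn_mul; [exact: img_open|exact: Cn_cst|exact: smooth_cn].
  exact: smooth_cn.
split; [exact: sm|move=> i x ix]; have oU := img_open (M := M) (i := i).
have df y : img i y -> differentiable (f \o inv i) y by exact: Cn_diff (smooth_cn i 0 sf).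
have dh y : img i y -> differentiable (h \o inv i) y by exact: Cn_diff (smooth_cn i 0 sh).
have dF := Cn_diff (HX_cn g i 0 sf) ix; have dH := Cn_diff (HX_cn g i 0 sh) ix.
have ne : \forall y \near x, a *: HX g f i y + HX g h i y = HX g (fun p => a * f p + h p) i y.
  by apply: (near_open oU ix) => y iy; rewrite HXD; [|exact: df|exact: dh].
apply: (killm_ext ne); apply: killm_lin dF dH (kf i x ix) (kh i x ix).
exact: (km_diff (kmetric_chart g i) ix).
Qed.

Lemma kah_cst (r : R) : kah g (fun=> r).
Proof.
have HX0 i y : HX g (fun=> r) i y = 0.
  rewrite /HX /ham; have -> : grad ((fun=> r) \o inv i) y = 0.
    by apply/rowP => j; rewrite !mxE; exact: derive_cst.
  by rewrite !mul0mx oppr0.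
have sm : smooth_fun M (fun _ : N => r).
  by move=> i; apply/smooth_onP => k; exact: Cn_cst.
split; [exact: sm|move=> i x ix]; rewrite /killm HX0.
have -> : jac (HX g (fun=> r) i) x = 0.
  apply/matrixP => a b; have -> : HX g (fun=> r) i = (fun=> 0) by apply/funext => y; exact: HX0.
  by rewrite !mxE derive_cst mxE.
rewrite mul0mx trmx0 mulmx0 !addr0 (derive_dE _ (km_diff (kmetric_chart g i) ix)).
exact: linear0.
Qed.

End Pullback.

(** * Integral curves of Hamiltonian fields and their uniqueness *)

Section IntegralCurves.
Context {R : realType} {n : nat} {N : topologicalType}.
Variables (M : complexManifold R n N) (g : kahlerMetric M).
Local Notation dom := (@chart_dom R n N M).
Local Notation ch := (@chart R n N M).
Local Notation inv := (@chart_inv R n N M).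
Local Notation img := (@chart_img R n N M).
Implicit Types (f : N -> R) (phi : N -> N) (c : R -> N).

Definition icv f c (t : R) : Prop := {for t, continuous c} /\
  exists i, dom i (c t) /\ isd (fun s => ch i (c s)) t (HX g f i (ch i (c t))).

(** Besides the transport of integral curves by isometries, the case of the identity gives the
    independence of the chart in [icv_all]. *)
Lemma push_isd phi f c t i j : {for t, continuous c} -> hisoN g phi (c t) -> smooth_fun M f ->
  dom i (c t) -> dom j (phi (c t)) ->
  isd (fun s => ch i (c s)) t (HX g (f \o phi) i (ch i (c t))) ->
  isd (fun s => ch j (phi (c s))) t (HX g f j (ch j (phi (c t)))).
Proof.
move=> cc h sf ci cj hd; have [Q [oQ Qx sL _]] := hisoN_all h ci cj.
have dL := smooth_on_diff sL Qx.
have := isd_comp hd dL; rewrite (jacE _ dL) (HX_push h sf ci cj); apply: isd_ext.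
have n1 : \forall s \near t, dom i (c s) by apply: cc; exact: near_dom.
by apply: filterS n1 => s si; rewrite local_repE.
Qed.

Lemma icv_all f c t j : smooth_fun M f -> icv f c t -> dom j (c t) ->
  isd (fun s => ch j (c s)) t (HX g f j (ch j (c t))).
Proof.
move=> sf [cc [i [ci hd]]] cj.
exact: (push_isd cc (hisoN_id g (c t)) sf ci cj hd).
Qed.

Lemma icv_push phi f c t : hisoN g phi (c t) -> smooth_fun M f ->
  icv (f \o phi) c t -> icv f (fun s => phi (c s)) t.
Proof.
move=> h sf [cc [i [ci hd]]]; split.
  by apply: (@continuous_comp _ _ _ c phi) => //; case: h.
have [j cj] := chart_cover M (phi (c t)); exists j; split=> //.
exact: push_isd hd.
Qed.

Lemma icv_ext f c c' t : (\forall s \near t, c s = c' s) -> icv f c t -> icv f c' t.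
Proof.
move=> ne [cc [i [ci hd]]]; have e0 := nbhs_singleton ne; split.
  move=> A; rewrite -e0 => /cc cA; have : \forall s \near t, A (c s) by exact: cA.
  by apply: filterS2 ne => s es As; rewrite /= -es.
exists i; rewrite -e0; split=> //; apply: isd_ext hd.
by apply: filterS ne => s ->.
Qed.

Lemma HXZ (a : R) f i x : differentiable (f \o inv i) x ->
  HX g (fun p => a * f p) i x = a *: HX g f i x.
Proof.
move=> df; have d0 : differentiable ((fun=> 0 : R) \o inv i) x by exact: differentiable_cst.
have := HXD g a df d0; have -> : (fun p => a * f p + 0) = (fun p => a * f p).
  by apply/funext => p; rewrite addr0.
move=> ->; rewrite -[RHS]addr0; congr (_ + _); rewrite /HX /ham.
have -> : grad ((fun=> 0 : R) \o inv i) x = 0.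
  by apply/rowP => j; rewrite !mxE; exact: derive_cst.
by rewrite !mul0mx oppr0.
Qed.

Lemma icv_affine (a b : R) f c t : smooth_fun M f -> icv f c (a * t + b) ->
  icv (fun p => a * f p) (fun s => c (a * s + b)) t.
Proof.
move=> sf [cc [i [ci hd]]]; split.
  have cab : {for t, continuous (fun s : R => a * s + b)}.
    apply: (@isd_cont _ _ (fun s : R => a * s + b) t a).
    apply: isd_eq (isd_add (isd_mul (isd_cst a t) (isd_id t)) (isd_cst b t)) _.
    by rewrite mul0r add0r mulr1 addr0.
  exact: (@continuous_comp _ _ _ (fun s : R => a * s + b) c).
exists i; split=> //; rewrite HXZ; last exact: smooth_fun_diff.
exact: (isd_rescale hd).
Qed.

Lemma icv_shift (b : R) f c t : smooth_fun M f -> icv f c (t + b) -> icv f (fun s => c (s + b)) t.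
Proof.
move=> sf h; have := @icv_affine 1 b f c t sf; rewrite mul1r => /(_ h).
have -> : (fun p => 1 * f p) = f by apply/funext => p; rewrite mul1r.
by apply: icv_ext; near=> s; rewrite mul1r.
Unshelve. all: by end_near. Qed.

Lemma smooth_scale (a : R) f : smooth_fun M f -> smooth_fun M (fun p => a * f p).
Proof.
move=> sf i; apply/smooth_onP => k.
by apply: Cn_mul; [exact: img_open|exact: Cn_cst|exact: smooth_cn].
Qed.

(** By [real_ind]. If the curves agree on [[0, s)], they agree at [s] by continuity and the
    Hausdorff property, and then near [s] by uniqueness in a chart. The assumption near 0 provides a
    two-sided neighbourhood of the starting time. *)
Lemma icv_unique_pos f c1 c2 (T t : R) : smooth_fun M f -> c1 0 = c2 0 ->
  (forall s, 0 <= s < T -> icv f c1 s /\ icv f c2 s) ->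
  (\forall s \near (0 : R), icv f c1 s /\ icv f c2 s) ->
  0 <= t < T -> c1 t = c2 t.
Proof.
move=> sf e0 h h0 /andP[t0 tT].
have nT (s : R) : 0 <= s < T -> \forall r \near s, icv f c1 r /\ icv f c2 r.
  move=> /andP[s0 sT]; have [->//|sn0] := eqVneq s 0.
  have sp : 0 < s by rewrite lt_neqAle eq_sym sn0.
  apply: filterS2 (lt_nbhsl sT) (lt_nbhsr sp) => r r1 r2; apply: h.
  by rewrite r1 ltW.
apply: (@real_ind R (fun s => c1 s = c2 s) t) => // s /andP[s0 st] lt.
have sT : 0 <= s < T by rewrite s0 (le_lt_trans st).
have [k1 k2] := h s sT.
have es : c1 s = c2 s.
  have [->//|sn0] := eqVneq s 0.
  have sp : 0 < s by rewrite lt_neqAle eq_sym sn0.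
  apply: (@manifold_hausdorff _ _ _ M) => A B hA hB.
  have n1 : \forall r \near s, A (c1 r) by exact: k1.1.
  have n2 : \forall r \near s, B (c2 r) by exact: k2.1.
  have /nbhs_ballP[d /= d0 hd] : \forall r \near s, (A (c1 r) /\ B (c2 r)) /\ 0 < r.
    by apply: filterI; [exact: filterI|exact: lt_nbhsr].
  pose r := s - d / 2.
  have br : ball s d r by rewrite /ball /= /r opprB addrCA subrr addr0 gtr0_norm; lra.
  have [[A1 B1] r0] := hd _ br; exists (c1 r); split=> //.
  by rewrite lt // /r; move: r0; rewrite /= /r; lra.
have [i si] := chart_cover M (c1 s).
have si2 : dom i (c2 s) by rewrite -es.
have d1 : \forall r \near s, dom i (c1 r) by apply: k1.1; exact: near_dom.
have d2 : \forall r \near s, dom i (c2 r) by apply: k2.1; exact: near_dom.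
have i1 : \forall r \near s, isd (fun r => ch i (c1 r)) r (HX g f i (ch i (c1 r))).
  by apply: filterS2 (nT s sT) d1 => r [a _] b; exact: icv_all.
have i2 : \forall r \near s, isd (fun r => ch i (c2 r)) r (HX g f i (ch i (c2 r))).
  by apply: filterS2 (nT s sT) d2 => r [_ a] b; exact: icv_all.
have e1 : ch i (c1 s) = ch i (c2 s) by rewrite es.
have := local_unique (img_open (M := M) (i := i)) (HX_cn g i 1 sf) (img_ch si) e1 i1 i2.
apply: filterS3 d1 d2 => r r1 r2 er.
by rewrite -(chartK r1) er chartK.
Qed.

Lemma icv_unique f c1 c2 (T t : R) : smooth_fun M f -> c1 0 = c2 0 ->
  (forall s : R, `|s| < T -> icv f c1 s /\ icv f c2 s) -> `|t| < T -> c1 t = c2 t.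
Proof.
move=> sf e0 h tT.
have T0 : 0 < T by exact: le_lt_trans tT.
have n0 : \forall s \near (0 : R), `|s| < T.
  have := nbhsx_ballx (0 : R) _ T0; apply: filterS => s; rewrite /ball /= sub0r normrN; by [].
have pos (s : R) : 0 <= s < T -> `|s| < T by case/andP => s0 sT; rewrite ger0_norm.
have [t0|/ltW t0] := leP 0 t.
  apply: (@icv_unique_pos f c1 c2 T t) => //.
  - by move=> s /pos; exact: h.
  - by apply: filterS n0 => s; exact: h.
  - by rewrite t0; rewrite ger0_norm in tT.
(* Negative times: reversing time replaces [f] by its negative. *)
have := @icv_unique_pos (fun p => -1 * f p) (fun s => c1 (-1 * s + 0)) (fun s => c2 (-1 * s + 0)) T (- t).
rewrite !mulN1r opprK !addr0 oppr0; apply => //.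
- exact: smooth_scale.
- move=> s /pos sT; have [|h1 h2] := h (-1 * s + 0); first by rewrite mulN1r addr0 normrN.
  by split; exact: icv_affine.
- apply: filterS n0 => s sT; have [|h1 h2] := h (-1 * s + 0); first by rewrite mulN1r addr0 normrN.
  by split; exact: icv_affine.
- by rewrite oppr_ge0 t0; rewrite ler0_norm in tT.
Qed.

End IntegralCurves.

(** * Extension of a flow from short times to all times *)

Section ExtendFlow.
Context {R : realType}.

Lemma iter_commute (T : Type) (f h : T -> T) k x : (forall y, f (h y) = h (f y)) ->
  iter k (f \o h) x = iter k f (iter k h x).
Proof.
move=> fh; elim: k => //= k ->; congr (f _); move: (iter k h x) => y; elim: k => //= k IH.
by rewrite -fh IH.
Qed.

(** [Th t] is the [k]-fold iterate of [th (t / k)] for any [k] large enough; two choices of [k]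
    agree with their product. That [Th s] is an iterate of a short-time map is kept in the
    conclusion, because properties stable under composition then pass to [Th s]. *)
Lemma extend_flow (T : Type) (e : R) (th : R -> T -> T) : 0 < e -> (forall x, th 0 x = x) ->
  (forall s t x, `|s| < e -> `|t| < e -> th (s + t) x = th s (th t x)) ->
  exists Th : R -> T -> T, [/\ forall s x, `|s| < e -> Th s x = th s x,
    forall s t x, Th (s + t) x = Th s (Th t x) &
    forall s, exists k r, `|r| < e /\ forall x, Th s x = iter k (th r) x].
Proof.
move=> e0 th0 thD.
have iterE j (r : R) x : `|j%:R * r| < e -> `|r| < e -> iter j (th r) x = th (j%:R * r) x.
  elim: j => [|j IH] jr re; first by rewrite mul0r th0.
  have jr' : `|j%:R * r| < e.
    apply: le_lt_trans jr; rewrite !normrM ler_wpM2r // !ger0_norm //.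
    by rewrite ler_nat.
  by rewrite /= IH // -thD // -[j.+1]addn1 natrD mulrDl mul1r addrC.
have P k l (t : R) x : (0 < k)%N -> (0 < l)%N -> `|t / k%:R| < e ->
    iter (k * l) (th (t / (k * l)%:R)) x = iter k (th (t / k%:R)) x.
  move=> k0 l0 tk; rewrite iterM; apply: eq_iter => y.
  have lE : l%:R * (t / (k * l)%:R) = t / k%:R.
    by rewrite natrM; field; rewrite !pnatr_eq0 -!lt0n k0 l0.
  rewrite iterE ?lE //; apply: le_lt_trans tk.
  rewrite -lE [leRHS]normrM ler_peMl // ger0_norm // ler1n //.
have Q k l (t : R) x : (0 < k)%N -> (0 < l)%N -> `|t / k%:R| < e -> `|t / l%:R| < e ->
    iter l (th (t / l%:R)) x = iter k (th (t / k%:R)) x.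
  move=> k0 l0 tk tl; rewrite -(P k l) // -(P l k) // mulnC; by [].
have ex (t : R) : exists k, (0 < k)%N /\ `|t / k%:R| < e.
  exists (Num.truncn (`|t| / e)).+1; split=> //.
  rewrite normrM normfV (ger0_norm (ler0n _ _)) ltr_pdivrMr // mulrC -ltr_pdivrMr //.
  exact: truncnS_gt.
have /choice[K hK] := ex.
exists (fun t x => iter (K t) (th (t / (K t)%:R)) x); split.
- move=> s x se; have [k0 ks] := hK s.
  by rewrite (Q 1%N) //= divr1.
- move=> s t x.
  have [a0 as_] := hK s; have [b0 bt] := hK t; have [c0 cst] := hK (s + t).
  (* A common number of steps for the three times; with it the claim reduces to [th] at short times,
     where the steps commute. *)
  pose k := (K s * K t * K (s + t)%R)%N.
  have k0 : (0 < k)%N by rewrite !muln_gt0 a0 b0.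
  have sm (r : R) l : (0 < l)%N -> (l <= k)%N -> `|r / l%:R| < e -> `|r / k%:R| < e.
    move=> l0 lk; apply: le_lt_trans; rewrite !normrM ler_wpM2l // !normfV.
    by rewrite !ger0_norm // lef_pV2 ?posrE ?ltr0n // ler_nat.
  have sk : `|s / k%:R| < e by apply: (sm _ _ a0) as_; rewrite /k -mulnA leq_pmulr // muln_gt0 b0.
  have tk : `|t / k%:R| < e.
    by apply: (sm _ _ b0) bt; rewrite /k mulnAC leq_pmull // muln_gt0 a0.
  have stk : `|(s + t) / k%:R| < e by apply: (sm _ _ c0) cst; rewrite /k leq_pmull // muln_gt0 a0.
  rewrite (Q k (K (s + t))) // (Q k (K s)) // (Q k (K t)) //.
  rewrite -iter_commute => [|y]; last by rewrite -!thD // addrC.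
  by apply: eq_iter => y /=; rewrite mulrDl thD.
- by move=> s; exists (K s), (s / (K s)%:R); have [_ ?] := hK s.
Qed.

End ExtendFlow.

(** * The global flow of a Kähler function on a compact manifold *)

Section GlobalFlow.
Context {R : realType} {n : nat} {N : topologicalType}.
Variables (M : complexManifold R n N) (g : kahlerMetric M).
Local Notation dom := (@chart_dom R n N M).
Local Notation ch := (@chart R n N M).
Local Notation inv := (@chart_inv R n N M).
Local Notation img := (@chart_img R n N M).
Implicit Types (f : N -> R) (phi : N -> N).

Lemma hisoN_ext phi psi p : (\forall q \near p, phi q = psi q) -> hisoN g phi p -> hisoN g psi p.
Proof.
move=> ne [cp [i [j [pi pj h]]]]; have e0 := nbhs_singleton ne; split.
  move=> A; rewrite -e0 => /cp cA; have : \forall s \near p, A (phi s) by exact: cA.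
  by apply: filterS2 ne => s es As; rewrite /= -es.
exists i, j; rewrite -e0; split; [exact: pi|exact: pj|apply: hiso_ext h].
by apply: filterS (near_inv pi ne) => y ey; rewrite /local_rep /= ey.
Qed.

(** Joint continuity is recorded because it makes the flow a path for the compact-open topology,
    hence a path in [Aut0]. *)
Definition flow_at f (e : R) (th : R -> N -> N) (q : N) : Prop := th 0 q = q /\
  forall s : R, `|s| < e -> [/\ icv g f (th^~ q) s, hisoN g (th s) q &
    {for (s, q), continuous (fun z : R * N => th z.1 z.2)}].

Lemma flow_family_hiso f i x0 (r e s : R) th x : kah g f ->
  flow_family (img i) (HX g f i) (ball x0 r) e th -> ball x0 r x -> `|s| < e ->
  hiso (g i) (g i) (th s) x.
Proof.
move=> [sf kf] fam xr se; have K := kmetric_chart g i; have oB := @ball_open _ _ x0 r.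
have [s0|s0] := leP 0 s.
  apply: (flow_hiso K oB (sf i) (kf i) fam xr); by rewrite s0; rewrite ger0_norm in se.
(* [flow_hiso] covers nonnegative times; the other times are those of the flow of [- f] run
   backwards. *)
have [sf' kf'] := kah_lin (-1) (conj sf kf) (kah_cst g 0).
have fam' : flow_family (img i) (HX g (fun p => -1 * f p + 0) i) (ball x0 r) e (fun t => th (- t)).
  split=> [y yr|y t yr te]; first by rewrite oppr0 fam.1.
  have [|Uy dy] := fam.2 y (- t) yr; first by rewrite normrN.
  split; first exact: Uy.
  have dfy : differentiable (f \o inv i) (th (- t) y) by exact: Cn_diff (smooth_cn i 0 sf) Uy.
  have -> : (fun p => -1 * f p + 0) = (fun p => -1 * f p) by apply/funext => p; rewrite addr0.
  rewrite HXZ //; have := @isd_rescale _ _ (th^~ y) (-1) 0 t (HX g f i (th (- t) y)).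
  rewrite mulN1r addr0 => /(_ dy); apply: isd_ext.
  by near=> u; rewrite mulN1r addr0.
have := flow_hiso K oB (sf' i) (kf' i) fam' xr; move=> /(_ (- s)); rewrite opprK; apply.
by rewrite oppr_ge0 (ltW s0); rewrite ltr0_norm in se.
Unshelve. all: by end_near. Qed.

Lemma local_flow_at f (p : N) : kah g f ->
  exists2 e : R, 0 < e & exists th, \forall q \near p, flow_at f e th q.
Proof.
move=> [sf kf]; have [i pi] := chart_cover M p.
have [r [e [G [th [r0 e0 fam lip]]]]] :=
  local_flow (img_open (M := M) (i := i)) (img_ch pi) (HX_cn g i 1 sf).
exists e => //; exists (fun s q => inv i (th s (ch i q))).
have nb : \forall q \near p, ball (ch i p) r (ch i q).
  by apply: (near_ch (P := ball (ch i p) r) pi); exact: nbhsx_ballx.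
have nb2 : \forall q \near p, dom i q /\ \forall q' \near q, dom i q' /\ ball (ch i p) r (ch i q').
  apply: filterI (near_dom pi) _.
  by apply: (@nbhs_interior _ p [set q | dom i q /\ ball (ch i p) r (ch i q)]); exact: filterI (near_dom pi) nb.
apply: filterS nb2 => q [qi nq]; have [_ qr] := nbhs_singleton nq.
split; first by rewrite fam.1 // chartK.
have invc x : img i x -> {for x, continuous (inv i)}.
  by move=> [q' q'i <-]; exact: chart_inv_continuous.
have nlt (s : R) : `|s| < e -> \forall s' \near s, `|s'| < e.
  move=> se; apply: (@cvgr_lt _ _ (nbhs s) _ (fun s : R => `|s|) `|s|) => //.
  exact: norm_continuous.
move=> s se; have [Us ds] := fam.2 _ s qr se.
have jc : {for (s, q), continuous (fun z : R * N => inv i (th z.1 (ch i z.2)))}.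
  apply: (@continuous_comp _ _ _ (fun z : R * N => th z.1 (ch i z.2)) (inv i)); last exact: invc.
  apply/cvgrPdist_lt => eps eps0 /=.
  have eG : 0 < eps / (2 * (`|G| + 1)) by rewrite divr_gt0 // mulr_gt0 // ltr_wpDl.
  have n1 : \forall s' \near s, `|s'| < e /\ `|s - s'| < eps / (2 * (`|G| + 1)).
    by apply: filterI; [exact: nlt|exact: (cvgrPdist_lt _ _).1 (@cvg_id _ (nbhs s)) _ eG].
  have n2 : \forall q' \near q, ball (ch i p) r (ch i q') /\ `|ch i q - ch i q'| < eps / (2 * (`|G| + 1)).
    apply: filterI; first by apply: filterS nq => ? [].
    exact: (cvgrPdist_lt _ _).1 (@chart_continuous _ _ _ M i q qi) _ eG.
  exists ([set s' | `|s'| < e /\ `|s - s'| < eps / (2 * (`|G| + 1))],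
    [set q' | ball (ch i p) r (ch i q') /\ `|ch i q - ch i q'| < eps / (2 * (`|G| + 1))]) => //=.
  move=> [s' q'] /= [[s1 s2] [q1 q2]].
  apply: le_lt_trans (lip _ _ _ _ qr q1 se s1) _.
  apply: (@le_lt_trans _ _ ((`|G| + 1) * (`|ch i q - ch i q'| + `|s - s'|))).
    rewrite ler_wpM2r ?addr_ge0 //; apply: le_trans (ler_norm _) _; by rewrite lerDl.
  have eE : (`|G| + 1) * (eps / (2 * (`|G| + 1)) + eps / (2 * (`|G| + 1))) = eps.
    by field; rewrite gt_eqF // ltr_wpDl.
  have G1 : 0 < `|G| + 1 by rewrite ltr_wpDl.
  by rewrite -[ltRHS]eE (ltr_pM2l G1) ltrD.
have cs : {for s, continuous (fun s => inv i (th s (ch i q)))}.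
  apply: (@continuous_comp _ _ _ (th^~ (ch i q)) (inv i)); first exact: isd_cont ds.
  exact: invc.
split=> //.
  split=> //; exists i; split; first exact: inv_dom.
  rewrite invK //; apply: isd_ext ds.
  by apply: filterS (nlt s se) => s' s'e; have [? _] := fam.2 _ s' qr s'e; rewrite invK.
split.
  apply: (@continuous_comp _ _ _ (fun q => (s, q)) (fun z : R * N => inv i (th z.1 (ch i z.2)))) => //.
  move=> A [[B C] /= [hB hC] BC]; apply: filterS hC => q' Cq; apply: BC.
  by split=> //=; exact: nbhs_singleton.
exists i, i; split=> //; first exact: inv_dom.
apply: hiso_ext (flow_family_hiso (conj sf kf) fam qr se).
have ni := near_img qi; have nq' := near_inv qi nq.
apply: filterS2 ni nq' => y yi [y1 y2]; have [Uy _] := fam.2 _ s y2 se.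
by rewrite /local_rep /= (invK Uy) invK.
Qed.

(** Compactness gives one time [e] for all points. The local flows need no gluing: each point is
    moved by the local flow chosen at that very point, and [cons], from uniqueness, says that nearby
    choices agree. *)
Lemma uniform_flow f : compact [set: N] -> kah g f ->
  exists2 e : R, 0 < e & exists th, forall q, flow_at f e th q.
Proof.
move=> cN kf; have sf := kf.1.
have loc e (p : N) th : (\forall q \near p, flow_at f e th q) -> forall e', e' <= e ->
    \forall q \near p, flow_at f e' th q.
  move=> h e' ee; apply: filterS h => q [h0 h1]; split=> // s se; apply: h1.
  exact: lt_le_trans ee.
have : \forall e \near (0 : R)^'+, [set: N] `<=` (fun q => exists th, \forall q' \near q, flow_at f e th q').
  move/compact_near_coveringP : cN => /(_ R (0 : R)^'+ (fun e q => exists th, \forall q' \near q, flow_at f e th q')).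
  apply=> p _; have [e e0 [th hth]] := local_flow_at p kf.
  exists ([set q | \forall q' \near q, flow_at f e th q'], [set e' | e' <= e]) => /=.
    split; first exact: nbhs_interior.
    exact: nbhs_right_le.
  by move=> [q e'] /= [h1 h2]; exists th; apply: loc h2.
move=> nE.
have nE2 : \forall e \near (0 : R)^'+, [set: N] `<=` (fun q => exists th, \forall q' \near q, flow_at f e th q')
    /\ 0 < e.
  by apply: filterI => //; exact: nbhs_right_gt.
have [e [h e0]] := @filter_ex _ _ (at_right_proper_filter (0 : R)) _ nE2.
have /choice[th hth] (q : N) : exists th, \forall q' \near q, flow_at f e th q' by exact: (h q I).
exists e => //; exists (fun s q => th q s q) => q.
have cons q' (s : R) : flow_at f e (th q) q' -> `|s| < e -> th q s q' = th q' s q'.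
  move=> [a0 a1] se; have [b0 b1] := nbhs_singleton (hth q').
  apply: (@icv_unique _ _ _ _ g f ((th q)^~ q') ((th q')^~ q') e) => //; first by rewrite a0 b0.
  by move=> t te; have [? _ _] := a1 t te; have [? _ _] := b1 t te.
have [h0 h1] := nbhs_singleton (hth q); split=> // s se.
have [i1 i2 i3] := h1 s se.
have nlt : \forall s' \near s, `|s'| < e.
  apply: (@cvgr_lt _ _ (nbhs s) _ (fun s : R => `|s|) `|s|) => //.
  exact: norm_continuous.
split.
- exact: i1.
- by apply: hisoN_ext i2; apply: filterS (hth q) => q' fq; exact: cons.
move=> A /= /i3 hA.
have nz : \forall z \near (s, q), th q z.1 z.2 = th z.2 z.1 z.2.
  exists ([set s' | `|s'| < e], [set q' | flow_at f e (th q) q']) => /=.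
    by split; [exact: nlt|exact: hth].
  by move=> [s' q'] /= [u v]; exact: cons.
by apply: filterS2 nz hA => z; rewrite /= => ->.
Qed.

Record global_flow f (Th : R -> N -> N) : Prop := GlobalFlow {
  gf0 : forall q, Th 0 q = q;
  gfD : forall s t q, Th (s + t) q = Th s (Th t q);
  gf_icv : forall q t, icv g f (Th^~ q) t;
  gf_autp : forall t, autp g (Th t) (Th (- t));
  gf_cont : continuous (fun z : R * N => Th z.1 z.2) }.

Lemma ex_global_flow f : compact [set: N] -> kah g f -> exists Th, global_flow f Th.
Proof.
move=> cN kf; have [e' e'0 [th hth]] := uniform_flow cN kf; have sf := kf.1.
(* With half the existence time, [s + t] is still admissible when [s] and [t] are shorter than
   [e]. *)
pose e := e' / 2; have e0 : 0 < e by rewrite divr_gt0.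
have ee' (s : R) : `|s| < e -> `|s| < e' by move=> h; apply: lt_trans h _; rewrite /e; lra.
have th0 x : th 0 x = x by case: (hth x).
have thD s t x : `|s| < e -> `|t| < e -> th (s + t) x = th s (th t x).
  move=> se te; apply: (@icv_unique _ _ _ _ g f (fun s => th (s + t) x) (th^~ (th t x)) e) => //.
    by rewrite add0r th0.
  move=> u ue; split.
    apply: (@icv_shift _ _ _ _ g t f (th^~ x) u) => //; have [_ h] := hth x; have [] := h (u + t) => //.
    apply: le_lt_trans (ler_normD _ _) _; rewrite [e']splitr -/e; exact: ltrD.
  by have [_ h] := hth (th t x); have [] := h u (ee' _ ue).
have [Th [T1 T2 T3]] := extend_flow e0 th0 thD.
have T0 q : Th 0 q = q by rewrite T1 ?normr0.
have hT s q : hisoN g (Th s) q.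
  have [k [r [re hr]]] := T3 s.
  have : hisoN g (iter k (th r)) q.
    elim: k {hr} => [|k IH]; first exact: (hisoN_id g q).
    apply: (@hisoN_comp _ _ _ _ g (th r) (iter k (th r)) q IH).
    by have [_ h] := hth (iter k (th r) q); have [] := h r (ee' _ re).
  by apply: hisoN_ext; near=> y; rewrite hr.
have near0 (t : R) : \forall s \near t, `|s - t| < e.
  have := nbhsx_ballx t _ e0; apply: filterS => s; rewrite /ball /= distrC; by [].
have TE s t q : `|s - t| < e -> Th s q = th (s - t) (Th t q).
  by move=> st; rewrite -T1 // -T2 subrK.
exists Th; split=> //.
- move=> q t; have : icv g f (fun s => th (s - t) (Th t q)) t.
    apply: (@icv_shift _ _ _ _ g (- t) f (th^~ (Th t q)) t) => //; rewrite subrr; have [_ h] := hth (Th t q).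
    by have [] := h 0; rewrite ?normr0.
  by apply: icv_ext; apply: filterS (near0 t) => s /TE ->.
- move=> t; split=> // [q|q].
    by rewrite -T2 addNr T0.
  by rewrite -T2 subrr T0.
- move=> [t q] A /= hA.
  have [_ /(_ 0)] := hth (Th t q); rewrite normr0 => /(_ e'0)[_ _ jc].
  have hA' : nbhs (th 0 (Th t q)) A by rewrite th0.
  have : {for (t, q), continuous (fun z : R * N => th (z.1 - t) (Th t z.2))}.
    apply: (@continuous_comp _ _ _ (fun z : R * N => (z.1 - t, Th t z.2)) (fun z : R * N => th z.1 z.2)).
      have c1 : {for t, continuous (fun s : R => s - t)}.
        by apply: cvgB; [exact: cvg_id|exact: cvg_cst].
      have [c2 _] := hT t q.
      move=> B [[B1 B2] /= [hB1 hB2] BB]; exists ([set s | B1 (s - t)], [set p | B2 (Th t p)]) => /=.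
        by split; [exact: (c1 B1)|exact: (c2 B2)].
      by move=> [s' q'] /= [u v]; exact: (BB (s' - t, Th t q') (conj u v)).
    by rewrite /= subrr.
  move=> /(_ A) /=; rewrite subrr => /(_ hA') hB.
  have nz : \forall z \near (t, q), th (z.1 - t) (Th t z.2) = Th z.1 z.2.
    exists ([set s' | `|s' - t| < e], setT) => /=; first by split; [exact: near0|exact: filterT].
    by move=> [s' q'] /= [u _]; rewrite -TE.
  by apply: filterS2 nz hB => z; rewrite /= => ->.
Unshelve. all: by end_near. Qed.

End GlobalFlow.

(** * The Poisson bracket, and Kähler functions determined by a 1-jet *)

Section Bracket.
Context {R : realType} {n : nat} {N : topologicalType}.
Variables (M : complexManifold R n N) (g : kahlerMetric M).
Local Notation E := 'rV[R]_(n + n).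
Local Notation dom := (@chart_dom R n N M).
Local Notation ch := (@chart R n N M).
Local Notation inv := (@chart_inv R n N M).
Local Notation img := (@chart_img R n N M).

Lemma HX_near_cst (r : R) (f : N -> R) i y : (\forall z \near y, f (inv i z) = r) -> HX g f i y = 0.
Proof.
move=> h; rewrite /HX /ham; have -> : grad (f \o inv i) y = 0.
  apply/rowP => k; rewrite !mxE -(near_eq_derive _ (_ : \forall z \near y, r = (f \o inv i) z)).
    exact: derive_cst.
  by apply: filterS h => z hz; rewrite /= hz.
by rewrite !mul0mx oppr0.
Qed.

Local Notation HX := (HX g).
Implicit Types (f h : N -> R) (phi : N -> N).

(** For [phi] the identity this is the independence of the bracket from the chart; in general it
    gives invariance under isometries. *)
Lemma br_push_chart phi p i j f h : hisoN g phi p -> smooth_fun M f -> smooth_fun M h ->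
  dom i p -> dom j (phi p) ->
  'D_(HX (h \o phi) i (ch i p)) ((f \o phi) \o inv i) (ch i p) =
  'D_(HX h j (ch j (phi p))) (f \o inv j) (ch j (phi p)).
Proof.
move=> hp sf sh pi pj; have [Q [oQ Qx sL _]] := hisoN_all hp pi pj.
have dL := smooth_on_diff sL Qx; have lE := local_repE phi j pi.
have df : differentiable (f \o inv j) (local_rep phi i j (ch i p)).
  by rewrite lE; exact: smooth_fun_diff.
rewrite -(near_eq_derive _ (near_local f hp.1 pi pj)) (derive_comp _ dL df).
by rewrite (jacE _ dL) (HX_push hp sh pi pj) lE.
Qed.

(* The Poisson bracket df(X_h); the choice of the chart at p is immaterial. *)
Definition br f h (p : N) : R :=
  let i := sval (cid (chart_cover M p)) in 'D_(HX h i (ch i p)) (f \o inv i) (ch i p).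

Lemma brE f h i p : smooth_fun M f -> smooth_fun M h -> dom i p ->
  br f h p = 'D_(HX h i (ch i p)) (f \o inv i) (ch i p).
Proof.
move=> sf sh pi; rewrite /br; case: cid => j pj /=.
exact: (br_push_chart (hisoN_id g p) sf sh pj pi).
Qed.

Lemma br_push phi f h p : (forall p, hisoN g phi p) -> smooth_fun M f -> smooth_fun M h ->
  br (f \o phi) (h \o phi) p = br f h (phi p).
Proof.
move=> hphi sf sh; have [i pi] := chart_cover M p; have [j pj] := chart_cover M (phi p).
rewrite (brE _ _ pi) ?(brE _ _ pj) //; try exact: smooth_pullback.
exact: (br_push_chart (hphi p)).
Qed.

Lemma br_form f h i p : smooth_fun M f -> smooth_fun M h -> dom i p ->
  br f h p = mxform (MI n *m g i (ch i p)) (HX f i (ch i p)) (HX h i (ch i p)).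
Proof.
move=> sf sh pi; rewrite (brE sf sh pi) (ham_derive (kmetric_chart g i)) //.
  exact: img_ch.
exact: smooth_fun_diff.
Qed.

Lemma br_anti f h p : smooth_fun M f -> smooth_fun M h -> br f h p = - br h f p.
Proof.
move=> sf sh; have [i pi] := chart_cover M p.
rewrite (br_form sf sh pi) (br_form sh sf pi).
exact: (omega_anti (kmetric_chart g i) _ _ (img_ch pi)).
Qed.

Lemma br_lin (a : R) f h k p : smooth_fun M f -> smooth_fun M h -> smooth_fun M k ->
  smooth_fun M (fun p => a * f p + h p) ->
  br (fun p => a * f p + h p) k p = a * br f k p + br h k p.
Proof.
move=> sf sh sk sfh; have [i pi] := chart_cover M p.
have df := smooth_fun_diff sf pi; have dh := smooth_fun_diff sh pi.
rewrite (br_form sfh sk pi) (br_form sf sk pi) (br_form sh sk pi) HXD //.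
by rewrite /mxform !mulmxDl mx00D -!scalemxAl; congr (_ + _); rewrite mxE.
Qed.

Lemma br_linr (a : R) f h k p : smooth_fun M f -> smooth_fun M h -> smooth_fun M k ->
  smooth_fun M (fun p => a * f p + h p) ->
  br k (fun p => a * f p + h p) p = a * br k f p + br k h p.
Proof.
move=> sf sh sk sfh; rewrite br_anti // br_lin // (br_anti p sk sf) (br_anti p sk sh).
by rewrite mulrN opprD.
Qed.

Lemma icv_derive f h c t : smooth_fun M f -> smooth_fun M h -> icv g h c t ->
  isd (fun s => f (c s)) t (br f h (c t)).
Proof.
move=> sf sh [cc [i [ci hd]]]; rewrite (brE sf sh ci).
have := isd_comp hd (smooth_fun_diff sf ci); apply: isd_ext.
have n1 : \forall s \near t, dom i (c s) by apply: cc; exact: near_dom.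
by apply: filterS n1 => s si; rewrite /= chartK.
Qed.

Lemma HX_br f h i x : smooth_fun M f -> smooth_fun M h -> img i x ->
  HX (br f h) i x = HX h i x *m jac (HX f i) x - HX f i x *m jac (HX h i) x.
Proof.
move=> sf sh ix.
have := ham_br (kmetric_chart g i) ix (smooth_cn i 2 sf) (smooth_cn i 2 sh).
move=> <-; apply: ham_ext; apply: (near_open (img_open (i := i)) ix) => y iy.
by rewrite /= (brE sf sh (inv_dom iy)) invK.
Qed.

Lemma smooth_continuous f : smooth_fun M f -> continuous f.
Proof.
move=> sf p; have [i pi] := chart_cover M p.
have c : {for p, continuous (fun q => (f \o inv i) (ch i q))}.
  apply: (@continuous_comp _ _ _ (ch i) (f \o inv i)); first exact: chart_continuous.
  by apply: differentiable_continuous; exact: smooth_fun_diff.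
move=> A; rewrite /= -{1}(chartK pi) => /c; apply: filterS2 (near_dom pi) => q qi.
by rewrite /= chartK.
Qed.

Lemma smooth_bounded f : compact [set: N] -> smooth_fun M f -> exists C : R, forall p, `|f p| <= C.
Proof.
move=> cN sf.
have : \forall C \near (+oo : set_system R), [set: N] `<=` (fun p => `|f p| <= C).
  move/compact_near_coveringP : cN => /(_ R (+oo : set_system R) (fun C p => `|f p| <= C)).
  apply=> p _; have n1 : \forall q \near p, `|f p - f q| < 1.
    have c : {for p, continuous f} by exact: smooth_continuous.
    exact: (cvgrPdist_lt _ _).1 c _ ltr01.
  exists ([set q | `|f p - f q| < 1], [set C | `|f p| + 1 <= C]) => /=.
    by split=> //; exact: nbhs_pinfty_ge.
  move=> [q C] /= [h1 h2]; apply: le_trans h2.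
  have := ler_normB (f p) (f p - f q); rewrite subKr => /le_trans; apply.
  by rewrite lerD2l ltW.
by move=> /filter_ex[C hC]; exists C => p; exact: hC.
Qed.

Lemma jet_loc f i q : kah g f -> dom i q -> HX f i (ch i q) = 0 -> jac (HX f i) (ch i q) = 0 ->
  \forall q' \near q, f q' = f q.
Proof.
move=> [sf kf] qi h0 j0.
have n0 := killing_jet (kmetric_chart g i) (fun k => HX_cn g i k sf) (kf i) (img_ch qi) h0 j0.
have /nbhs_ballP[r /= r0 hr] : \forall y \near ch i q, img i y /\ HX f i y = 0.
  by apply: filterI n0; exact: near_img.
have cst y : ball (ch i q) r y -> (f \o inv i) y = (f \o inv i) (ch i q).
  rewrite -ball_normE /= => yr; set x := ch i q in yr hr *; pose v := y - x.
  have := @isd_const1 R (fun s => (f \o inv i) (s *: v + x)) 1.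
  rewrite scale1r scale0r add0r subrK normr1; apply=> s s1.
  have /hr[si s0] : ball x r (s *: v + x).
    rewrite -ball_normE /= opprD addrC subrK normrN normrZ /v.
    by apply: le_lt_trans yr; rewrite distrC ler_piMl.
  have ds : differentiable (f \o inv i) (s *: v + x) by exact: Cn_diff (smooth_cn i 0 sf) si.
  apply: isd_eq (isd_line ds) _.
  by rewrite (gradE _ ds) -(hamE (kmetric_chart g i) _ si) -/(HX f i _) s0 !mul0mx mxE.
have nb : \forall q' \near q, ball (ch i q) r (ch i q').
  by apply: (near_ch (P := ball (ch i q) r) qi); exact: nbhsx_ballx.
apply: filterS2 nb (near_dom qi) => q' /cst + q'i.
by rewrite /= !chartK.
Qed.

(** The set [A] where [f] has locally the value [f p] is open, and nonempty by [jet_loc]. It is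
    closed: on [A] the 1-jet of the field vanishes, hence by continuity also at limit points of [A],
    near which [jet_loc] makes [f] constant again. *)
Lemma kah_jet f i p : connected [set: N] -> kah g f -> dom i p -> HX f i (ch i p) = 0 ->
  jac (HX f i) (ch i p) = 0 -> forall q, f q = f p.
Proof.
move=> conn kf pi h0 j0; have sf := kf.1.
pose A : set N := [set q : N | \forall q' \near q, f q' = f p].
have oA : open A.
  by rewrite openE => q qA; exact: (@nbhs_interior _ q [set q | f q = f p] qA).
suff AT : A = setT by move=> q; have : A q by [rewrite AT]; exact: nbhs_singleton.
apply: conn; first by exists p; exact: jet_loc kf pi h0 j0.
  by exists A => //; rewrite setTI.
exists A; last by rewrite setTI.
rewrite closedE => q qA; apply: contrapT => nA; apply: qA => /=.
have [j qj] := chart_cover M q; set x := ch j q.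
have Az q' : dom j q' -> A q' -> HX f j (ch j q') = 0 /\ jac (HX f j) (ch j q') = 0.
  move=> q'j Aq'; have n1 : \forall y \near ch j q', HX f j y = 0.
    have /nbhs_interior := near_inv q'j Aq'; apply: filterS => y hy.
    exact: (HX_near_cst hy).
  split; first exact: nbhs_singleton n1.
  have e : \forall y \near ch j q', (fun=> 0) y = HX f j y by apply: filterS n1 => y ->.
  by rewrite -(near_eq_jac e); apply/matrixP => a b; rewrite !mxE derive_cst mxE.
have [[hx jx]|nz] := pselect (HX f j x = 0 /\ jac (HX f j) x = 0).
  have nf := jet_loc kf qj hx jx.
  have nf2 := @nbhs_interior _ q [set q' | f q' = f q] nf.
  apply: filterS nf2 => q' hq' Aq'; apply: nA.
  have e : f q = f p by rewrite -(nbhs_singleton hq') (nbhs_singleton Aq').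
  by apply: filterS nf => ?; rewrite e.
have c1 : {for x, continuous (HX f j)}.
  by apply: differentiable_continuous; exact: Cn_diff (HX_cn g j 0 sf) (img_ch qj).
have c2 : {for x, continuous (jac (HX f j))}.
  by apply: differentiable_continuous; exact: Cn_diff (Cn_jac (img_open (i := j)) (HX_cn g j 1 sf)) (img_ch qj).
have key (W : normedModType R) (F : E -> W) : {for x, continuous F} -> F x != 0 ->
    \forall q' \near q, F (ch j q') != 0.
  move=> cF F0; apply: (near_ch (P := fun y => F y != 0) qj).
  have nF : 0 < `|F x| by rewrite normr_gt0.
  apply: filterS ((cvgrPdist_lt _ _).1 cF _ nF) => y; apply: contraTneq => ->.
  by rewrite subr0 ltxx.
have [hx0|hx0] := eqVneq (HX f j x) 0.
  have jx0 : jac (HX f j) x != 0 by apply/eqP => jx0; apply: nz.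
  apply: filterS2 (key _ _ c2 jx0) (near_dom qj) => q' nq q'j Aq'.
  by have [_ e] := Az q' q'j Aq'; rewrite e eqxx in nq.
apply: filterS2 (key _ _ c1 hx0) (near_dom qj) => q' nq q'j Aq'.
by have [e _] := Az q' q'j Aq'; rewrite e eqxx in nq.
Qed.

End Bracket.

(** * An invariant inner product for a bounded group of matrices *)

Section InvariantForm.
Context {R : realType}.

(** The squared Hilbert-Schmidt norm; unlike the maximum norm it satisfies the parallelogram law. *)
Definition hs m (A : 'M[R]_m) : R := \sum_(p : 'I_m * 'I_m) A p.1 p.2 ^+ 2.

Lemma hs_ge0 m (A : 'M[R]_m) : 0 <= hs A.
Proof. by apply: sumr_ge0 => p _; rewrite sqr_ge0. Qed.

Lemma hs_parallelogram m (A B : 'M[R]_m) :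
  hs (2^-1 *: (A + B)) = (hs A + hs B) / 2 - hs (A - B) / 4.
Proof.
rewrite /hs -big_split /= !mulr_suml -sumrB; apply: eq_bigr => p _; rewrite !mxE.
by field.
Qed.

Lemma hs_le m (A : 'M[R]_m) : hs A <= (m * m)%:R * `|A| ^+ 2.
Proof.
apply: (@le_trans _ _ (\sum_(p : 'I_m * 'I_m) `|A| ^+ 2)).
  apply: ler_sum => p _; rewrite -real_normK ?num_real // ler_sqr ?nnegrE //.
  exact: mx_norm_ge.
by rewrite sumr_const card_prod card_ord -[leLHS]mulr_natl.
Qed.

Lemma hs_ge m (A : 'M[R]_m) : `|A| ^+ 2 <= hs A.
Proof.
rewrite -[leRHS]sqr_sqrtr ?hs_ge0 // ler_sqr ?nnegrE ?sqrtr_ge0 //.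
apply: mx_norm_le; rewrite ?sqrtr_ge0 // => i j; rewrite -sqrtr_sqr ler_sqrt ?hs_ge0 //.
by rewrite /hs (bigD1 (i, j)) //= lerDl sumr_ge0 // => p _; rewrite sqr_ge0.
Qed.

(* A minimising sequence of S |-> sup_a hs (a S a^T) over an invariant convex
   set of positive forms is Cauchy by the parallelogram law, and so close to
   its translates that the limit is invariant. *)
Lemma invariant_form m (Gam : set 'M[R]_m) (C : R) : Gam 1%:M ->
  (forall a b, Gam a -> Gam b -> Gam (a *m b)) ->
  (forall a, Gam a -> exists2 b, Gam b & a *m b = 1%:M) ->
  (forall a (u : 'rV[R]_m), Gam a -> `|u *m a| <= C * `|u|) ->
  exists S : 'M[R]_m, [/\ S^T = S, forall u, u != 0 -> 0 < mxform S u u &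
    forall a, Gam a -> a *m S *m a^T = S].
Proof.
move=> G1 GM GV GC.
pose c0 := `|C| + 1; have c00 : 0 < c0 by rewrite ltr_wpDl.
have GC' a (u : 'rV[R]_m) : Gam a -> `|u *m a| <= c0 * `|u|.
  move=> Ga; apply: le_trans (GC a u Ga) _; rewrite ler_wpM2r //.
  by apply: le_trans (ler_norm _) _; rewrite lerDl.
have GN a : Gam a -> `|a| <= c0.
  move=> Ga; apply: mx_norm_le => [|i j]; first exact: ltW.
  have -> : a i j = ((delta_mx 0 i : 'rV_m) *m a) 0 j by rewrite -rowE mxE.
  apply: le_trans (mx_norm_ge _ _ _) _; apply: le_trans (GC' _ _ Ga) _.
  rewrite -[leRHS]mulr1 ler_pM2l //; apply: mx_norm_le => // a' b'; rewrite mxE.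
  by case: (_ && _); rewrite ?normr1 ?normr0.
(* [kap] bounds the effect on [hs] of [T |-> a *m T *m a^T], and that of its inverse, uniformly over
   [Gam]. *)
pose kap := (m * m)%:R * (m%:R * (m%:R * c0) * c0) ^+ 2 + 1.
have kap0 : 0 < kap by rewrite ltr_wpDl // mulr_ge0 // sqr_ge0.
have hsk a T : Gam a -> hs (a *m T *m a^T) <= kap * hs T.
  move=> Ga; have n1 : `|a *m T *m a^T| <= m%:R * (m%:R * c0) * c0 * `|T|.
    apply: le_trans (norm_mulmx _ _) _.
    have h1 : `|a *m T| <= m%:R * c0 * `|T|.
      apply: le_trans (norm_mulmx _ _) _; rewrite ler_wpM2r // ler_wpM2l //; exact: GN.
    have h2 : `|a^T| <= c0 by apply: le_trans (norm_trmx _) (GN _ Ga).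
    apply: (@le_trans _ _ (m%:R * (m%:R * c0 * `|T|) * c0)).
      by apply: ler_pM => //; rewrite ?mulr_ge0 // ler_wpM2l.
    by rewrite le_eqVlt; apply/orP; left; apply/eqP; ring.
  apply: le_trans (hs_le _) _; apply: (@le_trans _ _ ((m * m)%:R * (m%:R * (m%:R * c0) * c0 * `|T|) ^+ 2)).
    by rewrite ler_wpM2l // ler_sqr ?nnegrE // !mulr_ge0 // ltW.
  rewrite /kap; move: (_ * c0) => A; rewrite exprMn mulrA.
  apply: ler_pM; [|exact: sqr_ge0|by rewrite lerDl|exact: hs_ge].
  by rewrite mulr_ge0 // sqr_ge0.
have hskV a T : Gam a -> hs T <= kap * hs (a *m T *m a^T).
  move=> Ga; have [b Gb ab] := GV a Ga; have ba := mulmx1C ab.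
  have {1}-> : T = b *m (a *m T *m a^T) *m b^T.
    by rewrite !mulmxA ba mul1mx -mulmxA -trmx_mul ba trmx1 mulmx1.
  exact: hsk.
pose del := (c0 ^+ 2)^-1.
have del0 : 0 < del by rewrite invr_gt0 exprn_gt0.
(* The lower bound is imposed along all of [Gam], which makes [Q] stable under [Gam] and under
   midpoints; being quantitative, it survives the limit and gives definiteness. The value of [del]
   is such that [1%:M] qualifies, as [|u| <= c0 * |u *m a|]. *)
pose Q (S : 'M[R]_m) := S^T = S /\ forall a (u : 'rV[R]_m), Gam a ->
  del * `|u| ^+ 2 <= mxform S (u *m a) (u *m a).
have Q1 : Q 1%:M.
  split=> [|a u Ga]; first exact: trmx1.
  have [b Gb ab] := GV a Ga.
  have h1 : `|u| <= c0 * `|u *m a|.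
    by have := GC' b (u *m a) Gb; rewrite -mulmxA ab mulmx1.
  have h2 : `|u *m a| ^+ 2 <= mxform 1%:M (u *m a) (u *m a).
    move: (u *m a) => w.
    have fE : mxform 1%:M w w = \sum_j w 0 j ^+ 2.
      by rewrite /mxform mulmx1 mxE; apply: eq_bigr => j _; rewrite mxE expr2.
    have f0 : 0 <= mxform 1%:M w w by rewrite fE sumr_ge0 // => j _; rewrite sqr_ge0.
    rewrite -[leRHS]sqr_sqrtr // ler_sqr ?nnegrE ?sqrtr_ge0 //.
    apply: mx_norm_le; rewrite ?sqrtr_ge0 // => i j; rewrite ord1 -sqrtr_sqr ler_sqrt //.
    by rewrite fE (bigD1 j) //= lerDl sumr_ge0 // => l _; rewrite sqr_ge0.
  apply: le_trans h2; rewrite /del mulrC ler_pdivrMr ?exprn_gt0 // mulrC -exprMn.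
  by rewrite ler_sqr ?nnegrE // mulr_ge0 // ltW.
have Qact a S : Gam a -> Q S -> Q (a *m S *m a^T).
  move=> Ga [Ss Sd]; split; first by rewrite !trmx_mul trmxK Ss mulmxA.
  move=> b u Gb; rewrite -mxform_mul -mulmxA; apply: Sd; exact: GM.
have Qmid S T : Q S -> Q T -> Q (2^-1 *: (S + T)).
  move=> [Ss Sd] [Ts Td]; split; first by rewrite linearZ linearD /= Ss Ts.
  move=> a u Ga; rewrite /mxform -scalemxAr -scalemxAl mxE mulmxDr mulmxDl mx00D.
  by have := Sd a u Ga; have := Td a u Ga; rewrite /mxform; lra.
pose bd (S : 'M[R]_m) r := forall a, Gam a -> hs (a *m S *m a^T) <= r.
pose X : set R := [set r | exists2 S, Q S & bd S r].
have X0 : X !=set0.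
  by exists (kap * hs (1%:M : 'M[R]_m)), 1%:M => // a Ga; exact: hsk.
have Xlb : has_lbound X.
  exists 0 => r [S QS bS]; apply: le_trans (bS _ G1); exact: hs_ge0.
set c := inf X.
(* By the parallelogram law the midpoint of [S] and [T] has a bound smaller by
   [hs (S - T) / (4 * kap)], and no bound lies below the infimum [c]. *)
have near_min S T e : Q S -> Q T -> bd S (c + e) -> bd T (c + e) -> hs (S - T) <= 4 * kap * e.
  move=> QS QT bS bT.
  have : c <= c + e - hs (S - T) / (4 * kap).
    apply: ge_inf => //; exists (2^-1 *: (S + T)); first exact: Qmid.
    move=> a Ga; have -> : a *m (2^-1 *: (S + T)) *m a^T = 2^-1 *: (a *m S *m a^T + a *m T *m a^T).
      by rewrite -scalemxAr -scalemxAl mulmxDr mulmxDl.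
    rewrite hs_parallelogram.
    have -> : a *m S *m a^T - a *m T *m a^T = a *m (S - T) *m a^T by rewrite mulmxBr mulmxBl.
    have h1 := bS a Ga; have h2 := bT a Ga.
    have h3 : hs (S - T) / (4 * kap) <= hs (a *m (S - T) *m a^T) / 4.
      rewrite ler_pdivrMr ?mulr_gt0 //; apply: le_trans (hskV a _ Ga) _.
      by rewrite le_eqVlt; apply/orP; left; apply/eqP; field.
    by move: h1 h2 h3; move: (hs _) (hs _) (hs _) (_ / (4 * kap)) => *; lra.
  rewrite lerBrDl -lerBrDr [c + e]addrC addrK ler_pdivrMr ?mulr_gt0 //.
  by rewrite [e * _]mulrC.
(* An excess [4 ^- k] over the infimum means a distance of order [2 ^- k], the rate required by
   [geom_cvg]. *)
have /choice[S hS] (k : nat) : exists S, Q S /\ bd S (c + (4 ^+ k)^-1).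
  have e0 : 0 < (4 ^+ k)^-1 :> R by rewrite invr_gt0 exprn_gt0.
  have [r [S QS bS] rc] := inf_adherent e0 (conj X0 Xlb).
  by exists S; split=> // a Ga; apply: le_trans (bS a Ga) (ltW rc).
pose K := Num.sqrt (4 * kap).
have K0 : 0 <= K by exact: sqrtr_ge0.
have sm A k : hs A <= 4 * kap * (4 ^+ k)^-1 -> `|A| <= K / 2 ^+ k.
  move=> h; rewrite -ler_sqr ?nnegrE ?divr_ge0 ?exprn_ge0 //.
  apply: le_trans (hs_ge A) _; apply: le_trans h _.
  have e4 : 4 = 2 ^+ 2 :> R by ring.
  have k0 : 0 <= 4 * kap by rewrite mulr_ge0 // ltW.
  by rewrite expr_div_n (sqr_sqrtr k0) {2}e4 -!exprM mulnC.
have step k : `|mxvec (S k.+1) - mxvec (S k)| <= K / 2 ^+ k.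
  rewrite -linearB; apply: mx_norm_le => [|i j]; first by rewrite divr_ge0 // exprn_ge0.
  rewrite ord1; case/mxvec_indexP: j => a b; rewrite mxvecE; apply: le_trans (mx_norm_ge _ _ _) _.
  apply: sm; have [Q0 b0] := hS k; have [Q2 b2] := hS k.+1; apply: near_min => // a' Ga'.
  apply: le_trans (b2 a' Ga') _; rewrite lerD2l lef_pV2 ?posrE ?exprn_gt0 //.
  by rewrite exprS ler_peMl ?exprn_ge0 // ler1n.
have [l hl] := geom_cvg step.
pose L : 'M[R]_m := vec_mx l.
have hL k : `|L - S k| <= 2 * K / 2 ^+ k.
  apply: mx_norm_le => [|i j]; first by rewrite divr_ge0 ?mulr_ge0 // exprn_ge0.
  have -> : (L - S k) i j = (l - mxvec (S k)) 0 (mxvec_index i j).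
    by rewrite -[S k]mxvecK /L -linearB mxE mxvecK.
  by apply: le_trans (mx_norm_ge _ _ _) (hl k).
have eq0 (A : 'M[R]_m) (r : R) : (forall k, `|A| <= r / 2 ^+ k) -> A = 0.
  by move=> h; apply/eqP; rewrite -normr_eq0; apply/eqP; exact: half_pow_eq0 h.
have Linv a : Gam a -> a *m L *m a^T = L.
  move=> Ga; apply/eqP; rewrite -subr_eq0; apply/eqP.
  apply: (@eq0 _ (m%:R * (m%:R * c0) * c0 * (2 * K) + K + 2 * K)) => k.
  have -> : a *m L *m a^T - L = a *m (L - S k) *m a^T + (a *m S k *m a^T - S k) - (L - S k).
    rewrite mulmxBr mulmxBl; apply/matrixP => i j; rewrite !mxE; ring.
  rewrite [leRHS]mulrDl [X in _ <= X + _]mulrDl; apply: le_trans (ler_normB _ _) _; apply: lerD; last exact: hL.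
  apply: le_trans (ler_normD _ _) _; apply: lerD.
    apply: le_trans (norm_mulmx _ _) _.
    have h1 : `|a *m (L - S k)| <= m%:R * c0 * (2 * K / 2 ^+ k).
      apply: le_trans (norm_mulmx _ _) _; apply: ler_pM; rewrite ?mulr_ge0 ?hL //.
      by rewrite ler_wpM2l //; exact: GN.
    have h2 : `|a^T| <= c0 by apply: le_trans (norm_trmx _) (GN _ Ga).
    apply: (@le_trans _ _ (m%:R * (m%:R * c0 * (2 * K / 2 ^+ k)) * c0)).
      by apply: ler_pM => //; rewrite ?mulr_ge0 // ler_wpM2l.
    by rewrite le_eqVlt; apply/orP; left; apply/eqP; ring.
  (* Every translate of [a *m S k *m a^T] is a translate of [S k], so both are equally close to the
     infimum and therefore close to each other. *)
  apply: sm; have [Qk bk] := hS k; apply: near_min => //; first exact: Qact.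
  move=> b Gb; have -> : b *m (a *m S k *m a^T) *m b^T = (b *m a) *m S k *m (b *m a)^T.
    by rewrite trmx_mul !mulmxA.
  by apply: bk; exact: GM.
exists L; split => //.
  apply/eqP; rewrite -subr_eq0; apply/eqP; apply: (@eq0 _ (2 * K + 2 * K)) => k.
  have [[Sk _] _] := hS k.
  have -> : L^T - L = (L - S k)^T - (L - S k).
    by rewrite linearB /= Sk opprB addrA subrK.
  rewrite mulrDl; apply: le_trans (ler_normB _ _) _; apply: lerD; last exact: hL.
  exact: le_trans (norm_trmx _) (hL k).
move=> u u0; apply: (@lt_le_trans _ _ (del * `|u| ^+ 2)).
  by rewrite mulr_gt0 // exprn_gt0 // normr_gt0.
rewrite -subr_ge0 leNgt; apply/negP => lt0.
have : - (mxform L u u - del * `|u| ^+ 2) = 0.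
  apply: (@half_pow_eq0 _ _ (m%:R * (m%:R * `|u|) * `|u| * (2 * K))) => [|k]; first by rewrite oppr_ge0 ltW.
  have [[_ Sd] _] := hS k; have := Sd _ u G1; rewrite mulmx1 => h1.
  have h2 : `|mxform (L - S k) u u| <= m%:R * (m%:R * `|u|) * `|u| * (2 * K) / 2 ^+ k.
    apply: le_trans (mx_norm_ge (u *m (L - S k) *m u^T) 0 0) _.
    apply: le_trans (norm_mulmx _ _) _.
    have h3 : `|u *m (L - S k)| <= m%:R * `|u| * (2 * K / 2 ^+ k).
      by apply: le_trans (norm_mulmx _ _) _; rewrite ler_wpM2l // mulr_ge0.
    apply: (@le_trans _ _ (m%:R * (m%:R * `|u| * (2 * K / 2 ^+ k)) * `|u|)).
      by apply: ler_pM; rewrite ?norm_trmx // ?mulr_ge0 // ler_wpM2l.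
    by rewrite le_eqVlt; apply/orP; left; apply/eqP; ring.
  have h3 : - mxform (L - S k) u u <= `|mxform (L - S k) u u| by rewrite -normrN ler_norm.
  apply: le_trans (le_trans h3 h2).
  by rewrite mxformD mxformN !opprD !opprK lerD2l.
by move/eqP; rewrite oppr_eq0 => /eqP z; rewrite z ltxx in lt0.
Qed.

End InvariantForm.

(** * Conjugation in a finite-dimensional Lie algebra with a bounded adjoint group *)

Section CompactLie.
Context {R : realType} {D : nat}.
Local Notation E := 'rV[R]_D.
Variables (B : E -> E -> E) (ex : E -> R -> 'M[R]_D).
Hypothesis B_linl : forall (a : R) u v w, B (a *: u + v) w = a *: B u w + B v w.
Hypothesis B_anti : forall u v, B u v = - B v u.
Hypothesis ex0 : forall m, ex m 0 = 1%:M.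
Hypothesis exD : forall m s t, ex m (s + t) = ex m s *m ex m t.
Hypothesis ex_isd : forall m u t, isd (fun t => u *m ex m t) t (B (u *m ex m t) m).
Hypothesis exB : forall m t u v, B (u *m ex m t) (v *m ex m t) = B u v *m ex m t.

(** The group generated by the one-parameter groups of the elements of [h]. It is taken as it is,
    without closure, so that its elements correspond to actual compositions of flows. *)
Inductive Gam (h : set E) : 'M[R]_D -> Prop :=
| Gam1 : Gam h 1%:M
| GamS a m t : Gam h a -> h m -> Gam h (a *m ex m t).

Variable C0 : R.
Hypothesis Gam_bounded : forall a (u : E), Gam setT a -> `|u *m a| <= C0 * `|u|.

Lemma B_linr (a : R) u v w : B w (a *: u + v) = a *: B w u + B w v.
Proof. by rewrite B_anti B_linl (B_anti w u) (B_anti w v) opprD scalerN. Qed.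

Lemma B0l w : B 0 w = 0.
Proof. by have := B_linl 1 0 0 w; rewrite !scale1r addr0 => /esym/eqP; rewrite -subr_eq0 addrK => /eqP. Qed.

Lemma B_subl u v w : B (u - v) w = B u w - B v w.
Proof. by rewrite addrC -scaleN1r B_linl scaleN1r addrC. Qed.

Lemma B_subr u v w : B w (u - v) = B w u - B w v.
Proof. by rewrite addrC -scaleN1r B_linr scaleN1r addrC. Qed.

Definition adm (v : E) : 'M[R]_D := \matrix_i B (delta_mx 0 i) v.

Lemma admE u v : u *m adm v = B u v.
Proof.
rewrite mulmx_sum_row [in RHS](row_sum_delta u).
suff h r : \sum_(i <- r) u 0 i *: row i (adm v) = B (\sum_(i <- r) u 0 i *: delta_mx 0 i) v by exact: h.
elim: r => [|i r IH]; first by rewrite !big_nil B0l.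
by rewrite !big_cons B_linl IH rowK.
Qed.

Lemma B_bounded : exists2 b : R, 0 <= b & forall u v, `|B u v| <= b * `|u| * `|v|.
Proof.
pose c := \sum_i `|adm (delta_mx 0 i)|.
have c0 : 0 <= c by exact: sumr_ge0.
exists (D%:R * (D%:R * c)); first by rewrite !mulr_ge0.
move=> u v; rewrite -admE; apply: le_trans (norm_mulmx _ _) _.
have h : `|adm v| <= D%:R * c * `|v|.
  apply: mx_norm_le => [|i j]; first by rewrite !mulr_ge0.
  rewrite mxE B_anti -admE mxE normrN; apply: le_trans (mx_norm_ge _ _ _) _.
  apply: le_trans (norm_mulmx _ _) _; rewrite mulrAC ler_wpM2r // ler_wpM2l //.
  by rewrite /c (bigD1 i) //= lerDl sumr_ge0.
apply: le_trans (ler_wpM2l _ h) _; first by rewrite mulr_ge0.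
by rewrite le_eqVlt; apply/orP; left; apply/eqP; ring.
Qed.

(** The constant curve [e] solves the same linear equation [u' = B u m]; uniqueness is the Gronwall
    inequality for the difference. *)
Lemma ex_fix_pos e m t : B e m = 0 -> 0 <= t -> e *m ex m t = e.
Proof.
move=> h t0; have [b b0 hb] := B_bounded.
have bm : 0 <= b * `|m| by rewrite mulr_ge0.
have [G G0 hG] := @gronwall R D _ t bm t0.
apply/eqP; rewrite -subr_eq0 -normr_le0.
have := hG (fun s => e *m ex m s - e) (fun s => B (e *m ex m s) m - 0) 0 t.
rewrite ex0 mulmx1 subrr normr0 addr0 mulr0; apply; rewrite ?t0 ?lexx //.
  by move=> s _; apply: isd_sub; [exact: ex_isd|exact: isd_cst].
by move=> s _; rewrite addr0 subr0 -[B _ m]subr0 -{1}h -B_subl mulrAC; exact: hb.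
Qed.

Lemma ex_fix e m t : B e m = 0 -> e *m ex m t = e.
Proof.
move=> h; have [t0|/ltW t0] := leP 0 t; first exact: ex_fix_pos.
have e1 : e *m ex m (- t) = e by apply: ex_fix_pos => //; rewrite oppr_ge0.
by rewrite -{1}e1 -mulmxA -exD addNr ex0 mulmx1.
Qed.

Definition cent (s : seq E) (u : E) : bool := all (fun e => B u e == 0) s.

Lemma centP s u : reflect (forall e, e \in s -> B u e = 0) (cent s u).
Proof. by apply: (iffP allP) => h e /h /eqP. Qed.

(** In place of the Jacobi identity stands the invariance [exB]: [u] and [v] are fixed by [ex e t],
    hence so is [B u v], and one differentiates at 0. *)
Lemma cent_br s u v : cent s u -> cent s v -> cent s (B u v).
Proof.
move=> /centP hu /centP hv; apply/centP => e es.
have h t : B u v *m ex e t = B u v by rewrite -exB (ex_fix t (hu e es)) (ex_fix t (hv e es)).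
have := ex_isd e (B u v) 0; rewrite ex0 mulmx1 => /isd_val <-.
have -> : (fun t => B u v *m ex e t) = (fun=> B u v) by apply/funext => t; rewrite h.
exact: derive_cst.
Qed.

Lemma cent_fix s m e t : cent s m -> e \in s -> e *m ex m t = e.
Proof. by move=> /centP hm es; apply: ex_fix; rewrite B_anti hm // oppr0. Qed.

Lemma cent_ex s m u t : cent s m -> cent s u -> cent s (u *m ex m t).
Proof.
move=> hm /centP hu; apply/centP => e es.
by rewrite -(cent_fix t hm es) exB hu // mul0mx.
Qed.

Lemma Gam_cent s a u : Gam (cent s) a -> cent s u -> cent s (u *m a).
Proof.
move=> h; elim: h u => [|a' m t _ IH hm] u hu; first by rewrite mulmx1.
by rewrite mulmxA; apply: cent_ex => //; exact: IH.
Qed.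

Lemma Gam_fix (h : set E) a e : (forall m, h m -> B e m = 0) -> Gam h a -> e *m a = e.
Proof.
by move=> H; elim=> [|a' m t _ IH hm]; rewrite ?mulmx1 // mulmxA IH ex_fix // H.
Qed.

Lemma Gam_sub (h h' : set E) a : h `<=` h' -> Gam h a -> Gam h' a.
Proof. by move=> hh; elim=> [|a' m t _ IH hm]; [exact: Gam1|apply: GamS => //; exact: hh]. Qed.

Lemma Gam_mul h a b : Gam h a -> Gam h b -> Gam h (a *m b).
Proof.
move=> ha; elim=> [|b' m t _ IH hm]; first by rewrite mulmx1.
by rewrite mulmxA; exact: GamS.
Qed.

Lemma Gam_inv h a : Gam h a -> exists2 b, Gam h b & a *m b = 1%:M.
Proof.
elim=> [|a' m t _ [b hb ab] hm]; first by exists 1%:M; [exact: Gam1|rewrite mulmx1].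
exists (ex m (- t) *m b).
  by apply: Gam_mul => //; rewrite -[ex m _]mul1mx; apply: GamS => //; exact: Gam1.
by rewrite mulmxA -[a' *m _ *m _]mulmxA -exD subrr ex0 mulmx1.
Qed.

Fixpoint centmx (s : seq E) : 'M[R]_D :=
  if s is e :: s' then (kermx (adm e) :&: centmx s')%MS else 1%:M.

Lemma centmxP s u : (u <= centmx s)%MS = cent s u.
Proof.
elim: s => [|e s IH] /=; first exact: submx1.
rewrite sub_capmx IH; congr (_ && _).
by apply/idP/idP => [/sub_kermxP|/eqP h]; [rewrite admE => ->|apply/sub_kermxP; rewrite admE].
Qed.

(** When [a] squared has no larger kernel on [K] than [a], the image [P] of [K] meets the kernel of
    [a] trivially, so [a] is invertible on [P]. [Z] is the group inverse of [a] on [K]: zero on the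
    kernel of [a], inverse to [a] on [P]. *)
Lemma ginv (a K : 'M[R]_D) : (K *m a <= K)%MS ->
  (forall z : E, (z <= K)%MS -> z *m a *m a = 0 -> z *m a = 0) ->
  exists Z : 'M[R]_D, forall w : E, (w <= K)%MS ->
    [/\ (w *m Z <= K)%MS, w *m a = 0 -> w *m Z = 0, w *m Z = 0 -> w *m a = 0 &
        w *m Z *m a *m Z = w *m Z].
Proof.
move=> st ss; set P := K *m a.
have PK (z : E) : (z <= P)%MS -> exists2 y : E, (y <= K)%MS & z = y *m a.
  by move=> /submxP[y ->]; exists (y *m K); rewrite ?submxMl // mulmxA.
have cap0 : (P :&: kermx a)%MS = 0.
  apply/eqP; rewrite -submx0; apply/rV_subP => z; rewrite sub_capmx => /andP[/PK[y yK ->] /sub_kermxP h].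
  by rewrite (ss y yK h) sub0mx.
have PaP : (P *m a <= P)%MS by exact: submxMr.
have /submxP[X PX] : (P <= P *m a)%MS.
  rewrite -(mxrank_leqif_sup PaP).
  by have := mxrank_mul_ker P a; rewrite cap0 mxrank0 addn0 => ->.
have XPa : X *m P *m a = P by rewrite -mulmxA -PX.
have Za (y : E) : y *m X *m P *m a = y *m P by rewrite -[y *m X *m P]mulmxA -mulmxA XPa.
(* [y *m X *m P] is the preimage in [P] of [y *m P] under [a]. With [X] used twice, [w *m Z] is the
   element of [P] satisfying [w *m Z *m a *m a = w *m a]. *)
pose Z := pinvmx K *m X *m X *m P.
have ZP (z : E) : (z *m Z <= P)%MS by rewrite /Z mulmxA; exact: submxMl.
have Zaa (z : E) : (z <= K)%MS -> z *m Z *m a *m a = z *m a.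
  move=> zK; have zE : z = (z *m pinvmx K) *m K by rewrite mulmxKpV.
  have -> : z *m Z = z *m pinvmx K *m X *m X *m P by rewrite /Z !(mulmxA z).
  by rewrite Za Za /P mulmxA -zE.
have imker (z : E) : (z <= P)%MS -> z *m a = 0 -> z = 0.
  by move=> /PK[y yK ->]; exact: ss.
exists Z => w wK.
have WK : (w *m Z <= K)%MS by exact: submx_trans (ZP w) st.
split=> //.
- by move=> w0; apply: imker => //; apply: ss => //; rewrite Zaa.
- by move=> w0; rewrite -Zaa // w0 !mul0mx.
have mK : (w *m Z *m a <= K)%MS by exact: submx_trans (submxMr a WK) st.
apply/eqP; rewrite -subr_eq0; apply/eqP.
have dP : (w *m Z *m a *m Z - w *m Z <= P)%MS by rewrite addmx_sub // eqmx_opp.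
apply: imker => //; apply: ss; first exact: submx_trans dP st.
by rewrite mulmxBl mulmxBl Zaa // subrr.
Qed.

(** The map [m |-> f *m ex m 1] is approximated by its differential [B w] at [f = w], [m = 0],
    uniformly near this point. The difference of the curves for [m] and [m'] has derivative
    [B (p - q) m + B q (m - m')], where [p - q] is of order [m - m'], [m] is small and [q] is close
    to [w]. *)
Lemma ex_estimate w (e : R) : 0 < e -> exists2 r : R, 0 < r & r <= 1 /\
  forall f m m', `|f - w| <= r -> `|m| <= r -> `|m'| <= r ->
    `|f *m ex m 1 - f *m ex m' 1 - B w (m - m')| <= e * `|m - m'|.
Proof.
move=> e0; have [b b0 hb] := B_bounded.
have [G G0 hG] := @gronwall R D _ 1 b0 ler01.
pose k0 := G * (1 + b * `|w|).
have G0' := ltW G0.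
have k00 : 0 <= k0 by rewrite !(mulr_ge0, addr_ge0).
pose A := b * (G * (b * (k0 + `|w|))) + b * k0.
have A0 : 0 <= A by rewrite !(mulr_ge0, addr_ge0).
pose r := Num.min 1 (e / (A + 1)).
have A1 : 0 < A + 1 by rewrite ltr_wpDl.
have r0 : 0 < r by rewrite lt_min ltr01 divr_gt0.
have r1 : r <= 1 by rewrite ge_min lexx.
have rA : r * A <= e.
  apply: (@le_trans _ _ (e / (A + 1) * A)); first by rewrite ler_wpM2r // ge_min lexx orbT.
  by rewrite -[leRHS]mulr1 -mulrA ler_pM2l // ler_pdivrMl // mulr1 lerDl.
exists r => //; split=> // f m m' fr mr m'r.
pose p t := f *m ex m t; pose q t := f *m ex m' t; set d := m - m'.
have p0 : p 0 = f by rewrite /p ex0 mulmx1.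
have q0 : q 0 = f by rewrite /q ex0 mulmx1.
have hq (t : R) : 0 <= t <= 1 -> `|q t - w| <= k0 * r.
  move=> t01; have := hG (fun s => q s - w) (fun s => B (q s) m' - 0) (b * `|w| * r) t t01.
  rewrite q0 => H; apply: le_trans (H _ _ _) _.
  - by rewrite !mulr_ge0 // ltW.
  - by move=> s _; apply: isd_sub; [exact: ex_isd|exact: isd_cst].
  - move=> s _; rewrite subr0 -[q s](subrK w) -[B _ _]/(B (q s - w + w) m').
    rewrite -[q s - w]scale1r B_linl !scale1r subrK; apply: le_trans (ler_normD _ _) _.
    apply: lerD; apply: le_trans (hb _ _) _.
      rewrite -[leRHS]mulr1; apply: ler_pM => //; first by rewrite mulr_ge0.
      exact: le_trans m'r r1.
    by rewrite ler_wpM2l // mulr_ge0.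
  - by rewrite /k0 -[leRHS]mulrA ler_pM2l // [leRHS]mulrDl mul1r lerD2r.
have hqn (t : R) : 0 <= t <= 1 -> `|q t| <= k0 + `|w|.
  move=> t01; have := ler_normD (q t - w) w; rewrite subrK => /le_trans; apply.
  rewrite lerD2r; apply: le_trans (hq t t01) _; by rewrite -[leRHS]mulr1 ler_wpM2l.
have dpq s : isd (fun s => p s - q s) s (B (p s - q s) m + B (q s) d).
  apply: isd_eq (isd_sub (ex_isd m f s) (ex_isd m' f s)) _.
  by rewrite -/(p s) -/(q s) /d B_subl B_subr addrA subrK.
have hpq (t : R) : 0 <= t <= 1 -> `|p t - q t| <= G * (b * (k0 + `|w|) * `|d|).
  move=> t01; have := hG (fun s => p s - q s) (fun s => B (p s - q s) m + B (q s) d)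
    (b * (k0 + `|w|) * `|d|) t t01.
  rewrite p0 q0 subrr normr0 add0r; apply => [|s _|s st].
  - by rewrite !mulr_ge0 ?addr_ge0.
  - exact: dpq.
  - apply: le_trans (ler_normD _ _) _; apply: lerD; apply: le_trans (hb _ _) _.
      rewrite -[leRHS]mulr1; apply: ler_pM => //; first by rewrite mulr_ge0.
      exact: le_trans mr r1.
    rewrite ler_wpM2r // ler_wpM2l //; apply: hqn; case/andP: t01 => t0 t1; case/andP: st => s0 st.
    by rewrite s0 (le_trans st).
have := @isd_dom_pos R 1 D (fun s => p s - q s - s *: B w d)
  (fun s => B (p s - q s) m + B (q s) d - B w d) (fun s => r * A * `|d| * s) (fun=> r * A * `|d|) 1 ler01.
rewrite p0 q0 subrr scale0r !subr0 mulr0 subr0 mulr1 scale1r => H.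
apply: le_trans (H _ _ _) _; last by rewrite ler_wpM2r.
- move=> s _; apply: isd_sub; first exact: dpq.
  by apply: isd_eq (isd_scale (isd_id s) (isd_cst _ s)) _; rewrite scale1r scaler0 addr0.
- move=> s _; apply: isd_eq (isd_mul (isd_cst _ s) (isd_id s)) _.
  by rewrite mul0r add0r mulr1.
- move=> s s01; rewrite -addrA -B_subl; apply: le_trans (ler_normD _ _) _.
  have -> : r * A * `|d| = b * (G * (b * (k0 + `|w|) * `|d|)) * r + b * (k0 * r) * `|d|.
    by rewrite /A; ring.
  apply: lerD; apply: le_trans (hb _ _) _.
    by apply: ler_pM; rewrite ?mulr_ge0 // ler_wpM2l // hpq.
  by rewrite ler_wpM2r // ler_wpM2l // hq.
Qed.

Section form.
Variable S : 'M[R]_D.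
Hypothesis S_pos : forall u, u != 0 -> 0 < mxform S u u.
Hypothesis S_inv : forall a, Gam setT a -> a *m S *m a^T = S.

Lemma form_eq0 u : mxform S u u = 0 -> u = 0.
Proof. by move=> h; apply/eqP; apply: contraTT isT => /S_pos; rewrite h ltxx. Qed.

Lemma isd_form u m v t : isd (fun t => mxform S (u *m ex m t) v) t (mxform S (B (u *m ex m t) m) v).
Proof.
have h := isd_mulmx (isd_mulmx (ex_isd m u t) (isd_cst S t)) (isd_cst v^T t).
by have /isd_mxP/(_ 0 0) := h; rewrite !mulmx0 !addr0.
Qed.

(** The derivative at 0 of the constant function given by the invariance of [S] under [ex m s]. *)
Lemma form_skew u v m : mxform S (B u m) v = - mxform S u (B v m).
Proof.
have h := isd_mulmx (isd_mulmx (ex_isd m u 0) (isd_cst S 0)) (isd_trmx (ex_isd m v 0)).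
have e : (fun s => u *m ex m s *m S *m (v *m ex m s)^T) = (fun=> u *m S *m v^T).
  apply/funext => s; rewrite trmx_mul -!mulmxA; congr (u *m _); rewrite !mulmxA; congr (_ *m _).
  by rewrite S_inv // -[ex m s]mul1mx; apply: GamS => //; exact: Gam1.
move: h; rewrite /= e => /isd_mxP/(_ 0 0).
rewrite ex0 !mulmx1 mulmx0 addr0 mx00D => /isd_val; rewrite derive_cst => h0.
by apply/eqP; rewrite -addr_eq0; apply/eqP.
Qed.

(** By skewness the square norm of [B z w] is minus the product of [z] with [B (B z w) w], which is
    0. *)
Lemma adm_semisimple w (z : E) : z *m adm w *m adm w = 0 -> z *m adm w = 0.
Proof.
rewrite !admE => h; apply: form_eq0; rewrite form_skew h.
by rewrite /mxform trmx0 mulmx0 mxE oppr0.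
Qed.

Lemma closure_dist (A : set E) w : closure A w -> forall e : R, 0 < e -> exists2 a, A a & `|w - a| < e.
Proof.
move=> h e e0; have [a [Aa ba]] := h _ (nbhsx_ballx w e e0).
by exists a => //; move: ba; rewrite -ball_normE.
Qed.

(* The fixed point of the contraction [m |-> m + (f ex m 1) Z], Z an inverse of
   ad w modulo its kernel, conjugates f into the centraliser of w. *)
Lemma slice s w u : cent s w -> cent s u ->
  (forall e : R, 0 < e -> exists2 a, Gam (cent s) a & `|w - u *m a| < e) ->
  exists2 a, Gam (cent s) a & B (u *m a) w = 0.
Proof.
move=> cw cu app; set a := adm w; set K := centmx s.
have st : (K *m a <= K)%MS.
  apply/row_subP => i; rewrite row_mul centmxP admE; apply: cent_br => //.
  by rewrite -centmxP row_sub.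
have [Z hZ] := ginv st (fun z _ => @adm_semisimple w z).
pose nz := D%:R * `|Z| + 1.
have nz0 : 0 < nz by rewrite ltr_wpDl // mulr_ge0.
have nZ (y : E) : `|y *m Z| <= nz * `|y|.
  apply: le_trans (norm_mulmx _ _) _; rewrite mulrAC ler_wpM2r //.
  by rewrite /nz lerDl.
(* [nz] bounds the norm of [Z], so this precision makes [Psi] a contraction of ratio 1/2. *)
have e0 : 0 < (2 * nz)^-1 by rewrite invr_gt0 mulr_gt0.
have [r r0 [r1 est]] := ex_estimate w e0.
(* The second bound makes [|f *m Z| <= r / 2], since [w *m Z = 0]; it lets [Psi] map the ball of
   radius [r] into itself. *)
pose r' := Num.min r (r / (2 * nz)).
have r'0 : 0 < r' by rewrite lt_min r0 divr_gt0 // mulr_gt0.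
have [b Gb wb] := app r' r'0.
set f := u *m b in wb.
have cf : cent s f by exact: Gam_cent.
have fr : `|f - w| <= r by rewrite distrC; apply: le_trans (ltW wb) _; rewrite ge_min lexx.
have ww : w *m a = 0.
  rewrite admE; have := B_anti w w => /eqP; rewrite -addr_eq0 -mulr2n -scaler_nat scaler_eq0 pnatr_eq0 /=.
  by move/eqP.
have wK : (w <= K)%MS by rewrite centmxP.
have wZ : w *m Z = 0 by have [_ h _ _] := hZ w wK; exact: h.
have fZ : `|f *m Z| <= r / 2.
  have -> : f *m Z = (f - w) *m Z by rewrite mulmxBl wZ subr0.
  apply: le_trans (nZ _) _; rewrite mulrC -ler_pdivlMr //.
  rewrite distrC; apply: le_trans (ltW wb) _; rewrite ge_min; apply/orP; right.
  by rewrite le_eqVlt; apply/orP; left; apply/eqP; field; rewrite gt_eqF.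
pose Psi (m : E) := m + f *m ex m 1 *m Z.
(* The last condition places [m] where [a] and [Z] are mutually inverse; there the linear part
   [B w m = - m *m a] of the second summand of [Psi] cancels the first summand. *)
pose good (m : E) := [/\ cent s m, `|m| <= r & m *m a *m Z = m].
have lip m m' : good m -> good m' -> `|Psi m - Psi m'| <= 2^-1 * `|m - m'|.
  move=> [_ mr ma] [_ m'r m'a].
  have -> : Psi m - Psi m' = (f *m ex m 1 - f *m ex m' 1 - B w (m - m')) *m Z.
    have -> : B w (m - m') = - ((m - m') *m a) by rewrite admE B_anti.
    have e : (m - m') *m a *m Z = m - m' by rewrite !mulmxBl ma m'a.
    by rewrite opprK mulmxDl e mulmxBl /Psi opprD addrACA addrC.
  apply: le_trans (nZ _) _; apply: le_trans (ler_wpM2l (ltW nz0) (est _ _ _ fr mr m'r)) _.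
  by rewrite le_eqVlt; apply/orP; left; apply/eqP; field; rewrite gt_eqF.
have g0 : good 0 by split; rewrite ?mul0mx ?normr0 ?ltW //; apply/centP => e _; rewrite B0l.
have Psi0 : `|Psi 0| <= r / 2.
  by rewrite /Psi add0r ex_fix // B_anti B0l oppr0.
have gPsi m : good m -> good (Psi m).
  move=> gm; have [cm mr ma] := gm.
  have cN : cent s (f *m ex m 1) by exact: cent_ex.
  have NK : (f *m ex m 1 <= K)%MS by rewrite centmxP.
  have [h1 _ _ h4] := hZ _ NK.
  split.
  - by rewrite -centmxP; apply: addmx_sub => //; rewrite centmxP.
  - have -> : Psi m = Psi m - Psi 0 + Psi 0 by rewrite subrK.
    apply: le_trans (ler_normD _ _) _; have := lip m 0 gm g0; rewrite subr0.
    by move: Psi0 mr; move: (`|_|) (`|_|) (`|_|) => *; lra.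
  - by rewrite /Psi !mulmxDl ma h4.
pose sq k := iter k Psi 0.
have gk k : good (sq k) by elim: k => [|k IH]; [exact: g0|exact: gPsi].
have step k : `|sq k.+1 - sq k| <= (r / 2) / 2 ^+ k.
  elim: k => [|k IH]; first by rewrite expr0 divr1 subr0.
  apply: le_trans (lip _ _ (gk k.+1) (gk k)) _; rewrite exprS invfM mulrCA.
  by rewrite ler_pM2l // invr_gt0.
have [m hm] := geom_cvg step.
have lim_eq0 (x : E) c : (forall k, `|x| <= c / 2 ^+ k) -> x = 0.
  by move=> h; apply/eqP; rewrite -normr_eq0; apply/eqP; exact: half_pow_eq0 h.
have cm : cent s m.
  apply/centP => e es; apply: (@lim_eq0 _ (D%:R * (2 * (r / 2)) * `|adm e|)) => k.
  have [/centP ck _ _] := gk k.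
  have -> : B m e = (m - sq k) *m adm e by rewrite admE B_subl ck // subr0.
  apply: le_trans (norm_mulmx _ _) _.
  rewrite [leRHS]mulrAC ler_wpM2r // -mulrA ler_wpM2l //.
have mr : `|m| <= r.
  apply/ler_addgt0Pr => e' e'0.
  have [k hk] : exists k, 2 * (r / 2) / 2 ^+ k < e'.
    apply: contrapT => /forallNP nk; suff : e' = 0 by move=> z; rewrite z ltxx in e'0.
    apply: (@half_pow_eq0 _ _ (2 * (r / 2))) => [|k]; first exact: ltW.
    by rewrite leNgt; apply/negP/nk.
  have [_ kr _] := gk k.
  have := ler_normD (m - sq k) (sq k); rewrite subrK => /le_trans; apply.
  by rewrite addrC; apply: lerD => //; apply: le_trans (hm k) (ltW hk).
have [be be0 hB] := B_bounded.
(* The fixed point equation for the limit [m]; by the properties of [Z] it means that [f *m ex m 1]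
   commutes with [w]. *)
have NZ : f *m ex m 1 *m Z = 0.
  apply: (@lim_eq0 _ (nz * (((2 * nz)^-1 + be * `|w|) * (2 * (r / 2))) + r / 2)) => k.
  have [_ kr _] := gk k.
  have -> : f *m ex m 1 *m Z = (f *m ex m 1 - f *m ex (sq k) 1) *m Z + (sq k.+1 - sq k).
    rewrite mulmxBl; have -> : sq k.+1 - sq k = f *m ex (sq k) 1 *m Z.
      by rewrite /sq iterS -/(sq k) /Psi addrC addKr.
    by rewrite subrK.
  rewrite mulrDl; apply: le_trans (ler_normD _ _) _; apply: lerD; last exact: step.
  apply: le_trans (nZ _) _; rewrite -mulrA ler_pM2l // -mulrA.
  apply: (@le_trans _ _ (((2 * nz)^-1 + be * `|w|) * `|m - sq k|)); last first.
    by rewrite ler_wpM2l // addr_ge0 ?mulr_ge0 // ltW.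
  have := ler_normD (f *m ex m 1 - f *m ex (sq k) 1 - B w (m - sq k)) (B w (m - sq k)).
  rewrite subrK => /le_trans; apply; rewrite mulrDl; apply: lerD; first exact: est.
  exact: hB.
exists (b *m ex m 1); first exact: GamS.
rewrite mulmxA -/f -admE.
have NK : (f *m ex m 1 <= K)%MS by rewrite centmxP; exact: cent_ex.
by have [_ _ h _] := hZ _ NK; exact: h.
Qed.

End form.

Lemma form_bounded (S : 'M[R]_D) (u : E) : `|mxform S u u| <= (D%:R * (D%:R * `|S|)) * `|u| ^+ 2.
Proof.
apply: le_trans (mx_norm_ge (u *m S *m u^T) 0 0) _.
apply: le_trans (norm_mulmx _ _) _.
apply: (@le_trans _ _ (D%:R * (D%:R * `|u| * `|S|) * `|u|)).
  apply: ler_pM; rewrite ?mulr_ge0 ?norm_trmx // ler_wpM2l //; exact: norm_mulmx.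
by rewrite le_eqVlt; apply/orP; left; apply/eqP; ring.
Qed.

(* By induction on dim (cent s): a point w of the closure of the orbit of u
   where <., v> is maximal commutes with v; if w is central in cent s then u = w,
   otherwise the slice moves u into the smaller algebra cent (w :: s). *)
Theorem conjugate_commuting s u v : cent s u -> cent s v ->
  exists2 a, Gam (cent s) a & B (u *m a) v = 0.
Proof.
have GT1 : Gam setT 1%:M by exact: Gam1.
have [S [S_sym S_pos S_inv]] := invariant_form GT1 (@Gam_mul setT) (@Gam_inv setT) Gam_bounded.
move: {2}(\rank (centmx s)).+1 (ltnSn (\rank (centmx s))) => k.
elim: k s u => // k IH s u rk cu cv.
pose O := [set u *m a | a in [set a | Gam (cent s) a]].
have subT a : Gam (cent s) a -> Gam setT a by apply: Gam_sub.
have cO : compact (closure O).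
  apply: bounded_closed_compact; last exact: closed_closure.
  exists (C0 * `|u| + 1); split; first exact: num_real.
  move=> x xC w wO; have [_ [a Ga <-] wa] := closure_dist wO ltr01.
  have := ler_normD (w - u *m a) (u *m a); rewrite subrK => /le_trans; apply.
  apply: le_trans (ltW xC); rewrite addrC; apply: lerD; last exact: ltW.
  by apply: Gam_bounded; exact: subT.
have O0 : closure O !=set0.
  by exists u; apply: subset_closure; exists 1%:M; [exact: Gam1|rewrite mulmx1].
have cl : continuous (fun w => mxform S w v).
  move=> w; apply: differentiable_continuous.
  have d1 : differentiable (fun w : E => w *m S *m v^T) w.
    apply: diff_mulmx; last exact: differentiable_cst.
    by apply: diff_mulmx; [apply: ex_diff; exact: is_diff_id|exact: differentiable_cst].
  by have /diff_mxP := d1; apply.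
have [|w wO wmax] := compact_EVT_max O0 cO (f := fun w => mxform S w v).
  exact: continuous_subspaceT.
rewrite inE in wO.
have app (e : R) : 0 < e -> exists2 a, Gam (cent s) a & `|w - u *m a| < e.
  by move=> e0; have [_ [a Ga <-] wa] := closure_dist wO e0; exists a.
have cw : cent s w.
  apply/centP => e es; apply/eqP; rewrite -normr_le0; apply/ler_addgt0Pr => d d0; rewrite add0r.
  have d1 : 0 < d / (D%:R * `|adm e| + 1) by rewrite divr_gt0 // ltr_wpDl // mulr_ge0.
  have [a Ga wa] := app _ d1.
  have /centP ca := Gam_cent Ga cu.
  have -> : B w e = (w - u *m a) *m adm e by rewrite admE B_subl ca // subr0.
  apply: le_trans (norm_mulmx _ _) _; rewrite mulrAC mulrC.
  apply: le_trans (ler_wpM2r _ (ltW wa)) _; first by rewrite mulr_ge0.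
  by rewrite mulrAC ler_pdivrMr ?ltr_wpDl ?mulr_ge0 // ler_wpM2l ?lerDl // ltW.
have Oex m t : cent s m -> closure O (w *m ex m t).
  move=> hm Q /nbhs_ballP[e /= e0 hQ].
  have d1 : 0 < e / (D%:R * `|ex m t| + 1) by rewrite divr_gt0 // ltr_wpDl // mulr_ge0.
  have [a Ga wa] := app _ d1; exists (u *m (a *m ex m t)); split.
    by exists (a *m ex m t) => //; exact: GamS.
  apply: hQ; rewrite -ball_normE /= mulmxA -mulmxBl.
  apply: le_lt_trans (norm_mulmx _ _) _; rewrite mulrAC mulrC.
  have p1 : 0 < D%:R * `|ex m t| + 1 by rewrite ltr_wpDl // mulr_ge0.
  apply: (@le_lt_trans _ _ (`|w - u *m a| * (D%:R * `|ex m t| + 1))).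
    by rewrite ler_wpM2l // lerDl.
  by rewrite -ltr_pdivlMr.
(* The closure of the orbit is stable under [ex m t], so 0 is a maximum of the product with [v]
   along this curve. *)
have crit m : cent s m -> mxform S (B w m) v = 0.
  move=> hm; pose phi t := mxform S (w *m ex m t) v.
  have dphi t : isd phi t (mxform S (B (w *m ex m t) m) v) by exact: isd_form.
  have /isd_val h0 : isd phi 0 0.
    apply: (@derive1_at_max R phi (-1) 1 0) => [|t _||t _].
    - by lra.
    - by case: (dphi t).
    - by rewrite in_itv /= ltrN10 ltr01.
    - rewrite /phi ex0 mulmx1; apply: wmax; rewrite inE; exact: Oex.
  by have /isd_val := dphi 0; rewrite h0 ex0 mulmx1 => <-.
(* Take [m = B v w], which lies in [cent s]: by skewness the critical equation says that the square
   norm of [B v w] is 0. *)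
have wv : B w v = 0.
  rewrite B_anti; have cvw : cent s (B v w) by exact: cent_br.
  have := crit _ cvw; rewrite B_anti /mxform !mulNmx mxE -/(mxform S _ v).
  rewrite (form_skew S_inv) opprK => /(form_eq0 S_pos) ->; by rewrite oppr0.
have [cen|/existsNP[m /not_implyP[hm nm]]] := pselect (forall m, cent s m -> B w m = 0).
  (* A central [w] is fixed by the group, so all points of the orbit have the same distance to [w]
     for [S]; since they accumulate at [w], this distance is 0. *)
  have uw : u = w.
    apply/eqP; rewrite -subr_eq0; apply/eqP; apply: (form_eq0 S_pos).
    apply/eqP; rewrite -normr_le0; apply/ler_addgt0Pr => d d0; rewrite add0r.
    pose c := D%:R * (D%:R * `|S|) + 1.
    have c0 : 0 < c by rewrite ltr_wpDl // !mulr_ge0.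
    have d1 : 0 < Num.sqrt (d / c) by rewrite sqrtr_gt0 divr_gt0.
    have [a Ga wa] := app _ d1.
    have -> : mxform S (u - w) (u - w) = mxform S (u *m a - w) (u *m a - w).
      by rewrite -{3 4}(Gam_fix cen Ga) -mulmxBl mxform_mul S_inv //; exact: subT.
    apply: le_trans (form_bounded _ _) _; rewrite distrC.
    apply: (@le_trans _ _ (c * (d / c))); last by rewrite mulrC divfK // gt_eqF.
    apply: ler_pM; [by rewrite !mulr_ge0|exact: sqr_ge0|by rewrite lerDl|].
    have dc : 0 <= d / c by rewrite divr_ge0 // ltW.
    by rewrite -[leRHS](sqr_sqrtr dc) ler_sqr ?nnegrE ?sqrtr_ge0 // ltW.
  by exists 1%:M; [exact: Gam1|rewrite mulmx1 uw].
have [a1 Ga1 h1] := slice S_pos S_inv cw cu app.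
have c1 : cent (w :: s) (u *m a1) by rewrite /= h1 eqxx /=; exact: Gam_cent.
have c2 : cent (w :: s) v by rewrite /= B_anti wv oppr0 eqxx.
(* [m] is in [cent s] but does not commute with [w], so adding [w] to the list lowers the
   dimension. *)
have rlt : (\rank (centmx (w :: s)) < k)%N.
  apply: leq_trans (rk : (\rank (centmx s) <= k)%N); apply: rank_ltmx.
  rewrite /ltmx capmxSr /=; apply/negP => le.
  have : (m <= kermx (adm w) :&: centmx s)%MS by apply: submx_trans le; rewrite centmxP.
  rewrite sub_capmx => /andP[/sub_kermxP]; rewrite admE B_anti => /eqP; rewrite oppr_eq0 => /eqP.
  by move/nm.
have [a2 Ga2 h2] := IH _ _ rlt c1 c2.
exists (a1 *m a2); last by rewrite mulmxA.
by apply: Gam_mul => //; apply: Gam_sub Ga2 => x /= /andP[].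
Qed.

End CompactLie.

(** * A basis of a function space dual to evaluation at points *)

Section Interpolation.
Context {R : realType}.

(* V is finite-dimensional since Jt is injective on it; a biorthogonal system of
   points and functions of maximal size is a basis. *)
Lemma interpolation (T : Type) (V : set (T -> R)) m (Jt : (T -> R) -> 'rV[R]_m) :
  V (fun=> 0) -> (forall (a : R) F G, V F -> V G -> V (fun p => a * F p + G p)) ->
  (forall (a : R) F G, V F -> V G -> Jt (fun p => a * F p + G p) = a *: Jt F + Jt G) ->
  (forall F, V F -> Jt F = 0 -> forall p, F p = 0) ->
  exists D (x : 'I_D -> T) (b : 'I_D -> T -> R), [/\ forall j, V (b j),
    forall j k, b j (x k) = (j == k)%:R &
    forall F, V F -> forall p, F p = \sum_j F (x j) * b j p].
Proof.
move=> V0 Vlin Jlin Jinj.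
have J0 : Jt (fun=> 0) = 0.
  have := Jlin 1 _ _ V0 V0; rewrite scale1r; have -> : (fun _ : T => 1 * 0 + 0 : R) = (fun=> 0).
    by apply/funext => p; rewrite mulr0 addr0.
  by move=> /esym/eqP; rewrite -subr_eq0 addrK => /eqP.
have Vsum D (b : 'I_D -> T -> R) (u : 'I_D -> R) (r : seq 'I_D) : (forall j, V (b j)) ->
    V (fun p => \sum_(j <- r) u j * b j p) /\
    Jt (fun p => \sum_(j <- r) u j * b j p) = \sum_(j <- r) u j *: Jt (b j).
  move=> hb; elim: r => [|j r [IH1 IH2]].
    have -> : (fun p => \sum_(j <- [::]) u j * b j p) = (fun=> 0) by apply/funext => p; rewrite big_nil.
    by rewrite big_nil.
  have -> : (fun p => \sum_(i <- j :: r) u i * b i p) = (fun p => u j * b j p + \sum_(i <- r) u i * b i p).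
    by apply/funext => p; rewrite big_cons.
  by rewrite big_cons -IH2; split; [exact: Vlin|exact: Jlin].
pose Q D := exists (x : 'I_D -> T) (b : 'I_D -> T -> R), (forall j, V (b j)) /\
  (forall j k, b j (x k) = (j == k)%:R).
have Q0 : exists D, `[< Q D >].
  by exists 0%N; apply/asboolP; exists (fun i : 'I_0 => False_rect _ (notF (ltn_ord i))),
    (fun _ _ => 0); split=> -[].
have Qm D : `[< Q D >] -> (D <= m)%N.
  move=> /asboolP[x [b [hb bx]]].
  suff : row_free (\matrix_j Jt (b j)) by rewrite /row_free => /eqP <-; exact: rank_leq_col.
  rewrite -kermx_eq0; apply/negPn/negP => /rowV0Pn[u /sub_kermxP uA u0].
  have [Vs Js] := Vsum D b (fun j => u 0 j) (index_enum _) hb.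
  have z : Jt (fun p => \sum_j u 0 j * b j p) = 0.
    by rewrite Js; apply: (etrans _ uA); rewrite mulmx_sum_row; apply: eq_bigr => j _; rewrite rowK.
  case/negP: u0; apply/eqP/rowP => k; have := Jinj _ Vs z (x k).
  rewrite (bigD1 k) //= bx eqxx mulr1 big1 => [|j jk]; last by rewrite bx (negPf jk) mulr0.
  by rewrite addr0 mxE.
case: (ex_maxnP Q0 Qm) => D /asboolP[x [b [hb bx]]] Dmax.
exists D, x, b; split=> // F VF y.
have [VS _] := Vsum D b (fun j => F (x j)) (index_enum _) hb.
apply/eqP; rewrite -subr_eq0; apply/negPn/negP => F'y.
pose F' p := F p - \sum_j F (x j) * b j p.
have VF' : V F'.
  have -> : F' = (fun p => -1 * (\sum_j F (x j) * b j p) + F p).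
    by apply/funext => p; rewrite /F' mulN1r addrC.
  exact: Vlin.
have F'x k : F' (x k) = 0.
  rewrite /F' (bigD1 k) //= bx eqxx mulr1 big1 => [|j jk]; last by rewrite bx (negPf jk) mulr0.
  by rewrite addr0 subrr.
pose c p := (F' y)^-1 * F' p + 0.
have Vc : V c by exact: Vlin.
have cy : c y = 1 by rewrite /c addr0 mulVf.
have cx k : c (x k) = 0 by rewrite /c F'x mulr0 addr0.
(* If interpolation fails at [y], the system can be enlarged: [c] vanishes at the old points and
   equals 1 at [y], and the old functions are corrected by multiples of [c] so as to vanish at
   [y]. *)
pose x' (i : 'I_(D + 1)) := match fintype.split i with inl j => x j | inr _ => y end.
pose b' (i : 'I_(D + 1)) := match fintype.split i with inl j => (fun p => - b j y * c p + b j p) | inr _ => c end.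
have : (D + 1 <= D)%N; last by rewrite addn1 ltnn.
apply: Dmax; apply/asboolP; exists x', b'; split=> [i|i k].
  by rewrite /b'; case: fintype.split => [j|_] //; exact: Vlin.
have eqs : (i == k) = (fintype.split i == fintype.split k) by rewrite (can_eq (@splitK _ _)).
rewrite eqs /b' /x'; case: (fintype.split i) => [j|o]; case: (fintype.split k) => [l|o'].
- by rewrite cx mulr0 add0r bx.
- by rewrite cy mulr1 addNr.
- by rewrite cx.
- by rewrite cy !ord1 eqxx.
Qed.

End Interpolation.

(** * Finite dimension of the space of Kähler functions *)

Section KahlerAlgebra.
Context {R : realType} {n : nat} {N : topologicalType}.
Variables (M : complexManifold R n N) (g : kahlerMetric M).
Hypothesis conn : connected [set: N].
Variable p0 : N.
Local Notation kah := (kah g).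
Implicit Types (F : N -> R).

(** The injective map [Jt] records the value of [F] and the 1-jet of its field at [p0]; injectivity
    is [kah_jet]. *)
Lemma kah_interpolation : exists D (x : 'I_D -> N) (b : 'I_D -> N -> R),
  [/\ forall j, kah (b j), forall j k, b j (x k) = (j == k)%:R &
    forall F, kah F -> forall p, F p = \sum_j F (x j) * b j p].
Proof.
have [i pi] := chart_cover M p0; set y := chart i p0.
pose Jt F : 'rV[R]_(1 + ((n + n) + (n + n) * (n + n))) :=
  row_mx (F p0)%:M (row_mx (HX g F i y) (mxvec (jac (HX g F i) y))).
apply: (@interpolation R N kah _ Jt).
- exact: kah_cst.
- by move=> a F G; exact: kah_lin.
- move=> a F G [sF _] [sG _].
  have dF q : chart_img i q -> differentiable (F \o chart_inv i) q by exact: Cn_diff (smooth_cn i 0 sF).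
  have dG q : chart_img i q -> differentiable (G \o chart_inv i) q by exact: Cn_diff (smooth_cn i 0 sG).
  have yi : chart_img i y by exact: img_ch.
  have ne : \forall z \near y, a *: HX g F i z + HX g G i z = HX g (fun p => a * F p + G p) i z.
    by apply: (near_open (img_open (i := i)) yi) => z zi; rewrite HXD; [|exact: dF|exact: dG].
  rewrite /Jt -(near_eq_jac ne) -(nbhs_singleton ne) jac_lin.
  + rewrite !scale_row_mx !add_row_mx linearP scale_scalar_mx -raddfD; by [].
  + exact: Cn_diff (HX_cn g i 0 sF) yi.
  + exact: Cn_diff (HX_cn g i 0 sG) yi.
- move=> F kF h p.
  have h1 : F p0 = 0.
    by have := congr1 (fun w => lsubmx w 0 0) h; rewrite /Jt row_mxKl linear0 !mxE eqxx mulr1n.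
  have h2 : HX g F i y = 0.
    by have := congr1 (fun w => lsubmx (rsubmx w)) h; rewrite /Jt row_mxKr row_mxKl !linear0.
  have h3 : jac (HX g F i) y = 0.
    have := congr1 (fun w => vec_mx (rsubmx (rsubmx w))) h.
    by rewrite /Jt !row_mxKr mxvecK !linear0.
  by rewrite -h1; exact: (kah_jet conn kF pi h2 h3).
Qed.

End KahlerAlgebra.

(** * The conjugation theorem for Kähler functions *)

Section KahlerConjugation.
Context {R : realType} {n : nat} {N : topologicalType}.
Variables (M : complexManifold R n N) (g : kahlerMetric M).
Hypothesis cN : compact [set: N].
Hypothesis conn : connected [set: N].
Variable p0 : N.
Variable fl : (N -> R) -> R -> N -> N.
Hypothesis flP : forall f, kah g f -> global_flow g f (fl f).
Local Notation kah := (kah g).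
Local Notation br := (br g).
Implicit Types (F H m : N -> R).

Lemma fl_hisoN m t p : kah m -> hisoN g (fl m t) p.
Proof. by move=> km; have [_ _ h _] := gf_autp (flP km) t. Qed.

Lemma kah_fl F m t : kah F -> kah m -> kah (F \o fl m t).
Proof. by move=> kF km; apply: kah_pullback => // p; exact: fl_hisoN. Qed.

Lemma fl_isd F m p t : kah F -> kah m -> isd (fun t => F (fl m t p)) t (br F m (fl m t p)).
Proof.
move=> [sF _] km; have sm := km.1.
exact: (icv_derive sF sm (gf_icv (flP km) p t)).
Qed.

Lemma br_flow F m t p : kah F -> kah m -> br F m (fl m t p) = br (F \o fl m t) m p.
Proof.
move=> kF km; have h1 := fl_isd p 0 (kah_fl t kF km) km; rewrite (gf0 (flP km)) in h1.
have h2 := @isd_rescale _ _ (fun t => F (fl m t p)) 1 t 0 (br F m (fl m t p)).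
rewrite mulr0 add0r scale1r in h2; have {}h2 := h2 (fl_isd p t kF km).
have e : (fun s => (F \o fl m t) (fl m s p)) = (fun s => F (fl m (1 * s + t) p)).
  by apply/funext => s; rewrite /= -(gfD (flP km)) mul1r addrC.
by rewrite e in h1; rewrite -(isd_val h1) -(isd_val h2).
Qed.

Fixpoint centf (s : seq (N -> R)) F : Prop :=
  if s is e :: s' then (forall p, br F e p = 0) /\ centf s' F else True.

Fixpoint allkah (s : seq (N -> R)) : Prop := if s is e :: s' then kah e /\ allkah s' else True.

(** The counterpart of [Gam (cent s)] on the manifold. A matrix [a] acts as [F |-> F \o phi], so
    multiplying by [cex m t] on the right is composing with [fl m t] on the right. *)
Inductive Gen (s : seq (N -> R)) : (N -> N) -> Prop :=
| Gen1 : Gen s idfun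
| GenS phi m t : Gen s phi -> kah m -> centf s m -> Gen s (phi \o fl m t).

Section coordinates.
Variables (D : nat) (x : 'I_D -> N) (b : 'I_D -> N -> R).
Hypothesis kb : forall j, kah (b j).
Hypothesis bx : forall j k, b j (x k) = (j == k)%:R.
Hypothesis interp : forall F, kah F -> forall p, F p = \sum_j F (x j) * b j p.

Definition re (u : 'rV[R]_D) (p : N) : R := \sum_j u 0 j * b j p.
Definition co F : 'rV[R]_D := \row_j F (x j).

Lemma kah_re u : kah (re u).
Proof.
suff h (r : seq 'I_D) : kah (fun p => \sum_(j <- r) u 0 j * b j p) by exact: h.
elim: r => [|j r IH].
  have -> : (fun p => \sum_(j <- [::]) u 0 j * b j p) = (fun=> 0) by apply/funext => p; rewrite big_nil.
  exact: kah_cst.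
have -> : (fun p => \sum_(i <- j :: r) u 0 i * b i p) = (fun p => u 0 j * b j p + \sum_(i <- r) u 0 i * b i p).
  by apply/funext => p; rewrite big_cons.
exact: (kah_lin (u 0 j) (kb j) IH).
Qed.

Lemma coK F : kah F -> re (co F) = F.
Proof.
move=> kF; apply/funext => p; rewrite (interp kF p).
by apply: eq_bigr => j _; rewrite mxE.
Qed.

Lemma reK u : co (re u) = u.
Proof.
apply/rowP => k; rewrite mxE /re (bigD1 k) //= bx eqxx mulr1 big1 ?addr0 // => j jk.
by rewrite bx (negPf jk) mulr0.
Qed.

(** The interpolation identity for [F \o fl m t] differentiated at [t = 0] expresses the bracket as
    a combination of the [b j]; the Killing equation is not touched. *)
Lemma kah_br F m : kah F -> kah m -> kah (br F m).
Proof.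
move=> kF km; suff -> : br F m = re (co (br F m)) by exact: kah_re.
apply/funext => p; have h := fl_isd p 0 kF km; rewrite (gf0 (flP km)) in h.
rewrite -(isd_val h); apply: isd_val.
have h2 j : isd (fun t => F (fl m t (x j)) * b j p) 0 (co (br F m) 0 j * b j p).
  have hj := fl_isd (x j) 0 kF km; rewrite (gf0 (flP km)) in hj.
  by apply: isd_eq (isd_mul hj (isd_cst (b j p) 0)) _; rewrite mulr0 addr0 mxE.
apply: isd_ext (isd_sum (index_enum _) h2).
by near=> t; rewrite -(interp (kah_fl t kF km)).
Unshelve. all: by end_near. Qed.

Definition cB (u v : 'rV[R]_D) : 'rV[R]_D := co (br (re u) (re v)).
Definition cex (m : 'rV[R]_D) (t : R) : 'M[R]_D := \matrix_i co (b i \o fl (re m) t).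

Lemma re_cB u v : re (cB u v) = br (re u) (re v).
Proof. by apply: coK; apply: kah_br; exact: kah_re. Qed.

Lemma re_lin (a : R) u v : re (a *: u + v) = (fun p => a * re u p + re v p).
Proof.
apply/funext => p; rewrite /re mulr_sumr -big_split; apply: eq_bigr => j _ /=.
by rewrite !mxE mulrDl mulrA.
Qed.

Lemma cB_linl (a : R) u v w : cB (a *: u + v) w = a *: cB u w + cB v w.
Proof.
apply/rowP => j; rewrite !mxE re_lin br_lin //; try exact: (kah_re _).1.
exact: (kah_lin a (kah_re u) (kah_re v)).1.
Qed.

Lemma cB_anti u v : cB u v = - cB v u.
Proof. by apply/rowP => j; rewrite !mxE br_anti //; exact: (kah_re _).1. Qed.

Lemma cexE (u m : 'rV[R]_D) t : u *m cex m t = co (re u \o fl (re m) t).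
Proof.
apply/rowP => j; rewrite !mxE /= /re; apply: eq_bigr => i _; by rewrite !mxE.
Qed.

Lemma re_cex (u m : 'rV[R]_D) t : re (u *m cex m t) = re u \o fl (re m) t.
Proof. by rewrite cexE coK //; apply: kah_fl; exact: kah_re. Qed.

Lemma mulmx_inj (A A' : 'M[R]_D) : (forall u : 'rV[R]_D, u *m A = u *m A') -> A = A'.
Proof. by move=> h; apply/row_matrixP => i; rewrite !rowE h. Qed.

Lemma cex0 (m : 'rV[R]_D) : cex m 0 = 1%:M.
Proof.
apply: mulmx_inj => u; rewrite cexE mulmx1 -[RHS]reK; congr co; apply/funext => p.
by rewrite /= (gf0 (flP (kah_re m))).
Qed.

Lemma cexD (m : 'rV[R]_D) s t : cex m (s + t) = cex m s *m cex m t.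
Proof.
apply: mulmx_inj => u; rewrite mulmxA !cexE; congr co; apply/funext => p.
by rewrite /= (gfD (flP (kah_re m))) coK //; apply: kah_fl; exact: kah_re.
Qed.

Lemma cex_isd (m u : 'rV[R]_D) t : isd (fun t => u *m cex m t) t (cB (u *m cex m t) m).
Proof.
apply/isd_mxP => i j; rewrite ord1 mxE re_cex -br_flow; [|exact: kah_re|exact: kah_re].
apply: isd_ext (fl_isd (x j) t (kah_re u) (kah_re m)).
by near=> s; rewrite cexE mxE.
Unshelve. all: by end_near. Qed.

Lemma cexB (m : 'rV[R]_D) t (u v : 'rV[R]_D) : cB (u *m cex m t) (v *m cex m t) = cB u v *m cex m t.
Proof.
rewrite /cB !re_cex cexE re_cB; congr co; apply/funext => p.
have h q := fl_hisoN t q (kah_re m).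
by apply: br_push => //; exact: (kah_re _).1.
Qed.

Lemma Gam_phi (h : set 'rV[R]_D) a : Gam cex h a -> exists phi, forall u : 'rV[R]_D, u *m a = co (re u \o phi).
Proof.
suff H : Gam cex h a -> exists phi, forall u : 'rV[R]_D, re (u *m a) = re u \o phi.
  by move=> /H[phi hphi]; exists phi => u; rewrite -hphi reK.
elim=> [|a' m t _ [phi hphi] hm]; first by exists idfun => u; rewrite mulmx1.
exists (phi \o fl (re m) t) => u; rewrite mulmxA re_cex hphi; by [].
Qed.

(** The coordinates of a transformed function are values of the original one at other points,
    bounded independently of the transformation by compactness. *)
Lemma Gam_bdd : exists C : R, forall a (u : 'rV[R]_D), Gam cex setT a -> `|u *m a| <= C * `|u|.
Proof.
have /choice[c hc] (j : 'I_D) : exists c : R, forall p, `|b j p| <= c.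
  by apply: (smooth_bounded cN); exact: (kb j).1.
have c0 j : 0 <= c j by apply: le_trans (hc j p0).
exists (\sum_j c j) => a u /Gam_phi[phi ->].
apply: mx_norm_le => [|i j]; first by rewrite mulr_ge0 // sumr_ge0.
rewrite mxE /= /re; apply: le_trans (ler_norm_sum _ _ _) _; rewrite mulr_suml.
by apply: ler_sum => k _; rewrite normrM mulrC ler_pM // mx_norm_ge.
Qed.

Lemma cB_co F H : kah F -> kah H -> cB (co F) (co H) = co (br F H).
Proof. by move=> kF kH; rewrite /cB !coK. Qed.

Lemma cB_eq0 F H : kah F -> kah H -> cB (co F) (co H) = 0 <-> forall p, br F H p = 0.
Proof.
move=> kF kH; rewrite cB_co //; split=> [h p|h].
  rewrite -(coK (kah_br kF kH)) h /re big1 // => j _; by rewrite mxE mul0r.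
by apply/rowP => j; rewrite !mxE h.
Qed.

Lemma cent_co s F : allkah s -> kah F -> centf s F <-> cent cB (map co s) (co F).
Proof.
move=> + kF; elim: s => [|e s IH] //= [ke ks].
split=> [[h1 /(IH ks) h2]|/andP[/eqP/(cB_eq0 kF ke) h1 /(IH ks)]] //.
by rewrite h2 andbT; apply/eqP/(cB_eq0 kF ke).
Qed.

Lemma Gam_Gen s a : allkah s -> Gam cex (cent cB (map co s)) a ->
  exists2 phi, Gen s phi & forall u : 'rV[R]_D, re (u *m a) = re u \o phi.
Proof.
move=> ks; elim=> [|a' m t _ [phi gphi hphi] hm].
  by exists idfun; [exact: Gen1|move=> u; rewrite mulmx1].
exists (phi \o fl (re m) t); last by move=> u; rewrite mulmxA re_cex hphi.
apply: GenS => //; first exact: kah_re.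
by apply/(cent_co ks (kah_re m)); rewrite reK.
Qed.

Lemma kah_conj0 s F H : allkah s -> kah F -> kah H -> centf s F -> centf s H ->
  exists2 phi, Gen s phi & forall p, br (F \o phi) H p = 0.
Proof.
move=> ks kF kH /(cent_co ks kF) cF /(cent_co ks kH) cH.
have [C hC] := Gam_bdd.
have [a Ga h] := conjugate_commuting cB_linl cB_anti cex0 cexD cex_isd cexB hC cF cH.
have [phi gphi hphi] := Gam_Gen ks Ga; exists phi => //.
have e : F \o phi = re (co F *m a) by rewrite hphi coK.
have kFp : kah (F \o phi) by rewrite e; exact: kah_re.
by apply/(cB_eq0 kFp kH); rewrite e reK.
Qed.

End coordinates.

Theorem kah_conj s F H : allkah s -> kah F -> kah H -> centf s F -> centf s H ->
  exists2 phi, Gen s phi & forall p, br (F \o phi) H p = 0.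
Proof.
have [D [x [b [kb bx interp]]]] := kah_interpolation g conn p0.
exact: (kah_conj0 kb bx interp).
Qed.

Lemma Gen_cat s phi psi : Gen s phi -> Gen s psi -> Gen s (phi \o psi).
Proof. by move=> h; elim=> [//|psi' m t _ IH km cm]; exact: (GenS t IH km cm). Qed.

Lemma Gen_cons e s phi : Gen (e :: s) phi -> Gen s phi.
Proof. by elim=> [|phi' m t _ IH km /= [_ cm]]; [exact: Gen1|exact: GenS]. Qed.

Lemma Gen_autp s phi : Gen s phi -> exists psi, autp g phi psi.
Proof.
elim=> [|phi' m t _ [psi hpsi] km cm]; first by exists idfun; exact: autp_id.
by exists (fl m (- t) \o psi); exact: (autp_comp hpsi (gf_autp (flP km) t)).
Qed.

Lemma fl_fix F m t p : kah F -> kah m -> (forall p, br F m p = 0) -> F (fl m t p) = F p.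
Proof.
move=> kF km h; have := @isd_const1 R (fun t => F (fl m t p)) t.
rewrite (gf0 (flP km)); apply => s _.
by apply: isd_eq (fl_isd p s kF km) _; rewrite h.
Qed.

Lemma br_sym0 F H : kah F -> kah H -> (forall p, br F H p = 0) -> forall p, br H F p = 0.
Proof. by move=> [sF _] [sH _] h p; rewrite (br_anti g p sH sF) h oppr0. Qed.

Lemma Gen_fix s e phi : kah e -> Gen (e :: s) phi -> e \o phi = e.
Proof.
move=> ke; elim=> [//|phi' m t _ IH km /= [h _]]; apply/funext => p.
exact: (etrans (congr1 (@^~ (fl m t p)) IH) (fl_fix t p ke km (br_sym0 km ke h))).
Qed.

(** The flows in [Gen s] fix the members of [s], and the bracket is invariant under flows. *)
Lemma Gen_centf s F phi : allkah s -> kah F -> Gen s phi -> centf s F ->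
  kah (F \o phi) /\ centf s (F \o phi).
Proof.
move=> ks kF; elim=> [cF|phi' m t _ IH km cm /IH[kFp cFp]]; first by split; [exact: kF|exact: cF].
split; first exact: (kah_fl t kFp km).
elim: s ks cm cFp {IH} => [//|e s IH] /= [ke ks] [me cm] [h cF]; split; last exact: (IH ks cm cF).
move=> p; have ee : e = e \o fl m t.
  by apply/funext => q; rewrite /= (fl_fix t q ke km (br_sym0 km ke me)).
have := @br_push _ _ _ _ g (fl m t) (F \o phi') e p (fun q => fl_hisoN t q km) kFp.1 ke.1.
by rewrite -ee h => hh; exact: hh.
Qed.

End KahlerConjugation.

(** * The identity component of the automorphism group is a group containing the flows *)

Section IdentityComponent.
Context {R : realType} {n : nat} {N : topologicalType}.
Variables (M : complexManifold R n N) (g : kahlerMetric M).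
Local Notation CO := {compact-open, N -> N}.
Implicit Types (phi psi : N -> N).

Lemma rtrans_continuous psi : continuous psi -> continuous ((fun phi => phi \o psi) : CO -> CO).
Proof.
move=> cpsi phi.
have FF : Filter ((fun f : CO => f \o psi : CO) @ (phi : CO)) by exact: (@fmap_filter CO CO _ _ (nbhs_filter (phi : CO))).
apply/(@compact_open_cvgP N N _ _ FF) => K O cK oO h.
have cK' : compact (psi @` K) by apply: continuous_compact => //; exact: continuous_subspaceT.
have := compact_open_open cK' oO; rewrite openE => /(_ phi) H.
have : nbhs (phi : CO) [set h | h @` (psi @` K) `<=` O].
  by apply: H => _ [_ [q Kq <-] <-]; apply: h; exists q.
by apply: filterS => f hf _ [q Kq <-]; apply: hf; exists (psi q) => //; exists q.
Qed.

Lemma Aut0_id : Aut0 g idfun.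
Proof. by apply: connected_component_refl; exact: autp_Aut (autp_id g). Qed.

Lemma Aut0_Aut phi : Aut0 g phi -> Aut g phi.
Proof. exact: connected_component_sub. Qed.

Lemma Aut_continuous phi : Aut g phi -> continuous phi.
Proof. by move=> [_ [[c _] _]]. Qed.

Lemma Aut_comp phi psi : Aut g phi -> Aut g psi -> Aut g (phi \o psi).
Proof.
move=> /Aut_autp[i1 h1] /Aut_autp[i2 h2]; exact: autp_Aut (autp_comp h1 h2).
Qed.

Lemma component_rtrans phi chi psi : Aut g psi ->
  connected_component (Aut g : set CO) chi phi ->
  connected_component (Aut g : set CO) (chi \o psi) (phi \o psi).
Proof.
move=> Apsi [C [Cchi CA cC] Cphi].
exists ((fun h => h \o psi) @` C); last by exists phi.
split; first by exists chi.
- by move=> _ [h Ch <-]; apply: Aut_comp => //; exact: CA.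
- apply: (@connected_continuous_connected CO CO) => //.
  by apply: continuous_subspaceT; apply: rtrans_continuous; exact: Aut_continuous.
Qed.

Lemma Aut0_comp phi psi : Aut0 g phi -> Aut0 g psi -> Aut0 g (phi \o psi).
Proof.
move=> h1 h2; have h3 := component_rtrans (Aut0_Aut h2) h1.
exact: connected_component_trans h2 h3.
Qed.

Lemma Aut0_inv phi psi : autp g phi psi -> Aut0 g phi -> Aut0 g psi.
Proof.
move=> h h1; have Apsi := autp_Aut (autpV h).
have := component_rtrans Apsi h1; have -> : phi \o psi = idfun.
  by apply/funext => p /=; have [_ -> _ _] := h.
exact: connected_component_sym.
Qed.

(** The range of [Th] is connected as a continuous image of the line; continuity into the
    compact-open topology comes from joint continuity of the flow and a covering argument on the
    compact set [K]. *)
Lemma flow_Aut0 f Th t : global_flow g f Th -> Aut0 g (Th t).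
Proof.
move=> gf; exists (range Th); last by exists t.
split.
- by exists 0 => //; apply/funext => p; rewrite (gf0 gf).
- by move=> _ [s _ <-]; exact: autp_Aut (gf_autp gf s).
apply: (@connected_continuous_connected R CO); first exact/connected_intervalP.
apply: continuous_subspaceT => s; apply/compact_open_cvgP => K O /= cK oO h.
near=> r => w /= [+ + <-]; near: r.
move/compact_near_coveringP/near_covering_withinP : cK; apply.
move=> v Kv; have [[P Q] [Ps Qv] PQ] : nbhs (s, v) ((fun z : R * N => Th z.1 z.2) @^-1` O).
  by apply: (gf_cont gf); move: oO; rewrite openE; apply; apply: h; exists v.
by exists (Q, P) => // -[b a] /= [Qb Pa] Kb; exact: (PQ (a, b)).
Unshelve. all: by end_near. Qed.

Lemma inverseE phi psi : cancel phi psi -> cancel psi phi -> inverse phi = psi.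
Proof.
move=> c1 c2; apply/funext => p; rewrite /inverse; case: xgetP => [q _ <-|/(_ (psi p))]; first by rewrite c1.
by rewrite /= c2.
Qed.

End IdentityComponent.

(** * One-parameter subgroups of the torus *)

Section Torus.
Context {R : realType} {n : nat}.
Implicit Types (u v xi : 'rV[R]_n).

Lemma to_torusD u v : to_torus (u + v) = to_torus u + to_torus v.
Proof. exact: (Quotient.pi_add (@int_lattice R n)). Qed.

Lemma to_torus0 : to_torus (0 : 'rV[R]_n) = 0.
Proof.
have := to_torusD 0 0; rewrite addr0 => /esym/eqP; rewrite -subr_eq0 addrK => /eqP; by [].
Qed.

Lemma to_torus_surj (a : torus R n) : exists v, a = to_torus v.
Proof. by exists (generic_quotient.repr a); rewrite /to_torus generic_quotient.reprK. Qed.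

Lemma to_torus_eq0 v : to_torus v = 0 -> v \is a mxOver Num.int.
Proof.
rewrite -to_torus0 /to_torus => /eqP; rewrite -Quotient.idealrBE subr0; by [].
Qed.

Lemma one_param_eq0 xi : (forall t : R, to_torus (t *: xi) = 0) -> xi = 0.
Proof.
move=> h; apply/rowP => k; rewrite mxE; apply/eqP/negPn/negP => xk0.
(* At this time the [k]-th coordinate is 1/2, which is not an integer. *)
have /mxOverP/(_ 0 k) := to_torus_eq0 (h (2^-1 / xi 0 k)); rewrite mxE divfK // => /intrP[z hz].
have : (2 * z)%:~R = 1 :> R by rewrite intrM -hz mulfV // pnatr_eq0.
rewrite -[1]/(1%:~R) => /eqP; rewrite eqr_int => /eqP e.
by have := congr1 (fun z : int => odd `|z|%N) e; rewrite abszM oddM.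
Qed.

End Torus.

(** * Partial derivatives on a product *)

Section PartialDerivatives.
Context {R : realType} {V1 V2 W : normedModType R}.
Implicit Types (K : V1 * V2 -> W).

Lemma diff_partial2 K v x w : differentiable K (v, x) ->
  differentiable (fun y => K (v, y)) x /\ 'D_w (fun y => K (v, y)) x = 'D_(0, w) K (v, x).
Proof.
move=> dK; have dp : differentiable (fun y : V2 => (v, y)) x.
  by apply: differentiable_pair; [exact: differentiable_cst|apply: ex_diff; exact: is_diff_id].
have d2 : differentiable (fun y => K (v, y)) x by exact: (@differentiable_comp _ _ _ _ (fun y => (v, y)) K).
split; first exact: d2.
apply: (derive_line d2); apply: isd_ext (isd_line0 (0, w) dK).
near=> s; congr K; apply/pair_equal_spec => /=; split=> //.
by rewrite scaler0 add0r.
Unshelve. all: by end_near. Qed.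

Lemma isd_partial1 K xi x t : differentiable K (t *: xi, x) ->
  isd (fun s : R => K (s *: xi, x)) t ('D_(xi, 0) K (t *: xi, x)).
Proof.
move=> dK; have e s : s *: (xi, 0) + (0, x) = (s *: xi, x) :> V1 * V2.
  by apply/pair_equal_spec => /=; rewrite addr0 scaler0 add0r.
have := @isd_line R _ _ K (xi, 0) (0, x) t; rewrite e => /(_ dK).
by apply: isd_ext; near=> s; rewrite e.
Unshelve. all: by end_near. Qed.

End PartialDerivatives.

(** * The torus action as the flows of the components of the momentum map *)

Section Toric.
Context {R : realType} {n : nat} {N : topologicalType}.
Variables (M : complexManifold R n N) (g : kahlerMetric M).
Variables (Phi : torus R n -> N -> N) (J : N -> 'rV[R]_n).
Hypothesis toric : kahler_toric g Phi J.
Local Notation E := 'rV[R]_(n + n).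
Local Notation dom := (@chart_dom R n N M).
Local Notation ch := (@chart R n N M).
Local Notation inv := (@chart_inv R n N M).
Local Notation img := (@chart_img R n N M).
Local Notation Jx := (momentum J).
Implicit Types (xi eta : 'rV[R]_n).

Definition act (xi : 'rV[R]_n) : N -> N := Phi (to_torus xi).

Lemma act0 p : act 0 p = p.
Proof. by have [h _ _ _] := toric_smooth toric; rewrite /act to_torus0 h. Qed.

Lemma actD u v p : act (u + v) p = act u (act v p).
Proof. by have [_ h _ _] := toric_smooth toric; rewrite /act to_torusD h. Qed.

Lemma act_cont : continuous (fun vp : 'rV[R]_n * N => act vp.1 vp.2).
Proof. by have [_ _ h _] := toric_smooth toric. Qed.

Lemma act_hisoN v p : hisoN g (act v) p.
Proof. by have [psi [_ _ h _]] := Aut_autp (toric_aut toric (to_torus v)). Qed.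

Lemma J_act v p : J (act v p) = J p.
Proof. by have [_ h _] := toric_momentum toric; exact: h. Qed.

Lemma Jx_act xi v p : Jx xi (act v p) = Jx xi p.
Proof. by rewrite /momentum J_act. Qed.

Lemma Jx_lin (a : R) xi eta : Jx (a *: xi + eta) = (fun p => a * Jx xi p + Jx eta p).
Proof.
apply/funext => p; rewrite /momentum mulr_sumr -big_split; apply: eq_bigr => k _ /=.
by rewrite !mxE mulrDr mulrCA.
Qed.

Lemma Jx_smooth xi : smooth_fun M (Jx xi).
Proof.
have [sJ _ _] := toric_momentum toric; move=> i; apply/smooth_onP => k.
have oU := img_open (M := M) (i := i).
have /smooth_onP/(_ k)/(Cn_mxP _ _ oU) cJ := sJ i.
apply: (@Cn_ext _ _ _ _ _ (fun x => \sum_(l < n) (J \o inv i) x 0 l * xi 0 l)) => //.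
by apply: Cn_sum => // l _; apply: Cn_mul => //; exact: Cn_cst.
Qed.

Definition actloc i (vx : 'rV[R]_n * E) : E := ch i (act vx.1 (inv i vx.2)).

Definition actdom i : set ('rV[R]_n * E) :=
  [set vx | img i vx.2 /\ dom i (act vx.1 (inv i vx.2))].

Lemma actdom_open i : open (actdom i).
Proof.
rewrite openE => -[v x] [/= ix dx].
have n1 : \forall w \near (v, inv i x), dom i (act w.1 w.2).
  by apply: (@act_cont (v, inv i x)); exact: near_dom.
have [[P Q] /= [hP hQ] PQ] := n1.
have hQ' : \forall y \near x, Q (inv i y).
  have := near_inv (inv_dom ix) (P := Q); rewrite invK //; apply; exact: hQ.
have hi : \forall y \near x, img i y by apply: open_nbhs_nbhs; split=> //; exact: img_open.
exists (P, [set y | img i y /\ Q (inv i y)]) => /=; first by split=> //; exact: filterI.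
by move=> [w y] /= [Pw [iy Qy]]; split=> //; exact: (PQ (w, inv i y)).
Qed.

Lemma actloc_smooth i : smooth_on (actdom i) (actloc i).
Proof. by have [_ _ _ h] := toric_smooth toric; exact: h. Qed.

Lemma actdom0 i x : img i x -> actdom i (0, x).
Proof. by move=> ix; split=> //=; rewrite act0; exact: inv_dom. Qed.

Lemma actdom00 i xi x : img i x -> actdom i (0 *: xi, x).
Proof. by rewrite scale0r; exact: actdom0. Qed.

(** The momentum condition says that the fundamental field solves the equation defining the
    Hamiltonian field of [Jx xi], whose solution is unique. *)
Lemma actloc_HX i x xi : img i x -> 'D_(xi, 0) (actloc i) (0, x) = HX g (Jx xi) i x.
Proof.
move=> ix; have d := smooth_on_diff (@actloc_smooth i) (actdom00 xi ix).
have h := isd_partial1 d; rewrite scale0r in h.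
have [_ _ mm] := toric_momentum toric.
apply: (ham_uniq (kmetric_chart g i) ix); apply/rowP => j; rewrite [RHS]mxE.
have df : differentiable (Jx xi \o inv i) x by exact: Cn_diff (smooth_cn i 0 (Jx_smooth xi)) ix.
rewrite (derive_dE _ df) -(mm xi i x ix) /kform mulIE /fundamental_vfield derive1E.
by rewrite (isd_val h) /mxform trmx_delta -colE [RHS]mxE.
Qed.

Lemma act_icv xi p t : icv g (Jx xi) (fun t => act (t *: xi) p) t.
Proof.
have c0 q : icv g (Jx xi) (fun t => act (t *: xi) q) 0.
  split.
    have c1 : {for (0 : R), continuous (fun t : R => (t *: xi, q) : 'rV[R]_n * N)}.
      move=> A [[P Q] /= [hP hQ] PQ].
      have : \forall t \near (0 : R), P (t *: xi).
        by apply: (@scalel_continuous _ _ xi).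
      by apply: filterS => s Ps; apply: PQ; split=> //=; exact: nbhs_singleton hQ.
    apply: (@continuous_comp _ _ _ (fun t : R => (t *: xi, q) : 'rV[R]_n * N) (fun z => act z.1 z.2)) => //.
    exact: act_cont.
  have [i qi] := chart_cover M q; exists i; rewrite scale0r act0; split=> //.
  have d := smooth_on_diff (@actloc_smooth i) (actdom00 xi (img_ch qi)).
  have h := isd_partial1 d; rewrite scale0r actloc_HX in h; last exact: img_ch.
  by apply: isd_ext h; near=> s; rewrite /actloc /= chartK.
have h : icv g (Jx xi) (fun s => act ((s + - t) *: xi) (act (t *: xi) p)) t.
  apply: (@icv_shift _ _ _ _ g (- t) _ (fun s => act (s *: xi) (act (t *: xi) p))); first exact: Jx_smooth.
  by rewrite subrr; exact: c0.
by apply: icv_ext h; near=> s; rewrite -actD -scalerDl subrK.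
Unshelve. all: by end_near. Qed.

(** Derivatives in time and in space commute, by [schwarz] on the product: the time derivative of
    the Jacobian of the action is the Jacobian of the field. *)
Lemma act_jac i x xi : img i x ->
  isd (fun t : R => jac (fun y => actloc i (t *: xi, y)) x) 0 (jac (HX g (Jx xi) i) x).
Proof.
move=> ix; have oU := @actdom_open i; have cU k : Cn k (actdom i) (actloc i).
  by have /smooth_onP := @actloc_smooth i; apply.
have U0 := actdom0 ix; have U00 := actdom00 xi ix.
apply/isd_mxP => a j.
pose H vx := actloc i vx 0 j.
have cH k : Cn k (actdom i) H by have /(Cn_mxP _ _ oU)/(_ 0 j) := cU k.
pose d2 : 'rV[R]_n * E := (0, delta_mx 0 a); pose d1 : 'rV[R]_n * E := (xi, 0).
have jE t : actdom i (t *: xi, x) -> 'D_d2 H (t *: xi, x) = jac (fun y => actloc i (t *: xi, y)) x a j.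
  move=> Ut; have [dy De] := diff_partial2 (delta_mx 0 a) (Cn_diff (cU 0%N) Ut).
  have [_ De'] := diff_partial2 (delta_mx 0 a) (Cn_diff (cH 0%N) Ut).
  by rewrite -De' mxE (derive_mxE _ 0 j dy).
have h1 := isd_partial1 (Cn_diff (CnD d2 (cH 1%N)) U00); rewrite scale0r in h1.
have e : 'D_d1 ('D_d2 H) (0, x) = jac (HX g (Jx xi) i) x a j.
  rewrite (schwarz d1 d2 oU U0 (cH 1%N)).
  have [dz <-] := diff_partial2 (delta_mx 0 a) (Cn_diff (CnD d1 (cH 1%N)) U0).
  have dX : differentiable (HX g (Jx xi) i) x by exact: Cn_diff (HX_cn g i 0 (Jx_smooth xi)) ix.
  rewrite mxE (derive_mxE _ 0 j dX); apply: near_eq_derive.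
  apply: (near_open (img_open (i := i)) ix) => y iy.
  by rewrite -actloc_HX // (derive_mxE _ 0 j (Cn_diff (cU 0%N) (actdom0 iy))).
rewrite -e; apply: isd_ext h1.
have nU : \forall t \near (0 : R), actdom i (t *: xi, x).
  have [[P Q] /= [hP hQ] PQ] : nbhs ((0, x) : 'rV[R]_n * E) (actdom i).
    by apply: open_nbhs_nbhs; split.
  have : \forall t \near (0 : R), P (t *: xi).
    by apply: (@scalel_continuous _ _ xi); rewrite scale0r.
  by apply: filterS => s Ps; apply: PQ; split=> //=; exact: nbhs_singleton hQ.
by apply: filterS nU => t /jE.
Qed.

(** The Killing equation is the derivative at [t = 0] of [A t *m g (c t) *m (A t)^T = g x], which
    expresses that the torus acts by isometries. *)
Lemma kah_Jx xi : kah g (Jx xi).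
Proof.
split; first exact: Jx_smooth.
move=> i x ix; set X := HX g (Jx xi) i; set p := inv i x.
pose A (t : R) := jac (fun y => actloc i (t *: xi, y)) x.
have dA : isd A 0 (jac X x) by exact: act_jac.
pose c (t : R) := actloc i (t *: xi, x).
have dc : isd c 0 (X x).
  have h := isd_partial1 (smooth_on_diff (@actloc_smooth i) (actdom00 xi ix)).
  by rewrite scale0r actloc_HX in h.
have c0 : c 0 = x by rewrite /c /actloc scale0r act0 invK.
have dG : differentiable (g i) (c 0) by rewrite c0; exact: (km_diff (kmetric_chart g i)).
have A0 : A 0 = 1%:M.
  rewrite /A; have -> : jac (fun y => actloc i (0 *: xi, y)) x = jac idfun x.
    apply: near_eq_jac; apply: (near_open (img_open (i := i)) ix) => y iy.
    by rewrite /actloc scale0r act0 invK.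
  apply: jac_eq; first by apply: ex_diff; exact: is_diff_id.
  by move=> u; rewrite derive_id mulmx1.
have nE : \forall t \near (0 : R), A t *m g i (c t) *m (A t)^T = g i x.
  have nd : \forall t \near (0 : R), dom i (act (t *: xi) p).
    have [cc _] := act_icv xi p 0; apply: cc; rewrite scale0r act0.
    by apply: near_dom; exact: inv_dom.
  apply: filterS nd => t dt.
  have [Q [_ Qx _ hQ]] := hisoN_all (act_hisoN (t *: xi) p) (inv_dom ix) dt.
  by rewrite invK // in Qx hQ; have [_] := hQ _ Qx.
have h := isd_mulmx (isd_mulmx dA (isd_comp dc dG)) (isd_trmx dA).
have := isd_val h; rewrite (near_eq_derive _ nE) derive_cst A0 c0 trmx1 mulmx1 !mul1mx.
by move/esym; rewrite /killm [X in X + _]addrC.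
Unshelve. all: by end_near. Qed.

Lemma br_Jx xi eta p : br g (Jx xi) (Jx eta) p = 0.
Proof.
have := icv_derive (Jx_smooth xi) (Jx_smooth eta) (act_icv eta p 0); rewrite scale0r act0 => /isd_val <-.
have -> : (fun s : R => Jx xi (act (s *: eta) p)) = (fun=> Jx xi p) by apply/funext => s; rewrite Jx_act.
exact: derive_cst.
Qed.

Lemma act_inj xi : (forall (t : R) p, act (t *: xi) p = p) -> xi = 0.
Proof.
by move=> h; apply: one_param_eq0 => t; apply: (toric_effective toric) => p; exact: h.
Qed.

Lemma HX_cst_icv f p t : (forall i, dom i p -> HX g f i (ch i p) = 0) -> icv g f (fun=> p) t.
Proof.
move=> h; split; first exact: cvg_cst.
have [i pi] := chart_cover M p; exists i; split=> //; rewrite h //; exact: isd_cst.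
Qed.

(** The field of a constant vanishes, so the one-parameter group of [xi] acts trivially, and the
    action is effective. *)
Lemma Jx_cst xi (r : R) : (forall p, Jx xi p = r) -> xi = 0.
Proof.
move=> h; apply: act_inj => t p.
apply: (@icv_unique _ _ _ _ g (Jx xi) (fun t => act (t *: xi) p) (fun=> p) (`|t| + 1)).
- exact: Jx_smooth.
- by rewrite scale0r act0.
- move=> s _; split; first exact: act_icv.
  by apply: HX_cst_icv => i pi; apply: (@HX_near_cst _ _ _ _ g r); near=> z; rewrite h.
- by rewrite ltrDl.
Unshelve. all: by end_near. Qed.

End Toric.

(** * Kähler functions commuting with the momentum map *)

Section Centralizer.
Context {R : realType} {n : nat} {N : topologicalType}.
Variables (M : complexManifold R n N) (g : kahlerMetric M).
Variables (Phi : torus R n -> N -> N) (J : N -> 'rV[R]_n).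
Hypothesis toric : kahler_toric g Phi J.
Local Notation E := 'rV[R]_(n + n).
Local Notation I := (@MI R n).
Local Notation dom := (@chart_dom R n N M).
Local Notation ch := (@chart R n N M).
Local Notation inv := (@chart_inv R n N M).
Local Notation img := (@chart_img R n N M).
Local Notation Jx := (momentum J).
Implicit Types (xi eta : 'rV[R]_n).

Definition Jmx i (x : E) : 'M[R]_(n, n + n) := \matrix_k HX g (Jx (delta_mx 0 k)) i x.

Lemma Jmx_E i x xi : img i x -> xi *m Jmx i x = HX g (Jx xi) i x.
Proof.
move=> ix; rewrite mulmx_sum_row [in RHS](row_sum_delta xi).
have df eta : differentiable (Jx eta \o inv i) x.
  exact: Cn_diff (smooth_cn i 0 (Jx_smooth toric eta)) ix.
suff h r : \sum_(k <- r) xi 0 k *: row k (Jmx i x) = HX g (Jx (\sum_(k <- r) xi 0 k *: delta_mx 0 k)) i x by exact: h.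
elim: r => [|k r IH].
  rewrite !big_nil; apply/esym; apply: (@HX_near_cst _ _ _ _ g 0); near=> z.
  by rewrite /momentum big1 // => l _; rewrite mxE mulr0.
rewrite !big_cons Jx_lin HXD; [|exact: df|exact: df].
by rewrite IH rowK.
Unshelve. all: by end_near. Qed.

Lemma Jmx_isotropic i x xi eta : img i x ->
  mxform (I *m g i x) (xi *m Jmx i x) (eta *m Jmx i x) = 0.
Proof.
move=> ix; rewrite !Jmx_E //.
have := br_form g (Jx_smooth toric xi) (Jx_smooth toric eta) (inv_dom ix).
by rewrite (br_Jx toric) invK.
Qed.

(** The row space is isotropic, and omega applied to [w] and [w *m I] is the square norm of [w]. *)
Lemma Jmx_real i x (w : E) : img i x -> (w <= Jmx i x)%MS -> (w *m I <= Jmx i x)%MS -> w = 0.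
Proof.
move=> ix /submxP[a wa] /submxP[b wb]; have K := kmetric_chart g i.
have := Jmx_isotropic a b ix; rewrite -wa -wb mxform_mulr MIT mulmxN.
rewrite -[I *m g i x *m I]mulmxA -(km_herm K ix) mulmxA MI2 mulNmx mul1mx opprK => h.
by apply/eqP/negPn/negP => /(km_pos K ix); rewrite h ltxx.
Qed.

Lemma Cn_Jmx k i : Cn k (img i) (Jmx i).
Proof.
have oU := img_open (M := M) (i := i); apply/(Cn_mxP _ _ oU) => a b.
have /(Cn_mxP _ _ oU)/(_ 0 b) := HX_cn g i k (Jx_smooth toric (delta_mx 0 a)).
by apply: (Cn_ext oU) => x _; rewrite [RHS]mxE.
Qed.

Lemma mxform_rows m k (W : 'M[R]_m) (L : 'M[R]_(k, m)) a b :
  mxform W (delta_mx 0 a *m L) (delta_mx 0 b *m L) = (L *m W *m L^T) a b.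
Proof.
rewrite -[RHS]mxform_delta /mxform trmx_mul !mulmxA; by [].
Qed.

Lemma rank_max_derive i x xi (u : E) : img i x ->
  (forall y, img i y -> (\rank (Jmx i y) <= \rank (Jmx i x))%N) ->
  xi *m Jmx i x = 0 -> (u *m jac (HX g (Jx xi) i) x <= Jmx i x)%MS.
Proof.
move=> ix rmax xi0; set L := Jmx i x; have oU := img_open (M := M) (i := i).
have /submxP[P hP] : (row_base L <= L)%MS by rewrite eq_row_base.
pose Q := pinvmx (row_base L).
have BQ : row_base L *m Q = 1%:M by rewrite mulmxVp // row_base_free.
pose B y := P *m Jmx i y.
(* The rows of [B y] form a basis of the row space at [x]. They remain independent on [U], and since
   the rank is maximal at [x] they still span the row space there. *)
pose U := [set y | img i y /\ B y *m Q \in unitmx].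
have cBQ : Cn 0 (img i) (fun y => B y *m Q).
  apply: (@Cn_mulmx _ _ _ _ _ _ _ B (fun=> Q) oU); last exact: Cn_cst.
  exact: (@Cn_mulmx _ _ _ _ _ _ _ (fun=> P) (Jmx i) oU (Cn_cst _ _ _) (Cn_Jmx 0 i)).
have oUU : open U.
  rewrite openE => y [iy uy]; apply: filterI; first exact: open_nbhs_nbhs.
  have dd := Cn_diff (Cn_det oU cBQ) iy.
  have d0 : 0 < `|\det (B y *m Q)| by rewrite normr_gt0 -unitfE -unitmxE.
  apply: filterS ((cvgrPdist_lt _ _).1 (differentiable_continuous dd) _ d0) => z.
  rewrite unitmxE unitfE; apply: contraTneq => ->.
  by rewrite subr0 ltxx.
have Ux : U x by split=> //; rewrite /B -/L -hP BQ unitmx1.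
(* A differentiable projection onto the row space at [y]. The field satisfies [X = X *m T] near [x]
   and vanishes at [x], so its derivative there is itself multiplied by [T x]. *)
pose T y := Q *m invmx (B y *m Q) *m B y.
have cT : Cn 0 U T.
  have sU : U `<=` img i by move=> y [].
  have cB : Cn 0 U B.
    exact: (@Cn_mulmx _ _ _ _ _ _ _ (fun=> P) (Jmx i) oUU (Cn_cst _ _ _) (Cn_sub sU (Cn_Jmx 0 i))).
  apply: (@Cn_mulmx _ _ _ _ _ _ _ (fun y => Q *m invmx (B y *m Q)) B oUU) => //.
  apply: (@Cn_mulmx _ _ _ _ _ _ _ (fun=> Q) (fun y => invmx (B y *m Q)) oUU); first exact: Cn_cst.
  by apply: Cn_invmx => // [y []//|]; exact: Cn_sub cBQ.
have XT y : U y -> HX g (Jx xi) i y = HX g (Jx xi) i y *m T y.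
  move=> [iy uy]; rewrite -Jmx_E //.
  have BL : (B y <= Jmx i y)%MS by exact: submxMl.
  have LB : (Jmx i y <= B y)%MS.
    rewrite -(mxrank_leqif_sup BL) eqn_leq (mxrankS BL) /=.
    apply: leq_trans (rmax y iy) _; have := mxrankM_maxl (B y) Q; rewrite mxrank_unit //.
  have /submxP[c ->] : (xi *m Jmx i y <= B y)%MS by exact: submx_trans (submxMl _ _) LB.
  rewrite /T; move: (B y) c uy {BL LB} => b c uy.
  transitivity (c *m ((b *m Q) *m invmx (b *m Q)) *m b); last by rewrite !mulmxA.
  by rewrite mulmxV // mulmx1.
have dX : differentiable (HX g (Jx xi) i) x by exact: Cn_diff (HX_cn g i 0 (Jx_smooth toric xi)) ix.
have X0 : HX g (Jx xi) i x = 0 by rewrite -Jmx_E.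
have : 'D_u (HX g (Jx xi) i) x = 'D_u (fun y => HX g (Jx xi) i y *m T y) x.
  by apply: near_eq_derive; apply: (near_open oUU Ux).
rewrite (derive_mulmx u dX (Cn_diff cT Ux)) X0 mul0mx addr0 (jacE u dX) => ->.
rewrite /T /B mulmxA; apply: submx_trans (submxMl _ _) _; exact: submxMl.
Qed.

(* A point where the rank of the infinitesimal action is maximal: a field
   X_xi vanishing there has its derivative in L = span (X_eta), and this derivative
   is complex linear while L meets I L trivially, so the 1-jet of X_xi vanishes. *)
Lemma free_point : exists i x, img i x /\ row_free (Jmx i x).
Proof.
have [q _] := toric_nonempty toric; have [i0 qi0] := chart_cover M q.
pose P r := `[< exists i x, img i x /\ \rank (Jmx i x) = r >].
have P0 : exists r, P r.
  by exists (\rank (Jmx i0 (ch i0 q))); apply/asboolP; exists i0, (ch i0 q); split=> //; exact: img_ch.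
have Pn r : P r -> (r <= n)%N by move=> /asboolP[i [x [_ <-]]]; exact: rank_leq_row.
case: (ex_maxnP P0 Pn) => r /asboolP[i [x [ix rx]]] rmax; exists i, x; split=> //.
rewrite -kermx_eq0; apply/negPn/negP => /rowV0Pn[xi /sub_kermxP xi0 /negP]; apply.
have rm y : img i y -> (\rank (Jmx i y) <= \rank (Jmx i x))%N.
  by move=> iy; rewrite rx; apply: rmax; apply/asboolP; exists i, y.
have [sJ kJ] := kah_Jx toric xi.
have hol := kill_holomorphic (kmetric_chart g i) ix (smooth_cn i 2 sJ) (kJ i x ix).
have j0 : jac (HX g (Jx xi) i) x = 0.
  apply/row_matrixP => a; rewrite row0 rowE; set u := delta_mx 0 a.
  apply: (Jmx_real ix); first exact: rank_max_derive.
  by rewrite -mulmxA hol mulmxA; exact: rank_max_derive.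
have X0 : HX g (Jx xi) i x = 0 by rewrite -Jmx_E.
have pi := inv_dom ix.
have X0' : HX g (Jx xi) i (ch i (inv i x)) = 0 by rewrite invK.
have j0' : jac (HX g (Jx xi) i) (ch i (inv i x)) = 0 by rewrite invK.
have h := kah_jet (toric_connected toric) (kah_Jx toric xi) pi X0' j0'.
by apply/eqP; exact: (Jx_cst toric h).
Qed.

Theorem centralizer_torus F : kah g F -> (forall eta p, br g F (Jx eta) p = 0) ->
  exists xi (r : R), forall p, F p = Jx xi p + r.
Proof.
move=> kF hF; have [i [x [ix fr]]] := free_point; set L := Jmx i x in fr.
have K := kmetric_chart g i; have pi := inv_dom ix.
have uG : I *m g i x \in unitmx.
  rewrite unitmx_mul (km_unit K ix) andbT.
  have : I *m (- I) = 1%:M by rewrite mulmxN MI2 opprK.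
  by case/mulmx1_unit.
(* The orthogonal of [L] for omega contains [L] and has dimension 2n - n, so it equals [L];
   commuting with all [Jx eta] places the field of [F] in it. *)
have FL : (HX g F i x <= L)%MS.
  have LK : (L <= kermx (I *m g i x *m L^T))%MS.
    apply/sub_kermxP/matrixP => a b; have := Jmx_isotropic (delta_mx 0 a) (delta_mx 0 b) ix.
    by rewrite mxform_rows -/L => e; rewrite [RHS]mxE -e !mulmxA.
  have KL : (kermx (I *m g i x *m L^T) <= L)%MS.
    rewrite -(mxrank_leqif_sup LK) mxrank_ker.
    have -> : \rank (I *m g i x *m L^T) = n.
      have fu : row_full (I *m g i x) by rewrite row_full_unit.
      by rewrite (eqmxMfull _ fu) mxrank_tr; apply/eqP.
    by rewrite addnK; exact: fr.
  apply: submx_trans KL; apply/sub_kermxP/rowP => k; rewrite [RHS]mxE.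
  have := br_form g kF.1 (Jx_smooth toric (delta_mx 0 k)) pi.
  rewrite hF invK // -Jmx_E // -/L => ->.
  by rewrite /mxform trmx_mul trmx_delta !mulmxA -colE [RHS]mxE.
have /submxP[xi Fxi] := FL; rewrite /L Jmx_E // in Fxi.
pose F' p := -1 * Jx xi p + F p.
have kF' : kah g F' by exact: (kah_lin (-1) (kah_Jx toric xi) kF).
have X0 : HX g F' i x = 0.
  rewrite HXD; first by rewrite Fxi scaleN1r addNr.
    exact: Cn_diff (smooth_cn i 0 (Jx_smooth toric xi)) ix.
  exact: Cn_diff (smooth_cn i 0 kF.1) ix.
have b0 eta p : br g F' (Jx eta) p = 0.
  rewrite (br_lin g p (Jx_smooth toric xi) kF.1 (Jx_smooth toric eta) kF'.1).
  by rewrite (br_Jx toric) hF mulr0 addr0.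
(* The commutator of the field of [F'] with each row field is the Hamiltonian field of a vanishing
   bracket. At [x], where the field of [F'] vanishes, only this product is left of the
   commutator. *)
have LA : L *m jac (HX g F' i) x = 0.
  apply/row_matrixP => k; rewrite row0 row_mul rowE Jmx_E //.
  have := HX_br g kF'.1 (Jx_smooth toric (delta_mx 0 k)) ix.
  rewrite X0 mul0mx subr0 => <-; apply: (@HX_near_cst _ _ _ _ g 0); near=> z; exact: b0.
have hol := kill_holomorphic K ix (smooth_cn i 2 kF'.1) (kF'.2 i x ix).
(* [L] and its multiple by [I] meet trivially, so together they span all tangent vectors; the
   Jacobian commutes with [I] and hence vanishes on both. *)
have fr2 : row_free (col_mx L (L *m I)).
  rewrite -kermx_eq0; apply/negPn/negP => /rowV0Pn[w /sub_kermxP e w0]; case/negP: w0.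
  rewrite -{1}[w]hsubmxK mul_row_col in e.
  have e1 : rsubmx w *m L *m I = - (lsubmx w *m L).
    by apply/eqP; rewrite -addr_eq0 addrC -mulmxA; apply/eqP.
  have r0 : rsubmx w *m L = 0.
    apply: (Jmx_real ix); first exact: submxMl.
    by rewrite e1 eqmx_opp; exact: submxMl.
  have l0 : lsubmx w *m L = 0 by apply/eqP; rewrite -oppr_eq0 -e1 r0 mul0mx.
  have z (a : 'rV[R]_n) : a *m L = 0 -> a = 0.
    by move=> h; apply: (row_free_inj fr); rewrite h mul0mx.
  by rewrite -[w]hsubmxK (z _ r0) (z _ l0) row_mx0.
have A0 : jac (HX g F' i) x = 0.
  have uL : col_mx L (L *m I) \in unitmx by rewrite -row_free_unit.
  have : col_mx L (L *m I) *m jac (HX g F' i) x = 0.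
    by rewrite mul_col_mx LA -mulmxA -hol mulmxA LA mul0mx col_mx0.
  by move/(congr1 (mulmx (invmx (col_mx L (L *m I))))); rewrite mulKmx // mulmx0.
have X0' : HX g F' i (ch i (inv i x)) = 0 by rewrite invK.
have j0' : jac (HX g F' i) (ch i (inv i x)) = 0 by rewrite invK.
have h := kah_jet (toric_connected toric) kF' pi X0' j0'.
exists xi, (F' (inv i x)) => p; rewrite -(h p) /F' mulN1r addrA subrr add0r; by [].
Unshelve. all: by end_near. Qed.

End Centralizer.

(** * Conjugation into the torus and construction of the Weyl group element *)

Section ToricConjugation.
Context {R : realType} {n : nat} {N : topologicalType}.
Variables (M : complexManifold R n N) (g : kahlerMetric M).
Variables (Phi : torus R n -> N -> N) (J : N -> 'rV[R]_n).
Hypothesis toric : kahler_toric g Phi J.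
Variable p0 : N.
Variable fl : (N -> R) -> R -> N -> N.
Hypothesis flP : forall f, kah g f -> global_flow g f (fl f).
Local Notation Jx := (momentum J).
Local Notation kah := (kah g).
Local Notation br := (br g).
Local Notation Gen := (Gen g fl).
Local Notation centf := (centf g).
Local Notation allkah := (allkah g).
Implicit Types (xi eta : 'rV[R]_n) (F : N -> R) (s : seq (N -> R)).

Let cN := toric_compact toric.
Let conn := toric_connected toric.
Let Jk (k : 'I_n) := Jx (delta_mx 0 k).

Lemma br_cst F (r : R) p : smooth_fun M F -> br F (fun=> r) p = 0.
Proof.
move=> sF; have [i pi] := chart_cover M p.
rewrite (br_form g sF (kah_cst g r).1 pi) (@HX_near_cst _ _ _ _ g r (fun=> r)); last by near=> z.
by rewrite /mxform trmx0 mulmx0 mxE.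
Unshelve. all: by end_near. Qed.

Lemma kah_addc F (r : R) : kah F -> kah (fun p => F p + r).
Proof.
move=> kF; have := kah_lin 1 kF (kah_cst g r).
by have -> : (fun p => 1 * F p + r) = (fun p => F p + r) by apply/funext => p; rewrite mul1r.
Qed.

Lemma br_addc F H (r : R) p : kah F -> kah H -> br F (fun p => H p + r) p = br F H p.
Proof.
move=> kF kH; have kc := kah_cst g r; have kl := kah_lin 1 kH kc.
have := br_linr g p kH.1 kc.1 kF.1 kl.1; rewrite (br_cst r p kF.1) mul1r addr0 => <-.
by have -> : (fun p => 1 * H p + r) = (fun p => H p + r) by apply/funext => q; rewrite mul1r.
Qed.

Lemma momentum_sum eta p : Jx eta p = \sum_k eta 0 k * Jk k p.
Proof.
apply: eq_bigr => k _; rewrite /Jk /momentum (bigD1 k) //= mxE !eqxx mulr1 big1 ?addr0 1?mulrC //.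
by move=> l lk; rewrite mxE eqxx (negPf lk) mulr0.
Qed.

Lemma br_momentum F eta p : kah F -> (forall k, br F (Jk k) p = 0) -> br F (Jx eta) p = 0.
Proof.
move=> kF h; rewrite (row_sum_delta eta).
suff H (r : seq 'I_n) : br F (Jx (\sum_(k <- r) eta 0 k *: delta_mx 0 k)) p = 0 by exact: H.
elim: r => [|k r IH].
  rewrite big_nil; have -> : Jx 0 = (fun=> 0).
    by apply/funext => q; rewrite /momentum big1 // => l _; rewrite mxE mulr0.
  by apply: br_cst; exact: kF.1.
rewrite big_cons Jx_lin.
have k1 := kah_Jx toric (delta_mx 0 k).
have k2 := kah_Jx toric (\sum_(l <- r) eta 0 l *: delta_mx 0 l).
by rewrite (br_linr g p k1.1 k2.1 kF.1 (kah_lin _ k1 k2).1) IH h mulr0 addr0.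
Qed.

(** Once [F] commutes with [Jk k], this function is added to [s]; later conjugations then keep the
    relation. The components commute with each other, so all of them remain in the centraliser of
    the longer list. *)
Lemma conj_commuting (r : seq 'I_n) s F : allkah s -> (forall eta, centf s (Jx eta)) ->
  kah F -> centf s F -> exists phi, [/\ Gen s phi, kah (F \o phi), centf s (F \o phi) &
    forall k, k \in r -> forall p, br (F \o phi) (Jk k) p = 0].
Proof.
elim: r s F => [|k r IH] s F ks cJ kF cF.
  by exists idfun; split=> //; exact: Gen1.
have [phi1 g1 h1] := kah_conj cN conn p0 flP ks kF (kah_Jx toric (delta_mx 0 k)) cF (cJ _).
have [k1 c1] := Gen_centf flP ks kF g1 cF.
have ks1 : allkah (Jk k :: s) by split; [exact: (kah_Jx toric)|exact: ks].
have cJ1 eta : centf (Jk k :: s) (Jx eta).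
  by split; [move=> p; exact: (br_Jx toric)|exact: cJ].
have [phi2 [g2 k2 [b2 c2] h2]] := IH (Jk k :: s) (F \o phi1) ks1 cJ1 k1 (conj h1 c1).
exists (phi1 \o phi2); split.
- exact: (Gen_cat g1 (Gen_cons g2)).
- exact: k2.
- exact: c2.
- by move=> l; rewrite inE => /predU1P[->|lr]; [exact: b2|exact: h2].
Qed.

Lemma conj_torus s F : allkah s -> (forall eta, centf s (Jx eta)) -> kah F -> centf s F ->
  exists2 phi, Gen s phi & exists xi (r : R), forall p, F (phi p) = Jx xi p + r.
Proof.
move=> ks cJ kF cF; have [phi [g1 k1 c1 h1]] := conj_commuting (enum 'I_n) ks cJ kF cF.
exists phi => //; apply: (centralizer_torus toric k1) => eta p.
by apply: br_momentum => // k; apply: h1; rewrite mem_enum.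
Qed.

(** After conjugation the function [F k] is some [Jx xi] plus a constant. It can thus join [s]
    without excluding any [Jx eta], and the later flows fix it. *)
Lemma conj_family (r : seq 'I_n) s (F : 'I_n -> N -> R) : allkah s ->
  (forall eta, centf s (Jx eta)) -> (forall k, kah (F k)) -> (forall k, centf s (F k)) ->
  (forall k l p, br (F k) (F l) p = 0) ->
  exists2 c, Gen s c & forall k, k \in r -> exists xi (e : R), forall p, F k (c p) = Jx xi p + e.
Proof.
elim: r s F => [|k r IH] s F ks cJ kF cF FF.
  by exists idfun => //; exact: Gen1.
have [c1 g1 [xi [e h1]]] := conj_torus ks cJ (kF k) (cF k).
have [ic1 [_ _ hc1 _]] := Gen_autp flP g1.
have E1 : F k \o c1 = (fun p => Jx xi p + e) by apply/funext => p; exact: h1.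
have kJ := kah_Jx toric xi.
have kE : kah (F k \o c1) by rewrite E1; exact: kah_addc.
have ks1 : allkah ((F k \o c1) :: s) by split; [exact: kE|exact: ks].
have cJ1 eta : centf ((F k \o c1) :: s) (Jx eta).
  split; last exact: cJ.
  move=> p; rewrite E1.
  exact: (etrans (br_addc e p (kah_Jx toric eta) kJ) (br_Jx toric eta xi p)).
have kF1 l : kah (F l \o c1) /\ centf s (F l \o c1) by exact: (Gen_centf flP ks (kF l) g1 (cF l)).
have FF1 l m p : br (F l \o c1) (F m \o c1) p = 0.
  by rewrite (br_push p hc1 (kF l).1 (kF m).1) FF.
have cF1 l : centf ((F k \o c1) :: s) (F l \o c1) by split; [exact: FF1|exact: (kF1 l).2].
have [c2 g2 h2] := IH _ (fun l => F l \o c1) ks1 cJ1 (fun l => (kF1 l).1) cF1 FF1.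
exists (c1 \o c2); first exact: (Gen_cat g1 (Gen_cons g2)).
move=> l; rewrite inE => /predU1P[->|lr]; last exact: h2.
exists xi, e => p; have := congr1 (@^~ p) (Gen_fix flP kE g2); rewrite /= => ->; exact: h1.
Qed.

Lemma Gen_Aut0 s phi : Gen s phi -> Aut0 g phi.
Proof.
elim=> [|phi' m t _ IH km _]; first exact: Aut0_id.
by apply: Aut0_comp => //; exact: flow_Aut0 (flP km).
Qed.

Lemma kah_torus f : kah f -> exists xi phi (r : R),
  Aut0 g phi /\ f = (fun p => Jx xi (phi p) + r).
Proof.
move=> kf; have [phi g1 [xi [r h]]] := @conj_torus [::] f I (fun _ => I) kf I.
have [psi hpsi] := Gen_autp flP g1; exists xi, psi, r; split.
  exact: Aut0_inv hpsi (Gen_Aut0 g1).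
by apply/funext => p; rewrite -h; have [_ -> _ _] := hpsi.
Qed.

Lemma momentum_kah xi phi (r : R) : Aut0 g phi -> kah (fun p => Jx xi (phi p) + r).
Proof.
move=> /Aut0_Aut/Aut_autp[psi [_ _ h _]]; apply: kah_addc.
exact: (kah_pullback h (kah_Jx toric xi)).
Qed.

Lemma icv_addc F (r : R) c t : smooth_fun M F -> icv g (fun p => F p + r) c t -> icv g F c t.
Proof.
move=> sF [cc [i [ci hd]]]; split; [exact: cc|exists i; split; first exact: ci].
have := HXD g 1 (smooth_fun_diff sF ci) (smooth_fun_diff (kah_cst g r).1 ci).
have -> : (fun p => 1 * F p + r) = (fun p => F p + r) by apply/funext => p; rewrite mul1r.
rewrite scale1r (@HX_near_cst _ _ _ _ g r (fun=> r)); last by near=> z.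
by rewrite addr0 => <-.
Unshelve. all: by end_near. Qed.

(** The image under [chi] of an integral curve of [Jx eta] is an integral curve of [Jx xi], the
    constant [r] having no effect on the field; uniqueness gives the equality. *)
Lemma act_conj chi ichi xi eta (r : R) : autp g chi ichi ->
  (forall p, Jx eta (ichi p) = Jx xi p + r) ->
  forall (t : R) p, chi (act Phi (t *: eta) (ichi p)) = act Phi (t *: xi) p.
Proof.
move=> [c1 c2 h1 h2] he t p.
have sJ := Jx_smooth toric.
have e : (fun p => Jx xi p + r) \o chi = Jx eta by apply/funext => q; rewrite /= -he c1.
apply: (@icv_unique _ _ _ _ g (Jx xi) (fun t => chi (act Phi (t *: eta) (ichi p)))
  (fun t => act Phi (t *: xi) p) (`|t| + 1)).
- exact: sJ.
- by rewrite !scale0r !(act0 toric) c2.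
- move=> s _; split; last exact: (act_icv toric).
  apply: (@icv_addc _ r); first exact: sJ.
  apply: (icv_push (f := fun p => Jx xi p + r)); first exact: h1.
    exact: (kah_addc r (kah_Jx toric xi)).1.
  by rewrite e; exact: (act_icv toric).
- by rewrite ltrDl.
Qed.

Lemma momentum_conj_eq (ichi : N -> N) xi eta xi' (r r' : R) :
  (forall p, Jx eta (ichi p) = Jx xi p + r) -> (forall p, Jx eta (ichi p) = Jx xi' p + r') ->
  xi = xi' /\ r = r'.
Proof.
move=> h1 h2; have xx : xi = xi'.
  apply/eqP; rewrite -subr_eq0; apply/eqP; apply: (@Jx_cst _ _ _ _ _ _ _ toric _ (r' - r)) => p.
  have -> : xi - xi' = -1 *: xi' + xi by rewrite scaleN1r addrC.
  rewrite Jx_lin; have := h1 p; rewrite h2; lra.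
by split=> //; have := h1 p0; rewrite h2 xx; lra.
Qed.

(** If [ichi] pulls every [Jx eta] back to some [Jx (eta *m A)] up to a constant, conjugation by
    [chi] acts on the torus through [A], so [chi] normalises it. Comparison with the last hypothesis
    gives [xi' *m A = xi], and [r - r'] is the value of the cocycle. *)
Lemma weyl_main chi ichi xi xi' (r r' : R) (A : 'M[R]_n) (e : 'rV[R]_n -> R) :
  Aut0 g chi -> autp g chi ichi ->
  (forall eta p, Jx eta (ichi p) = Jx (eta *m A) p + e eta) ->
  (forall p, Jx xi' (ichi p) = Jx xi p + (r - r')) ->
  exists2 w, weyl_group g Phi w & (xi, r) = weyl_act_ext Phi J w (xi', r').
Proof.
move=> a0 ap hA hx; have [c1 c2 _ _] := ap.
have cv eta t p := act_conj ap (hA eta) t p.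
have [xA _] := momentum_conj_eq (hA xi') hx.
have iE : inverse chi = ichi by exact: inverseE.
have cv1 v : chi \o act Phi v \o ichi = act Phi (v *m A).
  by apply/funext => p; have := cv v 1 p; rewrite !scale1r.
(* Needed for the conjugates to exhaust the torus: a vector killed by [A] would have a constant
   momentum component. *)
have uA : A \in unitmx.
  rewrite -row_free_unit -kermx_eq0; apply/negPn/negP => /rowV0Pn[v /sub_kermxP vA /negP]; apply.
  apply/eqP; apply: (@Jx_cst _ _ _ _ _ _ _ toric _ (e v)) => p.
  have := hA v (chi p); rewrite c1 vA => ->; rewrite /momentum big1 ?add0r // => k _.
  by rewrite mxE mulr0.
pose w : set (N -> N) := [set chi \o tau | tau in toric_torus Phi].
have wchi : w chi.
  exists (act Phi 0); first by exists (to_torus 0).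
  by apply/funext => p /=; rewrite (act0 toric).
have wE phi : w phi -> exists v, phi = chi \o act Phi v.
  by move=> [_ [a _ <-] <-]; have [v ->] := to_torus_surj a; exists v.
have invw v : inverse (chi \o act Phi v) = act Phi (- v) \o ichi.
  by apply: inverseE => p /=; [rewrite c1 -(actD toric) addNr (act0 toric)
    |rewrite -(actD toric) subrr (act0 toric) c2].
have Adw phi : w phi -> Ad phi (Phi_star Phi xi') = Phi_star Phi xi.
  move=> /wE[v ->]; apply/funext => t; apply/funext => p.
  rewrite /Ad /= invw /= -/(act Phi v) /Phi_star -/(act Phi (t *: xi')) -/(act Phi (t *: xi)).
  by rewrite -!(actD toric) addrAC subrr add0r cv xA.
(* [weyl_act] and [cocycle] are defined by choice, with default 0; existence and uniqueness, for all
   representatives of the coset, show that the choice is the expected value. *)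
have wact : weyl_act Phi w xi' = xi.
  apply: xget_subset1; first by exists chi => //; rewrite Adw.
  have uniq eta : (exists2 phi, w phi & Phi_star Phi eta = Ad phi (Phi_star Phi xi')) -> eta = xi.
    move=> [phi /Adw ->] h; apply/eqP; rewrite -subr_eq0; apply/eqP; apply: (act_inj toric) => t p.
    have := congr1 (fun gam => gam t (act Phi (- (t *: xi)) p)) h.
    rewrite /Phi_star -/(act Phi (t *: eta)) -/(act Phi (t *: xi)) -!(actD toric) subrr (act0 toric).
    by rewrite scalerBr.
  by move=> e1 e2 /uniq -> /uniq ->.
have wcoc : cocycle Phi J w xi' = r - r'.
  have coc phi p : w phi -> Jx xi' (inverse phi p) - Jx (weyl_act Phi w xi') p = r - r'.
    move=> /wE[v ->]; rewrite invw wact /= (Jx_act toric) hx; lra.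
  apply: xget_subset1; first by exists chi => // p; exact: coc.
  by move=> x1 x2 [f1 w1 h1] [f2 w2 h2]; rewrite -(h1 p0) -(h2 p0) !coc.
exists w; last by rewrite /weyl_act_ext /= wact wcoc addrC subrK.
exists chi => //; split; first exact: a0.
apply/seteqP; split.
  move=> _ [_ [a _ <-] <-]; rewrite iE; have [v ->] := to_torus_surj a.
  by rewrite -/(act Phi v) cv1; exists (to_torus (v *m A)).
move=> _ [a _ <-]; have [v ->] := to_torus_surj a.
exists (act Phi (v *m invmx A)); first by exists (to_torus (v *m invmx A)).
by rewrite iE cv1 mulmxKV.
Qed.

Lemma momentum_conj_unique xi xi' phi phi' (r r' : R) : Aut0 g phi -> Aut0 g phi' ->
  (forall p, Jx xi (phi p) + r = Jx xi' (phi' p) + r') ->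
  exists2 w, weyl_group g Phi w & (xi, r) = weyl_act_ext Phi J w (xi', r').
Proof.
move=> a1 a2 h.
have [iphi hp1] := Aut_autp (Aut0_Aut a1); have [iphi' hp2] := Aut_autp (Aut0_Aut a2).
pose psi := phi \o iphi'; pose ipsi := phi' \o iphi.
have hpsi : autp g psi ipsi by exact: (autp_comp hp1 (autpV hp2)).
have apsi : Aut0 g psi by apply: Aut0_comp => //; exact: Aut0_inv hp2 a2.
have [_ _ _ hi] := hpsi.
have hx p : Jx xi' (ipsi p) = Jx xi p + (r - r').
  have := h (iphi p); have [_ -> _ _] := hp1; rewrite /ipsi /=; lra.
have kJ eta := kah_Jx toric eta.
pose F k := Jk k \o ipsi.
have kF k : kah (F k) by exact: (kah_pullback hi (kJ (delta_mx 0 k))).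
have ks : allkah [:: Jx xi] by split; [exact: kJ|].
have cJ eta : centf [:: Jx xi] (Jx eta) by split; [move=> p; exact: (br_Jx toric)|].
have kJp : kah (Jx xi' \o ipsi) by exact: (kah_pullback hi (kJ xi')).
have cF k : centf [:: Jx xi] (F k).
  (* [Jx xi] is, up to a constant, one more component of the momentum map pulled back by [ipsi],
     hence commutes with all the others. *)
  split=> // p; have -> : Jx xi = (fun p => (Jx xi' \o ipsi) p + (r' - r)).
    by apply/funext => q; rewrite /= hx; lra.
  rewrite (br_addc _ p (kF k) kJp) (br_push p hi (kJ _).1 (kJ _).1).
  exact: (br_Jx toric).
have FF k l p : br (F k) (F l) p = 0.
  by rewrite (br_push p hi (kJ _).1 (kJ _).1) (br_Jx toric).
have [c gc hc] := conj_family (enum 'I_n) ks cJ kF cF FF.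
have /choice[A hA] k : exists A, exists e : R, forall p, F k (c p) = Jx A p + e.
  by apply: hc; rewrite mem_enum.
have /choice[e he] := hA.
have [ic hic] := Gen_autp flP gc.
(* This is the element to be fed to [weyl_main]: correcting [ipsi] by [c] straightens all the [F k],
   and [c] fixes [Jx xi], so the relation between [xi] and [xi'] is unchanged. *)
have ap : autp g (ic \o psi) (ipsi \o c) by exact: (autp_comp (autpV hic) hpsi).
have ac : Aut0 g (ic \o psi) by apply: Aut0_comp => //; exact: Aut0_inv hic (Gen_Aut0 gc).
apply: (@weyl_main _ _ xi xi' r r' (\matrix_k A k) (fun eta => \sum_k eta 0 k * e k) ac ap).
  move=> eta p; rewrite momentum_sum.
  have -> : Jx (eta *m \matrix_k A k) p = \sum_k eta 0 k * Jx (A k) p.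
    rewrite mulmx_sum_row; suff H (s : seq 'I_n) :
        Jx (\sum_(k <- s) eta 0 k *: row k (\matrix_k A k)) p = \sum_(k <- s) eta 0 k * Jx (A k) p by exact: H.
    elim: s => [|k s IH]; first by rewrite !big_nil /momentum big1 // => l _; rewrite mxE mulr0.
    by rewrite !big_cons Jx_lin IH rowK.
  rewrite -big_split; apply: eq_bigr => k _ /=; rewrite -mulrDr; congr (_ * _).
  exact: he.
move=> p; rewrite /= hx; have := congr1 (@^~ p) (Gen_fix flP (kJ xi) gc); rewrite /= => ->; by [].
Qed.

End ToricConjugation.

Theorem proposition5p3 (R : realType) (n : nat) (N : topologicalType)
    (M : complexManifold R n N) (g : kahlerMetric M)
    (Phi : torus R n -> N -> N) (J : N -> 'rV[R]_n)
    (toric : kahler_toric g Phi J)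
    (f : N -> R) (f_smooth : smooth_fun M f) :
  (kahler_fun g f <->
     exists (xi : 'rV[R]_n) (phi : N -> N) (r : R),
       Aut0 g phi /\ f = (fun p => momentum J xi (phi p) + r)) /\
  (forall (xi xi' : 'rV[R]_n) (phi phi' : N -> N) (r r' : R),
     Aut0 g phi -> Aut0 g phi' ->
     f = (fun p => momentum J xi (phi p) + r) ->
     f = (fun p => momentum J xi' (phi' p) + r') ->
     exists2 w, weyl_group g Phi w &
       (xi, r) = weyl_act_ext Phi J w (xi', r')).
Proof.
have [p0 _] := toric_nonempty toric.
have /choice[fl flP] (h : N -> R) : exists Th, kah g h -> global_flow g h Th.
  (* The choice of flows is a total function; outside the Kähler functions the value is a
     placeholder. *)
  have [kh|nkh] := pselect (kah g h); last by exists (fun _ q => q).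
  by have [Th] := ex_global_flow (toric_compact toric) kh; exists Th.
split=> [|xi xi' phi phi' r r' a1 a2 e1 e2].
  split=> [/kahP kf|[xi [phi [r [a0 ->]]]]]; first exact: (kah_torus toric p0 flP kf).
  by apply/kahP; exact: (momentum_kah toric).
apply: (momentum_conj_unique toric p0 flP a1 a2) => p.
exact: (etrans (esym (congr1 (@^~ p) e1)) (congr1 (@^~ p) e2)).
Qed.
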